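(* Let $G<\mathrm{GL}_N$ be a classical Chevalley group of rank $r\ge2$ over $K=\mathbb{F}_q$, with $\ell=\dim(G)/r$, $q\ge e^{6r\log(2r)}$ and $\mathrm{char}(K)>N$. Fix $h\in G(\overline K)$ and let $B\subseteq G(\overline K)$ be a set generating the group $hG(K)h^{-1}$ with $e\in B=B^{-1}$. Let $T$ be a non-maximal torus of $G$ with $\deg(T)\le 2\deg(G)$. Then for every integer $t\ge1$, $$|B^t\cap T(K)|\le \frac{(2r)^{19r^2}}{r(r+1)}\,\big|B^{(2r)^{45r^3-1}t}\big|^{\frac{1}{\ell+1}}.$$
   Context: A classical Chevalley group is one of the following algebraic groups, viewed as subvarieties of the affine space $\mathbb{A}^{N^2}$ of $N\times N$ matrices: $\mathrm{SL}_n=\{x:\det x=1\}$ with $n\ge 2$, $N=n$, rank $r=n-1$; $\mathrm{SO}_N=\{x:\det x=1,\ x^\top x=\mathrm{Id}_N\}$ with either $N=2n$, $n\ge 4$, or $N=2n+1$, $n\ge 3$, rank $r=n$; $\mathrm{Sp}_{2n}=\{x: x^\top\Omega x=\Omega\}$ with $\Omega=\begin{pmatrix}0&\mathrm{Id}_n\\-\mathrm{Id}_n&0\end{pmatrix}$, $n\ge2$, $N=2n$, rank $r=n$. The rank is the dimension of a maximal torus; a non-maximal torus is a torus subgroup of $G$ not contained as maximal, i.e. of dimension $<r$. The degree of a pure-dimensional variety $V\subseteq\mathbb{A}^m$ of dimension $d$ is the number of intersection points with a generic linear subvariety of dimension $m-d$; for general $V$ it is the sum of the degrees of its pure-dimensional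 parts. $T(K)$ denotes the points of $T$ with all coordinates in $K$; $B^m$ is the set of products of $m$ elements of $B$. *)

(* Defs.v *)
From HB Require Import structures.
From mathcomp Require Import all_boot all_order all_algebra all_field.
From mathcomp Require Import finmap.
From mathcomp Require Import mpoly.
From Stdlib Require Rdefinitions Raxioms Rfunctions Rtrigo_def Rpower.

Set Implicit Arguments.
Unset Strict Implicit.
Unset Printing Implicit Defensive.

Import GRing.Theory.
Local Open Scope ring_scope.


Inductive chev := SLn of nat | SOeven of nat | SOodd of nat | Spn of nat.

Definition chev_valid (c : chev) : bool :=
  match c with
  | SLn n => 2 <= n
  | SOeven n => 4 <= n
  | SOodd n => 3 <= n
  | Spn n => 2 <= n
  end%N.

Definition chev_N (c : chev) : nat :=
  match c with
  | SLn n => n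
  | SOeven n => n + n
  | SOodd n => (n + n).+1
  | Spn n => n + n
  end.

Definition chev_rank (c : chev) : nat :=
  match c with
  | SLn n => n.-1
  | SOeven n => n
  | SOodd n => n
  | Spn n => n
  end.

Definition chev_dim (c : chev) : nat :=
  match c with
  | SLn n => (n * n).-1
  | SOeven n => ((n + n) * (n + n).-1)./2
  | SOodd n => ((n + n).+1 * (n + n))./2
  | Spn n => n * (n + n).+1
  end.

Definition omega_mx (L : nzRingType) (n : nat) : 'M[L]_(n + n) :=
  block_mx 0 1%:M (- 1%:M) 0.

Definition in_chev (L : comNzRingType) (c : chev) : 'M[L]_(chev_N c) -> bool :=
  match c return 'M[L]_(chev_N c) -> bool with
  | SLn n => fun x => \det x == 1
  | SOeven n => fun x => (\det x == 1) && (x^T *m x == 1%:M)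
  | SOodd n => fun x => (\det x == 1) && (x^T *m x == 1%:M)
  | Spn n => fun x => x^T *m omega_mx L n *m x == omega_mx L n
  end.

Arguments in_chev {L} c x.

Definition mx_over (F : finFieldType) (L : fieldType) (iota : {rmorphism F -> L})
  (N : nat) (x : 'M[L]_N) : bool :=
  [forall i, forall j, [exists a : F, iota a == x i j]].

Definition algebraic_over (F : fieldType) (L : fieldType) (iota : {rmorphism F -> L}) :=
  forall x : L, exists2 p : {poly F}, p != 0 & root (map_poly iota p) x.

Definition mxprod (L : pzRingType) (N : nat) (s : seq 'M[L]_N) : 'M[L]_N :=
  foldr (@mulmx L N N N) 1%:M s.

Fixpoint prodset (L : comNzRingType) (N : nat) (B : {fset 'M[L]_N}) (m : nat)
  : {fset 'M[L]_N} :=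
  match m with
  | 0 => [fset (1%:M : 'M[L]_N)]%fset
  | m'.+1 => [fset x *m y | x in B, y in prodset B m']%fset
  end.

Definition generates (L : fieldType) (N : nat) (B : {fset 'M[L]_N})
  (H : 'M[L]_N -> Prop) : Prop :=
  forall x, H x <-> exists s : seq ('M[L]_N * bool),
    all (fun yb => yb.1 \in B) s /\
    x = mxprod [seq (if yb.2 then invmx yb.1 else yb.1) | yb <- s].

Definition torus_image (L : fieldType) (N d : nat) (A : 'M[int]_(N, d))
  (P : 'M[L]_N) (x : 'M[L]_N) : Prop :=
  exists2 t : 'rV[L]_d, (forall j, t 0 j != 0) &
    x = P *m diag_mx (\row_i \prod_(j < d) (t 0 j) ^ (A i j)) *m invmx P.

(* T is a torus of dimension d in GL_N(L): a closed connected diagonalizable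
   subgroup, i.e. a conjugate of a subtorus of the diagonal torus, i.e. the
   image of a cocharacter map G_m^d -> D_N with finite kernel. *)
Definition is_torus (L : fieldType) (N d : nat) (T : 'M[L]_N -> Prop) : Prop :=
  exists A : 'M[int]_(N, d), exists2 P : 'M[L]_N,
    P \in unitmx &
    \rank (map_mx (intr : int -> rat) A) = d /\
    forall x, T x <-> torus_image A P x.

Definition aff_sub (L : fieldType) (N k : nat) (a : 'rV[L]_(N * N))
  (M : 'M[L]_(k, N * N)) (x : 'M[L]_N) : Prop :=
  exists v : 'rV[L]_k, mxvec x = a + v *m M.

Definition aff_coords (L : fieldType) (N k : nat) (a : 'rV[L]_(N * N))
  (M : 'M[L]_(k, N * N)) : 'I_(N * N + k * (N * N)) -> L :=
  fun i => match split i with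
           | inl j => a 0 j
           | inr j => mxvec M 0 j
           end.

Definition card_eq (T : eqType) (S : T -> Prop) (D : nat) : Prop :=
  exists s : seq T, [/\ uniq s, size s = D & forall x, S x <-> x \in s].

(* V (of dimension d) has degree D: a generic affine linear subvariety of
   dimension N^2 - d meets V in exactly D points; "generic" means: for all
   parameters outside the zero set of some nonzero polynomial. *)
Definition has_degree (L : fieldType) (N : nat) (V : 'M[L]_N -> Prop)
  (d D : nat) : Prop :=
  exists2 p : {mpoly L[N * N + (N * N - d) * (N * N)]}, p != 0 &
    forall (a : 'rV[L]_(N * N)) (M : 'M[L]_(N * N - d, N * N)),
      p.@[aff_coords a M] != 0 ->
      card_eq (fun x => V x /\ aff_sub a M x) D.

Definition q_large (q r : nat) : Prop :=
  Rdefinitions.Rle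
    (Rtrigo_def.exp (Rdefinitions.Rmult (Raxioms.INR (6 * r))
                                        (Rpower.ln (Raxioms.INR (2 * r)))))
    (Raxioms.INR q).

Definition main_bound (r dim X Y : nat) : Prop :=
  Rdefinitions.Rle (Raxioms.INR X)
    (Rdefinitions.Rmult
       (Rdefinitions.Rdiv (Raxioms.INR ((2 * r) ^ (19 * r ^ 2)))
                          (Raxioms.INR (r * (r + 1))))
       (Rpower.Rpower (Raxioms.INR Y)
          (Rdefinitions.Rinv
             (Rdefinitions.Rplus
                (Rdefinitions.Rdiv (Raxioms.INR dim) (Raxioms.INR r))
                Rdefinitions.R1)))).

(* Main.v *)
Require Import Defs.
From HB Require Import structures.
From mathcomp Require Import all_boot all_order all_fingroup all_algebra all_field.
From mathcomp Require Import finmap.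
From mathcomp Require Import mpoly.
From mathcomp Require Import zify ring.
From Stdlib Require Import Classical.
From Stdlib Require Rdefinitions Raxioms RIneq Rfunctions Rtrigo_def Rpower Exp_prop Lra.

Set Implicit Arguments.
Unset Strict Implicit.
Unset Printing Implicit Defensive.

Import Order.TTheory GRing.Theory Num.Theory.

Local Open Scope ring_scope.

(* Let H = h G(K) h^-1, let S be the set of words of length at most (N^2+1)^e in B,
   e = d N, and let k = l + 1.  By a dimension count a polynomial of degree e vanishing on S
   vanishes on H, and, q being large, also on every Cayley transform h = (1 - Y)(1 + Y)^-1
   of an element Y of the Lie algebra of G.  Since
   Ad(h) X = X + 2 (1 + Y)^-1 [X, Y] (1 - Y)^-1, suitable h_0 = 1, h_1, ..., h_l make the
   subspaces Ad(h_j) Lie(T) independent as soon as the spaces Lie(T), [Lie(T), Y_j] are; such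
   Y_j are obtained by distributing the roots of a maximal torus containing T among l colours so
   that the roots of one colour have no common zero on Lie(T), which is possible because
   dim T < r.  Replacing the h_j one at a time, for all a_0, ..., a_l in A = B^t :&: T(K) one
   finds s_j in S such that the prefixes of a_0 s_0 a_1 s_1 ... a_l have the same independence,
   i.e. the product map T^k -> G has injective differential at (a_0, ..., a_l).  Such points
   in one fibre are at most deg(T)^k (k d)^(k d) many: the products of powers of the defining
   equations by powers of a separating function are independent, and their number is compared
   with the Hilbert function of T.  Hence |A|^k <= |S|^l deg(T)^k (k d)^(k d) |B^M|.
   The same independence argument bounds deg(G), hence deg(T). *)

(** Degree, dimension and smoothness are handled by counting: spaces of functions of bounded degree
    are compared through finite sets of points that determine them, which works in positive
    characteristic. Thus [deg(T)] enters only as a growth rate: the degree [m] functions on [T] are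
    determined by at most [max(deg(T), 1) (m + cst)^d] points, and [cst] disappears when leading
    coefficients are compared. The value [e = d N] comes from replacing one [h_j] at a time:
    independence is then certified by a determinant of size [d] whose entries have degree [N] in the
    element that varies. Cayley transforms are used because they parametrise the group rationally
    over [K] with small degree, so that vanishing on [G(K)] can be tested on a grid of [q] values
    per coordinate. For [SL_n] the elements [Y] are nilpotent of rank at most one, and their Cayley
    transforms are transvections. To name the roots, coordinates are needed in which [T] is diagonal
    and the invariant form is hyperbolic simultaneously; a Witt decomposition respecting the weights
    provides them. *)

Lemma prod_seq_neq0P (R : idomainType) (I : eqType) (r : seq I) (F : I -> R) :
  reflect (forall i, i \in r -> F i != 0) (\prod_(i <- r) F i != 0).
Proof. by rewrite prodf_seq_neq0 /=; apply: allP. Qed.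

(** * Functions that are polynomial along lines, and their zeros *)

Section ClosedField.
Variable L : closedFieldType.

(** A root of [p - 1] serves; none exists only if [p - 1] is a nonzero constant, and then [p] is
    constant. *)
Lemma poly_nonroot (p : {poly L}) : p != 0 -> exists t, p.[t] != 0.
Proof.
move=> p0; have [sz|sz] := eqVneq (size (p - 1)) 1%N; last first.
  have [t /rootP] := closed_rootP (p - 1) sz.
  rewrite hornerD hornerN hornerC => /eqP; rewrite subr_eq0 => /eqP pt.
  by exists t; rewrite pt oner_neq0.
have [c _ pc] := size_poly1P _ (introT eqP sz); exists 0.
move/eqP: pc; rewrite subr_eq => /eqP pc; move: p0.
by rewrite pc -[1]polyC1 -polyCD polyC_eq0 hornerC.
Qed.

Lemma exists_uniq_seq n : exists2 s : seq L, uniq s & size s = n.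
Proof.
elim: n => [|n [s us ss]]; first by exists [::].
have p0 : \prod_(z <- s) ('X - z%:P) != 0 by rewrite monic_neq0 ?monic_prod_XsubC.
have [t] := poly_nonroot p0; rewrite -[_ == 0]/(root _ t) root_prod_XsubC => ts.
by exists (t :: s) => /=; rewrite ?ts ?ss.
Qed.

Lemma poly_nonroots (ps : seq {poly L}) : all (fun p => p != 0) ps ->
  exists t, all (fun p => p.[t] != 0) ps.
Proof.
move=> /allP ps0; have : \prod_(p <- ps) p != 0.
  by apply/prod_seq_neq0P => p pps; apply: ps0.
case/poly_nonroot => t; rewrite horner_prod => /prod_seq_neq0P h.
by exists t; apply/allP => p pps; apply: h.
Qed.

End ClosedField.

Section LinePoly.
Variables (L : fieldType) (V : lmodType L).
Implicit Types (f g : V -> L) (m n : nat).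

(** Degree is measured on affine lines, without coordinates: one notion serves scalars, vectors and
    matrices, passes through determinants and adjugates, and reduces nonvanishing to one
    variable. *)
Definition linepoly m f := forall u v : V,
  exists2 p : {poly L}, (size p <= m.+1)%N & forall t, f (u + t *: v) = p.[t].

Lemma linepoly_ext m f g : f =1 g -> linepoly m f -> linepoly m g.
Proof. by move=> e h u v; have [p sp pe] := h u v; exists p => // t; rewrite -e. Qed.

Lemma linepoly_le m n f : (m <= n)%N -> linepoly m f -> linepoly n f.
Proof.
by move=> mn h u v; have [p sp pe] := h u v; exists p => //; apply: leq_trans sp _.
Qed.

Lemma linepoly_cst m c : linepoly m (fun=> c).
Proof.
move=> u v; exists c%:P => [|t]; last by rewrite hornerC.
by rewrite size_polyC; case: eqP.
Qed.

Lemma linepolyD m f g : linepoly m f -> linepoly m g ->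
  linepoly m (fun x => f x + g x).
Proof.
move=> hf hg u v; have [p sp pe] := hf u v; have [q sq qe] := hg u v.
exists (p + q) => [|t]; last by rewrite hornerD pe qe.
by rewrite (leq_trans (size_polyD _ _)) // geq_max sp sq.
Qed.

Lemma linepolyM m n f g : linepoly m f -> linepoly n g ->
  linepoly (m + n) (fun x => f x * g x).
Proof.
move=> hf hg u v; have [p sp pe] := hf u v; have [q sq qe] := hg u v.
exists (p * q) => [|t]; last by rewrite hornerM pe qe.
apply: leq_trans (size_polyMleq _ _) _.
by move: sp sq; case: (size p) (size q) => [|a] [|b] //=; lia.
Qed.

Lemma linepolyZ m c f : linepoly m f -> linepoly m (fun x => c * f x).
Proof. by move=> h; apply: (@linepolyM 0); [apply: linepoly_cst | ]. Qed.

Lemma linepoly_sum (J : Type) (r : seq J) (P : pred J) m (F : J -> V -> L) :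
  (forall j, P j -> linepoly m (F j)) ->
  linepoly m (fun x => \sum_(j <- r | P j) F j x).
Proof.
move=> h; elim: r => [|j r ih].
  by apply: linepoly_ext (linepoly_cst m 0) => x; rewrite big_nil.
have [Pj|Pj] := boolP (P j); last by apply: linepoly_ext ih => x; rewrite big_cons (negPf Pj).
by apply: linepoly_ext (linepolyD (h j Pj) ih) => x; rewrite big_cons Pj.
Qed.

Lemma linepoly_prod (J : Type) (r : seq J) m (F : J -> V -> L) :
  (forall j, linepoly m (F j)) ->
  linepoly (size r * m) (fun x => \prod_(j <- r) F j x).
Proof.
move=> h; elim: r => [|j r ih] /=.
  by apply: linepoly_ext (linepoly_cst _ 1) => x; rewrite big_nil.
by rewrite mulSn; apply: linepoly_ext (linepolyM (h j) ih) => x; rewrite big_cons.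
Qed.

Lemma linepoly_prod_ord n m (F : 'I_n -> V -> L) : (forall j, linepoly m (F j)) ->
  linepoly (n * m) (fun x => \prod_j F j x).
Proof.
by move=> h; rewrite -{1}[n]card_ord cardE enumT; apply: (@linepoly_prod _ _ m F).
Qed.

Lemma linepoly_prod_ex (J : eqType) (r : seq J) (F : J -> V -> L) :
  (forall j, j \in r -> exists m, linepoly m (F j)) ->
  exists m, linepoly m (fun x => \prod_(j <- r) F j x).
Proof.
elim: r => [|j r ih] h.
  by exists 0; apply: linepoly_ext (linepoly_cst _ 1) => x; rewrite big_nil.
have [m hm] := h j (mem_head _ _).
have [i|n hn] := ih; first by move=> ir; apply: h; rewrite inE ir orbT.
by exists (m + n)%N; apply: linepoly_ext (linepolyM hm hn) => x; rewrite big_cons.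
Qed.

Lemma linepolyX m n f : linepoly m f -> linepoly (n * m) (fun x => f x ^+ n).
Proof.
move=> h; elim: n => [|n ih]; first exact: linepoly_cst.
by rewrite mulSn; apply: linepoly_ext (linepolyM h ih) => x; rewrite exprS.
Qed.

Lemma linepoly_det m n (A : V -> 'M[L]_n) :
  (forall i j, linepoly m (fun x => A x i j)) ->
  linepoly (n * m) (fun x => \det (A x)).
Proof.
move=> h; apply: linepoly_sum => s _; apply: linepolyZ.
by apply: linepoly_prod_ord => i; apply: h.
Qed.

Lemma linepoly_mulmx m n a b c (A : V -> 'M[L]_(a, b)) (B : V -> 'M[L]_(b, c)) :
  (forall i j, linepoly m (fun x => A x i j)) ->
  (forall i j, linepoly n (fun x => B x i j)) ->
  forall i j, linepoly (m + n) (fun x => (A x *m B x) i j).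
Proof.
move=> hA hB i j.
have h k : predT k -> linepoly (m + n) (fun x => A x i k * B x k j).
  by move=> _; apply: linepolyM.
by apply: linepoly_ext (linepoly_sum (index_enum _) h) => x; rewrite mxE.
Qed.

Lemma linepoly_adj m n (A : V -> 'M[L]_n) :
  (forall i j, linepoly m (fun x => A x i j)) ->
  forall i j, linepoly (n * m) (fun x => (\adj (A x)) i j).
Proof.
move=> h i j; apply: (@linepoly_le (n.-1 * m)); first by rewrite leq_mul ?leq_pred.
apply: linepoly_ext (linepolyZ ((-1) ^+ (j + i)) (@linepoly_det m _
  (fun x => row' j (col' i (A x))) _)) => [x|a b]; first by rewrite mxE /cofactor.
by apply: linepoly_ext (h (lift j a) (lift i b)) => x; rewrite !mxE.
Qed.

End LinePoly.

Lemma linepoly_comp (L : fieldType) (U V : lmodType L) m (f : U -> L) (phi : V -> U) :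
  (forall t u v, phi (u + t *: v) = phi u + t *: phi v) ->
  linepoly m f -> linepoly m (fun x => f (phi x)).
Proof.
by move=> hp h u v; have [p sp pe] := h (phi u) (phi v); exists p => // t; rewrite hp.
Qed.

Lemma linepoly_lin (L : fieldType) (V : lmodType L) (phi : V -> L) :
  (forall t u v, phi (u + t *: v) = phi u + t * phi v) -> linepoly 1 phi.
Proof.
move=> h u v; exists ((phi u)%:P + phi v *: 'X) => [|t].
  rewrite (leq_trans (size_polyD _ _)) // geq_max size_polyC.
  by rewrite (leq_trans (leq_b1 _)) // (leq_trans (size_scale_leq _ _)) ?size_polyX.
by rewrite h hornerD hornerC hornerZ hornerX mulrC.
Qed.

Lemma linepoly_mxE (L : fieldType) a b (i : 'I_a) (j : 'I_b) :
  linepoly 1 (fun x : 'M[L]_(a, b) => x i j).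
Proof. by apply: linepoly_lin => t u v; rewrite !mxE. Qed.

Section Nonvanishing.
Variables (L : closedFieldType) (V : lmodType L).

(** On the line joining the two witnesses both restrictions are nonzero polynomials, so they have a
    common nonroot. This plays the part of the irreducibility of affine space. *)
Lemma linepoly_mul_neq0 m n (f g : V -> L) u v : linepoly m f -> linepoly n g ->
  f u != 0 -> g v != 0 -> exists w, f w * g w != 0.
Proof.
move=> hf hg fu gv; have [p _ pe] := hf u (v - u); have [q _ qe] := hg u (v - u).
have p0 : p != 0.
  by apply: contraNneq fu => p0; rewrite -[u]addr0 -(scale0r (v - u)) pe p0 horner0.
have q0 : q != 0.
  apply: contraNneq gv => q0; rewrite -[v](subrK u) addrC -[v - u]scale1r qe.
  by rewrite q0 horner0.
have [|t /=] := @poly_nonroots L [:: p; q]; first by rewrite /= p0 q0.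
case/and3P=> pt qt _; exists (u + t *: (v - u)).
by rewrite pe qe mulf_neq0.
Qed.

Lemma linepoly_prod_neq0 (J : eqType) (r : seq J) (F : J -> V -> L) :
  (forall j, j \in r -> exists m, linepoly m (F j)) ->
  (forall j, j \in r -> exists u, F j u != 0) ->
  exists u, forall j, j \in r -> F j u != 0.
Proof.
elim: r => [|j r ih] h1 h2; first by exists 0.
have sub i : i \in r -> i \in j :: r by move=> ir; rewrite inE ir orbT.
have [i ir|i ir|v hv] := ih; [exact: h1 (sub _ ir) | exact: h2 (sub _ ir) | ].
have [m hm] := h1 j (mem_head _ _); have [u hu] := h2 j (mem_head _ _).
have [|n hn] := @linepoly_prod_ex L V J r F.
  by move=> i ir; apply: h1 (sub _ ir).
have [|w] := linepoly_mul_neq0 hm hn hu (v := v).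
  by apply/prod_seq_neq0P => i ir; apply: hv.
rewrite mulf_eq0 negb_or => /andP[fw /prod_seq_neq0P gw].
by exists w => i; rewrite inE => /predU1P[->//|ir]; apply: gw.
Qed.

End Nonvanishing.

Section Grid.

(** The coordinates are freed one at a time: in the induction [s] lists those that are not yet
    required to satisfy [P]. *)
Lemma product_vanishing (L : nmodType) (I : finType) (X : eqType) (D P : pred X)
  (f : {ffun I -> X} -> L) :
  (forall x, P x -> D x) ->
  (forall (v : {ffun I -> X}) i, (forall j, D (v j)) ->
     (forall x, P x -> f [ffun j => if j == i then x else v j] = 0) -> f v = 0) ->
  (forall v : {ffun I -> X}, (forall i, P (v i)) -> f v = 0) ->
  forall v : {ffun I -> X}, (forall i, D (v i)) -> f v = 0.
Proof.
move=> PD hsec hP v Dv.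
suff H (s : seq I) (w : {ffun I -> X}) : (forall i, D (w i)) ->
    (forall i, i \notin s -> P (w i)) -> f w = 0.
  by apply: (H (enum I)) => // i; rewrite mem_enum.
elim: s w => [|i s ih] w Dw Pw; first by apply: hP => i; apply: Pw.
apply: (hsec w i) => // x Px; apply: ih => j; rewrite ffunE.
  by case: ifP => _ //; apply: PD.
by case: (altP (j =P i)) => // ji js; apply: Pw; rewrite inE negb_or ji.
Qed.

(** More than [m] values per coordinate determine a function of degree at most [m] on lines. Later
    [U] is a set of nonzero scalars or the image of the finite field. *)
Lemma linepoly_grid (L : fieldType) a b m (f : 'M[L]_(a, b) -> L) (U : seq L) :
  linepoly m f -> uniq U -> (m < size U)%N ->
  (forall x : 'M[L]_(a, b), (forall i j, x i j \in U) -> f x = 0) -> forall x, f x = 0.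
Proof.
move=> hf uU mU h x.
pose mx (v : {ffun 'I_a * 'I_b -> L}) := \matrix_(i, j) v (i, j) : 'M[L]_(a, b).
have -> : x = mx [ffun k : 'I_a * 'I_b => x k.1 k.2] by apply/matrixP => i j; rewrite mxE ffunE.
apply: (@product_vanishing L _ L predT [pred z | z \in U] (f \o mx)) => //=; last first.
  by move=> v hv; apply: h => i j; rewrite mxE; apply: hv.
move=> v [i1 i2] _ hv.
have [p sp pe] := hf (mx v - v (i1, i2) *: delta_mx i1 i2) (delta_mx i1 i2).
have E t : mx v - v (i1, i2) *: delta_mx i1 i2 + t *: delta_mx i1 i2 =
    mx [ffun j => if j == (i1, i2) then t else v j].
  apply/matrixP => k l; rewrite !mxE ffunE xpair_eqE.
  by have [->|_] := eqVneq k i1; have [->|_] := eqVneq l i2; rewrite /=; ring.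
have p0 : p = 0.
  apply: (roots_geq_poly_eq0 _ uU); last exact: leq_trans mU.
  by apply/allP => t tU; rewrite /root -pe E hv.
by rewrite /= -[mx v](subrK (v (i1, i2) *: delta_mx i1 i2)) pe p0 horner0.
Qed.

End Grid.

(** * Determining functions by finitely many values; polynomials in given features *)

Lemma not_forall2_imp (A B : Type) (P : A -> Prop) (T : B -> Prop) (Q : A -> B -> Prop) :
  ~ (forall a, P a -> forall b, T b -> Q a b) ->
  exists a b, [/\ P a, T b & ~ Q a b].
Proof.
move=> h; apply: NNPP => h2; apply: h => a Pa b Tb; apply: NNPP => nQ.
by apply: h2; exists a, b.
Qed.

Section EvalMatrix.
Variables (L : fieldType) (X : Type) (K : nat) (F : 'I_K -> X -> L).

Definition evmx n (pts : 'I_n -> X) : 'M[L]_(n, K) := \matrix_(i, k) F k (pts i).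

Definition add_point n (pts : 'I_n -> X) (x : X) (i : 'I_(n + 1)) : X :=
  if split i is inl j then pts j else x.

Lemma add_pointP n (pts : 'I_n -> X) x (T : X -> Prop) :
  (forall i, T (pts i)) -> T x -> forall i, T (add_point pts x i).
Proof. by move=> h hx i; rewrite /add_point; case: split. Qed.

Lemma row_free_add_point n (pts : 'I_n -> X) x (c : 'I_K -> L) :
  row_free (evmx pts) -> (forall i, \sum_k c k * F k (pts i) = 0) ->
  \sum_k c k * F k x != 0 -> row_free (evmx (add_point pts x)).
Proof.
move=> fr h hx; apply: inj_row_free => v hv.
have E : evmx (add_point pts x) = col_mx (evmx pts) (\row_k F k x).
  apply/matrixP => i k; rewrite -[i]splitK /add_point.
  by case: split => j /=; rewrite ?col_mxEu ?col_mxEd !mxE ?(unsplitK (inl j)) ?(unsplitK (inr j)).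
pose C : 'cV[L]_K := \col_k c k.
have EC : evmx pts *m C = 0.
  apply/colP => i; rewrite !mxE -[RHS](h i).
  by apply: eq_bigr => k _; rewrite !mxE mulrC.
move: hv; rewrite E -[v]hsubmxK mul_row_col => hv.
have := congr1 (mulmx^~ C) hv; rewrite /= mulmxDl -!mulmxA EC mulmx0 add0r mul0mx.
rewrite [rsubmx v]mx11_scalar mul_scalar_mx => /rowP/(_ 0).
rewrite !mxE => /eqP; rewrite mulf_eq0; case/orP; last first.
  rewrite (eq_bigr (fun k => c k * F k x)) ?(negPf hx) // => k _.
  by rewrite !mxE mulrC.
move=> /eqP r0; move: hv; rewrite [rsubmx v]mx11_scalar mxE r0.
rewrite mul_scalar_mx scale0r addr0 => /eqP; rewrite mulmx_free_eq0 // => /eqP->.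
by rewrite raddf0 row_mx0.
Qed.

(** A point is added as long as some combination vanishes at the chosen points but not on all of
    [T]. Each addition raises the rank of the evaluation matrix, which is at most [K]. *)
Lemma separating_points (T : X -> Prop) : exists n (pts : 'I_n -> X),
  [/\ row_free (evmx pts), forall i, T (pts i) &
   forall c : 'I_K -> L, (forall i, \sum_k c k * F k (pts i) = 0) ->
   forall x, T x -> \sum_k c k * F k x = 0].
Proof.
suff H m n (pts : 'I_n -> X) : (K <= n + m)%N -> row_free (evmx pts) ->
    (forall i, T (pts i)) -> exists n (pts : 'I_n -> X),
    [/\ row_free (evmx pts), forall i, T (pts i) &
     forall c : 'I_K -> L, (forall i, \sum_k c k * F k (pts i) = 0) ->
     forall x, T x -> \sum_k c k * F k x = 0].
  have f0 : 'I_0 -> X by case.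
  by apply: (H K 0%N f0) => [||[]] //; rewrite /row_free flatmx0 mxrank0.
elim: m n pts => [|m ih] n pts Kn fr hT;
  (case: (classic (forall c : 'I_K -> L, (forall i, \sum_k c k * F k (pts i) = 0) ->
     forall x, T x -> \sum_k c k * F k x = 0)) => [h|]; first by exists n, pts).
  move=> /not_forall2_imp[c [x [hc Tx /eqP hx]]].
  have := row_free_add_point fr hc hx; rewrite /row_free => /eqP.
  by have := rank_leq_col (evmx (add_point pts x)); move: Kn; lia.
move=> /not_forall2_imp[c [x [hc Tx /eqP hx]]].
apply: (ih _ (add_point pts x)); first by move: Kn; lia.
  exact: row_free_add_point hc hx.
exact: add_pointP.
Qed.

End EvalMatrix.

Section Words.
Variable I : finType.

(** Words replace monomials: the spanning families become redundant, but induction on the degree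
    just peels off a letter, and [#|I| ^ D] is a sufficient count. *)
Fixpoint words D : seq (seq I) :=
  if D is D'.+1 then [seq i :: w | i <- enum I, w <- words D'] else [:: [::]].

Lemma size_words D : size (words D) = (#|I| ^ D)%N.
Proof. by elim: D => //= D ih; rewrite size_allpairs ih -cardE expnS. Qed.

Lemma size_in_words D w : w \in words D -> size w = D.
Proof.
elim: D w => [|D ih] w /=; first by rewrite inE => /eqP->.
by case/allpairsP => -[i v] /= [_ vD ->] /=; rewrite (ih v).
Qed.

End Words.

Section PolyFunctions.
Variables (L : fieldType) (X : Type) (I : finType) (z : X -> I -> L).

Definition mono (x : X) (w : seq I) : L := \prod_(i <- w) z x i.

(* Homogeneous polynomials of degree [D] in the features [z x i]; when one of
   the features is constantly 1 these are all polynomials of degree at most [D]. *)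
Definition polyf D (f : X -> L) := exists c : seq I -> L,
  forall x, f x = \sum_(w <- words I D) c w * mono x w.

Lemma polyf_ext D f g : f =1 g -> polyf D f -> polyf D g.
Proof. by move=> e [c h]; exists c => x; rewrite -e. Qed.

Lemma polyf0P f : polyf 0 f <-> exists c, forall x, f x = c.
Proof.
split=> [[c h]|[c h]].
  by exists (c [::]) => x; rewrite h big_seq1 /mono big_nil mulr1.
by exists (fun=> c) => x; rewrite h big_seq1 /mono big_nil mulr1.
Qed.

Lemma polyfSP D f : polyf D.+1 f <->
  exists2 g : I -> X -> L, (forall i, polyf D (g i)) &
    forall x, f x = \sum_i z x i * g i x.
Proof.
split=> [[c h]|[g hg h]].
  exists (fun i x => \sum_(w <- words I D) c (i :: w) * mono x w) => [i|x].
    by exists (fun w => c (i :: w)).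
  rewrite h /= big_allpairs_dep /= big_enum; apply: eq_bigr => i _.
  rewrite big_distrr /=; apply: eq_bigr => w _.
  by rewrite /mono big_cons mulrCA.
have [c hc] := fin_all_exists hg.
exists (fun w => if w is i :: v then c i v else 0) => x.
rewrite h /= big_allpairs_dep /= big_enum; apply: eq_bigr => i _.
rewrite (hc i) big_distrr /=; apply: eq_bigr => w _.
by rewrite /mono big_cons mulrCA.
Qed.

Lemma polyfD D f g : polyf D f -> polyf D g -> polyf D (fun x => f x + g x).
Proof.
move=> [c hc] [d hd]; exists (fun w => c w + d w) => x.
by rewrite hc hd -big_split /=; apply: eq_bigr => w _; rewrite mulrDl.
Qed.

Lemma polyfZ D a f : polyf D f -> polyf D (fun x => a * f x).
Proof.
move=> [c hc]; exists (fun w => a * c w) => x.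
by rewrite hc big_distrr /=; apply: eq_bigr => w _; rewrite mulrA.
Qed.

Lemma polyf_zero D : polyf D (fun=> 0).
Proof. by exists (fun=> 0) => x; rewrite big1 // => w _; rewrite mul0r. Qed.

Lemma polyf_sum (J : Type) (r : seq J) (P : pred J) D (f : J -> X -> L) :
  (forall j, P j -> polyf D (f j)) -> polyf D (fun x => \sum_(j <- r | P j) f j x).
Proof.
move=> h; elim: r => [|j r ih].
  by apply: polyf_ext (polyf_zero D) => x; rewrite big_nil.
have [Pj|Pj] := boolP (P j); last by apply: polyf_ext ih => x; rewrite big_cons (negPf Pj).
by apply: polyf_ext (polyfD (h j Pj) ih) => x; rewrite big_cons Pj.
Qed.

Lemma polyf_feature i : polyf 1 (z^~ i).
Proof.
apply/polyfSP; exists (fun j _ => (j == i)%:R) => [j|x].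
  by apply/polyf0P; exists (j == i)%:R.
rewrite (bigD1 i) //= eqxx mulr1 big1 ?addr0 // => j /negPf->.
by rewrite mulr0.
Qed.

Lemma polyfM D E f g : polyf D f -> polyf E g -> polyf (D + E) (fun x => f x * g x).
Proof.
elim: D f => [|D ih] f.
  by move=> /polyf0P[c hc] /(polyfZ c); apply: polyf_ext => x; rewrite hc.
move=> /polyfSP[h hh e] hg; apply/polyfSP.
exists (fun i x => h i x * g x) => [i|x]; first exact: ih.
by rewrite e big_distrl /=; apply: eq_bigr => i _; rewrite mulrA.
Qed.

Lemma polyf_prod (J : Type) (r : seq J) D (f : J -> X -> L) :
  (forall j, polyf D (f j)) -> polyf (size r * D) (fun x => \prod_(j <- r) f j x).
Proof.
move=> h; elim: r => [|j r ih].
  by apply/polyf0P; exists 1 => x; rewrite big_nil.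
by rewrite mulSn; apply: polyf_ext (polyfM (h j) ih) => x; rewrite big_cons.
Qed.

Lemma polyf_prod_ord n D (f : 'I_n -> X -> L) :
  (forall j, polyf D (f j)) -> polyf (n * D) (fun x => \prod_j f j x).
Proof.
by move=> h; rewrite -{1}[n]card_ord cardE enumT; apply: (@polyf_prod _ _ D f).
Qed.

Lemma polyf_mono w : polyf (size w) (fun x => mono x w).
Proof.
rewrite -[size w]muln1; apply: (@polyf_prod _ w 1 (fun i x => z x i)) => i.
exact: polyf_feature.
Qed.

Lemma polyf_sep (T : X -> Prop) D : exists n (pts : 'I_n -> X),
  [/\ (n <= #|I| ^ D)%N, forall i, T (pts i) &
   forall f, polyf D f -> (forall i, f (pts i) = 0) -> forall x, T x -> f x = 0].
Proof.
pose F k x := mono x (tnth (in_tuple (words I D)) k).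
have [n [pts [fr hT hs]]] := separating_points F T.
have FE (c : seq I -> L) x : \sum_(w <- words I D) c w * mono x w =
    \sum_k c (tnth (in_tuple (words I D)) k) * F k x by rewrite big_tnth.
exists n, pts; split=> //.
  by rewrite -(eqP fr) -size_words rank_leq_col.
move=> f [c hc] h0 x Tx; rewrite hc FE; apply: (hs (fun k => c (tnth _ k))) => // i.
by rewrite -FE -hc h0.
Qed.

(** The matrix of values [f j (pts i)] is triangular with nonzero diagonal, and it factors through
    the [#|I| ^ D] words. *)
Lemma polyf_indep_bound D n (pts : 'I_n -> X) (f : 'I_n -> X -> L) :
  (forall i, polyf D (f i)) -> (forall i, f i (pts i) != 0) ->
  (forall i j : 'I_n, (i < j)%N -> f j (pts i) = 0) -> (n <= #|I| ^ D)%N.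
Proof.
move=> hf hd ht; have [c hc] := fin_all_exists hf.
pose F k x := mono x (tnth (in_tuple (words I D)) k).
have FE i x : f i x = \sum_k c i (tnth (in_tuple (words I D)) k) * F k x.
  by rewrite hc big_tnth.
rewrite -size_words; have : row_free (evmx F pts); last first.
  by move=> /eqP<-; apply: rank_leq_col.
have /row_freeP[B hB] : row_free (evmx F pts *m
    \matrix_(k, i) c i (tnth (in_tuple (words I D)) k)).
  set M := _ *m _; have ME i j : M i j = f j (pts i).
    by rewrite FE mxE; apply: eq_bigr => k _; rewrite !mxE mulrC.
  rewrite row_free_unit unitmxE det_trig ?unitfE.
    by apply/prodf_neq0 => i _; rewrite ME.
  by apply/is_trig_mxP => i j ij; rewrite ME ht.
by apply/row_freeP; exists (\matrix_(k, i) c i (tnth (in_tuple (words I D)) k) *m B);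
  rewrite mulmxA.
Qed.

Section Unit.
Variable i0 : I.
Hypothesis z1 : forall x, z x i0 = 1.

Lemma polyfW D f : polyf D f -> polyf D.+1 f.
Proof.
move=> /(polyfM (polyf_feature i0)); rewrite add1n.
by apply: polyf_ext => x; rewrite z1 mul1r.
Qed.

Lemma polyf_le D E f : (D <= E)%N -> polyf D f -> polyf E f.
Proof. by move=> /subnK<- h; elim: (_ - _)%N => //= n ih; apply: polyfW. Qed.

Lemma polyf_cst D a : polyf D (fun=> a).
Proof. by apply: (@polyf_le 0); last by apply/polyf0P; exists a. Qed.

End Unit.

Lemma polyf_det D n (A : X -> 'M[L]_n) :
  (forall i j, polyf D (fun x => A x i j)) -> polyf (n * D) (fun x => \det (A x)).
Proof.
move=> h; apply: polyf_sum => s _; apply: polyfZ.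
by apply: polyf_prod_ord => i; apply: h.
Qed.

Lemma polyf_linepoly (V : lmodType L) (phi : V -> X) m D f :
  (forall i, linepoly m (fun v => z (phi v) i)) -> polyf D f ->
  linepoly (D * m) (fun v => f (phi v)).
Proof.
move=> hz; elim: D f => [|D ih] f.
  by move=> /polyf0P[c hc]; apply: linepoly_ext (linepoly_cst _ c) => v; rewrite hc.
move=> /polyfSP[g hg e]; rewrite mulSn.
have h i : predT i -> linepoly (m + D * m) (fun v => z (phi v) i * g i (phi v)).
  by move=> _; apply: linepolyM (hz i) (ih _ (hg i)).
by apply: linepoly_ext (linepoly_sum (index_enum I) h) => v; rewrite e.
Qed.

End PolyFunctions.

Lemma polyf_comp (L : fieldType) (X Y : Type) (I J : finType) (z : X -> I -> L)
  (y : Y -> J -> L) (phi : X -> Y) m D (f : Y -> L) :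
  (forall j, polyf z m (fun x => y (phi x) j)) -> polyf y D f ->
  polyf z (D * m) (fun x => f (phi x)).
Proof.
move=> hy; elim: D f => [|D ih] f.
  by move=> /polyf0P[c hc]; apply/polyf0P; exists c => x; apply: hc.
move=> /polyfSP[g hg e]; rewrite mulSn.
have h j : predT j -> polyf z (m + D * m) (fun x => y (phi x) j * g j (phi x)).
  by move=> _; apply: polyfM (hy j) (ih _ (hg j)).
by apply: polyf_ext (polyf_sum (index_enum J) h) => x; rewrite e.
Qed.

Section MatrixFeatures.
Variable L : fieldType.

Definition aug (X : Type) (J : finType) (u : X -> J -> L) (x : X) (o : option J) : L :=
  if o is Some j then u x j else 1.

Definition mxf N : 'M[L]_N -> option ('I_N * 'I_N) -> L :=
  aug (fun (x : 'M[L]_N) (k : 'I_N * 'I_N) => x k.1 k.2).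

Lemma card_mxf N : #|{: option ('I_N * 'I_N)}| = (N * N).+1.
Proof. by rewrite card_option card_prod card_ord. Qed.

Lemma polyf_mxE N (i j : 'I_N) : polyf (@mxf N) 1 (fun x => x i j).
Proof. exact: (polyf_feature (@mxf N) (Some (i, j))). Qed.

Lemma polyf_mx_cst N D a : polyf (@mxf N) D (fun=> a).
Proof. exact: (@polyf_cst _ _ _ (@mxf N) None). Qed.

Lemma polyf_mulmx (X : Type) (I : finType) (z : X -> I -> L) D E a b c
  (A : X -> 'M[L]_(a, b)) (B : X -> 'M[L]_(b, c)) :
  (forall i j, polyf z D (fun x => A x i j)) ->
  (forall i j, polyf z E (fun x => B x i j)) ->
  forall i j, polyf z (D + E) (fun x => (A x *m B x) i j).
Proof.
move=> hA hB i j.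
have h k : predT k -> polyf z (D + E) (fun x => A x i k * B x k j).
  by move=> _; apply: polyfM.
by apply: polyf_ext (polyf_sum (index_enum _) h) => x; rewrite mxE.
Qed.

Lemma polyf_mx_affine N (f : 'M[L]_N -> L) D (g : 'M[L]_N -> 'M[L]_N) :
  (forall i j, polyf (@mxf N) 1 (fun x => g x i j)) ->
  polyf (@mxf N) D f -> polyf (@mxf N) D (fun x => f (g x)).
Proof.
move=> hg hf; rewrite -[D]muln1; apply: polyf_comp hf => -[[i j]|] /=.
  exact: hg.
exact: polyf_mx_cst.
Qed.

Lemma polyf_mul2 N (a b : 'M[L]_N) D f : polyf (@mxf N) D f ->
  polyf (@mxf N) D (fun x => f (a *m x *m b)).
Proof.
apply: polyf_mx_affine => i j; rewrite -[1%N]/(0 + 1 + 0)%N.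
apply: polyf_mulmx => k l; last by apply/polyf0P; exists (b k l).
apply: polyf_mulmx => {}k {}l; last exact: polyf_mxE.
by apply/polyf0P; exists (a k l).
Qed.

End MatrixFeatures.

(** * Product sets and escape from the zeros of polynomials *)

Section ProductSets.
Variables (L : fieldType) (N : nat) (B : {fset 'M[L]_N}).

Lemma prodsetSP m x : reflect (exists a b, [/\ a \in B, b \in prodset B m & x = a *m b])
  (x \in prodset B m.+1).
Proof.
apply: (iffP idP) => [/imfset2P[a aB [b bP ->]]|[a [b [aB bP ->]]]].
  by exists a, b.
by apply/imfset2P; exists a => //; exists b.
Qed.

Lemma prodset0E x : (x \in prodset B 0) = (x == 1%:M).
Proof. by rewrite /= inE. Qed.

Lemma prodset1 x : x \in B -> x \in prodset B 1.
Proof. by move=> xB; apply/prodsetSP; exists x, 1%:M; rewrite prodset0E mulmx1. Qed.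

Lemma prodset_mul m n x y : x \in prodset B m -> y \in prodset B n ->
  x *m y \in prodset B (m + n).
Proof.
elim: m x => [|m ih] x; first by rewrite prodset0E => /eqP-> yP; rewrite mul1mx.
move=> /prodsetSP[a [b [aB bP ->]]] yP; rewrite addSn; apply/prodsetSP.
by exists a, (b *m y); rewrite mulmxA; split=> //; apply: ih.
Qed.

Hypothesis B1 : 1%:M \in B.

Lemma prodset_le m n x : (m <= n)%N -> x \in prodset B m -> x \in prodset B n.
Proof.
move=> /subnK<- xP; elim: (_ - _)%N => //= k ih; apply/prodsetSP.
by exists 1%:M, x; rewrite mul1mx.
Qed.

Variable e : nat.
Local Notation Q := ((N * N).+1 ^ e)%N.

(** The functions of degree [e] vanishing on [B^j] form a decreasing sequence of spaces inside a
    space of dimension at most [Q]. Two consecutive ones agree for some [j <= Q], and then the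
    sequence is constant, so points of [B^j] already determine vanishing on every power. *)
Lemma escape : exists n (pts : 'I_n -> 'M[L]_N),
  [/\ (n <= Q)%N, forall i, pts i \in prodset B Q &
   forall f, polyf (@mxf L N) e f -> (forall i, f (pts i) = 0) ->
   forall j x, x \in prodset B j -> f x = 0].
Proof.
pose V j (f : 'M[L]_N -> L) := polyf (@mxf L N) e f /\ forall x, x \in prodset B j -> f x = 0.
have [j jQ hj] : exists2 j, (j <= Q)%N & forall f, V j f -> V j.+1 f.
  apply: NNPP => no.
  (* If the sequence dropped at each of the [Q + 1] indices, the functions lost would form a
     triangular system that is too large. *)
  have [f hf] : exists f : 'I_Q.+1 -> 'M[L]_N -> L, forall j : 'I_Q.+1,
      V j (f j) /\ exists2 x, x \in prodset B j.+1 & f j x != 0.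
    apply: (@fin_all_exists _ _ (fun (j : 'I_Q.+1) f =>
      V j f /\ exists2 x, x \in prodset B j.+1 & f x != 0)) => j.
    apply: NNPP => noj; apply: no; exists (j : nat); first by rewrite -ltnS.
    move=> f Vf; split; first by case: Vf.
    move=> x xP; apply: NNPP => /eqP fx; apply: noj.
    by exists f; split=> //; exists x.
  have [pts hp1 hp2] := fin_all_exists2 (fun j => proj2 (hf j)).
  have := @polyf_indep_bound _ _ _ _ e _ pts f (fun j => (hf j).1.1) hp2.
  rewrite card_mxf ltnn => bad; suff: false by [].
  apply: bad => i j ij; apply: (hf j).1.2.
  exact: prodset_le (hp1 i).
have [n [pts [hn hT hs]]] := polyf_sep (@mxf L N) (fun x => x \in prodset B j) e.
exists n, pts; split=> [|i|f hf h0 k x xP]; first by rewrite -card_mxf.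
  exact: prodset_le (hT i).
have {h0} : V j f by split=> // y; apply: hs.
(* Stationarity propagates: [g] vanishes on [B^(i+1)] exactly when its left translates by the
   elements of [B] vanish on [B^i]. *)
have V_up i : forall g, V (j + i)%N g -> V (j + i).+1 g.
  elim: i => [|i ih] g; first by rewrite addn0; apply: hj.
  rewrite addnS => -[hg h0]; split=> // y /prodsetSP[a [b [aB bP ->]]].
  suff: V (j + i).+1 (fun y => g (a *m y)) by case=> _; apply.
  apply: ih; split=> [|c cP].
    have := polyf_mul2 a 1%:M hg; apply: polyf_ext => c; first by rewrite mulmx1.
  by apply: h0; apply/prodsetSP; exists a, c.
move=> Vf; have : V (j + k)%N f.
  by elim: k {xP} => [|k ih]; rewrite ?addn0 // addnS; apply: V_up.
by case=> _; apply; apply: prodset_le xP; apply: leq_addl.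
Qed.

End ProductSets.

(** * Kronecker substitution, linear relations, joint eigenvectors *)

Lemma classical_min (P : nat -> Prop) n : P n ->
  exists2 m, P m & forall k, P k -> (m <= k)%N.
Proof.
elim/ltn_ind: n => n ih Pn.
case: (classic (exists2 k, (k < n)%N & P k)) => [[k kn Pk]|no]; first exact: ih Pk.
by exists n => // k Pk; rewrite leqNgt; apply/negP => kn; apply: no; exists k.
Qed.

Lemma leq_expl m n e : (m <= n)%N -> (m ^ e <= n ^ e)%N.
Proof. by case: e => // e; rewrite leq_exp2r. Qed.

Lemma digits_inj K s (a b : nat -> nat) :
  (forall l, (l < s)%N -> (a l < K)%N /\ (b l < K)%N) ->
  (\sum_(l < s) a l * K ^ l = \sum_(l < s) b l * K ^ l)%N ->
  forall l, (l < s)%N -> a l = b l.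
Proof.
elim: s a b => [|s ih] a b h //.
have E (c : nat -> nat) : (\sum_(l < s.+1) c l * K ^ l = (\sum_(l < s) c l.+1 * K ^ l) * K + c 0)%N.
  rewrite big_ord_recl /= expn0 muln1 addnC big_distrl /=; congr (_ + _)%N.
  by apply: eq_bigr => l _; rewrite expnSr mulnA.
have [a0 b0] := h 0 (ltn0Sn s); rewrite !E => e.
have e0 : a 0 = b 0.
  by have := congr1 (modn^~ K) e; rewrite /= !modnMDl !modn_small.
have K0 : (0 < K)%N by case: (K) a0.
have {}ih := ih (fun l => a l.+1) (fun l => b l.+1) (fun l ls => h l.+1 ls).
case=> [//|l] ls; apply: ih ls.
by move/eqP: e; rewrite e0 eqn_add2r eqn_pmul2r // => /eqP.
Qed.

Section BoxPolynomials.
Variable L : closedFieldType.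

Definition boxpoly s K (coef : {ffun 'I_s -> 'I_K} -> L) (c : 'I_s -> L) :=
  \sum_a coef a * \prod_l c l ^+ a l.

(** Kronecker substitution: with [c l = t ^+ (K ^ l)], distinct exponent vectors with entries below
    [K] give distinct powers of [t]. *)
Lemma boxpoly_neq0 s K (coef : {ffun 'I_s -> 'I_K} -> L) a0 :
  coef a0 != 0 -> exists c, boxpoly coef c != 0.
Proof.
move=> ca0; pose code (a : {ffun 'I_s -> 'I_K}) := (\sum_(l < s) a l * K ^ l)%N.
have codeI a b : code a = code b -> a = b.
  pose ext (a : {ffun 'I_s -> 'I_K}) l := if insub l is Some i then a i : nat else 0.
  have extE (x : {ffun 'I_s -> 'I_K}) (l : 'I_s) : x l = ext x l :> nat by rewrite /ext valK.
  have EC x : code x = (\sum_(l < s) ext x l * K ^ l)%N.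
    by apply: eq_bigr => l _; rewrite extE.
  rewrite !EC => e; apply/ffunP => l; apply: val_inj; rewrite /= !extE.
  apply: (digits_inj _ e) => // k ks.
  by rewrite -(extE a (Ordinal ks)) -(extE b (Ordinal ks)) !ltn_ord.
pose p : {poly L} := \sum_a coef a *: 'X^(code a).
have p0 : p != 0.
  apply/eqP => /(congr1 (fun q : {poly L} => q`_(code a0))).
  rewrite coef_sum coef0 (bigD1 a0) //= coefZ coefXn eqxx mulr1 big1.
    by rewrite addr0; apply/eqP.
  move=> a aa0; rewrite coefZ coefXn; case: eqP => [/codeI e|]; last by rewrite mulr0.
  by rewrite -e eqxx in aa0.
have [t pt] := poly_nonroot p0; exists (fun l => t ^+ (K ^ l)).
suff -> : boxpoly coef (fun l => t ^+ (K ^ l)) = p.[t] by [].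
rewrite horner_sum; apply: eq_bigr => a _; rewrite hornerZ hornerXn; congr (_ * _).
by rewrite expr_sum; apply: eq_bigr => l _; rewrite -exprM mulnC.
Qed.

Lemma linepoly_boxpoly (V : lmodType L) s K (coef : {ffun 'I_s -> 'I_K} -> L)
  m (phi : V -> 'I_s -> L) : (forall l, linepoly m (phi^~ l)) ->
  linepoly (s * (K * m)) (fun v => boxpoly coef (phi v)).
Proof.
move=> h; apply: linepoly_sum => a _; apply: linepolyZ.
apply: (@linepoly_prod_ord L V s (K * m) (fun l v => phi v l ^+ a l)) => l.
apply: linepoly_le (linepolyX (a l) (h l)); rewrite leq_mul2r.
by rewrite [(a l <= K)%N]ltnW ?orbT.
Qed.

Lemma nontrivial_relation (J : finType) n (F : J -> 'I_n -> L) : (n < #|J|)%N ->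
  exists c : J -> L, (exists j, c j != 0) /\ forall i, \sum_j c j * F j i = 0.
Proof.
move=> nJ; pose M := \matrix_(j < #|J|, i < n) F (enum_val j) i.
have : kermx M != 0.
  by rewrite kermx_eq0 /row_free neq_ltn (leq_ltn_trans (rank_leq_col _)).
case/rowV0Pn => v /sub_kermxP vM v0; exists (fun j => v 0 (enum_rank j)); split.
  by have [j vj] := rV0Pn _ v0; exists (enum_val j); rewrite enum_valK.
move=> i; have := congr1 (fun A : 'rV_n => A 0 i) vM; rewrite !mxE => e.
rewrite -[RHS]e (reindex_onto enum_val enum_rank) => [|j _]; last exact: enum_rankK.
apply: eq_big => [j|j _]; first by rewrite enum_valK eqxx.
by rewrite enum_valK mxE.
Qed.

End BoxPolynomials.

(** By Cayley-Hamilton the product of the [M - a] over the characteristic roots is zero. Applying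
    the factors to [v] in turn, some factor is the first to land in [E]; the vector just before it
    is the one sought. *)
Lemma eigenvector_mod (L : closedFieldType) n (M E W : 'M[L]_n) :
  stablemx E M -> stablemx W M ->
  (exists2 v : 'rV_n, (v <= W)%MS & ~~ (v <= E)%MS) ->
  exists a, exists2 v : 'rV_n, (v <= W)%MS && ~~ (v <= E)%MS & (v *m (M - a%:M) <= E)%MS.
Proof.
case: n M E W => [|n] M E W sE sW [v vW vE].
  by rewrite [v]thinmx0 sub0mx in vE.
have [rs /= Hrs] := closed_field_poly_normal (char_poly M).
have : (v *m \prod_(a <- rs) (M - a%:M) <= E)%MS.
  suff -> : \prod_(a <- rs) (M - a%:M) = 0 by rewrite mulmx0 sub0mx.
  have := Cayley_Hamilton M; rewrite Hrs (monicP (char_poly_monic M)) scale1r rmorph_prod /=.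
  move=> <-; apply: eq_bigr => a _.
  by rewrite rmorphB /= horner_mx_X horner_mx_C.
elim: rs v vW vE {Hrs} => [|a rs ih] v vW vE; first by rewrite big_nil mulmx1 (negPf vE).
rewrite big_cons mulmxA; case: (boolP (v *m (M - a%:M) <= E)%MS) => [h _|h].
  by exists a, v; rewrite ?vW ?vE.
apply: ih h; rewrite mulmxBr mul_mx_scalar addmx_sub //.
  exact: submx_trans (submxMr _ vW) sW.
by rewrite eqmx_opp scalemx_sub.
Qed.

Section QuotientEigenvector.
Variables (L : closedFieldType) (n : nat).

Lemma common_eigenvector_mod N (Ms : 'I_N -> 'M[L]_n) (E : 'M[L]_n) :
  (forall i j, Ms i *m Ms j = Ms j *m Ms i) -> (forall j, stablemx E (Ms j)) ->
  (\rank E < n)%N ->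
  exists chi : 'I_N -> L, exists2 v : 'rV_n, ~~ (v <= E)%MS &
    forall j, (v *m (Ms j - (chi j)%:M) <= E)%MS.
Proof.
move=> cMs sE rE.
suff H (r : seq 'I_N) (W : 'M[L]_n) : (forall j, stablemx W (Ms j)) ->
    (exists2 v : 'rV_n, (v <= W)%MS & ~~ (v <= E)%MS) ->
    exists2 v : 'rV_n, (v <= W)%MS && ~~ (v <= E)%MS &
      forall j, j \in r -> exists a, (v *m (Ms j - a%:M) <= E)%MS.
  have [|v /andP[_ vE] hv] := H (enum 'I_N) 1%:M (fun j => submx1 _).
    have : ~~ (1%:M <= E)%MS.
      by apply/negP => /mxrankS; rewrite mxrank1 leqNgt rE.
    by case/row_subPn => i hi; exists (row i 1%:M); rewrite ?submx1.
  have [chi hchi] := fin_all_exists (fun j => hv j (mem_enum _ j)).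
  by exists chi, v.
elim: r W => [|j r ih] W sW vW.
  by have [v vW' vE] := vW; exists v; rewrite ?vW'.
have [a [v /andP[vWj vE] va]] := eigenvector_mod (sE j) (sW j) vW.
(* The vectors of [W] that are eigenvectors of [Ms j] for [a] modulo [E]; by commutation the other
   matrices preserve this space. *)
pose W' := (W :&: kermx ((Ms j - a%:M) *m cokermx E))%MS.
have inW' (u : 'rV_n) : (u <= W')%MS = (u <= W)%MS && (u *m (Ms j - a%:M) <= E)%MS.
  by rewrite sub_capmx sub_kermx mulmxA [(_ <= E)%MS]submxE.
have [||u /andP[uW' uE] hu] := ih W'.
- move=> i; apply/row_subP => k; rewrite row_mul inW'.
  have : (row k W' <= W')%MS by apply: row_sub.
  rewrite inW' => /andP[rW rE'].
  apply/andP; split; first exact: submx_trans (submxMr _ rW) (sW i).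
  have -> : row k W' *m Ms i *m (Ms j - a%:M) = row k W' *m (Ms j - a%:M) *m Ms i.
    by rewrite -!mulmxA mulmxBr mulmxBl cMs mul_mx_scalar mul_scalar_mx.
  exact: submx_trans (submxMr _ rE') (sE i).
- by exists v => //; rewrite inW' vWj va.
exists u; first by move: uW'; rewrite inW' uE => /andP[->].
move=> i; rewrite inE => /predU1P[->|/hu //].
by exists a; move: uW'; rewrite inW' => /andP[].
Qed.

End QuotientEigenvector.

(** * Torus points as joint eigenvalues: a finite reduced fibre bounds its algebra *)

Section IntWords.
Variable N : nat.

(** Separating positive and negative exponents turns a multiplicative relation between characters
    into an equality of two words without inverses, to which [M_rel] can be applied. *)
Definition posn (n : int) : nat := if n is Posz k then k else 0.
Definition negn (n : int) : nat := if n is Negz k then k.+1 else 0.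
Definition expword (f : 'I_N -> nat) : seq 'I_N := flatten [seq nseq (f i) i | i <- enum 'I_N].

Lemma posnBnegn n : n = (posn n)%:Z - (negn n)%:Z.
Proof. by case: n => k /=; rewrite ?subr0 ?sub0r // NegzE. Qed.

Lemma size_expword f : size (expword f) = (\sum_i f i)%N.
Proof.
rewrite /expword size_flatten /shape -map_comp sumnE big_map big_enum /=.
by apply: eq_bigr => i _; rewrite size_nseq.
Qed.

Lemma prod_expword (L : comNzRingType) (x : 'I_N -> L) f :
  \prod_(i <- expword f) x i = \prod_i x i ^+ f i.
Proof.
rewrite /expword big_flatten big_map big_enum /=.
by apply: eq_bigr => i _; rewrite big_nseq iter_mulr_1.
Qed.

Lemma sum_expword (L : comNzRingType) (x : 'I_N -> L) f :
  \sum_(i <- expword f) x i = \sum_i x i *+ f i.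
Proof.
rewrite /expword big_flatten big_map big_enum /=.
by apply: eq_bigr => i _; rewrite big_nseq iter_addr_0.
Qed.

Lemma prod_exprz_words (L : fieldType) (x : 'I_N -> L) (v : 'I_N -> int) :
  (forall i, x i != 0) ->
  \prod_(i <- expword (posn \o v)) x i =
  (\prod_i x i ^ v i) * \prod_(i <- expword (negn \o v)) x i.
Proof.
move=> x0; rewrite !prod_expword -big_split /=; apply: eq_bigr => i _.
by rewrite /= !exprnP -expfzDr // {2}[v i]posnBnegn subrK.
Qed.

End IntWords.

Section TorusPoints.
Variables (L : closedFieldType) (N d : nat) (A : 'M[int]_(N, d)) (U : 'M[int]_(d, N)).
Hypothesis UA : U *m A = 1%:M.
Hypothesis Asum : forall j, \sum_i A i j = 0.

(** The [i]-th diagonal entry of the torus element with parameter [tau]; the rows of [A] are the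
    weights. *)
Definition zt (tau : 'rV[L]_d) (i : 'I_N) : L := \prod_j tau 0 j ^ A i j.
Definition nz (tau : 'rV[L]_d) : Prop := forall j, tau 0 j != 0.

Lemma zt_neq0 tau i : nz tau -> zt tau i != 0.
Proof. by move=> h; apply/prodf_neq0 => j _; rewrite expfz_neq0. Qed.

Lemma zt_int_rel tau (v : 'I_N -> int) : nz tau -> (forall j, \sum_i v i * A i j = 0) ->
  \prod_i zt tau i ^ v i = 1.
Proof.
move=> h hv.
transitivity (\prod_j \prod_i (tau 0 j ^ A i j) ^ v i).
  rewrite exchange_big /=; apply: eq_bigr => i _.
  by rewrite (big_morph (fun x => x ^ v i) (id1 := 1) (op1 := *%R)) // => [x y|]; rewrite ?expfzMl ?exp1rz.
rewrite big1 // => j _.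
transitivity (tau 0 j ^ (\sum_i v i * A i j)); last by rewrite hv expr0z.
rewrite (big_morph (fun n => tau 0 j ^ n) (id1 := 1) (op1 := *%R)) // => [|x y]; last first.
  by rewrite expfzDr.
by apply: eq_bigr => i _; rewrite -exprz_exp exprz_exp mulrC exprz_exp.
Qed.

Lemma zt_prod1 tau : nz tau -> \prod_i zt tau i = 1.
Proof.
move=> h; rewrite -[RHS](@zt_int_rel tau (fun=> 1) h).
  by apply: eq_bigr => i _; rewrite expr1z.
by move=> j; rewrite -[RHS](Asum j); apply: eq_bigr => i _; rewrite mul1r.
Qed.

(* The rows of [A] generate the character lattice since [U *m A = 1]. *)
Lemma zt_surj (chi : 'I_N -> L) : (forall i, chi i != 0) ->
  (forall v : 'I_N -> int, (forall j, \sum_i v i * A i j = 0) -> \prod_i chi i ^ v i = 1) ->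
  exists2 tau, nz tau & forall i, zt tau i = chi i.
Proof.
move=> c0 hc; exists (\row_j \prod_i chi i ^ U j i) => [j|l].
  by rewrite mxE; apply/prodf_neq0 => i _; rewrite expfz_neq0.
have := hc (fun i => (A *m U - 1%:M) l i).
have -> : \prod_i chi i ^ (A *m U - 1%:M) l i =
    \prod_i chi i ^ (A *m U) l i / chi l.
  rewrite (eq_bigr (fun i => chi i ^ (A *m U) l i * chi i ^ (- (l == i)%:R))).
    rewrite big_split /=; congr (_ * _).
    rewrite (bigD1 l) //= eqxx big1 ?mulr1 // => i /negPf; rewrite eq_sym => ->.
    by rewrite oppr0 expr0z.
  by move=> i _; rewrite -expfzDr // !mxE.
move=> e.
have {}e : \prod_i chi i ^ (A *m U) l i = chi l.
  rewrite -[LHS](divfK (c0 l)) e ?mul1r // => j.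
  transitivity (((A *m U - 1%:M) *m A) l j); first by rewrite !mxE.
  by rewrite mulmxBl -mulmxA UA mulmx1 mul1mx subrr mxE.
rewrite -[RHS]e.
transitivity (\prod_j \prod_i (chi i ^ U j i) ^ A l j).
  apply: eq_bigr => j _; rewrite mxE.
  by rewrite (big_morph (fun x => x ^ A l j) (id1 := 1) (op1 := *%R)) // => [x y|]; rewrite ?expfzMl ?exp1rz.
rewrite exchange_big /=; apply: eq_bigr => i _; rewrite mxE.
rewrite (big_morph (fun n => chi i ^ n) (id1 := 1) (op1 := *%R)) // => [|x y]; last first.
  by rewrite expfzDr.
by apply: eq_bigr => j _; rewrite mulrC exprz_exp.
Qed.

Lemma zt_inj tau tau' : nz tau -> nz tau' -> zt tau =1 zt tau' -> tau = tau'.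
Proof.
suff H t : nz t -> forall j, t 0 j = \prod_i zt t i ^ U j i.
  move=> h h' e; apply/rowP => j; rewrite (H tau) // (H tau') //.
  by apply: eq_bigr => i _; rewrite e.
move=> h j; transitivity (\prod_k t 0 k ^ (U *m A) j k).
  rewrite UA (bigD1 j) //= mxE eqxx expr1z big1 ?mulr1 // => k /negPf.
  by rewrite eq_sym mxE => ->; rewrite expr0z.
transitivity (\prod_k \prod_i (t 0 k ^ A i k) ^ U j i).
  apply: eq_bigr => k _; rewrite mxE.
  rewrite (big_morph (fun n => t 0 k ^ n) (id1 := 1) (op1 := *%R)) // => [|x y]; last first.
    by rewrite expfzDr.
  by apply: eq_bigr => i _; rewrite mulrC exprz_exp.
rewrite exchange_big /=; apply: eq_bigr => i _.
by rewrite (big_morph (fun x => x ^ U j i) (id1 := 1) (op1 := *%R)) // => [x y|]; rewrite ?expfzMl ?exp1rz.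
Qed.

(** The Jacobian of the [d] linear forms [C] in the characters, in the logarithmic derivatives
    [tau_j d/dtau_j], which avoids dividing by [tau_j]. *)
Definition Jmx (C : 'M[L]_(N, d)) (tau : 'rV[L]_d) : 'M[L]_d :=
  \matrix_(l, j) \sum_i C i l * zt tau i * (A i j)%:~R.

Section Representation.
Variables (kappa n : nat) (M : 'I_N -> 'M[L]_kappa) (u : 'cV[L]_kappa).
Variables (C : 'M[L]_(N, d)) (c : 'I_d -> L) (pts : 'I_n -> 'rV[L]_d).

Definition mxword (s : seq 'I_N) : 'M[L]_kappa := foldr (fun i P => M i *m P) 1%:M s.

Hypothesis M_rel : forall s s' : seq 'I_N,
  (forall tau, nz tau -> \prod_(i <- s) zt tau i = \prod_(i <- s') zt tau i) ->
  mxword s = mxword s'.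
Hypothesis M_fibre : forall l, \sum_i C i l *: M i = (c l)%:M.
Hypothesis M_cyclic : forall w : 'rV_kappa, (forall s, w *m mxword s *m u = 0) -> w = 0.
Hypothesis fibre : forall tau, nz tau -> (forall l, \sum_i C i l * zt tau i = c l) ->
  exists a, tau = pts a.
Hypothesis pts_nz : forall a, nz (pts a).
Hypothesis pts_J : forall a, \det (Jmx C (pts a)) != 0.

Let eigenrow (chi : 'I_N -> L) (w : 'rV[L]_kappa) := forall i, w *m M i = chi i *: w.

Let M_comm i j : M i *m M j = M j *m M i.
Proof.
have /= := @M_rel [:: i; j] [:: j; i]; rewrite !mulmx1; apply => tau _.
by rewrite !big_cons !big_nil mulrCA.
Qed.

Let eigenrow_word chi w s : eigenrow chi w -> w *m mxword s = (\prod_(i <- s) chi i) *: w.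
Proof.
move=> h; elim: s => [|i s ih] /=; first by rewrite mulmx1 big_nil scale1r.
by rewrite mulmxA h -scalemxAl ih big_cons scalerA.
Qed.

(** An eigenrow that kills [u] kills every word applied to [u], hence is zero by cyclicity; so the
    eigenrows of one character are proportional. *)
Let eigenrow_line chi : exists2 e, eigenrow chi e &
  forall w, eigenrow chi w -> exists b, w = b *: e.
Proof.
case: (classic (exists2 w, eigenrow chi w & w != 0)) => [[w hw w0]|no]; last first.
  exists 0 => [i|w hw]; first by rewrite mul0mx scaler0.
  exists 0; rewrite scaler0; apply: NNPP => /eqP w0; apply: no.
  by exists w.
have wu : (w *m u) 0 0 != 0.
  apply: contraNneq w0 => e; apply/eqP/M_cyclic => s.
  rewrite (eigenrow_word _ hw) -scalemxAl [w *m u]mx11_scalar e raddf0.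
  by rewrite scaler0.
exists w => // v hv; exists ((v *m u) 0 0 / (w *m u) 0 0).
apply/eqP; rewrite -subr_eq0; apply/eqP/M_cyclic => s.
set b := _ / _; have hb : eigenrow chi (v - b *: w).
  by move=> i; rewrite mulmxBl hv -scalemxAl hw scalerBr !scalerA mulrC.
rewrite (eigenrow_word _ hb) -scalemxAl mulmxBl -scalemxAl [v *m u]mx11_scalar.
rewrite [w *m u]mx11_scalar scale_scalar_mx /b divfK // subrr.
by rewrite scaler0.
Qed.

Let eigenrow_comb chi J (r : seq J) (P : pred J) (F : J -> 'rV[L]_kappa) :
  (forall j, P j -> eigenrow chi (F j)) -> eigenrow chi (\sum_(j <- r | P j) F j).
Proof.
move=> h i; rewrite mulmx_suml scaler_sumr; apply: eq_bigr => j Pj.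
exact: h.
Qed.

(** In the application [M i] is multiplication by a character on the functions on the torus modulo
    the equations of a fibre, and [u] is the class of 1. The invertible Jacobians say that the fibre
    is reduced. If the algebra were larger than the number of points, a joint eigenrow modulo the
    span [E] of the true eigenrows would produce a generalised eigenrow of length two, that is, a
    nonzero tangent vector of the fibre. *)
Lemma torus_representation_bound : (kappa <= n)%N.
Proof.
rewrite leqNgt; apply/negP => nk.
have [e he1 he2] := fin_all_exists2 (fun a => eigenrow_line (zt (pts a))).
pose E0 : 'M_(n, kappa) := \matrix_a e a.
pose E := <<E0>>%MS.
have sE i : stablemx E (M i).
  rewrite /E (eqmxMr _ (genmxE _)) genmxE; apply/row_subP => a.
  rewrite row_mul rowK he1 scalemx_sub //.
  by rewrite -[e a](rowK e); apply: row_sub.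
have rE : (\rank E < kappa)%N.
  by rewrite genmxE (leq_ltn_trans (rank_leq_row _)).
(* The eigenvalues [chi] obey all relations between characters and all fibre equations, because a
   nonzero multiple of [w] cannot lie in [E]; hence [chi] is one of the points. *)
have [chi [w wE hw]] := common_eigenvector_mod M_comm sE rE.
have e_in_E a : (e a <= E)%MS by rewrite genmxE -[e a](rowK e) row_sub.
have wordE s : (w *m mxword s - (\prod_(i <- s) chi i) *: w <= E)%MS.
  elim: s => [|i s ih] /=; first by rewrite mulmx1 big_nil scale1r subrr sub0mx.
  have sEs : stablemx E (mxword s).
    elim: s {ih} => [|j s ih] /=; first by rewrite mulmx1.
    by rewrite mulmxA (submx_trans (submxMr _ (sE j))).
  rewrite big_cons -scalerA.
  have -> : w *m (M i *m mxword s) - chi i *: ((\prod_(j <- s) chi j) *: w) =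
      (w *m (M i - (chi i)%:M)) *m mxword s +
      chi i *: (w *m mxword s - (\prod_(j <- s) chi j) *: w).
    rewrite mulmxBr mul_mx_scalar mulmxBl -mulmxA -scalemxAl scalerBr.
    by rewrite addrA subrK.
  by rewrite addmx_sub ?scalemx_sub // (submx_trans (submxMr _ (hw i))).
have chi_rel s s' : (forall tau, nz tau -> \prod_(i <- s) zt tau i = \prod_(i <- s') zt tau i) ->
    \prod_(i <- s) chi i = \prod_(i <- s') chi i.
  move=> /M_rel e'; apply/eqP; rewrite -subr_eq0; apply: contraNT wE => h.
  have : ((\prod_(i <- s) chi i - \prod_(i <- s') chi i) *: w <= E)%MS.
    have -> : (\prod_(i <- s) chi i - \prod_(i <- s') chi i) *: w =
        (w *m mxword s' - (\prod_(i <- s') chi i) *: w) -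
        (w *m mxword s - (\prod_(i <- s) chi i) *: w).
      by rewrite e' opprB scalerBl [RHS]addrC addrA subrK.
    by rewrite addmx_sub ?eqmx_opp.
  by move=> /(scalemx_sub (\prod_(i <- s) chi i - \prod_(i <- s') chi i)^-1);
    rewrite scalerA mulVf // scale1r.
have chi0 i : chi i != 0.
  have : \prod_(i <- enum 'I_N) chi i = \prod_(i <- [::]) chi i.
    by apply: chi_rel => tau h; rewrite big_enum big_nil zt_prod1.
  rewrite big_nil big_enum => h; have : \prod_i chi i != 0 by rewrite h oner_neq0.
  by move/prodf_neq0; apply.
have words_rel v : (forall j, \sum_i v i * A i j = 0) -> forall tau, nz tau ->
    \prod_(i <- expword (posn \o v)) zt tau i = \prod_(i <- expword (negn \o v)) zt tau i.
  move=> hv tau h; rewrite prod_exprz_words => [|i]; last exact: zt_neq0.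
  by rewrite zt_int_rel // mul1r.
have negw0 v : \prod_(i <- expword (negn \o v)) chi i != 0.
  by apply/prod_seq_neq0P => i _.
have [v hv|tau0 tau0nz ztau0] := zt_surj chi0.
  have := chi_rel _ _ (words_rel v hv); rewrite prod_exprz_words // => h.
  by apply: (mulIf (negw0 v)); rewrite h mul1r.
have chi_fibre l : \sum_i C i l * chi i = c l.
  apply/eqP; rewrite -subr_eq0; apply: contraNT wE => h.
  have : ((\sum_i C i l * chi i - c l) *: w <= E)%MS.
    have -> : (\sum_i C i l * chi i - c l) *: w = - \sum_i C i l *: (w *m (M i - (chi i)%:M)).
      rewrite (eq_bigr (fun i => w *m (C i l *: M i) - (C i l * chi i) *: w)).
        by rewrite sumrB -mulmx_sumr M_fibre mul_mx_scalar -scaler_suml -scalerBl -scaleNr opprB.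
      by move=> i _; rewrite mulmxBr mul_mx_scalar scalerBr scalerA scalemxAr.
    by rewrite eqmx_opp summx_sub // => i _; apply: scalemx_sub.
  move=> /(scalemx_sub (\sum_i C i l * chi i - c l)^-1).
  by rewrite scalerA mulVf // scale1r.
have [a0 ea0] : exists a, tau0 = pts a.
  by apply: fibre => // l; rewrite -[RHS]chi_fibre; apply: eq_bigr => i _; rewrite ztau0.
have chiE i : chi i = zt (pts a0) i by rewrite -ea0 ztau0.
(* At a point different from [chi], a shifted [M i] kills the eigenrow and acts on [w] modulo [E] by
   a nonzero scalar; at [chi] the identity is used. The product [GT] of all these sends [E] into the
   eigenrows of [chi]. *)
have sep a : exists G : 'M[L]_kappa, [/\ (forall i, G *m M i = M i *m G),
    (exists2 g, g != 0 & (w *m G - g *: w <= E)%MS),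
    stablemx E G &
    (forall b, exists g, e b *m G = g *: e b /\ (b = a -> g = 0 \/ eigenrow chi (e a)))].
  case: (classic (exists i, zt (pts a) i <> chi i)) => [[i /eqP hi]|no].
    exists (M i - (zt (pts a) i)%:M); split.
    - by move=> j; rewrite mulmxBl mulmxBr M_comm scalar_mxC.
    - exists (chi i - zt (pts a) i); first by rewrite subr_eq0 eq_sym.
      rewrite mulmxBr mul_mx_scalar scalerBl opprB addrA subrK.
      by have := hw i; rewrite mulmxBr mul_mx_scalar.
    - by rewrite mulmxBr addmx_sub // eqmx_opp mul_mx_scalar scalemx_sub.
    - move=> b; exists (zt (pts b) i - zt (pts a) i); split.
        by rewrite mulmxBr he1 mul_mx_scalar scalerBl.
      by move=> ->; left; rewrite subrr.
  exists 1%:M; split=> [i|||b].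
  - by rewrite mul1mx mulmx1.
  - by exists 1; rewrite ?oner_neq0 // mulmx1 scale1r subrr sub0mx.
  - by rewrite mulmx1.
  - exists 1; rewrite mulmx1 scale1r; split=> // _; right => i.
    rewrite he1; congr (_ *: _); apply: NNPP => h; apply: no; by exists i.
have [G hG] := fin_all_exists sep.
pose GG (r : seq 'I_n) := foldr (fun a P => G a *m P) 1%:M r.
have GGcomm r i : GG r *m M i = M i *m GG r.
  elim: r => [|a r ih] /=; first by rewrite mul1mx mulmx1.
  by rewrite -mulmxA ih mulmxA; have [-> _ _ _] := hG a; rewrite mulmxA.
have GGs r : stablemx E (GG r).
  elim: r => [|a r ih] /=; first by rewrite mulmx1.
  by have [_ _ sG _] := hG a; rewrite mulmxA (submx_trans (submxMr _ sG)).
have GGw r : exists2 g, g != 0 & (w *m GG r - g *: w <= E)%MS.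
  elim: r => [|a r [g g0 ih]] /=.
    by exists 1; rewrite ?oner_neq0 // mulmx1 scale1r subrr sub0mx.
  have [_ [k k0 hk] _ _] := hG a; exists (k * g); first by rewrite mulf_neq0.
  have -> : w *m (G a *m GG r) - (k * g) *: w =
      (w *m G a - k *: w) *m GG r + k *: (w *m GG r - g *: w).
    by rewrite mulmxBl -scalemxAl scalerBr addrA mulmxA subrK scalerA.
  by rewrite addmx_sub ?scalemx_sub // (submx_trans (submxMr _ hk)).
have GGe r b : exists g, e b *m GG r = g *: e b /\ (b \in r -> g = 0 \/ eigenrow chi (e b)).
  elim: r => [|a r [g [ih1 ih2]]] /=; first by exists 1; rewrite mulmx1 scale1r.
  have [_ _ _ /(_ b)[k [hk1 hk2]]] := hG a; exists (k * g); split.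
    by rewrite mulmxA hk1 -scalemxAl ih1 scalerA.
  rewrite inE => /predU1P[ba|/ih2[->|]]; [|by left; rewrite mulr0|by right].
  case: (hk2 ba) => [->|]; first by left; rewrite mul0r.
  by rewrite -ba; right.
set GT := GG (enum 'I_n).
have eGT b : eigenrow chi (e b *m GT).
  have [g [-> /(_ (mem_enum _ b))[->|h]]] := GGe (enum 'I_n) b => i.
    by rewrite scale0r mul0mx scaler0.
  by rewrite -scalemxAl h scalerA mulrC -scalerA.
have eigE v : (v <= E)%MS -> eigenrow chi (v *m GT).
  rewrite genmxE => /submxP[D ->].
  have -> : D *m E0 *m GT = \sum_a D 0 a *: row a E0 *m GT.
    by rewrite [D *m E0]mulmx_sum_row mulmx_suml.
  apply: eigenrow_comb => a _ i.
  by rewrite rowK -scalemxAl -scalemxAl eGT scalerA mulrC -scalerA.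
set w' := w *m GT.
have w'E : ~~ (w' <= E)%MS.
  have [g g0 hg] := GGw (enum 'I_n); apply: contra wE => h.
  have : (g *: w <= E)%MS.
    have -> : g *: w = w' - (w' - g *: w) by rewrite opprB addrCA subrr addr0.
    by rewrite addmx_sub ?eqmx_opp.
  by move=> /(scalemx_sub g^-1); rewrite scalerA mulVf // scale1r.
pose e0 := e a0.
(* Only the eigenline of [e0] remains as an error term, so [beta / chi] behaves as a logarithmic
   derivative at the point [chi]. *)
have [beta hbeta] : exists beta : 'I_N -> L, forall i, w' *m M i = chi i *: w' + beta i *: e0.
  apply: (@fin_all_exists _ _ (fun i b => w' *m M i = chi i *: w' + b *: e0)) => i.
  have h : eigenrow (zt (pts a0)) (w *m (M i - (chi i)%:M) *m GT).
    by move=> j; rewrite -chiE; apply: (eigE _ (hw i)).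
  have [b hb] := he2 a0 _ h; exists b; rewrite -hb.
  rewrite mulmxBr mul_mx_scalar mulmxBl -scalemxAl -/w' addrC subrK.
  by rewrite /w' -!mulmxA GGcomm.
have e0M i : e0 *m M i = chi i *: e0 by rewrite he1 -chiE.
have e00 : e0 != 0.
  apply: contraNneq w'E => e00; have : eigenrow (zt (pts a0)) w'.
    by move=> i; rewrite hbeta e00 scaler0 addr0 chiE.
  by move=> /(he2 a0)[b ->]; rewrite scalemx_sub.
pose beta' i := beta i / chi i.
have w'word s : w' *m mxword s =
    (\prod_(i <- s) chi i) *: (w' + (\sum_(i <- s) beta' i) *: e0).
  elim: s => [|i s ih] /=; first by rewrite mulmx1 !big_nil scale0r addr0 scale1r.
  rewrite mulmxA hbeta mulmxDl -!scalemxAl ih (eigenrow_word _ e0M) !big_cons.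
  rewrite !scalerDl !scalerDr !scalerA -addrA; congr (_ + _).
  rewrite addrC; congr (_ *: _ + _ *: _); rewrite /beta' ?mulrA //.
  by field; apply: chi0.
have beta_rel v : (forall j, \sum_i v i * A i j = 0) -> \sum_i (v i)%:~R * beta' i = 0.
  move=> hv; have := M_rel (words_rel v hv) => /(congr1 (mulmx w')).
  rewrite !w'word (chi_rel _ _ (words_rel v hv)) => /(scalerI (negw0 v)).
  move=> /addrI /eqP; rewrite -subr_eq0 -scalerBl scaler_eq0 (negPf e00) orbF.
  rewrite !sum_expword -sumrB => /eqP h; rewrite -[RHS]h; apply: eq_bigr => i _ /=.
  rewrite {1}[v i]posnBnegn rmorphB /= mulrBl -!pmulrn.
  by rewrite !mulr_natl.
(* This derivation annihilates the relations between the weights, so it equals [A] applied to a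
   vector [nu] recovered through [U]; the fibre equations put [nu] in the kernel of the Jacobian. *)
pose nu := \col_j \sum_i (U j i)%:~R * beta' i.
have betaE l : beta' l = \sum_j (A l j)%:~R * nu j 0.
  have := @beta_rel (fun i => (A *m U - 1%:M) l i).
  have -> : \sum_i ((A *m U - 1%:M) l i)%:~R * beta' i =
      \sum_i ((A *m U) l i)%:~R * beta' i - beta' l.
    rewrite (eq_bigr (fun i => ((A *m U) l i)%:~R * beta' i - (l == i)%:R * beta' i)).
      rewrite sumrB; congr (_ - _).
      rewrite (bigD1 l) //= eqxx mul1r big1 ?addr0 // => i /negPf; rewrite eq_sym => ->.
      by rewrite mul0r.
    move=> i _; rewrite !mxE rmorphB /= mulrBl; congr (_ - _ * _).
    by case: eqP.
  move=> h; apply/esym/eqP; rewrite -subr_eq0 -[X in _ == X]h => [|j]; last first.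
    transitivity (((A *m U - 1%:M) *m A) l j); first by rewrite !mxE.
    by rewrite mulmxBl -mulmxA UA mulmx1 mul1mx subrr mxE.
  apply/eqP; congr (_ - _).
  rewrite (eq_bigr (fun j => \sum_i (A l j)%:~R * ((U j i)%:~R * beta' i))).
    rewrite exchange_big; apply: eq_bigr => i _ /=; rewrite mxE rmorph_sum /= mulr_suml.
    by apply: eq_bigr => j _; rewrite rmorphM mulrA.
  by move=> j _; rewrite mxE mulr_sumr.
have Jnu : Jmx C (pts a0) *m nu = 0.
  apply/colP => l; rewrite !mxE.
  transitivity (\sum_i C i l * beta i).
    rewrite (eq_bigr (fun j => \sum_i C i l * zt (pts a0) i * (A i j)%:~R * nu j 0)).
      rewrite exchange_big; apply: eq_bigr => i _ /=.
      rewrite -[beta i](divfK (chi0 i)) -/(beta' i) betaE mulr_suml mulr_sumr.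
      by apply: eq_bigr => j _; rewrite chiE; ring.
    by move=> j _; rewrite mxE mulr_suml.
  have : w' *m (\sum_i C i l *: M i) = c l *: w' by rewrite M_fibre mul_mx_scalar.
  rewrite mulmx_sumr (eq_bigr (fun i => (C i l * chi i) *: w' + (C i l * beta i) *: e0)).
    rewrite big_split /= -!scaler_suml chi_fibre -[RHS]addr0 => /addrI/eqP.
    by rewrite scaler_eq0 (negPf e00) orbF => /eqP.
  by move=> i _; rewrite -scalemxAr hbeta scalerDr !scalerA.
have nu0 : nu = 0.
  have Ju : Jmx C (pts a0) \in unitmx by rewrite unitmxE unitfE.
  by rewrite -[nu](mulKmx Ju) Jnu mulmx0.
have : eigenrow (zt (pts a0)) w'.
  move=> i; rewrite hbeta -chiE -[beta i](divfK (chi0 i)) -/(beta' i) betaE.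
  by rewrite big1 ?mul0r ?scale0r ?addr0 // => j _; rewrite nu0 mxE mulr0.
by move=> /(he2 a0)[b hb]; move: w'E; rewrite hb scalemx_sub.
Qed.

End Representation.

End TorusPoints.

(** * Functions on the torus and Noether normalisation *)

Section TorusFunctions.
Variables (L : closedFieldType) (N d : nat) (A : 'M[int]_(N, d)) (U : 'M[int]_(d, N)).
Hypothesis UA : U *m A = 1%:M.
Hypothesis Asum : forall j, \sum_i A i j = 0.

Local Notation X := 'rV[L]_d.
Local Notation zt := (zt (L := L) A).
Definition za : X -> option 'I_N -> L := aug zt.
Local Notation Rd := (polyf za).

Lemma Rd_le D E f : (D <= E)%N -> Rd D f -> Rd E f.
Proof. exact: (@polyf_le _ _ _ za None). Qed.

Lemma Rd_cst D a : Rd D (fun=> a).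
Proof. exact: (@polyf_cst _ _ _ za None). Qed.

Lemma Rd_zt i : Rd 1 (zt^~ i).
Proof. exact: (polyf_feature za (Some i)). Qed.

Lemma RdB D f g : Rd D f -> Rd D g -> Rd D (fun x => f x - g x).
Proof.
by move=> hf hg; apply: polyf_ext (polyfD hf (polyfZ (-1) hg)) => x; rewrite mulN1r.
Qed.

Lemma nz_const1 : nz (const_mx 1 : X).
Proof. by move=> j; rewrite mxE oner_neq0. Qed.

Section Clearing.

Let a := (\sum_i \sum_j absz (A i j))%N.
Let delta (tau : X) := \prod_j tau 0 j ^+ a.
Let m0 := (d * (a + a))%N.
Let zp (tau : X) (o : option 'I_N) :=
  if o is Some i then \prod_j tau 0 j ^+ absz (A i j + a%:Z) else delta tau.

Let A_ge i j : (absz (A i j) <= a)%N.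
Proof. by rewrite /a (bigD1 i) //= (bigD1 j) //= -addnA leq_addr. Qed.

(** Since [a] is at least every [|A i j|], each character times [delta] has exponents between 0 and
    [2 a]; so [delta ^+ D] removes all poles along the coordinate hyperplanes. *)
Lemma clear_denominators D f : Rd D f ->
  exists2 g : X -> L, linepoly (D * m0) g &
    forall tau, nz tau -> g tau = f tau * delta tau ^+ D.
Proof.
move=> [c hc]; exists (fun tau => \sum_(w <- words _ D) c w * mono zp tau w).
  pose g tau := \sum_(w <- words _ D) c w * mono zp tau w.
  apply: (@polyf_linepoly L X _ zp X id m0 D g); last by exists c.
  have h (e : 'I_d -> nat) : (forall j, (e j <= a + a)%N) ->
      linepoly m0 (fun tau : X => \prod_j tau 0 j ^+ e j).
    move=> he; apply: (@linepoly_prod_ord L X d (a + a) (fun j (tau : X) => tau 0 j ^+ e j)) => j.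
    apply: (@linepoly_le _ _ (e j * 1)); first by rewrite muln1.
    by apply: linepolyX; apply: linepoly_mxE.
  case=> [i|] /=; apply: h => j; last exact: leq_addr.
  by move: (A_ge i j); lia.
move=> tau ht; rewrite hc big_distrl /= big_seq [RHS]big_seq; apply: eq_bigr => w hw.
rewrite -mulrA; congr (_ * _); rewrite -(size_in_words hw) /mono.
elim: w {hw} => [|o w ih]; first by rewrite !big_nil mulr1.
rewrite !big_cons ih /= exprS mulrACA; congr (_ * _).
case: o => [i|] /=; last by rewrite mul1r.
rewrite /zt /delta -big_split /=; apply: eq_bigr => j _.
rewrite !exprnP -expfzDr //; congr (_ ^ _).
by move: (A_ge i j); lia.
Qed.

Let delta_neq0 tau : nz tau -> delta tau != 0.
Proof. by move=> h; apply/prodf_neq0 => j _; rewrite expf_neq0. Qed.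

Lemma torus_points_bound : exists kappa, forall D, exists n (pts : 'I_n -> X),
  [/\ (n <= (kappa * D + 1) ^ d)%N, forall i, nz (pts i) &
   forall f, Rd D f -> (forall i, f (pts i) = 0) -> forall tau, nz tau -> f tau = 0].
Proof.
(* Two elements more than the degree bound, so that [m0 * D + 1] values are left once 0 is
   discarded. *)
exists m0 => D; have [s us ss] := exists_uniq_seq L (m0 * D + 2).
pose V := take (m0 * D + 1) (rem 0 s).
have uV : uniq V by rewrite take_uniq // rem_uniq.
have sV : size V = (m0 * D + 1)%N.
  rewrite size_takel //; have [h|h] := boolP (0 \in s).
    by rewrite size_rem // ss; lia.
  by rewrite rem_id // ss; lia.
have V0 z : z \in V -> z != 0.
  by move=> /mem_take; rewrite mem_rem_uniq // inE => /andP[].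
pose T := {ffun 'I_d -> 'I_(m0 * D + 1)}.
pose P (t : T) : X := \row_j V`_(t j).
have cT : #|T| = ((m0 * D + 1) ^ d)%N by rewrite card_ffun !card_ord.
exists #|T|, (fun k => P (enum_val k)); split=> [|k j|f hf h0 tau ht]; first by rewrite cT.
  by rewrite mxE; apply: V0; rewrite mem_nth // sV.
have [g lg eg] := clear_denominators hf.
have : g tau = 0.
  apply: (linepoly_grid lg uV) => [|x hx]; first by rewrite sV mulnC addn1.
  have xnz : nz x by move=> j; apply: V0.
  rewrite eg //; suff -> : f x = 0 by rewrite mul0r.
  have hidx j : (index (x 0%R j) V < m0 * D + 1)%N by rewrite -sV index_mem.
  have -> : x = P [ffun j => Ordinal (hidx j)].
    by apply/rowP => j; rewrite mxE ffunE /= nth_index.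
  by rewrite -[[ffun j => _]]enum_rankK.
rewrite eg // => /eqP; rewrite mulf_eq0 expf_eq0 (negPf (delta_neq0 ht)) andbF orbF.
by move/eqP.
Qed.

Lemma Rd_mul_neq0 D E f g t1 t2 : Rd D f -> Rd E g -> nz t1 -> nz t2 ->
  f t1 != 0 -> g t2 != 0 -> exists2 tau, nz tau & f tau * g tau != 0.
Proof.
move=> hf hg h1 h2 f1 g2.
have [F lF eF] := clear_denominators hf; have [G lG eG] := clear_denominators hg.
(* Nonvanishing of [q] keeps the common witness on the torus. *)
pose q (tau : X) := \prod_j tau 0 j.
have lq : linepoly (d * 1) q.
  by apply: (@linepoly_prod_ord L X d 1 (fun j (tau : X) => tau 0 j)) => j; apply: linepoly_mxE.
have q1 : q t1 != 0 by apply/prodf_neq0.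
have [||t3 h3] := linepoly_mul_neq0 lF lG (u := t1) (v := t2).
- by rewrite eF // mulf_neq0 // expf_neq0 // delta_neq0.
- by rewrite eG // mulf_neq0 // expf_neq0 // delta_neq0.
have [tau] := linepoly_mul_neq0 (linepolyM lF lG) lq h3 q1.
rewrite mulf_eq0 negb_or => /andP[FG /prodf_neq0 ht].
have tnz : nz tau by move=> j; apply: ht.
exists tau => //; apply: contraNneq FG => e.
by rewrite eF // eG // mulrACA e mul0r.
Qed.

End Clearing.

Definition indep n (f : 'I_n -> X -> L) := forall c : 'I_n -> L,
  (forall tau, nz tau -> \sum_i c i * f i tau = 0) -> forall i, c i = 0.

Lemma indep_bound : exists kappa, forall D n (f : 'I_n -> X -> L),
  (forall i, Rd D (f i)) -> indep f -> (n <= (kappa * D + 1) ^ d)%N.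
Proof.
have [kappa h] := torus_points_bound; exists kappa => D n f hf fi.
have [m [pts [hm hnz hs]]] := h D; rewrite leqNgt; apply/negP => hn.
have [|c [[i ci] hc]] := @nontrivial_relation L 'I_n m (fun i k => f i (pts k)).
  by rewrite card_ord (leq_ltn_trans hm).
have /fi/(_ i)/eqP : forall tau, nz tau -> \sum_i c i * f i tau = 0.
  move=> tau; apply: (hs (fun tau => \sum_i c i * f i tau)) => //.
  by apply: polyf_sum => k _; apply: polyfZ.
by rewrite (negPf ci).
Qed.

Definition lam n (C : 'M[L]_(N, n)) (tau : X) (l : 'I_n) := \sum_i C i l * zt tau i.

Lemma Rd_lam n (C : 'M[L]_(N, n)) l : Rd 1 (fun tau => lam C tau l).
Proof. by apply: polyf_sum => i _; apply: polyfZ; apply: Rd_zt. Qed.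

(* [lamid C m f]: up to functions of degree [m], [f] lies in the degree [m + 1]
   part of the ideal generated by the linear forms [lam C]. *)
Definition lamid n (C : 'M[L]_(N, n)) m (f : X -> L) :=
  exists (r : 'I_n -> X -> L) r0, [/\ (forall l, Rd m (r l)), Rd m r0 &
    forall tau, nz tau -> f tau = \sum_l lam C tau l * r l tau + r0 tau].

Section Lamid.
Variables (n : nat) (C : 'M[L]_(N, n)).

Lemma lamid_ext m f g : (forall tau, nz tau -> f tau = g tau) ->
  lamid C m f -> lamid C m g.
Proof. by move=> e [r [r0 [h h0 hf]]]; exists r, r0; split=> // t ht; rewrite -e ?hf. Qed.

Lemma lamidD m f g : lamid C m f -> lamid C m g -> lamid C m (fun x => f x + g x).
Proof.
move=> [r [r0 [hr hr0 hf]]] [s [s0 [hs hs0 hg]]].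
exists (fun l x => r l x + s l x), (fun x => r0 x + s0 x); split=> [l||tau ht].
- exact: polyfD.
- exact: polyfD.
rewrite hf // hg // addrACA -big_split /=; congr (_ + _); apply: eq_bigr => l _.
by rewrite mulrDr.
Qed.

Lemma lamidM m k f g : Rd k g -> lamid C m f -> lamid C (k + m) (fun x => g x * f x).
Proof.
move=> hg [r [r0 [hr hr0 hf]]]; exists (fun l x => g x * r l x), (fun x => g x * r0 x).
split=> [l||tau ht]; [exact: polyfM|exact: polyfM|].
rewrite hf // mulrDr mulr_sumr; congr (_ + _); apply: eq_bigr => l _.
by rewrite mulrCA.
Qed.

Lemma lamidZ m a f : lamid C m f -> lamid C m (fun x => a * f x).
Proof. by move=> h; apply: (@lamidM m 0 f (fun=> a)); first exact: Rd_cst. Qed.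

Lemma lamid_low m f : Rd m f -> lamid C m f.
Proof.
move=> hf; exists (fun _ _ => 0), f; split=> [l||tau ht] //; first exact: Rd_cst.
by rewrite big1 ?add0r // => l _; rewrite mulr0.
Qed.

Lemma lamid_lam m l r : Rd m r -> lamid C m (fun x => lam C x l * r x).
Proof.
move=> hr; exists (fun k x => if k == l then r x else 0), (fun=> 0); split=> [k||tau ht].
- by case: eqP => _ //; apply: Rd_cst.
- exact: Rd_cst.
rewrite (bigD1 l) //= eqxx big1 ?addr0 // => k /negPf->.
by rewrite mulr0.
Qed.

Lemma lamid_sum m (J : Type) (s : seq J) (P : pred J) (f : J -> X -> L) :
  (forall j, P j -> lamid C m (f j)) -> lamid C m (fun x => \sum_(j <- s | P j) f j x).
Proof.
move=> h; elim: s => [|j s ih].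
  apply: lamid_ext (lamid_low (Rd_cst m 0)) => t _; by rewrite big_nil.
have [Pj|Pj] := boolP (P j).
  by apply: lamid_ext (lamidD (h j Pj) ih) => t _; rewrite big_cons Pj.
by apply: lamid_ext ih => t _; rewrite big_cons (negPf Pj).
Qed.

(** Noether normalisation in filtered form: beyond degree [m0] the forms [lam C] generate everything
    up to lower degree. Geometrically, they have no common zero at infinity on the closure of the
    torus. *)
Definition noether m0 := forall m f, (m0 <= m)%N -> Rd m.+1 f -> lamid C m f.

Lemma noether_propagates m0 : (forall f, Rd m0.+1 f -> lamid C m0 f) -> noether m0.
Proof.
move=> h m f /subnK<-; elim: (m - m0)%N f => [|k ih] f; first by rewrite add0n; apply: h.
rewrite addSn => /polyfSP[g hg hf].
have hi o : predT o -> lamid C (1 + (k + m0)) (fun x => za x o * g o x).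
  by move=> _; apply: lamidM; [apply: polyf_feature|apply: ih].
by apply: lamid_ext (lamid_sum (index_enum _) hi) => t _; rewrite hf.
Qed.

End Lamid.

Lemma noether_start : noether (1%:M : 'M[L]_N) 0.
Proof.
move=> m f _ /polyfSP[g hg hf]; exists (fun i => g (Some i)), (g None); split=> // t ht.
rewrite hf (bigD1 None) //= mul1r addrC; congr (_ + _).
rewrite (reindex_omap Some id) /=; last by case.
apply: eq_big => [i|i _]; first by rewrite eqxx.
congr (_ * _); rewrite /lam (bigD1 i) //= mxE eqxx mul1r big1 ?addr0 // => k /negPf.
by rewrite mxE => ->; rewrite mul0r.
Qed.

Lemma Rd_boxpoly n K (C : 'M[L]_(N, n)) (coef : {ffun 'I_n -> 'I_K} -> L) :
  Rd (n * K) (fun tau => boxpoly coef (lam C tau)).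
Proof.
apply: polyf_sum => a _; apply: polyfZ.
apply: (@polyf_prod_ord L X _ za n K (fun l x => lam C x l ^+ a l)) => l.
have : Rd (size (nseq (a l) tt) * 1) (fun x => \prod_(j <- nseq (a l) tt) lam C x l).
  by apply: (@polyf_prod L X _ za _ _ 1 (fun _ x => lam C x l)) => _; apply: Rd_lam.
rewrite size_nseq muln1 => h1; apply: (Rd_le (ltnW (ltn_ord (a l)))).
by apply: polyf_ext h1 => x; rewrite big_nseq iter_mulr_1.
Qed.

(** There are [K ^ n] box monomials, of degree at most [n K], whereas [(kappa n K + 1)^d] points
    determine functions of that degree. As [d < n], the choice [K = g^d + 1] makes the monomials
    more numerous. *)
Lemma lam_relation n (C : 'M[L]_(N, n)) : (d < n)%N ->
  exists K (coef : {ffun 'I_n -> 'I_K} -> L), (exists a, coef a != 0) /\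
    forall tau, nz tau -> boxpoly coef (lam C tau) = 0.
Proof.
move=> dn; have [kappa h] := torus_points_bound.
pose g := (kappa * n + 1)%N; pose K := (g ^ d).+1.
have [m [pts [hm hnz hs]]] := h (n * K)%N.
have [|coef [c0 hc]] := @nontrivial_relation L {ffun 'I_n -> 'I_K} m
  (fun a k => \prod_l lam C (pts k) l ^+ a l).
  rewrite card_ffun !card_ord (leq_ltn_trans hm) //.
  have l1 : (kappa * (n * K) + 1 <= g * K)%N by rewrite /g mulnDl mulnA mul1n leq_add2l.
  apply: (@leq_ltn_trans ((g * K) ^ d)); first exact: leq_expl.
  apply: (@leq_trans (K ^ d.+1)); last by rewrite leq_pexp2l.
  by rewrite expnMn expnS ltn_pmul2r ?expn_gt0.
exists K, coef; split=> // tau; apply: (hs (fun tau => boxpoly coef (lam C tau))) => //.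
exact: Rd_boxpoly.
Qed.

End TorusFunctions.

Section Noether.
Variables (L : closedFieldType) (N d : nat) (A : 'M[int]_(N, d)).

Local Notation X := 'rV[L]_d.
Local Notation zt := (zt (L := L) A).
Local Notation za := (za (L := L) A).
Local Notation Rd := (polyf za).
Local Notation lam := (lam A).
Local Notation lamid := (lamid A).
Local Notation noether := (noether A).

(** Projection from a point [c] at which the top form of a relation is nonzero. Modulo the [n]
    projected forms [C'] every [lam C l] becomes [c l] times a single form [w], and the relation
    makes [w ^+ e] of lower degree; functions of high degree are then rewritten with [w ^+ e] as a
    factor. *)
Lemma noether_step n (C : 'M[L]_(N, n.+1)) m0 : (d < n.+1)%N -> noether C m0 ->
  exists (C' : 'M[L]_(N, n)) m1, noether C' m1.
Proof.
move=> dn hC; have [K [coef [[a1 ca1] hrel]]] := lam_relation A C dn.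
pose deg (a : {ffun 'I_n.+1 -> 'I_K}) := (\sum_l a l)%N.
have [a0 ca0 amax] := @arg_maxnP _ a1 (fun a => coef a != 0) deg ca1.
set e := deg a0 in amax.
pose top a := if deg a == e then coef a else 0.
have [|c Pc] := @boxpoly_neq0 L n.+1 K top a0; first by rewrite /top eqxx.
set P := boxpoly top c in Pc.
have e0 : (0 < e)%N.
  rewrite lt0n; apply: contraNneq Pc => e0.
  rewrite -(hrel _ (@nz_const1 L d)) /P; apply/eqP; apply: eq_bigr => a _.
  rewrite /top; case: (eqVneq (deg a) e) => [ea|ea].
    have al l : a l = 0%N :> nat.
      by move/eqP: ea; rewrite e0 sum_nat_eq0 => /forallP/(_ l)/eqP.
    by congr (_ * _); apply: eq_bigr => l _; rewrite al !expr0.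
  have [->|ca] := eqVneq (coef a) 0; first by rewrite !mul0r.
  have /= le := amax a ca; case/negP: ea.
  by rewrite e0 -leqn0 -[0%N]e0.
have [l0 cl0] : exists l0, c l0 != 0.
  apply: NNPP => no; have c0 l : c l = 0.
    by apply: NNPP => /eqP h; apply: no; exists l.
  move/eqP: Pc; apply; apply: big1 => a _; rewrite /top; case: eqP => [ea|]; last by rewrite mul0r.
  have [l al] : exists l, a l != 0%N :> nat.
    apply: NNPP => no2; move: e0; rewrite -ea /deg big1 // => l _.
    by apply: NNPP => /eqP h; apply: no2; exists l.
  by rewrite (bigD1 l) //= c0 expr0n (negPf al) mul0r mulr0.
pose C' : 'M[L]_(N, n) := \matrix_(i, l) (C i (lift l0 l) - c (lift l0 l) / c l0 * C i l0).
pose w tau := (c l0)^-1 * lam C tau l0.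
have lamE tau l : lam C tau (lift l0 l) = lam C' tau l + c (lift l0 l) * w tau.
  rewrite /lam /w !mulr_sumr -big_split /=; apply: eq_bigr => i _.
  by rewrite mxE; ring.
have lam0E tau : lam C tau l0 = c l0 * w tau by rewrite /w mulrA mulfV // mul1r.
have hw : Rd 1 w by apply: polyfZ; apply: Rd_lam.
have hwX k : Rd k (fun tau => w tau ^+ k).
  elim: k => [|k ih]; first exact: Rd_cst.
  by apply: polyf_ext (polyfM hw ih) => x; rewrite exprS.
have lam_mod l : lamid C' 0 (fun tau => lam C tau l - c l * w tau).
  case: (unliftP l0 l) => [k|] ->; last first.
    by apply: lamid_ext (lamid_low C' (Rd_cst A 0 0)) => t _; rewrite lam0E subrr.
  have := lamid_lam C' k (Rd_cst A 0 1); apply: lamid_ext => t _.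
  by rewrite lamE addrK mulr1.
have word_mod (s : seq 'I_n.+1) p : size s = p.+1 -> lamid C' p (fun tau =>
    \prod_(l <- s) lam C tau l - \prod_(l <- s) c l * w tau ^+ p.+1).
  elim: p s => [|p ih] [|l s] // [ss].
    apply: lamid_ext (lam_mod l) => t _.
    by rewrite (size0nil ss) !big_seq1 expr1.
  have h1 := lamidM (Rd_lam A C l) (ih s ss).
  have h2 := lamidM (polyfZ (\prod_(l <- s) c l) (hwX p.+1)) (lam_mod l).
  rewrite addn0 in h2; rewrite add1n in h1.
  apply: lamid_ext (lamidD h1 h2) => t _; rewrite !big_cons [w t ^+ p.+2]exprS.
  by ring.
have wE : lamid C' e.-1 (fun tau => w tau ^+ e).
  have h0 : lamid C' e.-1 (fun tau => P * w tau ^+ e).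
    have hcomb : lamid C' e.-1 (fun tau =>
        \sum_(a | deg a == e) coef a * (\prod_l lam C tau l ^+ a l -
           \prod_l c l ^+ a l * w tau ^+ e) +
        \sum_(a | deg a != e) coef a * \prod_l lam C tau l ^+ a l).
      apply: lamidD.
        apply: lamid_sum => a /eqP ea; apply: lamidZ.
        have sz : size (expword (fun l => nat_of_ord (a l))) = e.-1.+1.
          by rewrite prednK // -ea size_expword.
        have := word_mod _ _ sz; apply: lamid_ext => t _.
        by rewrite !prod_expword prednK.
      apply: lamid_low; apply: polyf_sum => a ea.
      have [->|ca] := eqVneq (coef a) 0.
        by apply: polyf_ext (Rd_cst A _ 0) => t; rewrite mul0r.
      apply: polyfZ; have lea : (deg a <= e.-1)%N.
        by have := amax a ca; rewrite /= leq_eqVlt (negPf ea) /=; case: (e).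
      apply: (Rd_le lea).
      have := polyf_prod (expword (fun l => nat_of_ord (a l))) (D := 1) (fun l => Rd_lam A C l).
      rewrite muln1 size_expword.
      by apply: polyf_ext => t; rewrite -prod_expword.
    apply: lamid_ext (lamidZ (-1) hcomb) => tau ht.
    have := hrel tau ht; rewrite /boxpoly (bigID (fun a => deg a == e)) /= => /eqP.
    rewrite addrC addr_eq0 => /eqP->.
    have -> : P = \sum_(a | deg a == e) coef a * \prod_l c l ^+ a l.
      rewrite /P /boxpoly (bigID (fun a => deg a == e)) /= [X in _ + X]big1 => [|a /negPf ea].
        by rewrite addr0; apply: eq_bigr => a /eqP ea; rewrite /top ea eqxx.
      by rewrite /top ea mul0r.
    rewrite -sumrB mulN1r -sumrN mulr_suml; apply: eq_bigr => a _.
    by ring.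
  by apply: lamid_ext (lamidZ P^-1 h0) => t _; rewrite mulrA mulVf // mul1r.
exists C', (m0 + e)%N => m f hm hf.
(* Each use of [hC] extracts one factor [w]; starting beyond [m0 + e] leaves room for [e]
   extractions. *)
have peel j : (j <= e)%N -> exists2 g, Rd (m.+1 - j) g &
    lamid C' m (fun tau => f tau - w tau ^+ j * g tau).
  elim: j => [|j ih] je.
    exists f; first by rewrite subn0.
    by apply: lamid_ext (lamid_low C' (Rd_cst A m 0)) => t _; rewrite expr0 mul1r subrr.
  have [g hg hfg] := ih (ltnW je).
  have mj : (m.+1 - j)%N = (m - j).+1 by lia.
  rewrite mj in hg; have [|r [r0 [hr hr0 hgr]]] := hC (m - j)%N g _ hg; first by lia.
  have jm : (j + (m - j) = m)%N by lia.
  exists (fun tau => \sum_l c l * r l tau).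
    by rewrite subSS; apply: polyf_sum => l _; apply: polyfZ.
  have h1 : lamid C' m (fun tau => w tau ^+ j *
      (\sum_l r l tau * (lam C tau l - c l * w tau) + r0 tau)).
    rewrite -jm; apply: lamidM => //; apply: lamidD; last exact: lamid_low.
    apply: lamid_sum => l _; rewrite -[(m - j)%N]addn0; exact: lamidM.
  apply: lamid_ext (lamidD hfg h1) => t ht; rewrite hgr // exprSr.
  have -> : \sum_l r l t * (lam C t l - c l * w t) =
      \sum_l lam C t l * r l t - w t * \sum_l c l * r l t.
    by rewrite mulr_sumr -sumrB; apply: eq_bigr => l _; ring.
  by ring.
have [g hg hfg] := peel e (leqnn e).
have h := lamidM hg wE.
have em : (m.+1 - e + e.-1 = m)%N by lia.
rewrite em in h; apply: lamid_ext (lamidD hfg h) => t _.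
by rewrite [g t * _]mulrC subrK.
Qed.

Lemma noether_exists : (d <= N)%N -> exists (C : 'M[L]_(N, d)) m0, noether C m0.
Proof.
move=> dN.
suff H k : (d + k <= N)%N -> exists (C : 'M[L]_(N, N - k)) m0, noether C m0.
  have [|C] := H (N - d)%N; first by rewrite subnKC.
  by move: C; rewrite subKn // => C [m0 hm]; exists C, m0.
elim: k => [_|k ih dk]; first by rewrite subn0; exists 1%:M, 0%N; apply: noether_start.
have [|C [m0 hC]] := ih; first by lia.
have NE : (N - k)%N = (N - k.+1).+1 by lia.
move: C hC; rewrite NE => C hC; apply: noether_step hC; by lia.
Qed.

(** A single degree suffices by [noether_propagates]. There the property holds as soon as the
    products [h C o v], evaluated at finitely many separating points, span all value vectors. With
    [R] inverting the evaluation matrix at [C0], the determinant of [R *m G C] certifies this. *)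
Lemma noether_open (C0 : 'M[L]_(N, d)) m0 : noether C0 m0 ->
  exists (phi : 'M[L]_(N, d) -> L) m, [/\ linepoly m phi, phi C0 != 0 &
    forall C, phi C != 0 -> noether C m0].
Proof.
move=> hC0; pose W := words (option 'I_N) m0.+1; pose V := words (option 'I_N) m0.
pose F (k : 'I_(size W)) tau := mono za tau (tnth (in_tuple W) k).
have [n [pts [fr hnz hs]]] := separating_points F (@nz L d).
have FE f : Rd m0.+1 f -> exists c : 'I_(size W) -> L, forall tau, f tau = \sum_k c k * F k tau.
  case=> c hc; exists (fun k => c (tnth (in_tuple W) k)) => tau.
  by rewrite hc -/W big_tnth.
have zero f : Rd m0.+1 f -> (forall i, f (pts i) = 0) -> forall tau, nz tau -> f tau = 0.
  move=> /FE[c hc] h tau ht; rewrite hc; apply: (hs c) => // i.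
  by rewrite -hc.
pose h C (o : option 'I_d) (v : 'I_(size V)) tau :=
  (if o is Some l then lam C tau l else 1) * mono za tau (tnth (in_tuple V) v).
pose IT := (option 'I_d * 'I_(size V))%type.
pose G C : 'M[L]_(#|{: IT}|, n) :=
  \matrix_(k, i) h C (enum_val k).1 (enum_val k).2 (pts i).
have hV v : Rd m0 (fun tau => mono za tau (tnth (in_tuple V) v)).
  have /size_in_words <- := mem_tnth v (in_tuple V); exact: polyf_mono.
have hR C o v : Rd m0.+1 (h C o v).
  case: o => [l|].
    exact: (@polyfM L X _ za 1 m0 _ _ (Rd_lam A C l) (hV v)).
  exact: (@polyfM L X _ za 1 m0 _ _ (Rd_cst A 1 1) (hV v)).
have hid C o v : lamid C m0 (h C o v).
  case: o => [l|] /=; first exact: (lamid_lam C l (hV v)).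
  by apply: lamid_low; apply: polyf_ext (hV v) => t; rewrite /h mul1r.
have spanV f : Rd m0 f -> exists c : 'I_(size V) -> L,
    forall tau, f tau = \sum_v c v * mono za tau (tnth (in_tuple V) v).
  case=> c hc; exists (fun k => c (tnth (in_tuple V) k)) => tau.
  by rewrite hc -/V big_tnth.
have spanG f : lamid C0 m0 f -> exists c : IT -> L, forall tau, nz tau ->
    f tau = \sum_k c k * h C0 k.1 k.2 tau.
  case=> [r [r0 [hr hr0 hf]]].
  have [cr hcr] := fin_all_exists (fun l => spanV _ (hr l)).
  have [c0 hc0] := spanV _ hr0.
  exists (fun k => if k.1 is Some l then cr l k.2 else c0 k.2) => tau ht.
  rewrite hf // -(pair_bigA _ (fun o v => (if o is Some l then cr l v else c0 v) * h C0 o v tau)) /=.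
  rewrite [RHS](bigD1 None) //= [LHS]addrC; congr (_ + _).
    by rewrite hc0; apply: eq_bigr => v _; rewrite /h mul1r.
  rewrite [RHS](reindex_omap Some id) /=; last by case.
  apply: eq_big => [l|l _]; first by rewrite eqxx.
  rewrite hcr mulr_sumr; apply: eq_bigr => v _; rewrite /h.
  by ring.
have full : row_full (G C0).
  have [B hB] := row_freeP fr.
  suff : (1%:M <= G C0)%MS by rewrite sub1mx.
  apply/row_subP => j.
  pose f tau := \sum_k B k j * F k tau.
  have hf : Rd m0.+1 f.
    apply: polyf_sum => k _; apply: polyfZ.
    by have /size_in_words <- := mem_tnth k (in_tuple W); apply: polyf_mono.
  have [c hc] := spanG f (hC0 m0 f (leqnn _) hf).
  suff -> : row j (1%:M : 'M_n) = \row_k c (enum_val k) *m G C0 by apply: submxMl.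
  apply/rowP => i; rewrite !mxE.
  transitivity (f (pts i)).
    have := congr1 (fun M : 'M_n => M i j) hB; rewrite !mxE eq_sym => <-.
    by apply: eq_bigr => k _; rewrite !mxE mulrC.
  rewrite hc; last exact: hnz.
  rewrite (reindex_onto enum_val enum_rank) => [|k _]; last exact: enum_rankK.
  by apply: eq_big => [k|k _]; rewrite ?enum_valK ?eqxx // !mxE.
have /row_fullP[R hR1] := full.
exists (fun C => \det (R *m G C)), (n * (0 + 1))%N; split.
- apply: linepoly_det; apply: linepoly_mulmx => k l.
    by apply: linepoly_cst.
  apply: (@linepoly_ext L _ _ (fun C => h C (enum_val k).1 (enum_val k).2 (pts l))).
    by move=> C; rewrite mxE.
  rewrite /h; case: (enum_val k) => -[o|] v /=; last exact: linepoly_cst.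
  apply: linepoly_lin => t C C'; rewrite mulrA -mulrDl; congr (_ * _).
  rewrite /lam mulr_sumr -big_split /=; apply: eq_bigr => i _.
  by rewrite !mxE; ring.
- by rewrite hR1 det1 oner_neq0.
move=> C hC; apply: noether_propagates => f hf.
pose ev : 'rV[L]_n := \row_i f (pts i).
have uG : R *m G C \in unitmx by rewrite unitmxE unitfE.
pose b := ev *m invmx (R *m G C) *m R.
have bE : b *m G C = ev by rewrite -mulmxA mulmxKV.
have hg : lamid C m0 (fun tau => \sum_k b 0 k * h C (enum_val k).1 (enum_val k).2 tau).
  by apply: lamid_sum => k _; apply: lamidZ.
apply: lamid_ext hg => tau ht; apply/eqP; rewrite -subr_eq0; apply/eqP.
apply: (zero (fun tau => \sum_k b 0 k * h C (enum_val k).1 (enum_val k).2 tau - f tau)) => //.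
  by apply: RdB => //; apply: polyf_sum => k _; apply: polyfZ.
move=> i; apply/eqP; rewrite subr_eq0; apply/eqP.
have := congr1 (fun M : 'rV_n => M 0 i) bE; rewrite !mxE => <-.
by apply: eq_bigr => k _; rewrite !mxE.
Qed.

End Noether.

(** * Hilbert function of the torus, bounded by the size of a reduced fibre *)

Section Hilbert.
Variables (L : closedFieldType) (N d : nat) (A : 'M[int]_(N, d)) (U : 'M[int]_(d, N)).
Hypothesis UA : U *m A = 1%:M.
Hypothesis Asum : forall j, \sum_i A i j = 0.

Local Notation X := 'rV[L]_d.
Local Notation zt := (zt (L := L) A).
Local Notation za := (za (L := L) A).
Local Notation Rd := (polyf za).
Local Notation lam := (lam A).
Local Notation lamid := (lamid A).
Local Notation noether := (noether A).
Local Notation Jmx := (Jmx A).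

Lemma Rd_detJ C : Rd d (fun tau => \det (Jmx C tau)).
Proof.
rewrite -[X in polyf _ X _]muln1; apply: polyf_det => i j.
have h k : predT k -> Rd 1 (fun tau => C k i * (A k j)%:~R * zt tau k).
  by move=> _; apply: polyfZ; apply: Rd_zt.
apply: polyf_ext (polyf_sum (index_enum _) h) => tau; rewrite mxE.
by apply: eq_bigr => k _; ring.
Qed.

Lemma detJ_open : exists (phi : 'M[L]_(N, d) -> L) m, [/\ linepoly m phi,
  (exists C, phi C != 0) & forall C, phi C != 0 -> \det (Jmx C (const_mx 1)) != 0].
Proof.
exists (fun C => \det (Jmx C (const_mx 1))), (d * 1)%N; split=> //.
  apply: linepoly_det => i j; apply: linepoly_lin => t u v; rewrite !mxE mulr_sumr.
  by rewrite -big_split /=; apply: eq_bigr => k _; rewrite !mxE; ring.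
(* With the rows of [U] as forms, the Jacobian at the unit element is [U A = 1]. *)
pose C : 'M[L]_(N, d) := \matrix_(i, l) (U l i)%:~R.
exists C; suff -> : Jmx C (const_mx 1) = 1%:M.
  by rewrite det1 oner_neq0.
apply/matrixP => l j; rewrite mxE.
transitivity (((U *m A) l j)%:~R : L); last by rewrite UA !mxE; case: eqP.
rewrite mxE rmorph_sum; apply: eq_bigr => i _ /=; rewrite mxE rmorphM /=.
suff -> : zt (const_mx 1) i = 1 by rewrite mulr1.
by apply: big1 => k _; rewrite mxE exp1rz.
Qed.

Section Critical.
Variable C : 'M[L]_(N, d).
Hypothesis J1 : \det (Jmx C (const_mx 1)) != 0.

Let D0 (tau : X) := nz tau /\ \det (Jmx C tau) = 0.
Let crit e n := exists (pts : 'I_n -> X) (g : 'I_n -> X -> L),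
  [/\ forall i, D0 (pts i), (forall i, Rd e (g i)), (forall i j, g i (pts j) = (i == j)%:R) &
  forall f, Rd e f -> (forall i, f (pts i) = 0) -> forall tau, D0 tau -> f tau = 0].
Let ind e n := exists f : 'I_n -> X -> L, (forall i, Rd e (f i)) /\ indep f.

Let crit_exists e : exists n, crit e n.
Proof.
pose W := words (option 'I_N) e.
pose F (k : 'I_(size W)) tau := mono za tau (tnth (in_tuple W) k).
have hF k : Rd e (F k).
  by have /size_in_words <- := mem_tnth k (in_tuple W); apply: polyf_mono.
have [n [pts [fr hnz hs]]] := separating_points F D0.
have [B hB] := row_freeP fr.
exists n, pts, (fun i tau => \sum_k B k i * F k tau); split=> //.
- by move=> i; apply: polyf_sum => k _; apply: polyfZ.
- move=> i j; have := congr1 (fun M : 'M_n => M j i) hB; rewrite !mxE eq_sym => <-.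
  by apply: eq_bigr => k _; rewrite !mxE mulrC.
move=> f [c hc] h tau ht.
have E x : f x = \sum_k c (tnth (in_tuple W) k) * F k x by rewrite hc -/W big_tnth.
by rewrite E; apply: (hs (fun k => c (tnth _ k))) => // i; rewrite -E.
Qed.

(** Multiples of [det J] vanish on the critical locus, so they can be added to functions independent
    there; and [det J] is not a zero divisor since it is nonzero at the unit element. *)
Let ind_step e n1 n2 : ind e n2 -> crit (e + d) n1 -> ind (e + d) (n1 + n2).
Proof.
move=> [f [hf fi]] [pts [g [hp hg gd _]]].
exists (fun i => match split i with inl a => g a
  | inr b => fun tau => f b tau * \det (Jmx C tau) end); split.
  by move=> i; case: split => [a|b]; [apply: hg | apply: polyfM; [apply: hf|apply: Rd_detJ]].
move=> c hc.
have E tau : nz tau -> \sum_a c (lshift n2 a) * g a tau +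
    (\sum_b c (rshift n1 b) * f b tau) * \det (Jmx C tau) = 0.
  move=> ht; have := hc tau ht; rewrite big_split_ord /= => h.
  rewrite -[RHS]h mulr_suml; congr (_ + _).
    by apply: eq_bigr => a _; rewrite (unsplitK (inl a)).
  by apply: eq_bigr => b _; rewrite (unsplitK (inr b)) mulrA.
have c1 a : c (lshift n2 a) = 0.
  have [pnz pJ] := hp a; have := E _ pnz; rewrite pJ mulr0 addr0 (bigD1 a) //=.
  rewrite gd eqxx mulr1 big1 ?addr0 // => b /negPf ba.
  by rewrite gd ba mulr0.
have c2 b : c (rshift n1 b) = 0.
  move: b; apply: fi => tau ht; apply: NNPP => /eqP h.
  have hs : Rd e (fun tau => \sum_b c (rshift n1 b) * f b tau).
    by apply: polyf_sum => b _; apply: polyfZ.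
  have [t tnz] := Rd_mul_neq0 hs (Rd_detJ C) ht (@nz_const1 L d) h J1.
  move/eqP; apply; rewrite -[RHS](E t tnz) [X in _ = X + _]big1 ?add0r // => a _.
  by rewrite c1 mul0r.
by move=> i; rewrite -[i]splitK; case: split => [a|b] /=.
Qed.

(* The critical values of [lam C] lie on a hypersurface: otherwise the degree
   [e] functions on the critical locus would be as numerous as those in [d]
   variables, for every [e], and summing over [e] would contradict [indep_bound]. *)
Lemma critical_values : exists K (coef : {ffun 'I_d -> 'I_K} -> L), (exists a, coef a != 0) /\
  forall tau, nz tau -> \det (Jmx C tau) = 0 -> boxpoly coef (lam C tau) = 0.
Proof.
have [K [n [hn [pts [g [_ _ _ hz]]]]]] : exists K n, (n < K ^ d)%N /\ crit (d * K) n.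
  apply: NNPP => no; have [kappa hk] := @indep_bound L N d A.
  (* Adding up [j] steps would give [j * j ^ d] independent functions of degree [2 d j], against the
     bound [(gam j)^d]; [j > gam ^ d] makes this impossible. *)
  pose gam := (kappa * (d * 2) + 1)%N; pose j := (gam ^ d).+1.
  have H i : exists2 n, (i * j ^ d <= n)%N & ind (d * (j + i)) n.
    elim: i => [|i [n hn hi]].
      exists 0%N; first by rewrite mul0n.
      by exists (fun _ _ => 0); split=> [[]|c _ []].
    have [n1 h1] := crit_exists (d * (j + i) + d).
    exists (n1 + n)%N; last by rewrite addnS mulnS addnC; apply: ind_step.
    rewrite mulSn leq_add // leqNgt; apply/negP => h2; apply: no.
    exists (j + i).+1, n1; split; last by rewrite mulnS addnC.
    by apply: leq_trans h2 _; apply: leq_expl; rewrite -addnS leq_addr.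
  have [n hn [f [hf fi]]] := H j.
  have := leq_trans hn (hk _ _ _ hf fi); rewrite leqNgt => /negP; apply.
  have l1 : (kappa * (d * (j + j)) + 1 <= gam * j)%N.
    rewrite /gam mulnDl mul1n -mulnA addnn -mul2n -mulnA leq_add2l.
    by rewrite /j.
  apply: (@leq_ltn_trans ((gam * j) ^ d)); first exact: leq_expl.
  by rewrite expnMn ltn_pmul2r ?expn_gt0.
have [|coef [c0 hc]] := @nontrivial_relation L {ffun 'I_d -> 'I_K} n
  (fun a k => \prod_l lam C (pts k) l ^+ a l).
  by rewrite card_ffun !card_ord.
exists K, coef; split=> // tau t1 t2.
by apply: (hz (fun tau => boxpoly coef (lam C tau))) => //; apply: Rd_boxpoly.
Qed.

End Critical.

Section Fibre.
Variables (C : 'M[L]_(N, d)) (m0 : nat) (c : 'I_d -> L).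
Hypothesis hC : noether C m0.

Let ll l tau := lam C tau l - c l.
(** Degree strictly below [m], with only the zero function for [m = 0]: the right degree for the
    coefficient of an equation of degree one. *)
Let RdP m (r : X -> L) := if m is m'.+1 then Rd m' r else forall tau, r tau = 0.

Let Rd_ll l : Rd 1 (ll l).
Proof. by apply: RdB; [apply: Rd_lam|apply: Rd_cst]. Qed.

Let RdPW m r : RdP m r -> Rd m r.
Proof.
case: m => [h|m h]; last exact: Rd_le h.
by apply: polyf_ext (Rd_cst A 0 0) => t; rewrite h.
Qed.

Let RdPD m f g : RdP m f -> RdP m g -> RdP m (fun x => f x + g x).
Proof. by case: m => [hf hg t|m]; [rewrite hf hg addr0|apply: polyfD]. Qed.

Let RdPZ m a f : RdP m f -> RdP m (fun x => a * f x).
Proof. by case: m => [hf t|m]; [rewrite hf mulr0|apply: polyfZ]. Qed.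

Let RdP_le m n r : (m <= n)%N -> RdP m r -> RdP n r.
Proof.
case: m n => [|m] [|n] //= mn h; last exact: Rd_le h.
by apply: polyf_ext (Rd_cst A n 0) => t; rewrite h.
Qed.

Let RdP_mul m l r : RdP m r -> RdP m.+1 (fun x => ll l x * r x).
Proof.
case: m => [h|m h] /=.
  by apply: polyf_ext (Rd_cst A 0 0) => t; rewrite h mulr0.
exact: (@polyfM L X _ za 1 m _ _ (Rd_ll l) h).
Qed.

(** [b] spans the functions of degree [m] modulo the first [j] fibre equations with coefficients of
    degree below [m]; so [h] bounds a value of the Hilbert function of this quotient. *)
Definition gens j m h (b : 'I_h -> X -> L) := (forall i, Rd m (b i)) /\
  forall f, Rd m f -> exists (a : 'I_h -> L) (r : 'I_d -> X -> L),
    (forall l, RdP m (r l)) /\ forall tau, nz tau ->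
    f tau = \sum_i a i * b i tau + \sum_(l < d | (l < j)%N) ll l tau * r l tau.

Let gens_trivial j m : exists b : 'I_(size (words (option 'I_N) m)) -> X -> L, gens j m b.
Proof.
pose W := words (option 'I_N) m.
exists (fun k tau => mono za tau (tnth (in_tuple W) k)); split=> [k|f [e he]].
  by have /size_in_words <- := mem_tnth k (in_tuple W); apply: polyf_mono.
exists (fun k => e (tnth (in_tuple W) k)), (fun _ _ => 0); split=> [l|tau _].
  by case: (m) => //= n; apply: Rd_cst.
rewrite [X in _ + X]big1 ?addr0; last by move=> l _; rewrite mulr0.
by rewrite he -/W big_tnth.
Qed.

(** Modulo the fibre equations [lam C l] is the constant [c l], so normalisation lowers the degree
    and no new generator appears. *)
Let gens_up m h (b : 'I_h -> X -> L) : (m0 <= m)%N -> gens d m b -> gens d m.+1 b.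
Proof.
move=> mm [hb hg]; split=> [i|f hf]; first exact: Rd_le (hb i).
have [r [r0 [hr hr0 hfr]]] := hC mm hf.
have [|a [s [hs e]]] := hg (fun tau => r0 tau + \sum_l c l * r l tau).
  by apply: polyfD => //; apply: polyf_sum => l _; apply: polyfZ.
exists a, (fun l x => r l x + s l x); split=> [l|tau ht].
  by apply: polyfD => //; apply: RdPW.
rewrite hfr // [X in _ = _ + X](eq_bigr (fun l => ll l tau * r l tau + ll l tau * s l tau)); last first.
  by move=> l _; rewrite mulrDr.
have E : \sum_(l < d | (l < d)%N) ll l tau * r l tau =
    \sum_l lam C tau l * r l tau - \sum_l c l * r l tau.
  rewrite (eq_bigl predT) => [|l]; last by rewrite ltn_ord.
  by rewrite -sumrB; apply: eq_bigr => l _; rewrite /ll mulrBl.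
rewrite big_split /= E; have := e tau ht => /(canRL (addrK _)) ->.
by ring.
Qed.

(** The coefficient of equation [j] has degree [m] and is expanded again modulo the earlier
    equations. This is the inequality [H_j(m+1) <= H_(j+1)(m+1) + H_j(m)] between Hilbert
    functions. *)
Let gens_step j (jd : (j < d)%N) m h h' (b : 'I_h -> X -> L) (b' : 'I_h' -> X -> L) :
  gens j.+1 m.+1 b -> gens j m b' -> exists b'' : 'I_(h + h') -> X -> L, gens j m.+1 b''.
Proof.
move=> [hb hg] [hb' hg']; pose jj := Ordinal jd.
exists (fun i => match split i with inl a => b a | inr a => fun x => ll jj x * b' a x end).
split=> [i|f hf].
  case: split => k; first exact: hb.
  exact: (@polyfM L X _ za 1 m _ _ (Rd_ll jj) (hb' k)).
have [a [r [hr e]]] := hg f hf; have [a' [r' [hr' e']]] := hg' (r jj) (hr jj).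
exists (fun i => match split i with inl k => a k | inr k => a' k end).
exists (fun l x => r l x + ll jj x * r' l x); split=> [l|tau ht].
  by apply: (@RdPD m.+1) => //; apply: RdP_mul.
rewrite big_split_ord /= (eq_bigr (fun k => a k * b k tau)) => [|k _]; last first.
  by rewrite (unsplitK (inl k)).
rewrite [X in _ = _ + X + _](eq_bigr (fun k => ll jj tau * (a' k * b' k tau))); last first.
  by move=> k _; rewrite (unsplitK (inr k)) mulrCA.
rewrite e // -addrA; congr (_ + _); rewrite (bigD1 jj) //= e' // mulrDr -addrA -mulr_sumr.
congr (_ + _); rewrite [RHS](eq_bigr (fun l => ll l tau * r l tau + ll jj tau * (ll l tau * r' l tau))).
  rewrite big_split /= addrC mulr_sumr; congr (_ + _); apply: eq_bigl => l.
  by rewrite ltnS leq_eqVlt -(inj_eq val_inj) /=; case: ltngtP.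
by move=> l _; ring.
Qed.

Let gens_base j j' h (b : 'I_h -> X -> L) : gens j' 0 b -> gens j 0 b.
Proof.
move=> [hb hg]; split=> // f /hg[a [r [hr e]]]; exists a, r; split=> // tau ht.
by rewrite e //; congr (_ + _); rewrite !big1 // => l _; rewrite hr mulr0.
Qed.

Section Kappa.
Variables (kappa m1 : nat) (b : 'I_kappa -> X -> L).
Hypothesis m01 : (m0 <= m1)%N.
Hypothesis gb : gens d m1 b.
Hypothesis kmin : forall h m (b' : 'I_h -> X -> L), (m0 <= m)%N -> gens d m b' -> (kappa <= h)%N.

Let gens_ge m : (m1 <= m)%N -> gens d m b.
Proof.
move=> /subnK<-; elim: (m - m1)%N => [|k ih]; first by rewrite add0n.
by rewrite addSn; apply: gens_up => //; apply: leq_trans m01 (leq_addl _ _).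
Qed.

Let ideal (f : X -> L) := exists M (r : 'I_d -> X -> L), (forall l, Rd M (r l)) /\
  forall tau, nz tau -> f tau = \sum_l ll l tau * r l tau.

Let ideal_ext f g : (forall tau, nz tau -> f tau = g tau) -> ideal f -> ideal g.
Proof. by move=> e [M [r [h hf]]]; exists M, r; split=> // t ht; rewrite -e ?hf. Qed.

Let idealD f g : ideal f -> ideal g -> ideal (fun x => f x + g x).
Proof.
move=> [M [r [hr hf]]] [M' [s [hs hg]]]; exists (M + M')%N, (fun l x => r l x + s l x).
split=> [l|t ht].
  by apply: polyfD; [apply: (Rd_le (leq_addr _ _) (hr l))|apply: (Rd_le (leq_addl _ _) (hs l))].
by rewrite hf // hg // -big_split /=; apply: eq_bigr => l _; rewrite mulrDr.
Qed.

Let idealM D f g : Rd D g -> ideal f -> ideal (fun x => g x * f x).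
Proof.
move=> hg [M [r [hr hf]]]; exists (D + M)%N, (fun l x => g x * r l x); split=> [l|t ht].
  exact: polyfM.
by rewrite hf // mulr_sumr; apply: eq_bigr => l _; rewrite mulrCA.
Qed.

Let idealZ a f : ideal f -> ideal (fun x => a * f x).
Proof. by apply: (@idealM 0 f (fun=> a)); apply: Rd_cst. Qed.

Let ideal0 : ideal (fun=> 0).
Proof.
exists 0%N, (fun _ _ => 0); split=> [l|t _]; first exact: Rd_cst.
by rewrite big1 // => l _; rewrite mulr0.
Qed.

Let ideal_sum (J : Type) (s : seq J) (f : J -> X -> L) :
  (forall j, ideal (f j)) -> ideal (fun x => \sum_(j <- s) f j x).
Proof.
move=> h; elim: s => [|j s ih]; first by apply: ideal_ext ideal0 => t _; rewrite big_nil.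
by apply: ideal_ext (idealD (h j) ih) => t _; rewrite big_cons.
Qed.

Let comb (a : 'cV[L]_kappa) (tau : X) := \sum_i a i 0 * b i tau.

Let combB a a' tau : comb (a - a') tau = comb a tau - comb a' tau.
Proof. by rewrite /comb -sumrB; apply: eq_bigr => i _; rewrite !mxE mulrBl. Qed.

Let comb_gen D f : Rd D f -> exists a, ideal (fun x => f x - comb a x).
Proof.
move=> hf; have [_ hg] := gens_ge (leq_addl D m1).
have [a [r [hr e]]] := hg f (Rd_le (leq_addr _ _) hf).
exists (\col_i a i), (D + m1)%N, r; split=> [l|t ht]; first exact: RdPW.
have -> : comb (\col_i a i) t = \sum_i a i * b i t.
  by apply: eq_bigr => i _; rewrite mxE.
rewrite e //.
by rewrite addrC addKr; apply: eq_bigl => l; rewrite ltn_ord.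
Qed.

Let comb_indep a : ideal (comb a) -> a = 0.
Proof.
move=> [M [r [hr e]]]; apply/colP => i0; rewrite mxE; apply: NNPP => /eqP ai0.
have [hb hg] := gens_ge (leq_addl M.+1 m1).
suff : gens d (M.+1 + m1) (fun i : 'I_kappa.-1 => b (lift i0 i)).
  move=> /(kmin (leq_trans m01 (leq_addl _ _))).
  by rewrite leqNgt ltn_predL (leq_ltn_trans _ (ltn_ord i0)).
split=> [i|f hf]; first exact: hb.
have [x [s [hs ef]]] := hg f hf.
exists (fun i => x (lift i0 i) - x i0 / a i0 0 * a (lift i0 i) 0).
exists (fun l y => s l y + (x i0 / a i0 0) * r l y); split=> [l|tau ht].
  apply: RdPD => //; apply: RdPZ; by apply: (@RdP_le M.+1); [apply: leq_addr|apply: hr].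
have e1 : b i0 tau = (a i0 0)^-1 * (\sum_l ll l tau * r l tau -
    \sum_i a (lift i0 i) 0 * b (lift i0 i) tau).
  have := e tau ht; rewrite /comb (bigD1_ord i0) //= => <-.
  by rewrite addrK mulrA mulVf // mul1r.
rewrite ef // (bigD1_ord i0) //= e1.
rewrite [in RHS](eq_bigr (fun i => x (lift i0 i) * b (lift i0 i) tau -
   x i0 / a i0 0 * (a (lift i0 i) 0 * b (lift i0 i) tau))); last first.
  by move=> i _; ring.
rewrite [X in _ = _ + X](eq_bigr (fun l => ll l tau * s l tau +
   x i0 / a i0 0 * (ll l tau * r l tau))); last by move=> l _; ring.
rewrite sumrB big_split /= -!mulr_sumr.
rewrite [X in _ = _ + (_ + _ * X)](eq_bigl predT) => [|l]; last by rewrite ltn_ord.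
by ring.
Qed.

(** Multiplication by the characters on the span of [b] modulo the ideal is a representation to
    which [torus_representation_bound] applies; it is cyclic because each [b j] is a polynomial in
    the characters applied to 1. *)
Lemma kappa_le n (pts : 'I_n -> X) :
  (forall tau, nz tau -> (forall l, lam C tau l = c l) -> exists a, tau = pts a) ->
  (forall a, \det (Jmx C (pts a)) != 0) -> (kappa <= n)%N.
Proof.
move=> hp hJ; have [hb _] := gb.
have /fin_all_exists[M hM] (i : 'I_N) : exists Mi : 'M[L]_kappa,
    forall a, ideal (fun x => zt x i * comb a x - comb (Mi *m a) x).
  have /fin_all_exists[co hco] (j : 'I_kappa) := comb_gen (polyfM (Rd_zt L A i) (hb j)).
  exists (\matrix_(k, j) co j k 0) => a.
  have h j : ideal (fun x => a j 0 * (zt x i * b j x - comb (co j) x)) by apply: idealZ.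
  apply: ideal_ext (ideal_sum (index_enum _) h) => t _.
  rewrite /comb mulr_sumr; rewrite (eq_bigr (fun j => zt t i * (a j 0 * b j t) -
     \sum_k a j 0 * (co j k 0 * b k t))); last first.
    by move=> j _; rewrite mulrBr mulr_sumr mulrCA.
  rewrite sumrB; congr (_ - _); rewrite exchange_big; apply: eq_bigr => k _ /=.
  by rewrite mxE mulr_suml; apply: eq_bigr => j _; rewrite mxE; ring.
have [u hu] := comb_gen (Rd_cst A 0 1).
have word s a : ideal (fun x => (\prod_(i <- s) zt x i) * comb a x - comb (mxword M s *m a) x).
  elim: s => [|i s ih] /=.
    by apply: ideal_ext ideal0 => t _; rewrite big_nil mul1r mul1mx subrr.
  apply: ideal_ext (idealD (idealM (Rd_zt L A i) ih) (hM i (mxword M s *m a))) => t _.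
  by rewrite big_cons mulmxA; ring.
have mx_eq (P Q : 'M[L]_kappa) : (forall a, ideal (comb (P *m a - Q *m a))) -> P = Q.
  move=> h; apply/eqP; rewrite -subr_eq0; apply/eqP/matrixP => i j.
  have := comb_indep (h (delta_mx j 0)); rewrite -mulmxBl => /colP/(_ i).
  by rewrite -colE !mxE.
apply: (@torus_representation_bound _ _ _ _ _ UA Asum kappa n M u C c pts) => //.
- move=> s s' e; apply: mx_eq => a.
  apply: ideal_ext (idealD (word s' a) (idealZ (-1) (word s a))) => t ht.
  by rewrite combB e //; ring.
- move=> l; apply: mx_eq => a.
  have h1 : ideal (fun x => ll l x * comb a x).
    exists m1, (fun k x => if k == l then comb a x else 0); split=> [k|t _].
      case: eqP => _; last exact: Rd_cst.
      by apply: polyf_sum => i _; apply: polyfZ.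
    by rewrite (bigD1 l) //= eqxx big1 ?addr0 // => k /negPf->; rewrite mulr0.
  have h2 := ideal_sum (index_enum _) (fun i => idealZ (C i l) (hM i a)).
  apply: ideal_ext (idealD h1 (idealZ (-1) h2)) => t _.
  rewrite combB mulmx_suml mul_scalar_mx /ll /lam mulrBl mulr_suml.
  have -> : comb (\sum_i C i l *: M i *m a) t = \sum_i C i l * comb (M i *m a) t.
    rewrite /comb (eq_bigr (fun k => \sum_i C i l * ((M i *m a) k 0 * b k t))).
      by rewrite exchange_big; apply: eq_bigr => i _ /=; rewrite mulr_sumr.
    move=> k _; rewrite summxE mulr_suml; apply: eq_bigr => i _.
    by rewrite -scalemxAl mxE mulrA.
  have -> : comb (c l *: a) t = c l * comb a t.
    by rewrite /comb mulr_sumr; apply: eq_bigr => k _; rewrite mxE mulrA.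
  rewrite [X in -1 * X](eq_bigr (fun i => C i l * zt t i * comb a t - C i l * comb (M i *m a) t)).
    by rewrite sumrB; ring.
  by move=> i _; ring.
move=> w hw; apply/rowP => j; rewrite mxE.
have [e he] := hb j.
pose v := \sum_(s <- words (option 'I_N) m1) e s *: (mxword M (pmap id s) *m u).
have -> : w 0 j = (w *m delta_mx j 0) 0 (0 : 'I_1) by rewrite -colE mxE.
suff -> : delta_mx j 0 = v.
  rewrite /v mulmx_sumr summxE big1 // => s _.
  by rewrite -scalemxAr mulmxA hw scaler0 mxE.
apply/eqP; rewrite -subr_eq0; apply/eqP; apply: comb_indep.
have combS (a : L) y t : comb (a *: y) t = a * comb y t.
  by rewrite /comb mulr_sumr; apply: eq_bigr => k _; rewrite mxE mulrA.
have monoE s t : mono za t s = \prod_(i <- pmap id s) zt t i.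
  rewrite /mono; elim: s => [|[i|] s ih] /=; first by rewrite !big_nil.
    by rewrite !big_cons ih.
  by rewrite big_cons ih mul1r.
have h s : ideal (fun x => e s * (mono za x s - comb (mxword M (pmap id s) *m u) x)).
  apply: idealZ; have hm : Rd (size s) (fun x => mono za x s) by apply: polyf_mono.
  apply: ideal_ext (idealD (idealM hm hu) (word (pmap id s) u)) => t _.
  by rewrite -monoE; ring.
apply: ideal_ext (ideal_sum (words _ m1) h) => t _.
have -> : comb (delta_mx j 0 - v) t = b j t -
    \sum_(s <- words (option 'I_N) m1) e s * comb (mxword M (pmap id s) *m u) t.
  rewrite combB; congr (_ - _).
    rewrite /comb (bigD1 j) //= mxE !eqxx mul1r big1 ?addr0 // => k /negPf.
    by rewrite mxE => ->; rewrite mul0r.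
  rewrite /v /comb (eq_bigr (fun k => \sum_(s <- words (option 'I_N) m1)
    e s * ((mxword M (pmap id s) *m u) k 0 * b k t))).
    by rewrite exchange_big; apply: eq_bigr => s _ /=; rewrite mulr_sumr.
  move=> k _; rewrite summxE mulr_suml; apply: eq_bigr => s _.
  by rewrite mxE mulrA.
by rewrite he -sumrB; apply: eq_bigr => s _; rewrite mulrBr.
Qed.

End Kappa.

(** Modulo all [d] equations the Hilbert function is eventually at most [n]. Removing the equations
    one at a time means summing over the degrees, which raises the exponent by one each time and
    keeps the leading factor. *)
Lemma fibre_hilbert_bound n (pts : 'I_n -> X) : (0 < d)%N ->
  (forall tau, nz tau -> (forall l, lam C tau l = c l) -> exists a, tau = pts a) ->
  (forall a, \det (Jmx C (pts a)) != 0) ->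
  exists cst, forall m, exists k (q : 'I_k -> X),
    [/\ (k <= maxn n 1 * (m + cst) ^ d)%N, forall i, nz (q i) &
    forall f, Rd m f -> (forall i, f (q i) = 0) -> forall tau, nz tau -> f tau = 0].
Proof.
move=> d0 hp hJ; set D1 := maxn n 1; have D10 : (0 < D1)%N by rewrite leq_max orbT.
pose P h := exists m (b : 'I_h -> X -> L), (m0 <= m)%N /\ gens d m b.
have [|kappa [m1 [b [m01 gb]]] kmin] := @classical_min P (size (words (option 'I_N) m0)).
  by have [b hb] := gens_trivial d m0; exists m0, b.
have kn : (kappa <= D1)%N.
  rewrite leq_max; apply/orP; left; apply: (kappa_le m01 gb _ hp hJ) => h m b' mm gb'.
  by apply: kmin; exists m, b'.
(* A crude bound in the degrees below [m1], where [b] need not generate; it only affects [cst]. *)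
pose W := (N.+1 ^ m1)%N.
have Hd m : exists h (b : 'I_h -> X -> L), gens d m b /\ (h <= if (m1 <= m)%N then D1 else W)%N.
  case: ifP => mm; last first.
    have [b' hb] := gens_trivial d m; exists _, b'; split=> //.
    rewrite size_words card_option card_ord leq_pexp2l // ltnW //.
    by rewrite ltnNge mm.
  exists kappa, b; split=> //; move: mm => /subnK<-.
  elim: (m - m1)%N => [|k ih]; first by rewrite add0n.
  by rewrite addSn; apply: gens_up => //; apply: leq_trans m01 (leq_addl _ _).
have H i : (i < d)%N -> exists2 cst, (0 < cst)%N & forall m,
    exists h (b : 'I_h -> X -> L), gens (d.-1 - i) m b /\ (h <= D1 * (m + cst) ^ i.+1)%N.
  elim: i => [_|i ih id].
    exists (1 + W * m1.+1)%N => // m; rewrite subn0 expn1.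
    suff [h [b' [hb hh]]] : exists h (b : 'I_h -> X -> L), gens d.-1 m b /\
        (h <= D1 * m.+1 + W * (minn m m1).+1)%N.
      exists h, b'; split=> //; apply: leq_trans hh _.
      rewrite addnA addn1 mulnDr leq_add2l.
      apply: leq_trans (leq_pmull _ D10); rewrite leq_mul2l ltnS geq_minr orbT //.
    elim: m => [|m [h' [b' [hb' hh']]]].
      have [h [b' [hb hh]]] := Hd 0%N; exists h, b'; split; first exact: gens_base hb.
      apply: leq_trans hh _; rewrite min0n !muln1; case: ifP => _.
        exact: leq_addr.
      exact: leq_addl.
    have [h [b2 [hb2 hh2]]] := Hd m.+1.
    have jd : (d.-1 < d)%N by rewrite ltn_predL.
    have [|b3 hb3] := @gens_step d.-1 jd m h h' b2 b' _ hb'; first by rewrite prednK.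
    exists (h + h')%N, b3; split=> //.
    apply: leq_trans (leq_add hh2 hh') _.
    move: D10; rewrite /minn; move: (W) (D1) => w D; case: ifP => h1; case: ifP => h2; case: ifP => h3 D0; nia.
  have [cst c0 hc] := ih (ltnW id); exists cst => // m.
  suff [h [b' [hb hh]]] : exists h (b : 'I_h -> X -> L), gens (d.-1 - i.+1) m b /\
      (h <= m.+1 * (D1 * (m + cst) ^ i.+1))%N.
    exists h, b'; split=> //; apply: leq_trans hh _.
    rewrite mulnCA leq_mul2l; apply/orP; right; rewrite [in X in (_ <= X)%N]expnS leq_mul2r.
    by rewrite -[m.+1]addn1 leq_add2l c0 orbT.
  have jE : (d.-1 - i = (d.-1 - i.+1).+1)%N by lia.
  elim: m => [|m [h' [b' [hb' hh']]]].
    have [h [b' [hb hh]]] := hc 0%N; exists h, b'; split; first exact: gens_base hb.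
    by rewrite mul1n.
  have [h [b2 [hb2 hh2]]] := hc m.+1; rewrite jE in hb2.
  have jd : (d.-1 - i.+1 < d)%N by lia.
  have [b3 hb3] := gens_step jd hb2 hb'.
  exists (h + h')%N, b3; split=> //.
  rewrite mulSn; apply: leq_add => //; apply: leq_trans hh' _.
  by rewrite !leq_mul2l leq_expl ?leq_add2r ?orbT.
have [|cst c0 hc] := H d.-1; first by rewrite ltn_predL.
exists cst => m; have [h [b' [[hb hg] hh]]] := hc m.
rewrite subnn prednK // in hg hh.
have [k [q [fr qnz hs]]] := separating_points b' (@nz L d).
exists k, q; split=> // [|f hf h0 tau ht].
  by apply: leq_trans hh; rewrite -(eqP fr) rank_leq_col.
have [a [r [_ e]]] := hg f hf.
have E x : nz x -> f x = \sum_i a i * b' i x.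
  by move=> hx; rewrite e // [X in _ + X]big_pred0 ?addr0.
rewrite E //; apply: (hs a) => // i.
by rewrite -E.
Qed.

End Fibre.

End Hilbert.

(** * Multivariate polynomials as functions; saturation of the weight matrix *)

Section Mpoly.
Variable L : closedFieldType.

Lemma linepoly_meval (V : lmodType L) n (p : {mpoly L[n]}) m (phi : V -> 'I_n -> L) :
  (forall i, linepoly m (phi^~ i)) -> exists m', linepoly m' (fun v => p.@[phi v]).
Proof.
move=> h; exists (n * (msize p * m))%N.
have h1 (mm : 'X_{1..n}) : mm \in msupp p ->
    linepoly (n * (msize p * m)) (fun v => p@_mm * \prod_i phi v i ^+ mm i).
  move=> hm; apply: linepolyZ.
  apply: (@linepoly_prod_ord L V n (msize p * m) (fun i v => phi v i ^+ mm i)) => i.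
  apply: (@linepoly_le _ _ (mm i * m)); last exact: linepolyX.
  rewrite leq_mul2r; apply/orP; right; apply: ltnW.
  by apply: leq_ltn_trans (msize_mdeg_lt hm); rewrite mdegE (bigD1 i) //= leq_addr.
apply: linepoly_ext (linepoly_sum (msupp p) h1) => v.
by rewrite mevalE [RHS]big_seq.
Qed.

Lemma mpoly_neq0_eval n (p : {mpoly L[n]}) : p != 0 -> exists v, p.@[v] != 0.
Proof.
move=> p0; pose K := msize p.
pose mn (a : {ffun 'I_n -> 'I_K}) : 'X_{1..n} := [multinom (a i : nat) | i < n].
have mnI : injective mn.
  move=> a b /mnmP h; apply/ffunP => i; apply: val_inj.
  by have := h i; rewrite !mnmE.
have surj m : m \in msupp p -> exists a, m = mn a.
  move=> hm; have lt i : (m i < K)%N.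
    by apply: leq_ltn_trans (msize_mdeg_lt hm); rewrite mdegE (bigD1 i) //= leq_addr.
  by exists [ffun i => Ordinal (lt i)]; apply/mnmP => i; rewrite mnmE ffunE.
have [m0 hm0] : exists m, m \in msupp p.
  by move: p0; rewrite -msupp_eq0; case: (msupp p) => // m s _; exists m; rewrite mem_head.
have [a0 ea0] := surj _ hm0.
have [|c hc] := @boxpoly_neq0 L n K (fun a => p@_(mn a)) a0.
  by rewrite -ea0 -mcoeff_msupp.
exists c; apply: contraNneq hc => e; rewrite /boxpoly -[X in _ == X]e mevalE.
pose F (m : 'X_{1..n}) := p@_m * \prod_i c i ^+ m i.
apply/eqP; transitivity (\sum_(m <- [seq mn a | a <- enum {ffun 'I_n -> 'I_K}]) F m).
  rewrite big_map big_enum /=; apply: eq_bigr => a _; congr (_ * _).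
  by apply: eq_bigr => i _; rewrite mnmE.
rewrite (bigID (fun m => m \in msupp p)) /= [X in _ + X]big1 ?addr0 => [|m hm]; last first.
  by rewrite /F (memN_msupp_eq0 hm) mul0r.
rewrite -big_filter; apply: perm_big; apply: uniq_perm.
- by rewrite filter_uniq // map_inj_uniq ?enum_uniq.
- exact: msupp_uniq.
move=> m; rewrite mem_filter andb_idr // => /surj[a ->].
by rewrite map_f // mem_enum.
Qed.

End Mpoly.

Section Saturation.
Variables (L : closedFieldType).

Definition texp m n (B : 'M[int]_(m, n)) (t : 'rV[L]_n) : 'rV[L]_m := \row_k zt B t k.

Lemma texp_nz m n (B : 'M[int]_(m, n)) t : nz t -> nz (texp B t).
Proof. by move=> h k; rewrite mxE zt_neq0. Qed.

Lemma zt_mul m n p (A : 'M[int]_(m, n)) (B : 'M[int]_(n, p)) (t : 'rV[L]_p) i :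
  nz t -> zt (A *m B) t i = zt A (texp B t) i.
Proof.
move=> ht; transitivity (\prod_j \prod_k (t 0 j ^ B k j) ^ A i k).
  apply: eq_bigr => j _; rewrite mxE.
  rewrite (big_morph (fun n => t 0 j ^ n) (id1 := 1) (op1 := *%R)) // => [|x y]; last first.
    by rewrite expfzDr.
  by apply: eq_bigr => k _; rewrite mulrC exprz_exp.
rewrite exchange_big; apply: eq_bigr => k _ /=; rewrite mxE.
by rewrite [RHS](big_morph (fun x => x ^ A i k) (id1 := 1) (op1 := *%R)) // => [x y|]; rewrite ?expfzMl ?exp1rz.
Qed.

Lemma texp_mul m n p (A : 'M[int]_(m, n)) (B : 'M[int]_(n, p)) (t : 'rV[L]_p) :
  nz t -> texp (A *m B) t = texp A (texp B t).
Proof. by move=> ht; apply/rowP => i; rewrite !mxE zt_mul. Qed.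

Lemma texp1 n (t : 'rV[L]_n) : texp 1%:M t = t.
Proof.
apply/rowP => i; rewrite mxE /zt (bigD1 i) //= mxE eqxx expr1z big1 ?mulr1 // => j /negPf.
by rewrite mxE eq_sym => ->; rewrite expr0z.
Qed.

Lemma exprz_root (x : L) (n : int) : x != 0 -> n != 0 -> exists2 y, y != 0 & y ^ n = x.
Proof.
have H (z : L) k : z != 0 -> exists2 y, y != 0 & y ^+ k.+1 = z.
  move=> z0; have [|y /rootP] := closed_rootP ('X^(k.+1) - z%:P) _.
    by rewrite size_XnsubC.
  rewrite !hornerE ?hornerXn => /eqP; rewrite subr_eq0 => /eqP yz; exists y => //.
  by apply: contraNneq z0 => y0; rewrite -yz y0 expr0n.
case: n => [[|k]|k] x0 n0; [by rewrite eqxx in n0|exact: H|].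
have [|y y0 yx] := H x^-1 k; first by rewrite invr_eq0.
by exists y; rewrite // NegzE -exprnN yx invrK.
Qed.

(** The Smith normal form gives [A0 = A (D R)], where [A] consists of columns of an invertible
    integer matrix, [D] is diagonal without zeros and [R] is invertible. Nonzero scalars have roots
    in a closed field, so [t -> t^(D R)] is onto and the images coincide. *)
Lemma torus_saturation N d (A0 : 'M[int]_(N, d)) (P : 'M[L]_N) :
  \rank (map_mx (intr : int -> rat) A0) = d ->
  exists (A : 'M[int]_(N, d)) (U : 'M[int]_(d, N)), U *m A = 1%:M /\
    forall x, torus_image A0 P x <-> torus_image A P x.
Proof.
move=> rk; have dN : (d <= N)%N by rewrite -rk rank_leq_row.
have [S uS [R uR [ds _ eA]]] := int_Smith_normal_form A0.
pose I : 'M[int]_(N, d) := \matrix_(i, j) (i == j :> nat)%:R.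
pose D : 'M[int]_d := \matrix_(i, j) (ds`_i *+ (i == j :> nat)).
have ID : \matrix_(i < N, j < d) (ds`_i *+ (i == j :> nat)) = I *m D.
  apply/matrixP => i j; rewrite !mxE (bigD1 j) //= !mxE eqxx mulr1n big1 => [|k /negPf kj].
    by rewrite addr0; case: eqP => [->|_]; rewrite ?mul1r // mul0r mulr0n.
  by rewrite !mxE -(inj_eq val_inj) /= in kj *; rewrite kj mulr0n mulr0.
have II : I^T *m I = 1%:M.
  apply/matrixP => i j; rewrite !mxE (bigD1 (widen_ord dN i)) //= !mxE eqxx mul1r.
  rewrite big1 ?addr0 => [|k /negPf ki].
    by rewrite -(inj_eq val_inj).
  rewrite !mxE; suff -> : (k == i :> nat) = false by rewrite mul0r.
  by rewrite -ki -(inj_eq val_inj).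
pose A := S *m I; pose U := I^T *m invmx S.
have eA2 : A0 = A *m (D *m R) by rewrite eA ID /A !mulmxA.
exists A, U; split; first by rewrite /U /A mulmxA mulmxKV.
have ds0 (k : 'I_d) : ds`_k != 0.
  apply/negP => /eqP dk; have : (\rank (map_mx (intr : int -> rat) (D *m R)) < d)%N.
    rewrite ltn_neqAle rank_leq_row andbT -/(row_free _) row_free_unit unitmxE det_map_mx.
    rewrite det_mulmx unitfE intr_eq0 mulf_eq0 negb_or negb_and negbK; apply/orP; left.
    apply/det0P; exists (delta_mx 0 k).
      by apply/eqP => /matrixP/(_ 0 k); rewrite !mxE !eqxx.
    apply/rowP => j; rewrite -rowE !mxE.
    by rewrite dk mul0rn.
  rewrite ltnNge => /negP; apply; rewrite -{1}rk eA2 map_mxM; exact: mxrankM_maxr.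
move=> x; split=> -[t ht ->].
  exists (texp (D *m R) t); first exact: texp_nz.
  congr (_ *m diag_mx _ *m _); apply/rowP => i; rewrite !mxE.
  by have := zt_mul A (D *m R) i ht; rewrite -eA2.
have /fin_all_exists2[s s0 hs] (k : 'I_d) := exprz_root (ht k) (ds0 k).
have sn : nz (\row_k s k) by move=> k; rewrite mxE.
exists (texp (invmx R) (\row_k s k)); first exact: texp_nz.
congr (_ *m diag_mx _ *m _); apply/rowP => i; rewrite !mxE.
have E2 : texp (D *m R) (texp (invmx R) (\row_k s k)) = t.
  rewrite texp_mul; last exact: texp_nz.
  rewrite -(texp_mul R (invmx R) sn) mulmxV // texp1.
  apply/rowP => k; rewrite mxE /zt (bigD1 k) //= !mxE eqxx mulr1n hs.
  by rewrite big1 ?mulr1 // => j /negPf; rewrite !mxE eq_sym -(inj_eq val_inj) /= => ->; rewrite mulr0n expr0z.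
have := @zt_mul _ _ _ A (D *m R) (texp (invmx R) (\row_k s k)) i (texp_nz _ sn).
by rewrite -eA2 E2 => /esym.
Qed.

(** A nontrivial exponent [m] is detected by an [x] that is neither 0 nor a root of [X^m - 1]. *)
Lemma trivial_character d (v : 'I_d -> int) :
  (forall t : 'rV[L]_d, nz t -> \prod_j t 0 j ^ v j = 1) -> forall j, v j = 0.
Proof.
move=> h j; apply/eqP; apply: contraT => vj.
pose m := absz (v j); have m0 : (0 < m)%N by rewrite absz_gt0.
have p0 : 'X * ('X^m - 1%:P) != 0 :> {poly L}.
  by rewrite mulf_neq0 ?polyX_eq0 // -size_poly_eq0 size_XnsubC.
have [x] := poly_nonroot p0; rewrite !hornerE ?hornerXn mulf_eq0 negb_or => /andP[x0 xm].
have hn : nz (\row_k (if k == j then x else 1) : 'rV[L]_d).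
  by move=> k; rewrite mxE; case: ifP => _ //; apply: oner_neq0.
have := h _ hn; rewrite (bigD1 j) //= mxE eqxx big1 => [|k /negPf kj]; last by rewrite mxE kj exp1rz.
rewrite mulr1 => e; move: xm; rewrite subr_eq0 => /eqP; case; rewrite /m.
case: (v j) e => k /=; first by [].
by rewrite NegzE -exprnN => /(congr1 GRing.inv); rewrite invrK invr1.
Qed.

End Saturation.

(** * Generic linear sections and the degree of the torus *)

Section Sections.
Variables (L : closedFieldType) (n k d : nat).
Hypothesis nkd : n = (k + d)%N.

Lemma sub_k : (k <= n)%N. Proof. by rewrite nkd leq_addr. Qed.

Definition lowi (i : 'I_k) : 'I_n := widen_ord sub_k i.
Definition highi (i : 'I_d) : 'I_n := cast_ord (esym nkd) (rshift k i).

Lemma lowi_highi i j : lowi i != highi j.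
Proof. by rewrite -(inj_eq val_inj) /= ltn_eqF // (leq_trans (ltn_ord i)) ?leq_addr. Qed.

Lemma highi_inj : injective highi.
Proof. by move=> i j /cast_ord_inj/rshift_inj. Qed.

Lemma low_or_high (i : 'I_n) : (exists j, i = lowi j) \/ (exists j, i = highi j).
Proof.
case: (ltnP i k) => h; [left; exists (Ordinal h)|right]; first exact: val_inj.
have h2 : (i - k < d)%N by rewrite ltn_subLR // -nkd.
by exists (Ordinal h2); apply: val_inj; rewrite /= subnKC.
Qed.

(* The linear subspace cut out by the last [d] columns of [V] is spanned by the
   first [k] rows of its adjugate. *)
Definition sec_eqs (V : 'M[L]_n) : 'M[L]_(n, d) := colsub highi V.
Definition sec_span (V : 'M[L]_n) : 'M[L]_(k, n) := rowsub lowi (\adj V).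

Lemma sec_spanP V (a y : 'rV[L]_n) : \det V != 0 ->
  (exists v, y = a + v *m sec_span V) <-> y *m sec_eqs V = a *m sec_eqs V.
Proof.
move=> V0; have uV : V \in unitmx by rewrite unitmxE unitfE.
split=> [[v ->]|e].
  rewrite mulmxDl -mulmxA; suff -> : sec_span V *m sec_eqs V = 0 by rewrite mulmx0 addr0.
  apply/matrixP => i j; transitivity ((\adj V *m V) (lowi i) (highi j)).
    by rewrite /sec_span /sec_eqs mxE [RHS]mxE; apply: eq_bigr => l _; rewrite !mxE.
  by rewrite mul_adj_mx !mxE (negPf (lowi_highi i j)) mulr0n.
pose b := (y - a) *m V *m ((\det V)^-1)%:M.
have yE : y - a = b *m \adj V.
  by rewrite /b mul_mx_scalar -scalemxAl -mulmxA mul_mx_adj mul_mx_scalar scalerA mulVf // scale1r.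
have b0 j : b 0 (highi j) = 0.
  rewrite /b mul_mx_scalar mxE; have -> : ((y - a) *m V) 0 (highi j) = 0; last by rewrite mulr0.
  transitivity ((y *m sec_eqs V - a *m sec_eqs V) 0 j); last by rewrite e subrr mxE.
  by rewrite -mulmxBl mxE [RHS]mxE; apply: eq_bigr => l _; rewrite !mxE.
exists (\row_i b 0 (lowi i)); rewrite -[LHS](subrK a) addrC; congr (_ + _).
apply/rowP => j; rewrite yE !mxE (bigID (fun i : 'I_n => (i < k)%N)) /=.
rewrite [X in _ + X]big1 ?addr0 => [|i ik].
  rewrite (big_ord_narrow sub_k); apply: eq_bigr => i _.
  by rewrite !mxE.
case: (low_or_high i) => [[l il]|[l ->]]; last by rewrite b0 mul0r.
by move: ik; rewrite il /= ltn_ord.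
Qed.

Lemma linepoly_sec_span i j : linepoly n (fun V => sec_span V i j).
Proof.
have h : linepoly (n * 1) (fun V : 'M[L]_n => (\adj V) (lowi i) j).
  by apply: (linepoly_adj (A := fun V : 'M[L]_n => V)) => a b; apply: linepoly_mxE.
by move: h; rewrite muln1; apply: linepoly_ext => V; rewrite /sec_span [RHS]mxE.
Qed.

End Sections.

Section GenericSection.
Variables (L : closedFieldType) (N d : nat).
Hypothesis NN : (N * N = (N * N - d) + d)%N.

Lemma linepoly_aff_coords (V : lmodType L) (p : {mpoly L[N * N + (N * N - d) * (N * N)]}) m
  (a : V -> 'rV[L]_(N * N)) (M : V -> 'M[L]_(N * N - d, N * N)) :
  (forall j, linepoly m (fun v => a v 0 j)) -> (forall i j, linepoly m (fun v => M v i j)) ->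
  exists m', linepoly m' (fun v => p.@[aff_coords (a v) (M v)]).
Proof.
move=> ha hM; apply: (@linepoly_meval L V _ p m) => i; rewrite /aff_coords; case: split => j.
  exact: ha.
case/mxvec_indexP: j => k l.
by apply: linepoly_ext (hM k l) => v; rewrite mxvecE.
Qed.

Lemma linepoly_det_id n : linepoly (n * 1) (fun W : 'M[L]_n => \det W).
Proof. by apply: (linepoly_det (A := fun W : 'M[L]_n => W)) => i j; apply: linepoly_mxE. Qed.

(** Degree is tested on sections given by spanning data [(a, M)], while the argument needs sections
    given by equations [V]. Nonvanishing of [p] is carried along [V -> adj V]: every invertible [W]
    is the adjugate of [mu W^-1] when [mu^(N^2 - 1) = det W]. *)
Lemma generic_section (p : {mpoly L[N * N + (N * N - d) * (N * N)]}) : (1 < N)%N -> p != 0 ->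
  exists a0, (exists m, linepoly m (fun V => p.@[aff_coords a0 (sec_span NN V)])) /\
    exists V, p.@[aff_coords a0 (sec_span NN V)] != 0.
Proof.
move=> N1 p0.
have [v0 pv0] := mpoly_neq0_eval p0.
pose a0 : 'rV[L]_(N * N) := \row_j v0 (lshift _ j).
pose M0 : 'M[L]_(N * N - d, N * N) := vec_mx (\row_j v0 (rshift _ j)).
have coordsE a a' (M M' : 'M[L]_(N * N - d, N * N)) : a = a' -> M = M' ->
  p.@[aff_coords a M] = p.@[aff_coords a' M'] by move=> -> ->.
have pM0 : p.@[aff_coords a0 M0] != 0.
  suff -> : p.@[aff_coords a0 M0] = p.@[v0] by [].
  apply: meval_eq => i; rewrite /aff_coords -[in RHS](splitK i); case: split => j /=.
    by rewrite mxE.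
  by rewrite /M0 vec_mxK mxE.
exists a0; split.
  apply: (linepoly_aff_coords _ (m := (N * N)%N) (a := fun=> a0)) => [j|i j].
    exact: linepoly_cst.
  exact: linepoly_sec_span.
have [mr lr] : exists m, linepoly m (fun W : 'M[L]_(N * N) =>
    p.@[aff_coords a0 (rowsub (lowi NN) W)]).
  apply: (linepoly_aff_coords _ (m := 1%N) (a := fun=> a0)) => [j|i j]; first exact: linepoly_cst.
  apply: (@linepoly_ext _ _ _ (fun W : 'M[L]_(N * N) => W (lowi NN i) j)).
    by move=> W; rewrite mxE.
  exact: linepoly_mxE.
have [||W] := linepoly_mul_neq0 (u := \matrix_(i, j) (if insub (i : nat) is Some k then M0 k j else 0)) (v := 1%:M) lr (@linepoly_det_id (N * N)%N).
- suff -> : rowsub (lowi NN) (\matrix_(i, j) (if insub (i : nat) is Some k then M0 k j else 0)) = M0 by [].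
  by apply/matrixP => i j; rewrite [LHS]mxE [LHS]mxE /= valK.
- by rewrite det1 oner_neq0.
rewrite mulf_eq0 negb_or => /andP[pW dW].
have uW : W \in unitmx by rewrite unitmxE unitfE.
have [m' em'] : exists m', (N * N = m'.+2)%N.
  by exists (N * N - 2)%N; move: N1; case: (N) => [|[|m']] // _; lia.
have [//|mu mu0 emu] := @exprz_root L (\det W) m'.+1%:Z dW.
exists (mu *: invmx W).
suff eadj : \adj (mu *: invmx W) = W by rewrite /sec_span eadj.
have uV : mu *: invmx W \in unitmx by rewrite unitmxZ ?unitfE // unitmx_inv.
have pw : mu ^+ (N * N) = \det W * mu by rewrite [X in mu ^+ X]em' exprSr -emu.
rewrite -[LHS](mulKmx uV) mul_mx_adj mul_mx_scalar detZ det_inv pw invmxZ // invmxK.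
rewrite scalerA -[RHS]scale1r; congr (_ *: _).
by field; rewrite mu0 dW.
Qed.

End GenericSection.

Section TorusDegree.
Variables (L : closedFieldType) (N d : nat) (A : 'M[int]_(N, d)) (U : 'M[int]_(d, N)).
Hypothesis UA : U *m A = 1%:M.
Hypothesis Asum : forall j, \sum_i A i j = 0.
Variable P : 'M[L]_N.
Hypothesis uP : P \in unitmx.
Hypothesis d0 : (0 < d)%N.

Definition xt (tau : 'rV[L]_d) : 'M[L]_N := P *m diag_mx (\row_i zt A tau i) *m invmx P.

Lemma xt_inj tau tau' : nz tau -> nz tau' -> xt tau = xt tau' -> tau = tau'.
Proof.
move=> h h' /(congr1 (fun M => invmx P *m M *m P)).
rewrite /xt !mulmxA !mulVmx // !mul1mx -!mulmxA !mulVmx // !mulmx1 => e.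
apply: (zt_inj UA h h') => i.
by have := congr1 (fun M : 'M_N => M i i) e; rewrite !mxE eqxx !mulr1n.
Qed.

Let Z : 'M[L]_(N, N * N) := \matrix_i mxvec (P *m delta_mx i i *m invmx P).

Lemma mxvec_xt tau : mxvec (xt tau) = (\row_i zt A tau i) *m Z.
Proof.
rewrite mulmx_sum_row /xt.
rewrite diag_mx_sum_delta.
rewrite mulmx_sumr mulmx_suml linear_sum; apply: eq_bigr => i _.
by rewrite -scalemxAr -scalemxAl linearZ /= mxE rowK.
Qed.

Lemma Z_free : exists Zr, Z *m Zr = 1%:M.
Proof.
suff : row_free Z by move/row_freeP.
apply: inj_row_free => v hv.
have : P *m diag_mx v *m invmx P = 0.
  apply: (can_inj mxvecK); rewrite linear0 -hv mulmx_sum_row.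
  rewrite diag_mx_sum_delta.
  rewrite mulmx_sumr mulmx_suml linear_sum; apply: eq_bigr => i _.
  by rewrite -scalemxAr -scalemxAl linearZ /= rowK.
move=> /(congr1 (fun M => invmx P *m M *m P)).
rewrite !mulmxA mulVmx // mul1mx -!mulmxA mulVmx // mulmx1 mul0mx mulmx0 => e.
by apply/rowP => i; have := congr1 (fun M : 'M_N => M i i) e; rewrite !mxE eqxx mulr1n.
Qed.

Let dN : (d <= N)%N.
Proof.
have : row_free (map_mx (intr : int -> rat) U).
  apply/row_freeP; exists (map_mx intr A); rewrite -map_mxM UA map_mx1 //.
by move=> /eqP <-; apply: rank_leq_col.
Qed.

Let NN : (N * N = (N * N - d) + d)%N.
Proof.
rewrite subnK // (leq_trans dN) // leq_pmulr //.
exact: leq_trans d0 dN.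
Qed.

(** A section that is at once generic for the degree, normalising and noncritical meets the torus in
    [DT] points with invertible Jacobian, which form a fibre as in [fibre_hilbert_bound]. *)
Lemma torus_degree_bound (T : 'M[L]_N -> Prop) DT :
  (forall x, T x <-> exists2 tau, nz tau & x = xt tau) -> has_degree T d DT ->
  exists cst, forall m, exists k (q : 'I_k -> 'rV[L]_d),
    [/\ (k <= maxn DT 1 * (m + cst) ^ d)%N, forall i, nz (q i) &
    forall f, polyf (za A) m f -> (forall i, f (q i) = 0) -> forall tau, nz tau -> f tau = 0].
Proof.
move=> hT [p p0 hdeg].
(* For [N = 1] the zero column sums would give [A = 0], impossible for [d > 0]. *)
have N1 : (1 < N)%N.
  have N0 := leq_trans d0 dN; rewrite ltn_neqAle N0 andbT; apply/eqP => N1.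
  have A0 i j : A i j = 0.
    by rewrite -[RHS](Asum j) (bigD1 i) //= big1 ?addr0 // => k; case/eqP; apply: ord_inj; move: (ltn_ord i) (ltn_ord k); lia.
  have := congr1 (fun M : 'M_d => M (Ordinal d0) (Ordinal d0)) UA; rewrite !mxE eqxx big1 // => i _.
  by rewrite A0 mulr0.
have [a0 [[mc1 lc1] c1n]] := generic_section NN N1 p0.
pose c1 V := p.@[aff_coords a0 (sec_span NN V)].
have ldet := @linepoly_det_id L (N * N)%N.
have [Zr hZr] := Z_free.
have Zlin t u v : Z *m sec_eqs NN (u + t *: v) = Z *m sec_eqs NN u + t *: (Z *m sec_eqs NN v).
  rewrite scalemxAr -mulmxDr; congr (_ *m _).
  by apply/matrixP => i j; rewrite /sec_eqs !mxE.
have Zsurj (C : 'M[L]_(N, d)) : exists V, Z *m sec_eqs NN V = C.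
  exists (Zr *m C *m \matrix_(j, i) (highi NN j == i)%:R).
  suff -> : sec_eqs NN (Zr *m C *m \matrix_(j, i) (highi NN j == i)%:R) = Zr *m C.
    by rewrite mulmxA hZr mul1mx.
  apply/matrixP => i j; rewrite /sec_eqs mxE [LHS]mxE (bigD1 j) //= [X in _ * X]mxE eqxx mulr1.
  rewrite big1 ?addr0 // => l lj; rewrite [X in _ * X]mxE.
  by rewrite (inj_eq (@highi_inj _ _ _ NN)) (negPf lj) mulr0.
have [C0 [m0 hC0]] := @noether_exists L N d A dN.
have [phN [mN [lN nN okN]]] := noether_open hC0.
have [phJ [mJ [lJ [CJ nJ] okJ]]] := @detJ_open L N d A U UA.
have [V01 nV01] : exists V, c1 V * \det V != 0.
  have [V1 hV1] := c1n.
  by apply: (linepoly_mul_neq0 lc1 ldet hV1 (v := 1%:M)); rewrite det1 oner_neq0.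
have [VN eVN] := Zsurj C0; have [VJ eVJ] := Zsurj CJ.
have [V2 nV2] : exists V, (c1 V * \det V) * phN (Z *m sec_eqs NN V) != 0.
  apply: (linepoly_mul_neq0 (linepolyM lc1 ldet) (linepoly_comp Zlin lN) nV01 (v := VN)).
  by rewrite eVN.
have [V nV] : exists V, (c1 V * \det V) * phN (Z *m sec_eqs NN V) * phJ (Z *m sec_eqs NN V) != 0.
  apply: (linepoly_mul_neq0 (linepolyM (linepolyM lc1 ldet) (linepoly_comp Zlin lN))
    (linepoly_comp Zlin lJ) nV2 (v := VJ)).
  by rewrite eVJ.
move: nV; rewrite !mulf_eq0 !negb_or => /andP[/andP[/andP[h1 h2] /okN hN] /okJ hJ].
set C := Z *m sec_eqs NN V in hN hJ; set M := sec_span NN V in h1.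
have [K [coef [[a1 ca1] hcrit]]] := critical_values hJ.
(* The direction of the section is now fixed; its translate [a] is chosen so that the constants [c]
   avoid the hypersurface of critical values. *)
have [cs hcs] := boxpoly_neq0 ca1.
have uV : V \in unitmx by rewrite unitmxE unitfE.
have [ma la] : exists m, linepoly m (fun a => p.@[aff_coords a M]).
  apply: (linepoly_aff_coords _ (m := 1%N) (a := id) (M := fun=> M)) => [j|i j].
    exact: linepoly_mxE.
  exact: linepoly_cst.
have lb : linepoly (d * (K * 1)) (fun a : 'rV[L]_(N * N) => boxpoly coef ((a *m sec_eqs NN V) 0)).
  apply: linepoly_boxpoly => l; apply: linepoly_lin => t u v.
  by rewrite mulmxDl -scalemxAl !mxE.
have secV : rowsub (highi NN) (invmx V) *m sec_eqs NN V = 1%:M.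
  apply/matrixP => i j; transitivity ((invmx V *m V) (highi NN i) (highi NN j)).
    by rewrite /sec_eqs mxE [RHS]mxE; apply: eq_bigr => l _; rewrite !mxE.
  by rewrite mulVmx // !mxE (inj_eq (@highi_inj _ _ _ NN)).
have [|a] := linepoly_mul_neq0 la lb h1 (v := (\row_l cs l) *m rowsub (highi NN) (invmx V)).
  rewrite -mulmxA secV mulmx1; suff -> : boxpoly coef ((\row_l cs l) 0) = boxpoly coef cs by [].
  apply: eq_bigr => x _; congr (_ * _); apply: eq_bigr => l _.
  by rewrite mxE.
rewrite mulf_eq0 negb_or => /andP[pa ba].
pose c := (a *m sec_eqs NN V) 0.
have fibreE tau : aff_sub a M (xt tau) <-> forall l, lam A C tau l = c l.
  rewrite /aff_sub (sec_spanP NN a (mxvec (xt tau)) h2) mxvec_xt -mulmxA -/C.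
  have e l : lam A C tau l = ((\row_i zt A tau i) *m C) 0 l.
    by rewrite [RHS]mxE; apply: eq_bigr => i _; rewrite [X in _ = X * _]mxE mulrC.
  split=> [h l|h]; first by rewrite e h.
  by apply/rowP => l; rewrite -e h.
have [s [us ss hs]] := hdeg a M pa.
have /fin_all_exists2[pts pnz hpts] (k : 'I_DT) : exists2 tau, nz tau & nth 0 s k = xt tau.
  by apply/hT; apply: (proj1 ((hs _).2 _)); rewrite mem_nth // ss.
have pfib k l : lam A C (pts k) l = c l.
  apply: (fibreE (pts k)).1; rewrite -hpts.
  by apply: (proj2 ((hs _).2 _)); rewrite mem_nth // ss.
apply: (fibre_hilbert_bound UA Asum hN (c := c) (pts := pts) d0).
  move=> tau ht /fibreE hf.
  have : xt tau \in s by apply/hs; split=> //; apply/hT; exists tau.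
  move=> /(nthP 0)[k ks e]; rewrite ss in ks; exists (Ordinal ks).
  by apply: xt_inj => //; rewrite -hpts.
move=> k; apply: contraNneq ba => hJ0; rewrite -(hcrit (pts k)) //.
apply/eqP; apply: eq_bigr => x _; congr (_ * _); apply: eq_bigr => l _.
by rewrite pfib.
Qed.

End TorusDegree.

(** Comparison of leading coefficients in integers: [M] is taken to be a multiple of [beta + 1] so
    large that the lower terms cannot make up one unit. *)
Lemma growth_bound n C alpha beta s :
  (forall M, n * M ^ s <= C * (alpha * M + beta) ^ s)%N -> (n <= C * alpha ^ s)%N.
Proof.
move=> h; rewrite leqNgt; apply/negP => hn.
have [K hK] : exists K, forall x, (0 < x)%N ->
    (x * (alpha * x + 1) ^ s <= x * (alpha ^ s * x ^ s) + K * x ^ s)%N.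
  elim: (s) => [|s' [K hK]]; first by exists 0%N => x _; rewrite !expn0; lia.
  exists (alpha * K + alpha ^ s' + K)%N => x x0.
  have := leq_mul (leqnn (alpha * x + 1)) (hK x x0); rewrite mulnCA -expnS => /leq_trans; apply.
  have := leq_mul (leqnn K) (leq_pexp2l x0 (leqnSn s')).
  rewrite !expnS; move: (x ^ s')%N (alpha ^ s')%N => y a; nia.
pose x := (C * K).+1; have hx := hK x (ltn0Sn _).
have := h (beta.+1 * x)%N; rewrite leqNgt => /negP; apply.
have l1 : (alpha * (beta.+1 * x) + beta <= beta.+1 * (alpha * x + 1))%N by nia.
apply: (@leq_ltn_trans (C * (beta.+1 * (alpha * x + 1)) ^ s)).
  by rewrite leq_mul2l leq_expl ?orbT.
rewrite !expnMn mulnCA [(n * _)%N]mulnCA ltn_pmul2l ?expn_gt0 //.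
rewrite -(ltn_pmul2l (ltn0Sn (C * K))) -/x mulnCA.
apply: leq_ltn_trans (_ : _ <= C * (x * (alpha ^ s * x ^ s) + K * x ^ s))%N _.
  by rewrite leq_mul2l hx orbT.
have x0 : (0 < x ^ s)%N by rewrite expn_gt0.
have : (C * alpha ^ s + 1 <= n)%N by rewrite addn1.
by move: x0; rewrite {2 4}/x; move: (x ^ s)%N (alpha ^ s)%N => y a; nia.
Qed.

(** * Algebraic derivatives along curves *)

Section Regular.
Variable L : closedFieldType.
Implicit Types f g : L -> L.

(* [f] agrees near 0 with a rational function without pole at 0. *)
Definition reg f := exists p q : {poly L}, q.[0] != 0 /\
  forall t, q.[t] != 0 -> f t * q.[t] = p.[t].

Lemma reg_ext f g : f =1 g -> reg f -> reg g.
Proof. by move=> e [p [q [q0 h]]]; exists p, q; split=> // t; rewrite -e; apply: h. Qed.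

Lemma reg_poly (p : {poly L}) : reg (fun t => p.[t]).
Proof. by exists p, 1; rewrite hornerC oner_neq0; split=> // t _; rewrite hornerC mulr1. Qed.

Lemma reg_cst c : reg (fun=> c).
Proof. by apply: reg_ext (reg_poly c%:P) => t; rewrite hornerC. Qed.

Lemma regD f g : reg f -> reg g -> reg (fun t => f t + g t).
Proof.
move=> [p [q [q0 h]]] [p' [q' [q0' h']]]; exists (p * q' + p' * q), (q * q').
rewrite hornerM mulf_neq0 //; split=> // t; rewrite !(hornerD, hornerM, hornerZ, hornerX, hornerC) mulf_eq0 negb_or => /andP[a b].
by rewrite -h // -h' //; ring.
Qed.

Lemma regM f g : reg f -> reg g -> reg (fun t => f t * g t).
Proof.
move=> [p [q [q0 h]]] [p' [q' [q0' h']]]; exists (p * p'), (q * q').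
rewrite hornerM mulf_neq0 //; split=> // t; rewrite !(hornerD, hornerM, hornerZ, hornerX, hornerC) mulf_eq0 negb_or => /andP[a b].
by rewrite -h // -h' //; ring.
Qed.

Lemma regX f n : reg f -> reg (fun t => f t ^+ n).
Proof.
move=> h; elim: n => [|n ih]; first exact: reg_cst.
by apply: reg_ext (regM h ih) => t; rewrite exprS.
Qed.

Lemma reg_sum (J : Type) (s : seq J) (F : J -> L -> L) :
  (forall j, reg (F j)) -> reg (fun t => \sum_(j <- s) F j t).
Proof.
move=> h; elim: s => [|j s ih]; first by apply: reg_ext (reg_cst 0) => t; rewrite big_nil.
by apply: reg_ext (regD (h j) ih) => t; rewrite big_cons.
Qed.

Lemma reg_prod (J : Type) (s : seq J) (F : J -> L -> L) :
  (forall j, reg (F j)) -> reg (fun t => \prod_(j <- s) F j t).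
Proof.
move=> h; elim: s => [|j s ih]; first by apply: reg_ext (reg_cst 1) => t; rewrite big_nil.
by apply: reg_ext (regM (h j) ih) => t; rewrite big_cons.
Qed.

Lemma reg_eq0 f (del : {poly L}) : reg f -> del != 0 ->
  (forall t, t != 0 -> del.[t] != 0 -> f t = 0) -> f 0 = 0.
Proof.
move=> [p [q [q0 h]]] d0 hf.
have qn : q != 0 by apply: contraNneq q0 => ->; rewrite horner0.
have p0 : p = 0.
  apply/eqP; apply: contraT => pn.
  have [|t] := @poly_nonroots L [:: p; 'X; del; q].
    by rewrite /= pn polyX_eq0 d0 qn.
  rewrite /= hornerX => /and5P[pt t0 dt qt _].
  by move: pt; rewrite -h // hf // mul0r eqxx.
by have := h 0 q0; rewrite p0 horner0 => /eqP; rewrite mulf_eq0 (negPf q0) orbF => /eqP.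
Qed.

(** The difference quotient at 0 completed by a value [b]. Its regularity says that [b] is the
    derivative, and permits cancelling powers of [t] in any characteristic. *)
Definition diffq f (b : L) t := if t == 0 then b else (f t - f 0) / t.
Definition der f b := reg f /\ reg (diffq f b).

Lemma der_ext f g b : f =1 g -> der f b -> der g b.
Proof.
move=> e [h1 h2]; split; first exact: reg_ext h1.
by apply: reg_ext h2 => t; rewrite /diffq !e.
Qed.

Lemma der_cst c : der (fun=> c) 0.
Proof.
split; first exact: reg_cst.
by apply: reg_ext (reg_cst 0) => t; rewrite /diffq subrr mul0r; case: eqP.
Qed.

Lemma derD f g b c : der f b -> der g c -> der (fun t => f t + g t) (b + c).
Proof.
move=> [f1 f2] [g1 g2]; split; first exact: regD.
apply: reg_ext (regD f2 g2) => t; rewrite /diffq; case: eqP => // _.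
by rewrite -mulrDl; congr (_ / _); ring.
Qed.

Lemma derM f g b c : der f b -> der g c -> der (fun t => f t * g t) (b * g 0 + f 0 * c).
Proof.
move=> [f1 f2] [g1 g2]; split; first exact: regM.
apply: reg_ext (regD (regM f2 (reg_cst (g 0))) (regM f1 g2)) => t; rewrite /diffq.
case: eqP => [->|_] //.
by rewrite [_ / t * _]mulrAC mulrA -mulrDl; congr (_ / _); ring.
Qed.

Lemma der_sum (J : Type) (s : seq J) (F : J -> L -> L) (b : J -> L) :
  (forall j, der (F j) (b j)) -> der (fun t => \sum_(j <- s) F j t) (\sum_(j <- s) b j).
Proof.
move=> h; elim: s => [|j s ih].
  by rewrite big_nil; apply: der_ext (der_cst 0) => t; rewrite big_nil.
by rewrite big_cons; apply: der_ext (derD (h j) ih) => t; rewrite big_cons.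
Qed.

Lemma der_exprz v (n : int) : der (fun t => (1 + t * v) ^ n) (n%:~R * v).
Proof.
have qE t : (1 + v *: 'X : {poly L}).[t] = 1 + t * v.
  by rewrite -[X in X + _]polyC1 hornerD hornerC hornerZ hornerX mulrC.
have lin : der (fun t => 1 + t * v) v.
  split.
    by apply: reg_ext (reg_poly (1 + v *: 'X)) => t; rewrite qE.
  apply: reg_ext (reg_cst v) => t; rewrite /diffq mul0r addr0; case: eqP => // /eqP t0.
  by rewrite [1 + _]addrC addrK mulrC mulKf.
have inv : der (fun t => (1 + t * v)^-1) (- v).
  have q0 : (1 + v *: 'X : {poly L}).[0] != 0 by rewrite qE mul0r addr0 oner_neq0.
  split.
    exists 1, (1 + v *: 'X); split=> // t; rewrite qE => qt.
    by rewrite mulVf // -polyC1 hornerC.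
  exists (- v)%:P, (1 + v *: 'X); split=> // t; rewrite qE hornerC /diffq => qt.
  rewrite mul0r addr0 invr1; case: eqP => [->|/eqP t0]; first by rewrite mul0r addr0 mulr1.
  by rewrite mulrAC mulrBl mul1r mulVf // opprD addrA subrr sub0r mulNr [t * v]mulrC mulfK.
have pow f b k : der f b -> f 0 = 1 -> der (fun t => f t ^+ k) (k%:R * b).
  move=> hf f0; elim: k => [|k ih].
    by rewrite mul0r; apply: der_ext (der_cst 1) => t; rewrite expr0.
  have := derM hf ih; rewrite f0 expr1n mul1r mulr1 -nat1r mulrDl mul1r.
  by apply: der_ext => t; rewrite exprS.
case: n => n.
  by apply: pow lin _; rewrite mul0r addr0.
have := pow _ _ n.+1 inv; rewrite mul0r addr0 invr1 => /(_ erefl).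
rewrite NegzE mulrNz mulNr -mulrN; apply: der_ext => t.
by rewrite -exprnN exprVn.
Qed.

Definition derm m n (F : L -> 'M[L]_(m, n)) (D : 'M[L]_(m, n)) :=
  forall i j, der (fun t => F t i j) (D i j).

Lemma derm_cst m n (M : 'M[L]_(m, n)) : derm (fun=> M) 0.
Proof. by move=> i j; rewrite mxE; apply: der_cst. Qed.

Lemma derm_mul m n p (F : L -> 'M[L]_(m, n)) (G : L -> 'M[L]_(n, p)) D E :
  derm F D -> derm G E -> derm (fun t => F t *m G t) (D *m G 0 + F 0 *m E).
Proof.
move=> hF hG i j; rewrite !mxE -big_split /=.
have h k := derM (hF i k) (hG k j).
by apply: der_ext (der_sum (index_enum _) h) => t; rewrite mxE.
Qed.

End Regular.

(** * The differential of the product map on torus points *)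

Section Fibres.
Variables (L : closedFieldType) (N d : nat) (A : 'M[int]_(N, d)) (U : 'M[int]_(d, N)).
Hypothesis UA : U *m A = 1%:M.
Variable P : 'M[L]_N.
Hypothesis uP : P \in unitmx.

Local Notation xt := (xt A P).

(** A curve through [tau] with logarithmic velocity [v], polynomial in [t]; starting on the torus,
    it leaves it for finitely many [t] only. *)
Definition path (tau v : 'rV[L]_d) (t : L) : 'rV[L]_d := \row_j (tau 0 j * (1 + t * v 0 j)).

Lemma path0 tau v : path tau v 0 = tau.
Proof. by apply/rowP => j; rewrite mxE mul0r addr0 mulr1. Qed.

(** The element of the Lie algebra of the torus with coordinates [v]: the velocity of [xt] along
    [path], translated to the identity. *)
Definition Xt (v : 'rV[L]_d) : 'M[L]_N :=
  P *m diag_mx (\row_i \sum_j (A i j)%:~R * v 0 j) *m invmx P.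

Lemma der_zt tau v i : der (fun t => zt A (path tau v t) i)
  (zt A tau i * \sum_j (A i j)%:~R * v 0 j).
Proof.
have prodE (s : seq 'I_d) : der (fun t => \prod_(j <- s) (1 + t * v 0 j) ^ A i j)
    (\sum_(j <- s) (A i j)%:~R * v 0 j) /\ \prod_(j <- s) (1 + 0 * v 0 j) ^ A i j = 1.
  elim: s => [|j s [ih1 ih2]].
    by rewrite !big_nil; split=> //; apply: der_ext (der_cst 1) => t; rewrite big_nil.
  rewrite !big_cons ih2 mul0r addr0 exp1rz mulr1; split=> //.
  have := derM (der_exprz (v 0 j) (A i j)) ih1; rewrite ih2 mul0r addr0 exp1rz mulr1 mul1r.
  by apply: der_ext => t; rewrite big_cons.
have := derM (der_cst (zt A tau i)) (prodE (index_enum _)).1; rewrite mul0r add0r.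
apply: der_ext => t; rewrite /zt -big_split /=; apply: eq_bigr => j _.
by rewrite mxE expfzMl.
Qed.

Lemma derm_xt tau v : derm (fun t => xt (path tau v t)) (Xt v *m xt tau).
Proof.
have hd : derm (fun t => diag_mx (\row_i zt A (path tau v t) i))
    (diag_mx (\row_i (zt A tau i * \sum_j (A i j)%:~R * v 0 j))).
  move=> i j; rewrite !mxE; have [->|ij] := eqVneq i j; rewrite ?eqxx ?mulr1n ?mulr0n.
    by apply: der_ext (der_zt tau v j) => t; rewrite !mxE eqxx mulr1n.
  by apply: der_ext (der_cst 0) => t; rewrite !mxE (negPf ij).
have := derm_mul (derm_mul (derm_cst P) hd) (derm_cst (invmx P)).
rewrite mul0mx add0r mulmx0 addr0; congr derm.
rewrite /Xt /xt !mulmxA mulmxKV // -!mulmxA; congr (_ *m _); rewrite mulmxA; congr (_ *m _).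
rewrite mulmx_diag; congr diag_mx; apply/rowP => i; rewrite !mxE mulrC; congr (_ * _).
Qed.

Section Words.
Variables (k : nat) (sg : nat -> 'M[L]_N).
Hypothesis sgu : forall j, sg j \in unitmx.
Implicit Types (x : {ffun 'I_k -> 'rV[L]_d}) (v : 'M[L]_(k, d)).

Fixpoint prefix (a : nat -> 'M[L]_N) m : 'M[L]_N :=
  if m is m'.+1 then prefix a m' *m a m' *m sg m' else 1%:M.

Definition pt x (i : nat) : 'M[L]_N := if insub i is Some j then xt (x j) else 1%:M.

Lemma xt_unit tau : nz tau -> xt tau \in unitmx.
Proof.
move=> h; rewrite /xt !unitmx_mul unitmx_inv uP andbT /= unitmxE det_diag unitfE.
by apply/prodf_neq0 => i _; rewrite mxE; apply: zt_neq0.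
Qed.

Lemma prefix_unit a m : (forall i, a i \in unitmx) -> prefix a m \in unitmx.
Proof. by move=> h; elim: m => [|m ih] /=; rewrite ?unitmx1 // !unitmx_mul ih h sgu. Qed.

(** The differential of the product map at [x], translated from the right to the identity: a sum of
    conjugates of Lie algebra elements by the prefixes. *)
Definition tangent x v : 'M[L]_N :=
  \sum_(j < k) prefix (pt x) j *m Xt (row j v) *m invmx (prefix (pt x) j).

Definition pathk x v t : {ffun 'I_k -> 'rV[L]_d} := [ffun j => path (x j) (row j v) t].

Lemma derm_prefix x v : (forall j, nz (x j)) ->
  derm (fun t => prefix (pt (pathk x v t)) k) (tangent x v *m prefix (pt x) k).
Proof.
move=> hx; have up i : pt x i \in unitmx.
  by rewrite /pt; case: insubP => [j _ _|_]; rewrite ?xt_unit ?unitmx1.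
suff H m : (m <= k)%N -> derm (fun t => prefix (pt (pathk x v t)) m)
    ((\sum_(j < k | (j < m)%N) prefix (pt x) j *m Xt (row j v) *m invmx (prefix (pt x) j))
       *m prefix (pt x) m).
  have := H k (leqnn k); rewrite /tangent; congr (derm _ (_ *m _)).
  by apply: eq_bigl => j; rewrite ltn_ord.
elim: m => [_|m ih mk] /=.
  by rewrite big_pred0 // mul0mx; apply: derm_cst.
pose jm := Ordinal mk.
have ptE t : pt (pathk x v t) m = xt (path (x jm) (row jm v) t).
  by rewrite /pt (insubT (fun i => (i < k)%N) mk) ffunE.
have ptE0 : pt x m = xt (x jm) by rewrite /pt (insubT (fun i => (i < k)%N) mk).
have h := derm_mul (derm_mul (ih (ltnW mk)) (derm_xt (x jm) (row jm v))) (derm_cst (sg m)).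
move: h; rewrite mulmx0 addr0.
have e0 : pathk x v 0 = x by apply/ffunP => j; rewrite ffunE path0.
rewrite path0 e0 -ptE0 => h.
have E : (\sum_(j < k | (j < m.+1)%N) prefix (pt x) j *m Xt (row j v) *m invmx (prefix (pt x) j))
    *m (prefix (pt x) m *m pt x m *m sg m) =
    ((\sum_(j < k | (j < m)%N) prefix (pt x) j *m Xt (row j v) *m invmx (prefix (pt x) j))
       *m prefix (pt x) m *m pt x m + prefix (pt x) m *m (Xt (row jm v) *m pt x m)) *m sg m.
  rewrite (bigD1 jm) ?ltnSn //= addrC !mulmxA; congr (_ *m _).
  rewrite !mulmxDl; congr (_ + _); last by rewrite mulmxKV // prefix_unit.
  congr (_ *m _ *m _); apply: eq_bigl => j.
  by rewrite ltnS leq_eqVlt -(inj_eq val_inj) /=; case: ltngtP.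
by rewrite E => i j; apply: der_ext (h i j) => t; rewrite ptE.
Qed.

End Words.

End Fibres.

(** * Bounding the points of a fibre where the differential is injective *)

Section FibreBound.
Variables (L : closedFieldType) (N d : nat) (A : 'M[int]_(N, d)) (U : 'M[int]_(d, N)).
Hypothesis UA : U *m A = 1%:M.
Variable P : 'M[L]_N.
Hypothesis uP : P \in unitmx.
Variables (k : nat) (sg : nat -> 'M[L]_N).
Hypothesis sgu : forall j, sg j \in unitmx.

Local Notation X := 'rV[L]_d.
Local Notation xt := (xt A P).
Local Notation pt := (pt A P).
Local Notation prefix := (prefix sg).
Local Notation tangent := (tangent A P sg).
Local Notation Rd := (polyf (za A)).

Definition upd (x : {ffun 'I_k -> X}) j0 (tau : X) : {ffun 'I_k -> X} :=
  [ffun j => if j == j0 then tau else x j].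

Lemma Rd_xt i j : Rd 1 (fun tau => xt tau i j).
Proof.
have h l : predT l -> Rd 1 (fun tau => P i l * invmx P l j * zt A tau l).
  by move=> _; apply: polyfZ; apply: Rd_zt.
apply: polyf_ext (polyf_sum (index_enum _) h) => tau; rewrite /xt mxE.
apply: eq_bigr => l _; rewrite mxE (bigD1 l) //= !mxE eqxx mulr1n big1 => [|m /negPf ml].
  by rewrite addr0 mulrAC.
by rewrite !mxE ml mulr0n mulr0.
Qed.

Lemma Rd_prefix (x : {ffun 'I_k -> X}) j0 i j :
  Rd 1 (fun tau => prefix (pt (upd x j0 tau)) k i j).
Proof.
suff H m : (m <= k)%N -> (forall i j, Rd 1 (fun tau => prefix (pt (upd x j0 tau)) m i j)) /\
    ((m <= j0)%N -> forall tau, prefix (pt (upd x j0 tau)) m = prefix (pt x) m).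
  by have [] := H k (leqnn k).
elim: m => [|m ih] mk /=; first by split=> // a b; apply: Rd_cst.
have [ih1 ih2] := ih (ltnW mk); pose jm := Ordinal mk.
have cst (f : L) D : Rd D (fun=> f) by apply: Rd_cst.
have ptE tau : pt (upd x j0 tau) m = xt (if jm == j0 then tau else x jm).
  by rewrite /pt (insubT (fun i => (i < k)%N) mk) ffunE.
have ptE0 : pt x m = xt (x jm) by rewrite /pt (insubT (fun i => (i < k)%N) mk).
have sgR (F : X -> 'M[L]_N) : (forall i j, Rd 1 (fun tau => F tau i j)) ->
    forall i j, Rd 1 (fun tau => (F tau *m sg m) i j).
  by move=> hF; apply: (@polyf_mulmx _ _ _ _ 1 0 _ _ _ F (fun=> sg m) hF) => a b; apply: cst.
case: (ltngtP m j0) => hm.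
- have jj : (jm == j0) = false by apply: contraTF hm => /eqP<-; rewrite ltnn.
  split=> [a b|_ tau]; last by rewrite ih2 ?(ltnW hm) // ptE jj ptE0.
  apply: polyf_ext (cst ((prefix (pt x) m *m pt x m *m sg m) a b) 1%N) => tau.
  by rewrite ih2 ?(ltnW hm) // ptE jj ptE0.
- have jj : (jm == j0) = false by apply: contraTF hm => /eqP<-; rewrite ltnn.
  split=> [|//].
  apply: sgR => a b; apply: (@polyf_mulmx _ _ _ _ 1 0 _ _ _ _ (fun tau => pt (upd x j0 tau) m) ih1) => c e.
  by apply: polyf_ext (cst (xt (x jm) c e) 0%N) => tau; rewrite ptE jj.
have jj : jm == j0 by apply/eqP/val_inj.
split=> [|//].
apply: sgR => a b; apply: (@polyf_mulmx _ _ _ _ 0 1 _ _ _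
    (fun tau => prefix (pt (upd x j0 tau)) m) (fun tau => pt (upd x j0 tau) m)) => c e.
  by apply: polyf_ext (cst (prefix (pt x) m c e) 0%N) => tau; rewrite ih2 ?hm.
by apply: polyf_ext (Rd_xt c e) => tau; rewrite ptE jj.
Qed.

(** A generic projection [Pi] reduces the fibre equations to [s = k d] functions [g] while keeping
    all [n] differentials invertible. In each torus variable the test functions have degree at most
    [s M + n], so the factor [s^s] of the bound is the leading coefficient of
    [(s M + n + cst)^s]. *)
Lemma fibre_bound n (x : 'I_n -> {ffun 'I_k -> X}) (y : 'M[L]_N) D1 cst :
  (forall m, exists h (q : 'I_h -> X), [/\ (h <= D1 * (m + cst) ^ d)%N, forall i, nz (q i) &
    forall f, Rd m f -> (forall i, f (q i) = 0) -> forall tau, nz tau -> f tau = 0]) ->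
  injective x -> (forall a j, nz (x a j)) -> (forall a, prefix (pt (x a)) k = y) ->
  (forall a v, tangent (x a) v = 0 -> v = 0) ->
  (n <= D1 ^ k * (k * d) ^ (k * d))%N.
Proof.
move=> hdet xI xnz xy xtan; pose s := (k * d)%N.
have uy a : prefix (pt (x a)) k \in unitmx.
  apply: prefix_unit => // i; rewrite /pt; case: insubP => [j _ _|_]; rewrite ?unitmx1 //.
  exact: xt_unit.
have tanD a u v t : tangent (x a) (u + t *: v) = tangent (x a) u + t *: tangent (x a) v.
  rewrite /tangent scaler_sumr -big_split /=; apply: eq_bigr => j _.
  rewrite scalemxAl scalemxAr -mulmxDl -mulmxDr; congr (_ *m _ *m _).
  rewrite /Xt scalemxAl scalemxAr -mulmxDl -mulmxDr; congr (_ *m _ *m _).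
  apply/matrixP => b c; rewrite !mxE mulrnAr -mulrnDl; congr (_ *+ _).
  by rewrite mulr_sumr -big_split /=; apply: eq_bigr => l _; rewrite !mxE; ring.
pose Dm a : 'M[L]_(s, N * N) :=
  \matrix_l mxvec (tangent (x a) (vec_mx (delta_mx 0 l)) *m prefix (pt (x a)) k).
have DmE a v : mxvec (tangent (x a) v *m prefix (pt (x a)) k) = mxvec v *m Dm a.
  rewrite mulmx_sum_row; pose phi v := mxvec (tangent (x a) v *m prefix (pt (x a)) k).
  have phiD u w t : phi (u + t *: w) = phi u + t *: phi w.
    by rewrite /phi tanD mulmxDl -scalemxAl linearD linearZ.
  have phi0 : phi 0 = 0.
    by have := phiD 0 0 (-1); rewrite scaler0 addr0 scaleN1r subrr.
  rewrite -/(phi v) -{1}[v]mxvecK; move: (mxvec v) => {}v.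
  rewrite {1}(row_sum_delta v) linear_sum.
  elim: (index_enum _) => [|l r ih]; first by rewrite !big_nil phi0.
  by rewrite !big_cons linearZ /= [X in phi X]addrC phiD ih addrC rowK.
have Dfree a : row_free (Dm a).
  apply: inj_row_free => v hv.
  have := DmE a (vec_mx v); rewrite vec_mxK hv => /(congr1 vec_mx).
  rewrite mxvecK linear0 => h.
  have := congr1 (mulmx^~ (invmx (prefix (pt (x a)) k))) h; rewrite /= mulmxK // mul0mx.
  by move=> /xtan e; rewrite -[v]vec_mxK e linear0.
have [Pi hPi] : exists Pi : 'M[L]_(N * N, s), forall a, \det (Dm a *m Pi) != 0.
  have [|a _|Pi hPi] := @linepoly_prod_neq0 L 'M[L]_(N * N, s) 'I_n (enum 'I_n)
    (fun a Pi => \det (Dm a *m Pi)).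
  - move=> a _; exists (s * 1)%N; apply: linepoly_det => i j; apply: linepoly_lin => t u v.
    by rewrite mulmxDr -scalemxAr !mxE.
  - have [B hB] := row_freeP (Dfree a); exists B.
    by rewrite hB det1 oner_neq0.
  by exists Pi => a; apply: hPi; rewrite mem_enum.
pose ell (c : 'M[L]_(k, N)) (tau : {ffun 'I_k -> X}) := \sum_j \sum_i c j i * zt A (tau j) i.
have [c hc] : exists c, forall a b, a != b -> ell c (x a) != ell c (x b).
  have [|[a b]|c hc] := @linepoly_prod_neq0 L 'M[L]_(k, N) ('I_n * 'I_n)%type
     [seq p <- enum {: 'I_n * 'I_n} | p.1 != p.2]
     (fun p c => ell c (x p.1) - ell c (x p.2)).
  - move=> [a b] _; exists 1%N; apply: linepoly_lin => t u v.
    rewrite /ell -!sumrB mulr_sumr -big_split /=; apply: eq_bigr => j _.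
    rewrite -!sumrB mulr_sumr -big_split /=; apply: eq_bigr => i _.
    by rewrite !mxE; ring.
  - rewrite mem_filter /= => /andP[ab _].
    have [j [i hji]] : exists j i, zt A (x a j) i != zt A (x b j) i.
      apply: NNPP => no; move/eqP: ab; apply; apply: xI; apply/ffunP => j.
      apply: (zt_inj UA) => // i; apply: NNPP => h; apply: no; exists j, i.
      exact/eqP.
    exists (delta_mx j i); suff E tau : ell (delta_mx j i) tau = zt A (tau j) i.
      by rewrite !E subr_eq0.
    rewrite /ell (bigD1 j) //= (bigD1 i) //= mxE !eqxx mul1r !big1 ?addr0 //.
      by move=> j' /negPf h; rewrite big1 // => i' _; rewrite mxE h mul0r.
    by move=> i' /negPf h; rewrite mxE h andbF mul0r.
  exists c => a b ab; rewrite -subr_eq0; apply: (hc (a, b)).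
  by rewrite mem_filter /= ab mem_enum.
pose g (tau : {ffun 'I_k -> X}) (l : 'I_s) :=
  ((mxvec (prefix (pt tau) k) - mxvec y) *m Pi) 0 l.
pose fn M (ab : {ffun 'I_s -> 'I_M} * 'I_n) (tau : {ffun 'I_k -> X}) :=
  (\prod_l g tau l ^+ ab.1 l) * ell c tau ^+ ab.2.
have g_sec tau j0 l : Rd 1 (fun t => g (upd tau j0 t) l).
  have h i : predT i -> Rd 1 (fun t => Pi i l *
      (mxvec (prefix (pt (upd tau j0 t)) k) 0 i - mxvec y 0 i)).
    move=> _; apply: polyfZ; apply: RdB; last exact: Rd_cst.
    case/mxvec_indexP: i => a b; apply: polyf_ext (Rd_prefix tau j0 a b) => t.
    by rewrite mxvecE.
  apply: polyf_ext (polyf_sum (index_enum _) h) => t; rewrite /g mxE.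
  by apply: eq_bigr => i _; rewrite !mxE mulrC.
have ell_sec tau j0 : Rd 1 (fun t => ell c (upd tau j0 t)).
  apply: polyf_sum => j _; apply: polyf_sum => i _; apply: polyfZ.
  case: (eqVneq j j0) => [->|jj].
    by apply: polyf_ext (Rd_zt L A i) => t; rewrite ffunE eqxx.
  by apply: polyf_ext (Rd_cst A 1 (zt A (tau j) i)) => t; rewrite ffunE (negPf jj).
have RdX D f e : Rd D f -> Rd (e * D) (fun t => f t ^+ e).
  move=> hf; elim: e => [|e ih]; first exact: Rd_cst.
  by rewrite mulSn; apply: polyf_ext (polyfM hf ih) => t; rewrite exprS.
have fn_sec M ab tau j0 : Rd (s * M + n) (fun t => @fn M ab (upd tau j0 t)).
  apply: polyfM.
    apply: (@polyf_prod_ord L X _ (za A) s M (fun l t => g (upd tau j0 t) l ^+ ab.1 l)) => l.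
    apply: (@Rd_le _ _ _ _ (ab.1 l * 1)); first by rewrite muln1 ltnW.
    by apply: RdX; apply: g_sec.
  apply: (@Rd_le _ _ _ _ (ab.2 * 1)); first by rewrite muln1 ltnW.
  by apply: RdX; apply: ell_sec.
have hM M : (n * M ^ s <= D1 ^ k * (s * M + (n + cst)) ^ s)%N.
  rewrite leqNgt; apply/negP => big.
  have [nq [q [hq qnz qdet]]] := hdet (s * M + n)%N.
  pose grid := {ffun 'I_k -> 'I_nq}; pose gp (t : grid) : {ffun 'I_k -> X} := [ffun j => q (t j)].
  have [|coef [[ab0 c0] hrel]] := @nontrivial_relation L ({ffun 'I_s -> 'I_M} * 'I_n)%type #|grid|
    (fun ab i => fn M ab (gp (enum_val i))).
    rewrite card_prod !card_ffun !card_ord [X in (_ < X)%N]mulnC.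
    apply: leq_ltn_trans big; apply: leq_trans (leq_expl k hq) _.
    by rewrite expnMn -expnM [(d * k)%N]mulnC addnA.
  have rel (tau : {ffun 'I_k -> X}) : (forall j, nz (tau j)) -> \sum_ab coef ab * fn M ab tau = 0.
    move=> htau.
    apply: (@product_vanishing L _ X [pred t : X | [forall j, t 0 j != 0]]
       [pred t : X | [exists i, t == q i]]
       (fun tau : {ffun 'I_k -> X} => \sum_ab coef ab * @fn M ab tau)) => /=.
    - by move=> t /existsP[i /eqP->]; apply/forallP => j; apply: qnz.
    - move=> v i hv h0.
      have := qdet (fun t => \sum_ab coef ab * fn M ab (upd v i t)).
      have -> : \sum_ab coef ab * fn M ab v = \sum_ab coef ab * fn M ab (upd v i (v i)).
        suff -> : upd v i (v i) = v by [].
        by apply/ffunP => j; rewrite ffunE; case: eqP => [->|].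
      move=> H; apply: (H _ _ (v i)); last by move=> j; apply: (forallP (hv i)).
        by apply: polyf_sum => ab _; apply: polyfZ; apply: fn_sec.
      by move=> a; apply: h0; apply/existsP; exists a.
    - move=> v hv; have /fin_all_exists[t ht] i : exists a, v i = q a.
        by have /existsP[a /eqP ->] := hv i; exists a.
      have -> : v = gp [ffun i => t i] by apply/ffunP => i; rewrite !ffunE.
      by have := hrel (enum_rank [ffun i => t i]); rewrite enum_rankK.
    - by move=> i; apply/forallP => j; apply: htau.
  (* The relation is examined through its part of least order [e] in [g]. *)
  pose deg (ab : {ffun 'I_s -> 'I_M} * 'I_n) := (\sum_l ab.1 l)%N.
  have [[a1 b1] /= c1 amin] := @arg_minnP _ ab0 (fun ab => coef ab != 0) deg c0.
  set e := deg (a1, b1) in amin.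
  have low (p : 'I_n) (w : 'I_s -> L) :
      \sum_(ab | deg ab == e) coef ab * ((\prod_l w l ^+ ab.1 l) * ell c (x p) ^+ ab.2) = 0.
    (* The direction along which the functions [g] have prescribed derivatives [w]. *)
    pose W : 'rV[L]_s := (\row_l w l) *m invmx (Dm p *m Pi).
    pose v : 'M[L]_(k, d) := vec_mx W.
    have vD l : (mxvec (tangent (x p) v *m prefix (pt (x p)) k) *m Pi) 0 l = w l.
      by rewrite DmE vec_mxK -mulmxA mulmxKV ?mxE // unitmxE unitfE.
    pose tau := pathk (x p) v.
    have gder l : der (fun t => g (tau t) l) (w l).
      rewrite -vD !mxE.
      have hi i : der (fun t => (mxvec (prefix (pt (tau t)) k) 0 i - mxvec y 0 i) * Pi i l)
          (mxvec (tangent (x p) v *m prefix (pt (x p)) k) 0 i * Pi i l).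
        have h1 : der (fun t => mxvec (prefix (pt (tau t)) k) 0 i)
            (mxvec (tangent (x p) v *m prefix (pt (x p)) k) 0 i).
          case/mxvec_indexP: i => a b; rewrite mxvecE.
          apply: der_ext (derm_prefix A uP sgu v (xnz p) a b) => t.
          by rewrite mxvecE.
        have := derM (derD h1 (der_cst (- mxvec y 0 i))) (der_cst (Pi i l)).
        by rewrite mulr0 !addr0; apply: der_ext.
      apply: der_ext (der_sum (index_enum _) hi) => t; rewrite /g mxE.
      by apply: eq_bigr => i _; rewrite !mxE.
    have tau0 : tau 0 = x p by apply/ffunP => j; rewrite ffunE path0.
    have g0 l : g (tau 0) l = 0 by rewrite tau0 /g xy subrr mul0mx mxE.
    have lreg : reg (fun t => ell c (tau t)).
      apply: reg_sum => j; apply: reg_sum => i; apply: regM; first exact: reg_cst.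
      by apply: reg_ext (der_zt A (x p j) (row j v) i).1 => t; rewrite ffunE.
    (* The relation along the curve divided by [t ^+ e]: by minimality of [e], no subtraction is
       truncated where the coefficient is nonzero, and at [t = 0] only the part of order [e]
       survives. *)
    pose h t := \sum_ab coef ab * (t ^+ (deg ab - e) *
      ((\prod_l diffq (fun t => g (tau t) l) (w l) t ^+ ab.1 l) * ell c (tau t) ^+ ab.2)).
    have hreg : reg h.
      apply: reg_sum => ab; apply: regM; first exact: reg_cst.
      apply: regM; first by apply: regX; apply: reg_ext (reg_poly 'X) => t; rewrite hornerX.
      apply: regM; last exact: regX.
      by apply: reg_prod => l; apply: regX; apply: (gder l).2.
    have h0 : h 0 = 0.
      (* Its zeros are the parameters at which the curve leaves the torus. *)
      pose del : {poly L} := \prod_(jl : 'I_k * 'I_d) (1 + v jl.1 jl.2 *: 'X).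
      apply: (reg_eq0 hreg (del := del)).
        apply/prodf_neq0 => jl _; apply/eqP => /(congr1 (fun q : {poly L} => q.[0])).
        rewrite -[X in X + _]polyC1 hornerD hornerC hornerZ hornerX mulr0 addr0 horner0.
        exact/eqP/oner_neq0.
      move=> t t0 dt.
      have tnz j : nz (tau t j).
        move=> l; rewrite ffunE mxE [row j v 0 l]mxE mulf_neq0 //; first exact: xnz.
        move: dt; rewrite horner_prod => /prodf_neq0/(_ (j, l) isT) /=.
        by rewrite -[X in X + _]polyC1 hornerD hornerC hornerZ hornerX mulrC.
      apply: (mulfI (expf_neq0 e t0)); rewrite mulr0 -[RHS](rel _ tnz) /h mulr_sumr.
      apply: eq_bigr => ab _; have [->|cab] := eqVneq (coef ab) 0; first by rewrite !mul0r mulr0.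
      rewrite mulrCA; congr (_ * _); rewrite [LHS]mulrA -exprD subnKC; last exact: amin.
      rewrite /fn [LHS]mulrA; congr (_ * _); rewrite /deg expr_sum -big_split /=.
      apply: eq_bigr => l _; rewrite -exprMn; congr (_ ^+ _).
      by rewrite /diffq (negPf t0) g0 subr0 mulrC divfK.
    rewrite -[RHS]h0 /h [RHS](bigID (fun ab => deg ab == e)) /= [X in _ = _ + X]big1 ?addr0.
      apply: eq_bigr => ab /eqP ->; rewrite subnn expr0 mul1r tau0; congr (_ * (_ * _)).
      by apply: eq_bigr => l _; rewrite /diffq eqxx.
    move=> ab dab; have [->|cab] := eqVneq (coef ab) 0; first by rewrite mul0r.
    have lt : (e < deg ab)%N by rewrite ltn_neqAle eq_sym dab amin.
    by rewrite expr0n subn_eq0 leqNgt lt mul0r mulr0.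
  have coef0 (w : 'I_s -> L) b :
      \sum_(a | deg (a, b) == e) coef (a, b) * \prod_l w l ^+ a l = 0.
    (* For fixed [w] the leading part is a polynomial of degree below [n] in the value of [ell],
       which takes [n] distinct values on the points. *)
    pose r : {poly L} := \poly_(b < n) (if insub b is Some b' then
       \sum_(a | deg (a, b') == e) coef (a, b') * \prod_l w l ^+ a l else 0).
    have r0 : r = 0.
      apply: (@roots_geq_poly_eq0 _ _ [seq ell c (x p) | p <- enum 'I_n]).
      - apply/allP => z /mapP[p _ ->]; rewrite /root horner_poly -[X in _ == X](low p w).
        apply/eqP; transitivity (\sum_a \sum_(b | deg (a, b) == e)
          coef (a, b) * ((\prod_l w l ^+ a l) * ell c (x p) ^+ b)); last first.
          by rewrite pair_big_dep; apply: eq_big => [[? ?]|[? ?] _].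
        rewrite [RHS](exchange_big_dep xpredT) //=; apply: eq_bigr => b' _.
        rewrite valK mulr_suml; apply: eq_bigr => a _.
        by rewrite mulrA.
      - rewrite map_inj_uniq ?enum_uniq // => p p' /eqP h; apply/eqP; apply: contraTT h.
        exact: hc.
      by rewrite size_map size_enum_ord size_poly.
    have := congr1 (fun q : {poly L} => q`_b) r0.
    by rewrite coef0 coef_poly ltn_ord valK.
  pose top (a : {ffun 'I_s -> 'I_M}) := if deg (a, b1) == e then coef (a, b1) else 0.
  have [|w] := @boxpoly_neq0 L s M top a1; first by rewrite /top eqxx.
  rewrite /boxpoly (bigID (fun a => deg (a, b1) == e)) /= [X in _ + X]big1; last first.
    by move=> a /negPf h; rewrite /top h mul0r.
  rewrite addr0 => /eqP; apply; rewrite -[RHS](coef0 w b1).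
  by apply: eq_bigr => a h; rewrite /top h.
exact: growth_bound hM.
Qed.

End FibreBound.

(** * Cayley transforms and vanishing on the finite group *)

Definition cay (L : fieldType) N (Y : 'M[L]_N) := (1%:M - Y) *m invmx (1%:M + Y).

Section Cayley.
Variables (L : fieldType) (N : nat).
Implicit Types (Y Q X : 'M[L]_N).

(** The Lie algebra of the isometry group of the form [Q]. *)
Definition lieform Q Y := Y^T *m Q + Q *m Y = 0.

Lemma lieformP Q Y : lieform Q Y -> Y^T *m Q = - (Q *m Y).
Proof. by move=> /eqP; rewrite addr_eq0 => /eqP. Qed.

Lemma lieform_tr Q Y : lieform Q Y -> (1%:M + Y)^T *m Q = Q *m (1%:M - Y).
Proof. by move=> h; rewrite linearD /= trmx1 mulmxDl mul1mx lieformP // mulmxBr mulmx1. Qed.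

Lemma lieform_tr2 Q Y : lieform Q Y -> (1%:M - Y)^T *m Q = Q *m (1%:M + Y).
Proof.
by move=> h; rewrite linearB /= trmx1 mulmxBl mul1mx lieformP // opprK mulmxDr mulmx1.
Qed.

Lemma lieform_det Q Y : Q \in unitmx -> lieform Q Y -> \det (1%:M - Y) = \det (1%:M + Y).
Proof.
rewrite unitmxE unitfE => Q0 /lieform_tr/(congr1 determinant).
by rewrite !det_mulmx det_tr mulrC => /(mulfI Q0).
Qed.

Lemma cay_isometry Q Y : lieform Q Y -> 1%:M + Y \in unitmx ->
  (cay Y)^T *m Q *m cay Y = Q.
Proof.
move=> h u; rewrite /cay trmx_mul -!mulmxA [_^T *m (Q *m _)]mulmxA lieform_tr2 //.
have c : (1%:M + Y) *m (1%:M - Y) = (1%:M - Y) *m (1%:M + Y).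
  by rewrite mulmxDl !mulmxBr mulmxBl !mulmxDr !mul1mx !mulmx1 addrA subrK opprD addrA addrK.
rewrite -[Q *m _ *m _]mulmxA [(1%:M + Y) *m _]mulmxA c -[_ *m _ *m invmx _]mulmxA mulmxV // mulmx1.
rewrite -lieform_tr // mulmxA -trmx_mul mulmxV //.
by rewrite trmx1 mul1mx.
Qed.

Lemma cay_det Q Y : Q \in unitmx -> lieform Q Y -> 1%:M + Y \in unitmx -> \det (cay Y) = 1.
Proof.
move=> uQ h u; rewrite /cay det_mulmx det_inv (lieform_det uQ h) mulfV //.
by rewrite -unitfE -unitmxE.
Qed.

Lemma cay_nilp Y : Y *m Y = 0 -> 1%:M + Y \in unitmx /\ cay Y = 1%:M - Y *+ 2.
Proof.
move=> Y2; have e : (1%:M + Y) *m (1%:M - Y) = 1%:M.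
  by rewrite mulmxDl !mulmxBr mul1mx mulmx1 mul1mx Y2 subr0 subrK.
have [u _] := mulmx1_unit e; split=> //.
have -> : cay Y = (1%:M - Y) *m (1%:M - Y).
  by rewrite /cay; congr (_ *m _); rewrite -[RHS](mulKmx u) e mulmx1.
by rewrite mulmxBl !mulmxBr mul1mx mulmx1 mul1mx Y2 subr0 mulr2n opprD addrA.
Qed.

Lemma cay_conj X Y : 1%:M + Y \in unitmx -> 1%:M - Y \in unitmx ->
  cay Y *m X *m invmx (cay Y) =
  X + (invmx (1%:M + Y) *m (X *m Y - Y *m X) *m invmx (1%:M - Y)) *+ 2.
Proof.
move=> u v; have uc : cay Y \in unitmx by rewrite unitmx_mul v unitmx_inv.
apply: (can_inj (mulmxK uc)); rewrite mulmxKV // mulmxDl.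
set R := invmx (1%:M + Y).
(* With [R = (1 + Y)^-1] the formula reduces to [cay Y = 2 R - 1] and [R [X, Y] R = R X - X R]. *)
have cE : cay Y = R *+ 2 - 1%:M.
  apply: (can_inj (mulmxK u)); rewrite mulmxKV // mulmxBl mulr2n mulmxDl.
  by rewrite mulVmx // mul1mx opprD addrA addrK.
have c2 : invmx (1%:M - Y) *m cay Y = R by rewrite mulKmx.
have RX : R *m (X *m Y - Y *m X) *m R = R *m X - X *m R.
  have -> : X *m Y - Y *m X = X *m (1%:M + Y) - (1%:M + Y) *m X.
    by rewrite mulmxDl mulmxDr mulmx1 mul1mx opprD addrACA subrr add0r.
  by rewrite mulmxBr mulmxBl -!mulmxA mulmxV // mulmx1 !mulmxA mulVmx // mul1mx.
move: cE c2 RX; move: (cay Y) => C cE c2 RX.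
rewrite mulr2n mulmxDl -!mulmxA c2 !mulmxA RX cE !mulr2n mulmxBl mulmxBr mulmxDl mulmxDr mulmx1 mul1mx.
move: (R *m X) (X *m R) => a b.
by rewrite [RHS]addrAC; congr (_ - X); rewrite addrACA [b + _]addrC subrK.
Qed.

End Cayley.

Section Density.
Variables (F : finFieldType) (L : fieldType) (iota : {rmorphism F -> L}).

Lemma mx_overP N (x : 'M[L]_N) : reflect (exists y, x = map_mx iota y) (mx_over iota x).
Proof.
apply: (iffP forallP) => [h|[y ->] i]; last first.
  by apply/forallP => j; apply/existsP; exists (y i j); rewrite mxE.
have h2 (k : 'I_N * 'I_N) : exists a, iota a = x k.1 k.2.
  by have /existsP[a /eqP] := forallP (h k.1) k.2; exists a.
have [y hy] := fin_all_exists h2; exists (\matrix_(i, j) y (i, j)).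
by apply/matrixP => i j; rewrite !mxE hy.
Qed.

Definition Fgrid := [seq iota a | a <- enum F].

Lemma Fgrid_uniq : uniq Fgrid.
Proof. by rewrite map_inj_uniq ?enum_uniq //; apply: fmorph_inj. Qed.

Lemma size_Fgrid : size Fgrid = #|F|.
Proof. by rewrite size_map -cardE. Qed.

Lemma Fgrid_mx a b (x : 'M[L]_(a, b)) : (forall i j, x i j \in Fgrid) ->
  exists y, x = map_mx iota y.
Proof.
move=> h; have h2 (k : 'I_a * 'I_b) : exists c, iota c = x k.1 k.2.
  by have /mapP[c _ ->] := h k.1 k.2; exists c.
have [y hy] := fin_all_exists h2; exists (\matrix_(i, j) y (i, j)).
by apply/matrixP => i j; rewrite !mxE hy.
Qed.

Lemma map_cay N (Y : 'M[F]_N) : cay (map_mx iota Y) = map_mx iota (cay Y).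
Proof. by rewrite /cay map_mxM map_invmx map_mxB map_mxD map_mx1. Qed.

(** The linear map [y] sends all matrices onto the Lie algebra and is defined over [F]. The factor
    [det (1 + y Z) ^+ e] makes [f (cay (y Z))] polynomial in [Z], and one further [det] kills the
    grid points where [1 + y Z] is singular. The degree is at most [e (N + 1) + N], below the number
    of grid values. *)
Lemma form_density N (Q : 'M[F]_N) (eta : bool) (e : nat) (f : 'M[L]_N -> L) :
  2%:R != 0 :> L -> Q \in unitmx -> Q^T = (-1) ^+ eta *: Q ->
  (e * N.+1 + N < #|F|)%N -> polyf (@mxf L N) e f ->
  (forall g : 'M[F]_N, g^T *m Q *m g = Q -> \det g = 1 -> f (map_mx iota g) = 0) ->
  forall Y, lieform (map_mx iota Q) Y -> 1%:M + Y \in unitmx -> f (cay Y) = 0.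
Proof.
move=> two uQ tQ qe [cf fE] hG Y0 lY0 uY0.
pose QL := map_mx iota Q; pose R := invmx QL.
have uQL : QL \in unitmx by rewrite map_unitmx.
pose y (Z : 'M[L]_N) := R *m (Z - (-1) ^+ eta *: Z^T).
have yl i j : linepoly 1 (fun Z : 'M[L]_N => y Z i j).
  apply: linepoly_lin => t u v.
  have -> : y (u + t *: v) = y u + t *: y v.
    rewrite /y scalemxAr -mulmxDr; congr (_ *m _).
    by apply/matrixP => k l; rewrite !mxE; ring.
  by rewrite [LHS]mxE [X in _ + X]mxE.
have tQL : QL^T = (-1) ^+ eta *: QL.
  by rewrite /QL map_trmx tQ map_mxZ rmorphXn rmorphN1.
have sg : (-1) ^+ eta * (-1) ^+ eta = 1 :> L by rewrite -expr2 sqrr_sign.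
pose ft (Y : 'M[L]_N) (o : option ('I_N * 'I_N)) : L :=
  if o is Some k then ((1%:M - Y) *m \adj (1%:M + Y)) k.1 k.2 else \det (1%:M + Y).
pose Fh Y := \sum_(w <- words _ e) cf w * mono ft Y w.
have fhE Y : 1%:M + Y \in unitmx -> Fh Y = \det (1%:M + Y) ^+ e * f (cay Y).
  move=> uY; rewrite fE mulr_sumr; apply: eq_big_seq => w /size_in_words sw.
  rewrite mulrCA; congr (_ * _); rewrite -sw /mono.
  have -> : \det (1%:M + Y) ^+ size w = \prod_(k <- w) \det (1%:M + Y).
    by rewrite big_const_seq count_predT iter_mulr_1.
  rewrite -big_split /=; apply: eq_bigr => -[[i j]|] _ /=; last by rewrite mulr1.
  rewrite /cay /invmx uY -scalemxAr [in RHS]mxE mulrA mulfV ?mul1r //.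
  by rewrite -unitfE -unitmxE.
have yy Z : lieform QL (y Z).
  have trE (Y : 'M_N) : Y^T *m QL = (QL^T *m Y)^T by rewrite trmx_mul trmxK.
  rewrite /lieform trE tQL -scalemxAl /y mulKVmx //; apply/matrixP => i j.
  by rewrite !mxE mulrBr mulrA sg mul1r; ring.
have gl : linepoly (N + e * N.+1) (fun Z => \det (1%:M + y Z) * Fh (y Z)).
  have l1 b i j : linepoly 1 (fun Z => (1%:M + (-1) ^+ (b : bool) *: y Z) i j).
    apply: linepoly_ext (linepolyD (linepoly_cst _ (1%:M i j))
      (linepolyZ ((-1) ^+ b) (yl i j))) => Z.
    by rewrite [RHS]mxE; congr (_ + _); rewrite [RHS]mxE.
  have l0 i j : linepoly 1 (fun Z => (1%:M + y Z) i j).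
    by apply: linepoly_ext (l1 false i j) => Z; rewrite expr0 scale1r.
  have l2 i j : linepoly 1 (fun Z => (1%:M - y Z) i j).
    by apply: linepoly_ext (l1 true i j) => Z; rewrite expr1 scaleN1r.
  have ld : linepoly N (fun Z => \det (1%:M + y Z)).
    by have := linepoly_det l0; rewrite muln1.
  apply: linepolyM => //.
  apply: (@polyf_linepoly _ _ _ ft _ y); last by exists cf.
  case=> [[i j]|] /=; last first.
    exact: (@linepoly_le _ _ N).
  rewrite -add1n; apply: linepoly_mulmx => // k l.
  by have := linepoly_adj l0 k l; rewrite muln1.
have gz : forall Z, \det (1%:M + y Z) * Fh (y Z) = 0.
  apply: (linepoly_grid gl Fgrid_uniq); first by rewrite size_Fgrid addnC.
  move=> Z /Fgrid_mx[Z' ZE].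
  have [uY|] := boolP (1%:M + y Z \in unitmx); last first.
    by rewrite unitmxE unitfE negbK => /eqP->; rewrite mul0r.
  rewrite fhE //.
  pose Y' := invmx Q *m (Z' - (-1) ^+ eta *: Z'^T).
  have yE : y Z = map_mx iota Y'.
    by rewrite /y ZE map_mxM map_invmx map_mxB map_mxZ -map_trmx rmorphXn rmorphN1.
  have u' : 1%:M + Y' \in unitmx by rewrite -(map_unitmx iota) map_mxD map_mx1 -yE.
  have cE : cay (y Z) = map_mx iota (cay Y').
    by rewrite yE map_cay.
  have l' : lieform Q Y'.
    rewrite /lieform; have := yy Z; rewrite yE /lieform map_trmx -!map_mxM -map_mxD.
    by move=> h; apply: (map_mx_inj (f := iota)); rewrite map_mx0.
  by rewrite cE hG ?mulr0 //; [apply: cay_isometry | apply: cay_det uQ _ _].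
(* Division by 2 undoes the symmetrisation in [y]. *)
have Y0E : y (2%:R^-1 *: (QL *m Y0)) = Y0.
  have tW : (QL *m Y0)^T = - ((-1) ^+ eta *: (QL *m Y0)).
    by rewrite trmx_mul tQL -scalemxAr lieformP // scalerN.
  suff -> : y (2%:R^-1 *: (QL *m Y0)) = R *m (QL *m Y0) by rewrite mulKmx.
  rewrite /y; congr (_ *m _); move: tW; move: (QL *m Y0) => W tW.
  apply/matrixP => i j; move/matrixP/(_ i j): tW; rewrite !mxE => ->.
  move: (2%:R^-1) (mulVf two) ((-1) ^+ eta) sg => h2 h2E s sg.
  have -> : h2 * W i j - s * (h2 * - (s * W i j)) = h2 * (1 + s * s) * W i j by ring.
  by rewrite sg -[1 + 1]/(2%:R) h2E mul1r.
have := gz (2%:R^-1 *: (QL *m Y0)); rewrite Y0E fhE // => /eqP.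
rewrite mulf_eq0 mulf_eq0 expf_eq0 => /orP[|/orP[/andP[_]|/eqP//]];
  by rewrite (negPf (_ : \det (1%:M + Y0) != 0)) // -unitfE -unitmxE.
Qed.

(** The cone [w u = 0] is parametrised over [F] by letting [w] be the transpose of an antisymmetric
    matrix times [u]; then [1 + u w] is cubic in the parameters, which accounts for the factor 3. *)
Lemma sl_density N (e : nat) (f : 'M[L]_N -> L) :
  (e * 3 < #|F|)%N -> polyf (@mxf L N) e f ->
  (forall g : 'M[F]_N, \det g = 1 -> f (map_mx iota g) = 0) ->
  forall (u : 'cV_N) (w : 'rV_N), w *m u = 0 -> f (1%:M + u *m w) = 0.
Proof.
move=> qe hf hG u0 w0 wu0.
pose uu (K : fieldType) (x : 'M[K]_(1 + N, N)) := (usubmx x)^T.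
pose ww (K : fieldType) (x : 'M[K]_(1 + N, N)) := ((dsubmx x - (dsubmx x)^T) *m uu K x)^T.
have wuE K x : ww K x *m uu K x = 0.
  rewrite /ww trmx_mul linearB /= trmxK mulmxBr mulmxBl.
  apply/eqP; rewrite subr_eq0; apply/eqP.
  rewrite -[LHS]trmxK; apply/matrixP => i j; rewrite !ord1 mxE.
  by rewrite !trmx_mul !trmxK mulmxA.
have det1 (K : fieldType) x : \det (1%:M + uu K x *m ww K x) = 1.
  move: (uu K x) (ww K x) (wuE K x) => u w wu.
  (* Two block factorisations express [det (1 + u w) = 1 + w u], here equal to 1. *)
  have E : block_mx 1%:M w 0 1%:M *m block_mx 1%:M (- w) u 1%:M =
      block_mx (1%:M : 'M_1) 0 u 1%:M.
    by rewrite mulmx_block !mul1mx !mul0mx !mulmx1 wu addr0 add0r addNr add0r.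
  have E2 : block_mx 1%:M 0 (- u) 1%:M *m block_mx (1%:M : 'M_1) (- w) u 1%:M =
      block_mx 1%:M (- w) 0 (1%:M + u *m w).
    by rewrite mulmx_block !mul1mx !mul0mx !mulmx1 !addr0 addNr mulNmx mulmxN opprK addrC.
  have := congr1 determinant E2; have := congr1 determinant E.
  rewrite !det_mulmx !det_ublock !det_lblock !det1 !mul1r => -> <-.
  by [].
have gl : linepoly (e * 3) (fun x => f (1%:M + uu L x *m ww L x)).
  have lu i j : linepoly 1 (fun x => uu L x i j).
    by apply: linepoly_lin => t u v; rewrite /uu !mxE.
  have lV i j : linepoly 1 (fun x : 'M[L]_(1 + N, N) => (dsubmx x - (dsubmx x)^T) i j).
    by apply: linepoly_lin => t u v; rewrite !mxE; ring.
  have lw i j : linepoly 2 (fun x => ww L x i j).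
    have h := linepoly_mulmx lV lu j i.
    refine (linepoly_ext _ h) => x.
    by rewrite /ww [RHS]mxE.
  apply: (polyf_linepoly _ hf) => -[[i j]|] /=; last exact: linepoly_cst.
  apply: linepoly_ext (linepolyD (linepoly_cst 3 ((1%:M : 'M_N) i j))
    (linepoly_mulmx lu lw i j)) => x.
  by rewrite [RHS]mxE.
have gz : forall x, f (1%:M + uu L x *m ww L x) = 0.
  apply: (linepoly_grid gl Fgrid_uniq); first by rewrite size_Fgrid.
  move=> x /Fgrid_mx[x' ->].
  have -> : 1%:M + uu L (map_mx iota x') *m ww L (map_mx iota x') =
    map_mx iota (1%:M + uu F x' *m ww F x').
    have mu : uu L (map_mx iota x') = map_mx iota (uu F x').
      by apply/matrixP => i j; rewrite !mxE.
    have mw : ww L (map_mx iota x') = map_mx iota (ww F x').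
      by rewrite /ww mu -map_dsubmx map_trmx -map_mxB -map_mxM map_trmx.
    by rewrite mu mw -map_mxM -(map_mx1 iota) -map_mxD.
  by apply: hG; apply: det1.
have [u00|/matrix0Pn[i [j]]] := eqVneq u0 0.
  have := gz 0; have -> : uu L 0 = 0 by apply/matrixP => i j; rewrite !mxE.
  by rewrite u00 !mul0mx.
rewrite [j]ord1 => ui.
(* As [u' u0 = 1] and [w0 u0 = 0], the antisymmetrisation of [w0^T u'] sends [u0] to [w0^T]; so
   every [w0] is reached. *)
pose u' : 'rV[L]_N := (u0 i 0)^-1 *: delta_mx 0 i.
have uu' : u' *m u0 = 1%:M.
  rewrite -scalemxAl -rowE; apply/matrixP => a b.
  by rewrite !ord1 !mxE eqxx mulVf.
have := gz (col_mx u0^T (w0^T *m u')).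
have uE : uu L (col_mx u0^T (w0^T *m u')) = u0 by rewrite /uu col_mxKu trmxK.
rewrite /ww uE col_mxKd trmx_mul linearB /= trmxK trmx_mul trmxK mulmxBr.
have -> : u0^T *m (w0^T *m u') = 0 by rewrite mulmxA -trmx_mul wu0 trmx0 mul0mx.
by rewrite subr0 [u0^T *m _]mulmxA -trmx_mul uu' trmx1 mul1mx.
Qed.
End Density.

(** * Independence of conjugates near the identity *)

Definition free_mxs (L : fieldType) (I : finType) a b (G : I -> 'M[L]_(a, b)) :=
  forall c : I -> L, \sum_i c i *: G i = 0 -> forall i, c i = 0.

Definition mxs_mx (L : fieldType) (I : finType) a b (G : I -> 'M[L]_(a, b)) :
  'M_(#|I|, a * b) := \matrix_(k < #|I|) mxvec (G (enum_val k)).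

Lemma free_mxsP (L : fieldType) (I : finType) a b (G : I -> 'M[L]_(a, b)) :
  free_mxs G <-> row_free (mxs_mx G).
Proof.
have E (v : 'rV_#|I|) : v *m mxs_mx G = mxvec (\sum_i v 0 (enum_rank i) *: G i).
  rewrite mulmx_sum_row [RHS]linear_sum [RHS](reindex_onto enum_val enum_rank) /=;
    last by move=> i _; apply: enum_rankK.
  by apply: eq_big => [k|k _]; rewrite ?enum_valK ?eqxx // rowK linearZ.
split=> [h|h c hc i].
  apply: inj_row_free => v; rewrite E => /(congr1 vec_mx); rewrite mxvecK linear0 => /h hv.
  by apply/rowP => k; rewrite mxE -[k]enum_valK hv.
have : (\row_k c (enum_val k)) *m mxs_mx G = 0 *m mxs_mx G.
  rewrite [LHS]E mul0mx -[RHS](linear0 mxvec) -[X in _ = mxvec X]hc; congr mxvec; apply: eq_bigr => j _.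
  by rewrite mxE enum_rankK.
move/(row_free_inj h)/rowP/(_ (enum_rank i)).
by rewrite !mxE enum_rankK.
Qed.

Lemma free_mxs_open (L : closedFieldType) (V : lmodType L) (I : finType) a b m
  (G : V -> I -> 'M[L]_(a, b)) u0 :
  (forall i k l, linepoly m (fun u => G u i k l)) -> free_mxs (G u0) ->
  exists2 p : V -> L, linepoly (#|I| * m) p /\ p u0 != 0 &
    forall u, p u != 0 -> free_mxs (G u).
Proof.
move=> hG /free_mxsP/row_freeP[R hR].
exists (fun u => \det (mxs_mx (G u) *m R)); last first.
  move=> u; rewrite -unitfE -unitmxE => U; apply/free_mxsP/row_freeP.
  by exists (R *m invmx (mxs_mx (G u) *m R)); rewrite mulmxA mulmxV.
split; last by rewrite hR det1 oner_neq0.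
apply: linepoly_det => i j; rewrite -[m]addn0.
apply: linepoly_mulmx => [k l|k l]; last exact: linepoly_cst.
case/mxvec_indexP: l => x y; apply: linepoly_ext (hG (enum_val k) x y) => u.
by rewrite mxE mxvecE.
Qed.

Section NearIdentity.
Variables (L : closedFieldType) (N d s : nat) (X : 'I_d -> 'M[L]_N) (y : 'I_s -> 'M[L]_N).

Definition bracket (A B : 'M[L]_N) := A *m B - B *m A.

(** The correction term of [cay_conj] up to a scalar, with adjugates in place of inverses so that it
    is polynomial in the scaling of [Y]. *)
Definition adgen (Y : 'M[L]_N) (A : 'M_N) := \adj (1%:M + Y) *m A *m \adj (1%:M - Y).

Definition infmx (e : L^o) (k : 'I_d + 'I_s * 'I_d) : 'M_N :=
  match k with
  | inl i => X i
  | inr q => adgen (e *: y q.1) (bracket (X q.2) (y q.1))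
  end.

Hypothesis two : 2%:R != 0 :> L.
Hypothesis indep0 : forall (c0 : 'I_d -> L) (c : 'I_s -> 'I_d -> L),
  \sum_i c0 i *: X i + \sum_j \sum_i c j i *: bracket (X i) (y j) = 0 ->
  (forall i, c0 i = 0) /\ forall j i, c j i = 0.

(** Conjugation by [cay (e y)] changes [X] by a scalar multiple, nonzero for [e != 0], of [adgen (e
    y) [X, y]], and at [e = 0] the latter is the bracket. Independence there is an open condition,
    hence persists at some [e != 0]. *)
Lemma near_identity_cayley : exists2 e : L,
  forall j, (1%:M + e *: y j \in unitmx) && (1%:M - e *: y j \in unitmx) &
  forall (c0 : 'I_d -> L) (c : 'I_s -> 'I_d -> L),
  \sum_i c0 i *: X i +
    \sum_j \sum_i c j i *: (cay (e *: y j) *m X i *m invmx (cay (e *: y j))) = 0 ->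
  (forall i, c0 i = 0) /\ forall j i, c j i = 0.
Proof.
have l1 (b : bool) j k l : linepoly 1 (fun e : L^o => (1%:M + (-1) ^+ b *: (e *: y j)) k l).
  have h : linepoly 1 (fun e : L^o => (e : L)) by apply: linepoly_lin.
  apply: linepoly_ext (linepolyD (linepoly_cst _ ((1%:M : 'M_N) k l))
    (linepolyZ ((-1) ^+ b * y j k l) h)) => e.
  by rewrite !mxE; ring.
have lp j k l : linepoly 1 (fun e : L^o => (1%:M + e *: y j) k l).
  by apply: linepoly_ext (l1 false j k l) => e; rewrite expr0 scale1r.
have lm j k l : linepoly 1 (fun e : L^o => (1%:M - e *: y j) k l).
  by apply: linepoly_ext (l1 true j k l) => e; rewrite expr1 scaleN1r.
have hG (k : 'I_d + 'I_s * 'I_d) a b : linepoly (N + N) (fun e : L^o => infmx e k a b).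
  case: k => [i|[j i]]; first exact: linepoly_cst.
  rewrite /infmx /adgen /=; apply: linepoly_mulmx => {}a {}b; last first.
    by have := linepoly_adj (lm j) a b; rewrite muln1.
  rewrite -[X in linepoly X]addn0; apply: linepoly_mulmx => {}a {}b; last exact: linepoly_cst.
  by have := linepoly_adj (lp j) a b; rewrite muln1.
have sumE (e : L^o) (c : 'I_d + 'I_s * 'I_d -> L) : \sum_k c k *: infmx e k =
    \sum_i c (inl i) *: X i +
    \sum_j \sum_i c (inr (j, i)) *: adgen (e *: y j) (bracket (X i) (y j)).
  rewrite big_sumType /=; congr (_ + _); rewrite [RHS]pair_big /=.
  by apply: eq_bigr => -[j i].
have [|p [lpp p0] hp] := free_mxs_open (u0 := 0 : L^o) hG.
  move=> c; rewrite sumE => hc [i|[j i]].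
    have [|h _] := @indep0 (fun i => c (inl i)) (fun j i => c (inr (j, i))); last exact: h.
    rewrite -[RHS]hc; congr (_ + _); apply: eq_bigr => k _; apply: eq_bigr => l _.
    by rewrite /adgen scale0r subr0 addr0 adj1 mulmx1 mul1mx.
  have [|_ h] := @indep0 (fun i => c (inl i)) (fun j i => c (inr (j, i))); last exact: h.
  rewrite -[RHS]hc; congr (_ + _); apply: eq_bigr => k _; apply: eq_bigr => l _.
  by rewrite /adgen scale0r subr0 addr0 adj1 mulmx1 mul1mx.
pose Fs (o : option (option ('I_s * bool))) (e : L^o) : L := match o with
  | None => e
  | Some None => p e
  | Some (Some k) => \det (1%:M + (-1) ^+ (k.2 : bool) *: (e *: y k.1)) end.
have [o _|o _|e he] := @linepoly_prod_neq0 L L^o _ (enum {: option (option ('I_s * bool))}) Fs.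
- case: o => [[k|]|] /=.
  + by exists (N * 1)%N; apply: linepoly_det => a b; apply: l1.
  + by exists (#|{: 'I_d + 'I_s * 'I_d}| * (N + N))%N.
  + by exists 1%N; apply: linepoly_lin => t u v.
- case: o => [[k|]|] /=.
  + by exists 0; rewrite scale0r scaler0 addr0 det1 oner_neq0.
  + by exists 0.
  + by exists 1; apply: oner_neq0.
have e0 : (e : L) != 0 by apply: (he None); rewrite mem_enum.
have pe : p e != 0 by apply: (he (Some None)); rewrite mem_enum.
have D1 j : \det (1%:M + e *: y j) != 0.
  by have := he (Some (Some (j, false))); rewrite mem_enum /= expr0 scale1r; apply.
have D2 j : \det (1%:M - e *: y j) != 0.
  by have := he (Some (Some (j, true))); rewrite mem_enum /= expr1 scaleN1r; apply.
have U1 j : 1%:M + e *: y j \in unitmx by rewrite unitmxE unitfE.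
have U2 j : 1%:M - e *: y j \in unitmx by rewrite unitmxE unitfE.
exists (e : L) => [j|c0 c]; first by rewrite U1 U2.
pose ka j := ((\det (1%:M + e *: y j))^-1 * (\det (1%:M - e *: y j))^-1 * (e : L)) *+ 2.
have ka0 j : ka j != 0 by rewrite /ka -mulr_natr !mulf_neq0 ?invr_neq0.
have E j i : cay (e *: y j) *m X i *m invmx (cay (e *: y j)) =
    X i + ka j *: adgen (e *: y j) (bracket (X i) (y j)).
  rewrite cay_conj // /invmx U1 U2 /adgen /bracket; congr (_ + _).
  rewrite -scalemxAr -!scalemxAl -scalemxAr -scalerBr -scalemxAr -scalemxAl !scalerA.
  by rewrite -scaler_nat scalerA /ka; congr (_ *: _); rewrite -mulr_natl; ring.
pose cc (k : 'I_d + 'I_s * 'I_d) := match k with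
  | inl i => c0 i + \sum_j c j i | inr q => c q.1 q.2 * ka q.1 end.
move=> hc; have := hp e pe cc; rewrite sumE.
have -> : \sum_i cc (inl i) *: X i + \sum_j \sum_i cc (inr (j, i)) *:
    adgen (e *: y j) (bracket (X i) (y j)) = 0.
  rewrite -[RHS]hc /cc; under eq_bigr => i _ do rewrite scalerDl scaler_suml.
  rewrite big_split /= exchange_big /= -addrA; congr (_ + _).
  rewrite -big_split; apply: eq_bigr => j _ /=; rewrite -big_split; apply: eq_bigr => i _ /=.
  by rewrite E scalerDr scalerA.
move=> /(_ erefl) hcc.
have hcj j i : c j i = 0.
  by have /eqP := hcc (inr (j, i)); rewrite mulf_eq0 (negPf (ka0 j)) orbF => /eqP.
split=> // i; have := hcc (inl i); rewrite /cc big1 ?addr0 // => j _.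
Qed.

End NearIdentity.

(** * Witt bases made of weight vectors *)

Section Witt.
Variables (L : closedFieldType) (X : zmodType) (eta : bool).
Hypothesis two : 2%:R != 0 :> L.
Hypothesis tfree : forall x : X, x + x = 0 -> x = 0.

(** A change of basis that mixes only vectors of equal weight, so that the torus stays diagonal. *)
Definition wbase N (w w' : 'I_N -> X) (C : 'M[L]_N) :=
  C \in unitmx /\ forall i j, C i j != 0 -> w i = w' j.

(** The Gram matrix of an invariant form in a weight basis, symmetric for [eta = false] and skew for
    [eta = true]; invariance means that only opposite weights are paired. *)
Definition wform N (w : 'I_N -> X) (g : 'M[L]_N) :=
  [/\ g \in unitmx, g^T = (-1) ^+ eta *: g & forall i j, g i j != 0 -> w i + w j = 0].

Definition dualn (i : nat) : nat := if odd i then i.-1 else i.+1.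

(* Consecutive indices form hyperbolic pairs; if the size is odd the last index stands alone. *)
Definition hypmx N : 'M[L]_N := \matrix_(i, j)
  if j == dualn i :> nat then (if odd i then (-1) ^+ eta else 1)
  else ((i == j) && odd N && (i.+1 == N :> nat))%:R.

Lemma mulmx_neq0 a b c (A : 'M[L]_(a, b)) (B : 'M_(b, c)) i j :
  (A *m B) i j != 0 -> exists2 k, A i k != 0 & B k j != 0.
Proof.
rewrite mxE => h; apply: NNPP => h2; move/eqP: h; apply; apply: big1 => k _.
have [->|A0] := eqVneq (A i k) 0; first by rewrite mul0r.
have [->|B0] := eqVneq (B k j) 0; first by rewrite mulr0.
by case: h2; exists k.
Qed.

Lemma wbase_mul N (w w1 w2 : 'I_N -> X) C1 C2 :
  wbase w w1 C1 -> wbase w1 w2 C2 -> wbase w w2 (C1 *m C2).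
Proof.
move=> [u1 h1] [u2 h2]; split=> [|i j /mulmx_neq0[k /h1-> /h2->]] //.
by rewrite unitmx_mul u1.
Qed.

Lemma wform_base N (w w' : 'I_N -> X) g C :
  wform w g -> wbase w w' C -> wform w' (C^T *m g *m C).
Proof.
move=> [ug tg hg] [uC hC]; split.
- by rewrite !unitmx_mul unitmx_tr uC ug.
- by rewrite !trmx_mul trmxK tg -scalemxAl -scalemxAr mulmxA.
- move=> i j /mulmx_neq0[k /mulmx_neq0[l]]; rewrite mxE => /hC <- /hg h /hC <-.
  exact: h.
Qed.

Definition has_hyp N (w : 'I_N -> X) g :=
  exists C w', wbase w w' C /\ C^T *m g *m C = hypmx N.

Lemma has_hyp_base N (w w1 : 'I_N -> X) g C : wbase w w1 C ->
  has_hyp w1 (C^T *m g *m C) -> has_hyp w g.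
Proof.
move=> hC [C' [w' [h' e]]]; exists (C *m C'), w'; split; first exact: wbase_mul h'.
by rewrite trmx_mul -e !mulmxA.
Qed.

Lemma hypmx_rec n : hypmx (2 + n) = block_mx (hypmx 2) 0 0 (hypmx n).
Proof.
apply/matrixP => i j; rewrite -[i]splitK -[j]splitK.
case: (split i) => {}i; case: (split j) => {}j /=.
- rewrite block_mxEul !mxE; case: i => -[|[|//]] hi; case: j => -[|[|//]] hj //=; by case: (n) => [|k]; rewrite ?add2n ?add0n ?eqSS ?andbF.
- rewrite block_mxEur !mxE; case: i => -[|[|//]] hi //=.
- rewrite block_mxEdl !mxE; case: j => -[|[|//]] hj; rewrite /= /dualn /= ?negbK ?addSn ?add0n /=.
  + by case: (odd i).
  + by case oi: (odd i) => //=; case: (nat_of_ord i) oi.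
- rewrite block_mxEdr !mxE /= /dualn !negbK -!val_eqE /= ?addSn ?add0n !eqSS /= ?negbK.
  case oi: (odd i); last by rewrite !eqSS.
  by case: (nat_of_ord i) oi => [//|k] _; rewrite !eqSS.
Qed.

Lemma wform_small N (w : 'I_N -> X) g : (N <= 1)%N -> wform w g -> has_hyp w g.
Proof.
case: N w g => [|[|//]] w g _ [ug tg hg].
  exists 1%:M, w; split; last by apply/matrixP => -[].
  by split; [apply: unitmx1 | case].
have g0 : g 0 0 != 0 by move: ug; rewrite unitmxE det_mx11 unitfE.
have [c c2] : exists c : L, c ^+ 2 = (g 0 0)^-1.
  have [x hx] := @solve_monicpoly L 2 (nth 0 [:: (g 0 0)^-1]) isT.
  by exists x; rewrite hx !big_ord_recl big_ord0 /= !addr0 expr0 mulr1 mul0r addr0.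
have c0 : c != 0.
  have h : c ^+ 2 != 0 by rewrite c2 invr_eq0.
  by apply: contraNneq h => ->; rewrite expr0n.
exists c%:M, w; split.
  split=> [|i j _]; first by rewrite unitmxE det_scalar1 unitfE.
  by rewrite !ord1.
rewrite tr_scalar_mx mul_scalar_mx mul_mx_scalar; apply/matrixP => i j.
rewrite !ord1 !mxE /= mulrA -expr2 c2 mulVf //.
Qed.

(** If no basis vector is isotropic, every weight is its own opposite and hence zero; then all
    changes of basis are admissible and a quadratic equation gives an isotropic vector. *)
Lemma isotropic_diag n (w : 'I_(2 + n) -> X) g : wform w g ->
  (forall (w1 : 'I_(2 + n) -> X) g1 a, wform w1 g1 -> g1 a a = 0 -> has_hyp w1 g1) -> has_hyp w g.
Proof.
move=> hw ih; have [[a ga]|nz] := classic (exists a, g a a = 0); first exact: ih ga.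
have [ug tg hg] := hw.
have nz2 a : g a a != 0 by apply/eqP => ga; apply: nz; exists a.
have w0 a : w a = 0 by apply: tfree; apply: hg; apply: nz2.
pose i0 : 'I_(2 + n) := Ordinal (isT : 0 < 2 + n)%N.
pose i1 : 'I_(2 + n) := Ordinal (isT : 1 < 2 + n)%N.
have [c hc] : exists c, g i0 i0 + c * (g i0 i1 + g i1 i0) + c ^+ 2 * g i1 i1 = 0.
  have [x hx] := @solve_monicpoly L 2
    (nth 0 [:: - g i0 i0 / g i1 i1; - (g i0 i1 + g i1 i0) / g i1 i1]) isT.
  exists x; rewrite hx !big_ord_recl big_ord0 /= expr0 expr1.
  by field; apply: nz2.
pose C := 1%:M + c *: delta_mx i1 i0 : 'M[L]_(2 + n).
have i10 : i1 != i0 by [].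
have uC : C \in unitmx.
  have E : C *m (1%:M - c *: delta_mx i1 i0) = 1%:M.
    rewrite mulmxBr mulmx1 /C mulmxDl mul1mx -scalemxAl -scalemxAr.
    by rewrite mul_delta_mx_0 // !scaler0 addr0 addrK.
  by have [] := mulmx1_unit E.
have hC : wbase w w C by split=> // i j _; rewrite !w0.
apply: (has_hyp_base hC); apply: (ih _ _ i0); first exact: wform_base hC.
have colC : col i0 C = delta_mx i0 0 + c *: delta_mx i1 0.
  by apply/colP => k; rewrite !mxE !eqxx !andbT.
have -> : (C^T *m g *m C) i0 i0 = ((col i0 C)^T *m g *m col i0 C) 0 0.
  by rewrite -[RHS]/(_ 0 0) !mxE; apply: eq_bigr => k _; rewrite !mxE; congr (_ * _);
     apply: eq_bigr => l _; rewrite !mxE.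
have -> : (col i0 C)^T = delta_mx 0 i0 + c *: delta_mx 0 i1.
  by rewrite colC; apply/rowP => k; rewrite !mxE !eqxx !andbT.
rewrite colC mulmxDl -scalemxAl -!rowE mulmxDr -scalemxAr -!colE.
by rewrite !mxE -[RHS]hc; ring.
Qed.

Lemma wform_block n (w : 'I_(2 + n) -> X) g : wform w g ->
  [/\ (ulsubmx g)^T = (-1) ^+ eta *: ulsubmx g,
      dlsubmx g = (-1) ^+ eta *: (ursubmx g)^T &
      (drsubmx g)^T = (-1) ^+ eta *: drsubmx g].
Proof.
move=> [_ tg _]; have e i j : g j i = (-1) ^+ eta * g i j.
  by move/matrixP/(_ i j): tg; rewrite !mxE.
by split; apply/matrixP => i j; rewrite !mxE; apply: e.
Qed.

(** The last clause guards the weights: the two vectors are mixed only if [G 1 1 != 0], and then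
    both have weight zero. *)
Lemma corner_normal (G : 'M[L]_2) : G^T = (-1) ^+ eta *: G -> G 0 0 = 0 -> G 0 1 != 0 ->
  exists T : 'M[L]_2, [/\ T \in unitmx, T^T *m G *m T = hypmx 2, T 1 0 = 0 &
    T 0 1 != 0 -> G 1 1 != 0].
Proof.
move=> tG G00 G01.
have G10 : G 1 0 = (-1) ^+ eta * G 0 1.
  by move/matrixP/(_ 0 1): tG; rewrite !mxE.
have G11 : (-1) ^+ eta * G 1 1 = G 1 1.
  by move/matrixP/(_ 1 1): tG; rewrite !mxE.
set c := G 0 1 in G01 G10 *; pose b := G 1 1 / (2%:R * c ^+ 2).
pose T : 'M[L]_2 := \matrix_(i, j) if j == 0 then (i == 0)%:R else if i == 0 then - b else c^-1.
pose T' : 'M[L]_2 := \matrix_(i, j) if j == 0 then (i == 0)%:R else if i == 0 then b * c else c.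
exists T; split.
- suff E : T *m T' = 1%:M by have [] := mulmx1_unit E.
  apply/matrixP => -[[|[|//]] hi] [[|[|//]] hj];
    rewrite !mxE !big_ord_recl big_ord0 !mxE /=; first by ring.
  + by ring.
  + by ring.
  + by rewrite mul0r add0r addr0 mulVf.
- have e0 : forall h : (0 < 2)%N, Ordinal h = 0 by move=> h; apply: val_inj.
  have e1 : forall h : (1 < 2)%N, Ordinal h = 1 by move=> h; apply: val_inj.
  have e2 : lift ord0 ord0 = 1 :> 'I_2 by apply: val_inj.
  apply/matrixP => -[[|[|//]] hi] [[|[|//]] hj];
    rewrite ?e0 ?e1 !mxE !big_ord_recl big_ord0 !mxE !big_ord_recl !big_ord0 !mxE /= ?e2 ?G00.
  + by rewrite G10; ring.
  + by rewrite -/c G10 /dualn /=; field.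
  + by rewrite -/c G10 /dualn /=; field.
  + rewrite -/c G10 /dualn /= /b -G11; case: (eta) G11 => /= G11; rewrite ?expr0 ?expr1.
      have -> : G 1 1 = 0 by apply: (mulfI two); rewrite mulr0 mulr_natl mulr2n -{1}G11; ring.
      by ring.
    by field; rewrite ?G01 ?two.
- by rewrite mxE.
- by rewrite mxE /= oppr_eq0 /b mulf_eq0 negb_or => /andP[].
Qed.

Lemma hyperbolic_corner n (w : 'I_(2 + n) -> X) g a : wform w g -> g a a = 0 ->
  (forall (w1 : 'I_(2 + n) -> X) g1, wform w1 g1 -> ulsubmx g1 = hypmx 2 -> has_hyp w1 g1) -> has_hyp w g.
Proof.
move=> hw ga ih; have [ug tg hg] := hw.
have [b gab] : exists b, g a b != 0.
  apply: NNPP => h; have := mulmxV ug; move/matrixP/(_ a a); rewrite !mxE eqxx.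
  rewrite big1 => [/esym/eqP|k _]; first by rewrite oner_eq0.
  have [->|g0] := eqVneq (g a k) 0; first by rewrite mul0r.
  by case: h; exists k.
pose i0 : 'I_(2 + n) := lshift n 0; pose i1 : 'I_(2 + n) := lshift n 1.
have i10 : i1 != i0 by [].
have ba : b != a by apply: contraNneq gab => ->; rewrite ga.
(* The place to which [b] is moved when [a] is brought to the front; the second transposition then
   does not disturb [a]. *)
pose b1 := tperm i0 a b.
have b10 : b1 != i0.
  by rewrite -(inj_eq (@perm_inj _ (tperm i0 a))) /b1 tpermK tpermL.
pose s := (tperm i1 b1 * tperm i0 a)%g.
have s0 : s i0 = a by rewrite permM (tpermD i10 b10) tpermL.
have s1 : s i1 = b by rewrite permM tpermL /b1 tpermK.
have h1 : wbase w (w \o s) (perm_mx s^-1%g).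
  split=> [|i j]; first exact: unitmx_perm.
  rewrite !mxE; have [e _|] := eqVneq ((s^-1)%g i) j; last by rewrite eqxx.
  by rewrite /= -e permKV.
apply: (has_hyp_base h1); have hw1 := wform_base hw h1; move: hw1.
rewrite tr_perm_mx invgK -row_permE -col_permE.
set g1 := col_perm s _; move: (w \o s) => w2 hw1.
have g1a : g1 i0 i0 = 0 by rewrite !mxE s0.
have g1b : g1 i0 i1 != 0 by rewrite !mxE s0 s1.
move: g1 hw1 g1a g1b => g1 hw1 g1a g1b.
have [t1 t2 t3] := wform_block hw1.
have [||T [uT hT T10 T01]] := corner_normal t1; [by rewrite !mxE | by rewrite !mxE |].
have [_ _ hg1] := hw1.
have h2 : wbase w2 w2 (block_mx T 0 0 1%:M).
  split=> [|i j].
    by rewrite unitmxE det_ublock det1 mulr1 -unitmxE.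
  rewrite -[i]splitK -[j]splitK; case: (split i) => {}i; case: (split j) => {}j /=.
  - rewrite block_mxEul; have [->//|ij] := eqVneq i j.
    have wT : T 0 1 != 0 -> w2 i0 = w2 i1.
      move=> /T01; rewrite !mxE => /hg1/tfree w1; have := hg1 _ _ g1b.
      by rewrite -/i1 /i0 w1 addr0 => ->.
    case: i ij => -[|[|//]] hi; case: j => -[|[|//]] hj // _.
      have -> : Ordinal hi = 0 by apply: val_inj.
      by have -> : Ordinal hj = 1 by apply: val_inj.
    have -> : Ordinal hi = 1 by apply: val_inj.
    have -> : Ordinal hj = 0 by apply: val_inj.
    by rewrite T10 eqxx.
  - by rewrite block_mxEur mxE eqxx.
  - by rewrite block_mxEdl mxE eqxx.
  - by rewrite block_mxEdr mxE; have [->//|] := eqVneq i j; rewrite eqxx.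
apply: (has_hyp_base h2); apply: ih; first exact: wform_base h2.
rewrite -[g1]submxK tr_block_mx !mulmx_block block_mxKul !trmx0 !mul0mx !mulmx0 !addr0.
by [].
Qed.

(** The other vectors are made orthogonal to the hyperbolic pair. A vector is corrected only by the
    partner of a member it pairs with; both then have the weight opposite to that member, so weights
    are respected. *)
Lemma hyperbolic_split n (w : 'I_(2 + n) -> X) g : wform w g -> ulsubmx g = hypmx 2 ->
  (forall (w1 : 'I_n -> X) g1, wform w1 g1 -> has_hyp w1 g1) -> has_hyp w g.
Proof.
move=> hw ug ih; have [t1 t2 t3] := wform_block hw; have [_ _ hg] := hw.
set H := hypmx 2 in ug *; set B := ursubmx g in t2 *.
have e0 : forall h : (0 < 2)%N, Ordinal h = 0 by move=> h; apply: val_inj.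
have e1 : forall h : (1 < 2)%N, Ordinal h = 1 by move=> h; apply: val_inj.
have e2 : lift ord0 ord0 = 1 :> 'I_2 by apply: val_inj.
have tH : H^T = (-1) ^+ eta *: H by rewrite -ug.
have HH : H *m H^T = 1%:M.
  apply/matrixP => -[[|[|//]] hi] [[|[|//]] hj]; rewrite ?e0 ?e1 !mxE !big_ord_recl big_ord0 !mxE /=;
    rewrite /dualn /= ?mulr0 ?mul0r ?mulr1 ?addr0 ?add0r //.
  by rewrite -expr2 sqrr_sign.
pose M := - (H^T *m B).
have H01 : g (lshift n 0) (lshift n 1) != 0.
  by move/matrixP/(_ 0 1): ug; rewrite !mxE /= => ->; rewrite oner_neq0.
have w01 := hg _ _ H01.
have hC : wbase w w (block_mx 1%:M M 0 1%:M).
  split=> [|i j]; first by rewrite unitmxE det_ublock !det1 mulr1 unitr1.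
  rewrite -[i]splitK -[j]splitK; case: (split i) => {}i; case: (split j) => {}j /=.
  - by rewrite block_mxEul mxE; have [->//|] := eqVneq i j; rewrite eqxx.
  - rewrite block_mxEur mxE oppr_eq0 => /mulmx_neq0[k]; rewrite mxE => hki; rewrite !mxE => /hg wk.
    apply: (addrI (w (lshift n k))); rewrite wk.
    move: hki wk; case: i => -[|[|//]] hi; case: k => -[|[|//]] hk; rewrite ?e0 ?e1 !mxE /= ?eqxx //.
      by move=> _ _; rewrite addrC w01.
  - by rewrite block_mxEdl mxE eqxx.
  - by rewrite block_mxEdr mxE; have [->//|] := eqVneq i j; rewrite eqxx.
pose D1 := M^T *m B + drsubmx g.
have gE : (block_mx 1%:M M 0 1%:M)^T *m g *m block_mx 1%:M M 0 1%:M = block_mx H 0 0 D1.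
  rewrite -[g]submxK ug -/B t2 tr_block_mx !mulmx_block !trmx0 !trmx1 !mul1mx !mul0mx !mulmx1 !mulmx0 !addr0.
  have E1 : H *m M + B = 0 by rewrite /M mulmxN mulmxA HH mul1mx addNr.
  have E2 : M^T *m H + (-1) ^+ eta *: B^T = 0.
    rewrite /M linearN /= trmx_mul trmxK mulNmx -mulmxA.
    have -> : H *m H = (-1) ^+ eta *: 1%:M.
      by rewrite -HH tH -scalemxAr scalerA -expr2 sqrr_sign scale1r.
    by rewrite -scalemxAr mulmx1 addNr.
  by rewrite E1 E2 mul0mx add0r.
apply: (has_hyp_base hC); have hw1 := wform_base hw hC; move: hw1; rewrite gE => hw1.
have [u1 tg1 hg1] := hw1; have [s1 s2 s3] := wform_block hw1.
have [|C' [w' [[uC' hC'] eC']]] := ih (fun i => w (rshift 2 i)) D1.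
  split.
  - by move: u1; rewrite !unitmxE det_ublock unitrM => /andP[].
  - by move: s3; rewrite block_mxKdr.
  - move=> i j; rewrite -(block_mxEdr H 0 0 D1) => /hg1; apply.
exists (block_mx 1%:M 0 0 C'), (fun k => match split k with inl i => w (lshift n i) | inr j => w' j end).
split.
  split=> [|i j]; first by rewrite unitmxE det_ublock det1 mul1r -unitmxE.
  rewrite -[i]splitK -[j]splitK; case: (split i) => {}i; case: (split j) => {}j /=.
  - by rewrite block_mxEul mxE (unsplitK (inl j)); have [->//|] := eqVneq i j; rewrite eqxx.
  - by rewrite block_mxEur mxE eqxx.
  - by rewrite block_mxEdl mxE eqxx.
  - by rewrite block_mxEdr (unsplitK (inr j)) => /hC'.
rewrite hypmx_rec tr_block_mx !mulmx_block !trmx0 trmx1 !mul1mx !mul0mx !mulmx1 !mulmx0 !addr0 !add0r.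
by rewrite mul0mx eC'.
Qed.

Lemma witt_basis N (w : 'I_N -> X) g : wform w g -> has_hyp w g.
Proof.
elim/ltn_ind: N w g => N ih w g; have [N1|] := leqP N 1; first exact: wform_small.
case: N ih w g => [//|[//|n]] ih w g _ hw.
apply: (isotropic_diag hw) => w1 g1 a h1 ga.
apply: (hyperbolic_corner h1 ga) => w2 g2 h2 u2.
by apply: (hyperbolic_split h2 u2) => w3 g3; apply: ih; lia.
Qed.
End Witt.

(** * Weights on the Lie algebra and colourings of roots for [SL_n] *)

Section Weights.
Variables (L : closedFieldType) (N d : nat) (A : 'M[int]_(N, d)) (U : 'M[int]_(d, N)).
Hypothesis UA : U *m A = 1%:M.

(** The differential of the [i]-th character at the identity, an eigenvalue of [Xt A P v]. *)
Definition wt (v : 'rV[L]_d) i : L := \sum_j (A i j)%:~R * v 0 j.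

Lemma wt_lin (I : finType) (c : I -> L) (v : I -> 'rV_d) i :
  wt (\sum_k c k *: v k) i = \sum_k c k * wt (v k) i.
Proof.
rewrite /wt; under eq_bigr => j _ do rewrite summxE mulr_sumr.
rewrite exchange_big /=; apply: eq_bigr => k _; rewrite mulr_sumr.
by apply: eq_bigr => j _; rewrite mxE; ring.
Qed.

Lemma wt_inj v : (forall i, wt v i = 0) -> v = 0.
Proof.
move=> h; have e : map_mx intr A *m v^T = 0 :> 'cV[L]_N.
  by apply/colP => i; rewrite !mxE -[RHS](h i); apply: eq_bigr => j _; rewrite !mxE.
apply: trmx_inj; rewrite trmx0 -[LHS]mul1mx -(map_mx1 intr) -UA map_mxM /=.
by rewrite -mulmxA e mulmx0.
Qed.

(* Over the field the columns of [A] span the Lie algebra of the torus; the entries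
   with one colour are roots with no common zero on it. *)
Definition colouring s (y : 'I_s -> 'M[L]_N) :=
  [/\ forall c i, y c i i = 0,
      forall c c' i l, y c i l != 0 -> y c' i l != 0 -> c = c' &
      forall c v, (forall i l, y c i l != 0 -> wt v i = wt v l) -> v = 0].

(** In the weight basis the bracket with [y j] has the entries [(wt v i - wt v l) * y j i l].
    Colours occupy disjoint positions off the diagonal, so each summand can be read off
    separately. *)
Lemma colouring_independent s (y : 'I_s -> 'M[L]_N) P : P \in unitmx -> colouring y ->
  forall (c0 : 'I_d -> L) (c : 'I_s -> 'I_d -> L),
  \sum_i c0 i *: Xt A P (delta_mx 0 i) +
    \sum_j \sum_i c j i *: bracket (Xt A P (delta_mx 0 i)) (P *m y j *m invmx P) = 0 ->
  (forall i, c0 i = 0) /\ forall j i, c j i = 0.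
Proof.
move=> uP [y0 yd ys] c0 c h.
pose Dg (v : 'rV[L]_d) : 'M[L]_N := diag_mx (\row_i wt v i).
have XtE v : Xt A P v = P *m Dg v *m invmx P by [].
have sumD (I : finType) (b : I -> L) (v : I -> 'rV[L]_d) :
    \sum_k b k *: Dg (v k) = Dg (\sum_k b k *: v k).
  apply/matrixP => i l; rewrite summxE !mxE wt_lin -sumrMnl; apply: eq_bigr => k _.
  by rewrite !mxE mulrnAr.
have rowE (b : 'I_d -> L) : \sum_k b k *: delta_mx 0 k = \row_k b k.
  by rewrite [RHS]row_sum_delta; apply: eq_bigr => k _; rewrite mxE.
pose v0 := \row_k c0 k; pose vj j := \row_k c j k.
have E : Dg v0 + \sum_j bracket (Dg (vj j)) (y j) = 0.
  have conjK Z : invmx P *m (P *m Z *m invmx P) *m P = Z.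
    by rewrite -!mulmxA mulVmx // mulmx1 !mulmxA mulVmx // mul1mx.
  suff E' : P *m (Dg v0 + \sum_j bracket (Dg (vj j)) (y j)) *m invmx P = 0.
    by rewrite -[LHS]conjK E' mulmx0 mul0mx.
  rewrite -[RHS]h mulmxDr mulmxDl; congr (_ + _).
    by rewrite /v0 -rowE -sumD mulmx_sumr mulmx_suml; apply: eq_bigr => i _;
      rewrite XtE -scalemxAr -scalemxAl.
  rewrite mulmx_sumr mulmx_suml; apply: eq_bigr => j _.
  rewrite /vj -rowE -sumD /bracket mulmx_suml mulmx_sumr -sumrB mulmx_sumr mulmx_suml.
  apply: eq_bigr => i _; rewrite XtE -!scalemxAl -scalemxAr -scalerBr -scalemxAr -scalemxAl.
  congr (_ *: _); rewrite mulmxBr mulmxBl !mulmxA.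
  by rewrite (mulmxKV uP) (mulmxKV uP).
have ent i l : (i == l)%:R * wt v0 i + \sum_j (wt (vj j) i - wt (vj j) l) * y j i l = 0.
  move/matrixP/(_ i l): E; rewrite !mxE summxE => E0; rewrite -[RHS]E0; congr (_ + _).
    by rewrite mulr_natl.
  apply: eq_bigr => j _; rewrite /bracket /Dg mul_diag_mx mul_mx_diag !mxE; ring.
have V0 : v0 = 0.
  apply: wt_inj => i; have := ent i i; rewrite eqxx mul1r big1 ?addr0 // => j _.
  by rewrite y0 mulr0.
have Vj j : vj j = 0.
  apply: (ys j) => i l yil; have il : i != l by apply: contraNneq yil => ->; rewrite y0.
  have := ent i l; rewrite (negPf il) mul0r add0r (bigD1 j) //= big1 => [|j' j'j].
    by rewrite addr0 => /eqP; rewrite mulf_eq0 (negPf yil) orbF subr_eq0 => /eqP.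
  have [->|yil'] := eqVneq (y j' i l) 0; first by rewrite mulr0.
  by rewrite (yd _ _ _ _ yil yil') eqxx in j'j.
by split=> [i|j i]; [move/rowP/(_ i): V0 | move/rowP/(_ i): (Vj j)]; rewrite !mxE.
Qed.

Hypothesis Asum : forall j, \sum_i A i j = 0.

Lemma wt_sum0 v : \sum_i wt v i = 0.
Proof.
rewrite /wt exchange_big big1 //= => j _; rewrite -mulr_suml.
by rewrite -rmorph_sum Asum rmorph0 mul0r.
Qed.

Definition good_index a := forall v, (forall i l, i != a -> l != a -> wt v i = wt v l) -> v = 0.

(** A bad [a] yields a nonzero [v] whose weights equal some [kap] except at [a], where the zero sum
    forces [(1 - N) kap]. If all [a != b] were bad, these [N - 1] vectors would be independent,
    since [N] is invertible, in dimension [d < N - 1]. *)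
Lemma good_index_avoiding b : (d < N.-1)%N -> N%:R != 0 :> L -> exists2 a, a != b & good_index a.
Proof.
move=> dN N0; apply: NNPP => nex.
have h (k : 'I_N.-1) : exists v : 'rV[L]_d, v != 0 /\
    forall i l, i != lift b k -> l != lift b k -> wt v i = wt v l.
  apply: NNPP => hk; apply: nex; exists (lift b k); first by rewrite eq_sym neq_lift.
  by move=> v hv; apply/eqP; apply: contraT => v0; case: hk; exists v.
have [v hv] := fin_all_exists h.
have cN : (d < #|'I_N.-1|)%N by rewrite card_ord.
have [c [[k ck] hc]] := @nontrivial_relation L 'I_N.-1 d (fun k j => v k 0 j) cN.
pose kap k := wt (v k) b.
have wE k' i : i != lift b k' -> wt (v k') i = kap k'.
  by move=> ik; have [_ e] := hv k'; rewrite (e i b) // neq_lift.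
have wE2 k' : wt (v k') (lift b k') = kap k' - N%:R * kap k'.
  have := wt_sum0 (v k'); rewrite (bigD1 (lift b k')) //= (eq_bigr (fun=> kap k')); last first.
    by move=> i ik; apply: wE.
  move=> /eqP; rewrite addr_eq0 => /eqP->.
  rewrite sumr_const cardC1 card_ord -mulr_natl.
  have -> : N%:R = N.-1%:R + 1 :> L by rewrite natr1 prednK //; lia.
  by ring.
have rel i : \sum_k c k * wt (v k) i = 0.
  rewrite -wt_lin; suff -> : \sum_k c k *: v k = 0.
    by rewrite /wt big1 // => j _; rewrite mxE mulr0.
  apply/rowP => j; rewrite summxE mxE -[RHS](hc j); apply: eq_bigr => k' _.
  by rewrite mxE.
have kap0 k' : kap k' != 0.
  have [v0 _] := hv k'; apply: contraNneq v0 => k0; apply/eqP; apply: wt_inj => i.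
  have [->|/wE->//] := eqVneq i (lift b k').
  by rewrite wE2 k0 mulr0 subr0.
have := rel (lift b k); rewrite (eq_bigr (fun k' => c k' * kap k' - (k' == k)%:R * (c k' * (N%:R * kap k')))).
  rewrite sumrB (_ : \sum_i c i * kap i = 0); last exact: rel b.
  rewrite (bigD1 k) //= big1 => [|k' /negPf->]; last by rewrite mul0r.
  rewrite eqxx mul1r addr0 sub0r => /eqP; rewrite oppr_eq0 !mulf_eq0.
  by rewrite (negPf ck) (negPf N0) (negPf (kap0 k)).
move=> k' _; have [->|kk] := eqVneq k' k; first by rewrite wE2 -[true%:R]/(1 : L); ring.
rewrite -[false%:R]/(0 : L) mul0r subr0 wE //; apply: contraNneq kk => /lift_inj e; by rewrite e.
Qed.

(** Stars of roots: row [c] without column [i1] for [c != i1], row [i1] without column [i2], and as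
    last colour column [i1] without row [i2]. Each star ties together all indices but one, [i1] or
    [i2], both taken to be good; lying in one row or column off the diagonal, it is nilpotent of
    rank at most one. *)
Definition sl_colour (i1 i2 : 'I_N) (c : 'I_N.+1) (i l : 'I_N) : bool :=
  if c == N :> nat then [&& l == i1, i != i1 & i != i2]
  else if c == i1 :> nat then [&& i == i1, l != i1 & l != i2]
  else [&& i == c :> nat, l != i & l != i1].

Lemma sl_colouring : (d < N.-1)%N -> N%:R != 0 :> L -> exists y : 'I_N.+1 -> 'M[L]_N,
  colouring y /\ forall c, exists (u : 'cV[L]_N) (w : 'rV_N), w *m u = 0 /\ y c = u *m w.
Proof.
move=> dN N0; have N1 : (0 < N)%N by lia.
have [i1 _ g1] := good_index_avoiding (Ordinal N1) dN N0.
have [i2 i21 g2] := good_index_avoiding i1 dN N0.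
exists (fun c => \matrix_(i, l) (sl_colour i1 i2 c i l)%:R); split.
  have nzE c i l : (\matrix_(i, l) (sl_colour i1 i2 c i l)%:R : 'M[L]_N) i l != 0 ->
      sl_colour i1 i2 c i l by rewrite mxE; case: sl_colour; rewrite ?eqxx.
  have nzE2 c i l : sl_colour i1 i2 c i l ->
      (\matrix_(i, l) (sl_colour i1 i2 c i l)%:R : 'M[L]_N) i l != 0.
    by rewrite mxE => ->; apply: oner_neq0.
  split.
  - move=> c i; rewrite mxE /sl_colour; case: ifP => _; last case: ifP => _.
    + by case: eqVneq.
    + by case: eqVneq.
    + by rewrite eqxx andbF.
  - move=> c c' i l /nzE h /nzE h'; apply: val_inj; move: h h' => /=.
    rewrite /sl_colour -!val_eqE /=; do 4?[case: ifP => ?]; lia.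
  - move=> c v hv; have {}hv i l : sl_colour i1 i2 c i l -> wt v i = wt v l.
      by move=> h; apply: hv; apply: nzE2.
    have [cN|cN] := eqVneq (c : nat) N.
      have H i : i != i2 -> wt v i = wt v i1.
        move=> ii2; have [->//|ii1] := eqVneq i i1.
        by apply: hv; rewrite /sl_colour cN !eqxx ii1 ii2.
      by apply: g2 => i l /H-> /H->.
    have [ci|ci] := eqVneq (c : nat) i1.
      have H i : i != i2 -> wt v i1 = wt v i.
        move=> ii2; have [->//|ii1] := eqVneq i i1.
        by apply: hv; rewrite /sl_colour (negPf cN) ci !eqxx ii1 ii2.
      by apply: g2 => i l /H<- /H<-.
    have cN2 : (c < N)%N by rewrite ltn_neqAle cN -ltnS ltn_ord.
    have H i : i != i1 -> wt v (Ordinal cN2) = wt v i.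
      move=> ii1; have [->//|ic] := eqVneq i (Ordinal cN2).
      by apply: hv; rewrite /sl_colour (negPf cN) (negPf ci) eqxx ic ii1.
    by apply: g1 => i l /H<- /H<-.
move=> c; have [cN|cN] := eqVneq (c : nat) N.
  exists (\col_i ((i != i1) && (i != i2))%:R), (\row_l (l == i1)%:R); split.
    apply/matrixP => a b; rewrite !mxE big1 // => k _; rewrite !mxE.
    by have [->|] := eqVneq k i1; rewrite /= ?mulr0 ?mul0r.
  apply/matrixP => i l; rewrite !mxE big_ord1 !mxE /sl_colour cN eqxx.
  by case: (l == i1); rewrite ?mulr1 ?mulr0.
have [ci|ci] := eqVneq (c : nat) i1.
  exists (\col_i (i == i1)%:R), (\row_l ((l != i1) && (l != i2))%:R); split.
    apply/matrixP => a b; rewrite !mxE big1 // => k _; rewrite !mxE.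
    by have [->|] := eqVneq k i1; rewrite /= ?mulr0 ?mul0r.
  apply/matrixP => i l; rewrite !mxE big_ord1 !mxE /sl_colour (negPf cN) ci eqxx.
  by case: (i == i1); rewrite ?mul1r ?mul0r.
exists (\col_i (i == c :> nat)%:R), (\row_l ((l != c :> nat) && (l != i1))%:R); split.
  apply/matrixP => a b; rewrite !mxE big1 // => k _; rewrite !mxE.
  by have [_|_] := eqVneq (k : nat) c; rewrite /= ?mulr0 ?mul0r.
apply/matrixP => i l; rewrite !mxE big_ord1 !mxE /sl_colour (negPf cN) (negPf ci).
have [ic|] := eqVneq (i : nat) c; rewrite ?mul1r ?mul0r //=.
by rewrite -val_eqE /= ic.
Qed.

End Weights.

(** * Colourings of roots for orthogonal and symplectic groups *)

Section DualIndex.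
Variables (L : closedFieldType) (eta : bool) (N : nat).

Definition dualo (i : 'I_N) : 'I_N := insubd i (dualn i).

Lemma val_dualo (i : 'I_N) : dualo i = (if dualn i < N then dualn i else i)%N :> nat.
Proof. by rewrite /dualo val_insubd. Qed.

Lemma dualnE (i : nat) : dualn i = (i + (~~ odd i) - odd i)%N.
Proof. by rewrite /dualn; case: (odd i); lia. Qed.

Lemma dualoK : involutive dualo.
Proof.
move=> i; apply: val_inj; rewrite /= 2!val_dualo; case: (ltnP (dualn i) N) => h.
  have e : dualn (dualn i) = i by rewrite !dualnE; lia.
  by rewrite e ltn_ord.
by rewrite ltnNge h.
Qed.

Definition hyps (i : 'I_N) : L := if odd i then (-1) ^+ eta else 1.

Lemma hyps2 i : hyps i * hyps i = 1.
Proof. by rewrite /hyps; case: odd; rewrite ?mulr1 // -expr2 sqrr_sign. Qed.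

Lemma hyps_neq0 i : hyps i != 0.
Proof. by rewrite /hyps; case: odd; rewrite ?oner_neq0 // signr_eq0. Qed.

Lemma hypmxE i j : hypmx L eta N i j = (j == dualo i)%:R * hyps i.
Proof.
rewrite mxE /hyps -!val_eqE /= val_dualo; case: (ltnP (dualn i) N) => h.
  case: eqP => [_|ne]; first by rewrite mul1r.
  rewrite mul0r; case: eqP => //= e; case oN: (odd N) => //=.
  case: eqP => // e2; move: h; rewrite dualnE; have := ltn_ord i; lia.
have -> : (j == dualn i :> nat) = false by apply/eqP; have := ltn_ord j; lia.
have o : odd i = false /\ odd N && (i.+1 == N).
  by move: h; rewrite dualnE; have := ltn_ord i; lia.
by case: o => -> o; rewrite -andbA o andbT mulr1 eq_sym.
Qed.

Lemma hypmx_neq0 i : hypmx L eta N i (dualo i) != 0.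
Proof. by rewrite hypmxE eqxx mul1r hyps_neq0. Qed.

Lemma hypmx_orth : (hypmx L eta N)^T *m hypmx L eta N = 1%:M.
Proof.
apply/matrixP => i j; rewrite !mxE (bigD1 (dualo i)) //= big1 => [|k ki]; last first.
  rewrite [_^T i k]mxE hypmxE; have [e|] := eqVneq i (dualo k); last by rewrite !mul0r.
  by move: ki; rewrite e dualoK eqxx.
rewrite [_^T _ _]mxE !hypmxE dualoK eqxx mul1r addr0 eq_sym.
by have [->|] := eqVneq i j; rewrite ?mul1r ?hyps2 // mul0r mulr0.
Qed.

End DualIndex.

Section PairColours.
Variables (N : nat) (eta : bool) (sig : nat -> bool).

Definition typeD := ~~ odd N && ~~ eta.
(** Signs are relative to the vector [sig]: index [p] carries the signed coordinate of its pair,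
    negated when [psg p] holds. *)
Definition psg p := odd p (+) sig p./2.
Definition lastp p := odd N && (p.+1 == N).
(** A cyclic shift of [0, ..., N./2 - 2]. In type D, which has no roots [e_a] or [2 e_a], it gives
    each upper colour one extra root [- e_b - e_(n-1)], [n = N./2], with [b] different from the
    centre of that colour. *)
Definition rotp b := if b.+1 == N./2.-1 then 0%N else b.+1.

(* The colour of the root [x_p + x_q]; the colours below [N./2] hold the roots [e_a - e_b],
   those of the form [N./2 + v] a choice of one of [e_v + e_b], [- e_v - e_b] for each [b],
   and the last one, missing in type D, the roots [e_a] or [2 e_a]. *)
Definition pcol p q : nat :=
  if lastp p then (if psg q then N./2 + q./2 else (N./2).*2)
  else if lastp q then (if psg p then N./2 + p./2 else (N./2).*2)
  else if psg p (+) psg q then (if psg p then q./2 else p./2)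
  else if p == q then (if psg p then N./2 + p./2 else (N./2).*2)
  else if psg p then
    (if typeD && (maxn p./2 q./2 == N./2.-1) then N./2 + rotp (minn p./2 q./2)
     else N./2 + maxn p./2 q./2)
  else (N./2 + minn p./2 q./2)%N.

(** This is [dim(G) / r]: [2 n - 1] for [SO_(2n)], and [2 n + 1] for [SO_(2n+1)] and [Sp_(2n)]. *)
Definition ncol := (if typeD then N.-1 else (N./2).*2.+1)%N.

Definition pidx a (s : bool) : nat := ((s (+) sig a) + a.*2)%N.

Lemma pidx_half a s : (pidx a s)./2 = a.
Proof. by rewrite /pidx half_bit_double. Qed.

Lemma pidx_odd a s : odd (pidx a s) = s (+) sig a.
Proof. by rewrite /pidx oddD odd_double addbF oddb. Qed.

Lemma pidx_sg a s : psg (pidx a s) = s.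
Proof. by rewrite /psg pidx_half pidx_odd -addbA addbb addbF. Qed.

Lemma pidx_lt a s : (a < N./2)%N -> (pidx a s < N)%N.
Proof. by rewrite /pidx; case: (s (+) sig a); lia. Qed.

Lemma pidx_last a s : (a < N./2)%N -> lastp (pidx a s) = false.
Proof.
by move=> aN; rewrite /lastp /pidx; apply/negbTE; case: (s (+) sig a); lia.
Qed.

Lemma pidx_dual a s : dualn (pidx a s) = pidx a (~~ s).
Proof.
by rewrite /dualn pidx_odd /pidx addNb; case: (s (+) sig a).
Qed.

Lemma pidx_eq a b s t : (pidx a s == pidx b t) = (a == b) && (s == t).
Proof.
apply/eqP/andP => [e|[/eqP-> /eqP->]//].
by rewrite -(pidx_half a s) -(pidx_half b t) e eqxx -(pidx_sg a s) -(pidx_sg b t) e eqxx.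
Qed.

(** The positions that carry a root: dual pairs have weight zero, and in the orthogonal case the
    diagonal is absent. *)
Definition pallowed p q := (q != if (dualn p < N)%N then dualn p else p) && (eta || (p != q)).

Lemma pidx_allowed a b s t : (a < N./2)%N -> a != b -> pallowed (pidx a s) (pidx b t).
Proof.
move=> aN ab; rewrite /pallowed pidx_dual pidx_lt // !pidx_eq [b == a]eq_sym (negPf ab) /=.
by rewrite orbT.
Qed.

Lemma pidx_allowed2 a s : eta -> (a < N./2)%N -> pallowed (pidx a s) (pidx a s).
Proof.
move=> et aN; rewrite /pallowed pidx_dual pidx_lt // !pidx_eq et eqxx /=.
by case: s.
Qed.

Lemma pidx_allowed_last a s : odd N -> (a < N./2)%N -> pallowed (pidx a s) N.-1.
Proof.
move=> oN aN; have h t : (N.-1 == pidx a t) = false.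
  by apply/negbTE; rewrite /pidx; case: (t (+) sig a); lia.
by rewrite /pallowed pidx_dual pidx_lt // h eq_sym h orbT.
Qed.

Lemma pidx_col a b s t : (a < N./2)%N -> (b < N./2)%N -> a != b ->
  pcol (pidx a s) (pidx b t) = (if s (+) t then (if s then b else a)
    else if s then (if typeD && (maxn a b == N./2.-1) then N./2 + rotp (minn a b)
     else N./2 + maxn a b) else N./2 + minn a b)%N.
Proof.
by move=> aN bN ab; rewrite /pcol !pidx_last // !pidx_sg !pidx_half pidx_eq (negPf ab).
Qed.

Lemma pidx_col2 a s : (a < N./2)%N ->
  pcol (pidx a s) (pidx a s) = (if s then N./2 + a else (N./2).*2)%N.
Proof. by move=> aN; rewrite /pcol !pidx_last // pidx_sg pidx_half addbb eqxx. Qed.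

Lemma pidx_col_last a s : odd N -> (a < N./2)%N ->
  pcol (pidx a s) N.-1 = (if s then N./2 + a else (N./2).*2)%N.
Proof.
move=> oN aN; rewrite /pcol pidx_last // pidx_sg pidx_half.
by rewrite {1}/lastp oN prednK ?eqxx //; lia.
Qed.

Lemma pallowedC p q : (p < N)%N -> (q < N)%N -> pallowed p q = pallowed q p.
Proof.
move=> pN qN; rewrite /pallowed [p == q]eq_sym; congr (_ && _); congr (~~ _).
have dE := dualnE; have dd : dualn (dualn p) = p by rewrite !dE; lia.
have dd2 : dualn (dualn q) = q by rewrite !dE; lia.
case: ltnP => hp; case: ltnP => hq.
- by apply/eqP/eqP => e; rewrite e ?dd ?dd2.
- by apply/eqP/eqP => e; [move: hq; rewrite e dd | move: hp hq; rewrite e]; lia.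
- by apply/eqP/eqP => e; [move: hp hq; rewrite e | move: hp; rewrite e dd2]; lia.
- by rewrite eq_sym.
Qed.

Lemma pcolC p q : pcol p q = pcol q p.
Proof.
rewrite /pcol [q == p]eq_sym maxnC minnC.
have [lp|_] := boolP (lastp p); have [lq|_] := boolP (lastp q) => //.
- by move: lp lq; rewrite /lastp => /andP[_ /eqP <-] /andP[_]; rewrite eqSS => /eqP->.
- by rewrite [psg q (+) _]addbC; case: (psg p); case: (psg q) => //=; case: eqP => // ->.
Qed.

(** Let [n = N./2]. A colour below [n] makes all signed coordinates [Y] equal to one of them; every
    other colour makes them zero. For [n + v] the pair roots give [Y b = - Y v] for [b != v], and
    one extra root, [- e_v], [- 2 e_v] or in type D [- e_b - e_(n-1)], forces [Y v = 0]. *)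
Lemma pcol_separates (L : fieldType) (x : nat -> L) c : 2%:R != 0 :> L ->
  (typeD -> 3 < N./2)%N -> (eta -> ~~ odd N) -> (c < ncol)%N ->
  (forall p q, (p < N)%N -> (q < N)%N -> pallowed p q -> pcol p q = c -> x p + x q = 0) ->
  (forall a, x a.*2.+1 = - x a.*2) -> (odd N -> x N.-1 = 0) ->
  forall a b, (a < N./2)%N -> (b < N./2)%N ->
    (-1) ^+ sig a * x a.*2 = (-1) ^+ sig b * x b.*2.
Proof.
move=> two hD hC cN hx x2 xl; pose Y a := (-1) ^+ sig a * x a.*2.
have xE a s : x (pidx a s) = (-1) ^+ (s : bool) * Y a.
  rewrite /pidx /Y; case: s; case: (sig a) => /=; rewrite ?add1n ?add0n ?x2 ?expr1 ?expr0; ring.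
have R a b s t : (a < N./2)%N -> (b < N./2)%N -> a != b ->
    pcol (pidx a s) (pidx b t) = c -> (-1) ^+ (s : bool) * Y a + (-1) ^+ (t : bool) * Y b = 0.
  by move=> aN bN ab pc; rewrite -!xE; apply: hx => //; rewrite ?pidx_lt // pidx_allowed.
suff : (exists2 v, (v < N./2)%N & forall b, (b < N./2)%N -> b != v -> Y b = Y v) \/
    (forall a, (a < N./2)%N -> Y a = 0).
  case=> [[v vN h] a b aN bN|h a b aN bN]; rewrite -/(Y a) -/(Y b); last by rewrite !h.
  have H e : (e < N./2)%N -> Y e = Y v by have [->//|ev eN] := eqVneq e v; apply: h.
  by rewrite !H.
have Y0 a : Y a *+ 2 = 0 -> Y a = 0.
  by move/eqP; rewrite -mulr_natl mulf_eq0 (negPf two) => /eqP.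
have [cn|cn] := ltnP c N./2.
  left; exists c => // b bN bc.
  have := R c b false true cn bN; rewrite eq_sym bc pidx_col ?(eq_sym c) //= => /(_ isT erefl).
  by rewrite expr0 expr1 mul1r mulN1r => /eqP; rewrite subr_eq0 => /eqP.
right; have [cl|cl] := eqVneq c (N./2).*2.
  have nD : typeD = false.
    by apply/negbTE/negP => tD; move: cN; rewrite /ncol tD cl; move: tD; rewrite /typeD; lia.
  move=> a aN; move: nD; rewrite /typeD; have [oN _|oN] := boolP (odd N).
    have := hx (pidx a false) N.-1; rewrite xE expr0 mul1r xl // addr0; apply.
    - exact: pidx_lt.
    - lia.
    - exact: pidx_allowed_last.
    - by rewrite pidx_col_last.
  move=> /negbFE et; apply: Y0; have := hx (pidx a false) (pidx a false).
  rewrite xE expr0 mul1r -mulr2n; apply; rewrite ?pidx_lt //; first exact: pidx_allowed2.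
  by rewrite pidx_col2.
pose v := (c - N./2)%N; have cE : c = (N./2 + v)%N by rewrite /v; lia.
have vN : (v < N./2)%N.
  by move: cN cl; rewrite /ncol /v; case: ifP => [/andP[/negbTE oN _]|_]; lia.
have vD : typeD -> (v < N./2.-1)%N.
  by move=> tD; move: cN; rewrite /ncol tD /v; move: tD; rewrite /typeD; lia.
have Yb b : (b < N./2)%N -> b != v -> Y b = - Y v.
  move=> bN bv; apply/eqP; rewrite -addr_eq0; apply/eqP.
  have [vb|vb] := ltnP v b.
    have := R b v false false bN vN bv; rewrite pidx_col //= expr0 !mul1r; apply.
    by rewrite (minn_idPr (ltnW vb)).
  have lt : (b < v)%N by rewrite ltn_neqAle bv.
  have := R b v true true bN vN bv; rewrite pidx_col //= expr1 !mulN1r -opprD => h.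
  apply/eqP; rewrite -oppr_eq0; apply/eqP; apply: h; rewrite (maxn_idPr vb).
  by case: ifP => // /andP[tD]; have := vD tD; lia.
suff Yv : Y v = 0.
  by move=> a aN; have [->//|av] := eqVneq a v; rewrite Yb // Yv oppr0.
have [tD|nD] := boolP typeD; last first.
  move: nD; rewrite negb_and !negbK; have [oN _|oN /= et] := boolP (odd N).
    have := hx (pidx v true) N.-1; rewrite xE expr1 mulN1r xl // addr0 => h.
    apply/eqP; rewrite -oppr_eq0; apply/eqP; apply: h.
    - exact: pidx_lt.
    - lia.
    - exact: pidx_allowed_last.
    - by rewrite pidx_col_last.
  apply: Y0; have := hx (pidx v true) (pidx v true).
  rewrite xE expr1 mulN1r -mulr2n mulNrn => h; apply/eqP; rewrite -oppr_eq0; apply/eqP.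
  apply: h; rewrite ?pidx_lt //; first exact: pidx_allowed2.
  by rewrite pidx_col2.
have n3 := hD tD; have vn := vD tD.
pose b := (if v == 0 then N./2.-2 else v.-1)%N.
have bE : rotp b = v by rewrite /rotp /b; case: (eqVneq v 0%N) => [->|v0]; case: eqP; lia.
have bn : (b < N./2.-1)%N by rewrite /b; case: eqP; lia.
have bv : b != v by rewrite /b; case: (eqVneq v 0%N); lia.
have ln : (N./2.-1 < N./2)%N by lia.
have bl : b != N./2.-1 by rewrite neq_ltn bn.
have lv : N./2.-1 != v by rewrite eq_sym neq_ltn vn.
have bN : (b < N./2)%N by lia.
have := R b N./2.-1 true true bN ln bl; rewrite pidx_col //= expr1 !mulN1r (Yb b bN bv) (Yb _ ln lv) !opprK => h.
by apply: Y0; rewrite mulr2n; apply: h; rewrite (maxn_idPr (ltnW bn)) (minn_idPl (ltnW bn)) eqxx tD bE cE.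
Qed.

End PairColours.

Section FormColouring.
Variables (L : closedFieldType) (eta : bool) (N d : nat).
Variables (A : 'M[int]_(N, d)) (U : 'M[int]_(d, N)).
Hypothesis UA : U *m A = 1%:M.
Hypothesis two : 2%:R != 0 :> L.
Hypothesis anti : forall i j, hypmx L eta N i j != 0 -> forall k, A i k + A j k = 0.

Definition wtn (v : 'rV[L]_d) (p : nat) : L := oapp (wt A v) 0 (insub p : option 'I_N).

Lemma wtnE v (i : 'I_N) : wtn v i = wt A v i.
Proof. by rewrite /wtn valK. Qed.

Lemma wt_dual (v : 'rV[L]_d) i : wt A v (dualo i) = - wt A v i.
Proof.
apply/eqP; rewrite -addr_eq0; apply/eqP; rewrite /wt -big_split big1 //= => j _.
by rewrite -mulrDl -rmorphD addrC anti ?hypmx_neq0 // rmorph0 mul0r.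
Qed.

Lemma wtn_dual v a : wtn v a.*2.+1 = - wtn v a.*2.
Proof.
rewrite /wtn; case: insubP => [i _ ie|]; case: insubP => [j _ je|] /=.
- rewrite -wt_dual; congr wt; apply: val_inj; rewrite /= ie val_dualo je /dualn odd_double.
  by rewrite -ie ltn_ord.
- by move=> h; exfalso; have := ltn_ord i; move: h; rewrite ie; lia.
- move=> h; have ja : j = dualo j.
    have {}je : j = a.*2 :> nat by [].
    by apply: val_inj; rewrite /= val_dualo /dualn je odd_double (negPf h).
  have := wt_dual v j; rewrite -ja => /eqP; rewrite -addr_eq0 -mulr2n -mulr_natl mulf_eq0.
  by rewrite (negPf two) => /eqP->; rewrite oppr0.
- by move=> _ _; rewrite oppr0.
Qed.

Lemma wtn_last v : odd N -> wtn v N.-1 = 0.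
Proof.
move=> oN; have NN : (N.-1 < N)%N by lia.
have ja : Ordinal NN = dualo (Ordinal NN).
  have e : odd N.-1 = false by lia.
  by apply: val_inj; rewrite /= val_dualo /= /dualn e prednK ?ltnn //; lia.
have := wt_dual v (Ordinal NN); rewrite -ja => /eqP; rewrite -addr_eq0 -mulr2n -mulr_natl mulf_eq0.
by rewrite (negPf two) -wtnE /= => /eqP.
Qed.

Lemma wtn_inj v : (forall a, (a < N./2)%N -> wtn v a.*2 = 0) -> v = 0.
Proof.
move=> h; apply: (wt_inj UA) => i; rewrite -wtnE.
have [iN|iN] := ltnP i./2 N./2.
  rewrite -[X in wtn v X]odd_double_half; case: odd; last by rewrite add0n h.
  by rewrite add1n wtn_dual h // oppr0.
have oN : odd N by have := ltn_ord i; lia.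
have -> : i = N.-1 :> nat by have := ltn_ord i; lia.
exact: wtn_last.
Qed.

Lemma wtn_lin (I : finType) (c : I -> L) (v : I -> 'rV_d) p :
  wtn (\sum_k c k *: v k) p = \sum_k c k * wtn (v k) p.
Proof.
rewrite /wtn; case: insubP => [i _ _|_] /=; first exact: wt_lin.
by rewrite big1 // => k _; rewrite mulr0.
Qed.

(** The vector without minus signs and those with a single one at a place [b != 0] are [N./2]
    independent vectors; they cannot all come from a Lie algebra of dimension [d < N./2]. *)
Lemma sign_vector : (d < N./2)%N -> exists sig : nat -> bool, forall v : 'rV[L]_d,
  (forall a b, (a < N./2)%N -> (b < N./2)%N ->
     (-1) ^+ sig a * wtn v a.*2 = (-1) ^+ sig b * wtn v b.*2) -> v = 0.
Proof.
move=> dN; apply: NNPP => nex; pose sg (b : 'I_(N./2)) (a : nat) := (a == b) && (b != 0%N :> nat).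
have n0 : (0 < N./2)%N by lia.
pose z : 'I_(N./2) := Ordinal n0.
have h (b : 'I_(N./2)) : exists v : 'rV[L]_d, v != 0 /\ forall a, (a < N./2)%N ->
    wtn v a.*2 = (-1) ^+ sg b a * wtn v 0.
  apply: NNPP => hk; apply: nex; exists (sg b) => v hv.
  apply/eqP; apply: contraT => v0; case: hk; exists v; split=> // a aN.
  have := hv a 0%N aN n0; rewrite double0 {2}/sg.
  have -> : (0%N == b) && (b != 0%N :> nat) = false by case: (nat_of_ord b).
  by rewrite expr0 mul1r => <-; rewrite mulrA -expr2 sqrr_sign mul1r.
have [v hv] := fin_all_exists h.
have cN : (d < #|'I_(N./2)|)%N by rewrite card_ord.
have [c [[k ck] hc]] := @nontrivial_relation L 'I_(N./2) d (fun k j => v k 0 j) cN.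
have rel p : \sum_k c k * wtn (v k) p = 0.
  rewrite -wtn_lin; suff -> : \sum_k c k *: v k = 0.
    rewrite /wtn; case: insub => //= i; rewrite /wt big1 // => j _; rewrite mxE mulr0 //.
  apply/rowP => j; rewrite summxE mxE -[RHS](hc j); apply: eq_bigr => k' _.
  by rewrite mxE.
have kap0 b : wtn (v b) 0 != 0.
  have [v0 e] := hv b; apply: contraNneq v0 => k0; apply/eqP; apply: wtn_inj => a aN.
  by rewrite e // k0 mulr0.
have r0 : \sum_k c k * wtn (v k) 0 = 0 by rewrite -[0%N]double0.
have cz b : b != z -> c b = 0.
  move=> bz; have := rel b.*2; have b0 : (b != 0%N :> nat) by move: bz; rewrite -val_eqE.
  rewrite (eq_bigr (fun k => c k * wtn (v k) 0 - (k == b)%:R * (2%:R * (c k * wtn (v k) 0)))).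
    rewrite sumrB r0 sub0r (bigD1 b) //= big1 => [|k' /negPf->]; last by rewrite mul0r.
    rewrite eqxx mul1r addr0 => /eqP; rewrite oppr_eq0 !mulf_eq0 (negPf two) (negPf (kap0 b)).
    by rewrite orbF => /eqP.
  move=> k' _; have [_ ->] := hv k'; last exact: ltn_ord.
  have [->|kb] := eqVneq k' b.
    by rewrite /sg eqxx b0 expr1 -[true%:R]/(1 : L); ring.
  rewrite /sg val_eqE eq_sym (negPf kb) expr0 -[false%:R]/(0 : L); ring.
have kz : k = z by apply/eqP; apply: contraNT ck => /cz->.
move: r0; rewrite (bigD1 z) //= big1 => [|b bz]; last by rewrite cz // mul0r.
by rewrite addr0 -kz => /eqP; rewrite mulf_eq0 (negPf ck) (negPf (kap0 k)).
Qed.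

(** As [H^T] inverts [H], Lie algebra elements are [H^T S] with [S] of the symmetry opposite to [H].
    Colours are invariant under exchanging [p] and [q], so each supports such an [S]; the signs [s0]
    make it skew in the orthogonal case. *)
Lemma form_colouring : (d < N./2)%N -> (typeD N eta -> 3 < N./2)%N -> (eta -> ~~ odd N) ->
  exists y : 'I_(ncol N eta) -> 'M[L]_N,
  colouring A y /\ forall c, lieform (hypmx L eta N) (y c).
Proof.
move=> dN hD hC; have [sig hsig] := sign_vector dN.
pose s0 (p q : 'I_N) : L := if eta then 1 else if (p < q)%N then 1 else -1.
pose cc (p q : 'I_N) c := pallowed N eta p q && (pcol N eta sig p q == c).
pose S (c : 'I_(ncol N eta)) : 'M[L]_N := \matrix_(p, q) if cc p q c then s0 p q else 0.
pose H := hypmx L eta N.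
have s00 p q : s0 p q != 0.
  by rewrite /s0; case: ifP => _; [|case: ifP => _]; rewrite ?oppr_eq0 oner_neq0.
have tS c : (S c)^T = - ((-1) ^+ eta *: S c).
  apply/matrixP => p q; rewrite !mxE /cc pallowedC // pcolC; case: ifP => [|_]; last by rewrite mulr0 oppr0.
  move=> /andP[/andP[_ pq] _]; rewrite /s0; case: (eta) pq => /= pq; first by rewrite expr1 mulr1 opprK.
  by rewrite expr0 mul1r; case: ltngtP pq => //; rewrite opprK.
have tH : H^T = (-1) ^+ eta *: H.
  apply/matrixP => i j; rewrite [LHS]mxE [RHS]mxE !hypmxE.
  have [e|ij] := eqVneq i (dualo j); last first.
    rewrite mul0r; have [e|] := eqVneq j (dualo i); last by rewrite mul0r mulr0.
    by move: ij; rewrite e dualoK eqxx.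
  rewrite e dualoK eqxx !mul1r /hyps val_dualo; case: ltnP => jN.
    have -> : odd (dualn j) = ~~ odd j by rewrite dualnE; lia.
    by case: (odd j); rewrite /= ?mulr1 // -expr2 sqrr_sign.
  have oN : odd N by move: jN; rewrite dualnE; have := ltn_ord j; lia.
  have -> : eta = false by apply: contraTF oN.
  by rewrite expr0 mul1r.
have HH : H^T *m H = 1%:M := hypmx_orth L eta N.
pose y c := H^T *m S c.
have yE c i l : y c i l = hyps L eta (dualo i) * S c (dualo i) l.
  rewrite mxE (bigD1 (dualo i)) //= big1 => [|k ki]; last first.
    rewrite [_^T i k]mxE hypmxE; have [e|] := eqVneq i (dualo k); last by rewrite !mul0r.
    by move: ki; rewrite e dualoK eqxx.
  by rewrite [_^T _ _]mxE hypmxE dualoK eqxx mul1r addr0.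
have ynz c i l : y c i l != 0 -> cc (dualo i) l c.
  by rewrite yE mulf_eq0 negb_or [S c _ _]mxE => /andP[_]; case: ifP => //; rewrite eqxx.
exists y; split; last first.
  move=> c; rewrite /lieform /y trmx_mul trmxK tS.
  have -> : H *m (H^T *m S c) = S c by rewrite mulmxA (mulmx1C HH) mul1mx.
  rewrite !mulNmx -!scalemxAl -mulmxA.
  have -> : H *m H = (-1) ^+ eta *: 1%:M.
    by rewrite -HH tH -scalemxAl scalerA -expr2 sqrr_sign scale1r.
  by rewrite -scalemxAr mulmx1 scalerA -expr2 sqrr_sign scale1r addNr.
split.
- move=> c i; apply/eqP; apply: contraT => /ynz/andP[/andP[h _] _]; move: h.
  by rewrite -val_dualo dualoK eqxx.
- move=> c c' i l /ynz/andP[_ /eqP e] /ynz/andP[_ /eqP e']; apply: val_inj.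
  by rewrite /= -e -e'.
- move=> c v hv; apply: hsig => a b; apply: (pcol_separates two hD hC (ltn_ord c)).
  + move=> p q pN qN pa pc; rewrite -[p]/(val (Ordinal pN)) -[q]/(val (Ordinal qN)) !wtnE.
    have := hv (dualo (Ordinal pN)) (Ordinal qN); rewrite yE dualoK wt_dual mxE /cc /= pa pc eqxx /=.
    rewrite mulf_neq0 ?hyps_neq0 // => /(_ isT) <-; exact: addrN.
  + exact: wtn_dual.
  + exact: wtn_last.
Qed.

End FormColouring.

(** * A Bezout bound for transversal equations *)

Section Growth.

Lemma exp_beats_poly a n : exists j, ((1 + j * a) ^ n < 2 ^ j)%N.
Proof.
have quad s : (7 <= s)%N -> (2 * s * s < 2 ^ s)%N.
  elim: s => // s ih; rewrite leq_eqVlt => /orP[/eqP<-//|s7].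
  by have := ih s7; rewrite expnS; nia.
pose s := (7 + a + n)%N; exists (2 ^ s)%N.
apply: (@leq_ltn_trans ((2 ^ (s + a)) ^ n)).
  apply: leq_expl; rewrite expnD; have := ltn_expl a (ltnSn 1); have := expn_gt0 2 s; nia.
rewrite -expnM ltn_exp2l //; apply: leq_ltn_trans (quad s _); rewrite /s; nia.
Qed.

(** If [D > 2 C], then [P] at least doubles every [D] steps, which no polynomial bound allows. This
    is the origin of the factor 2 in the degree bounds below. *)
Lemma growth_factor (P : nat -> nat) n D C : (forall M, P M <= M ^ n)%N -> (0 < P 1)%N ->
  (forall M, D * P M <= C * P (M + D))%N -> (0 < C)%N -> (D <= 2 * C)%N.
Proof.
move=> hP P1 h C0; rewrite leqNgt; apply/negP => hD.
have H j : (2 ^ j <= P (1 + j * D))%N.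
  elim: j => [|j ih]; first by rewrite mul0n addn0.
  have := h (1 + j * D)%N; rewrite mulSn expnS [(D + _)%N]addnC addnA; nia.
have [j hj] := exp_beats_poly D n.
by have := leq_trans (H j) (hP _); rewrite leqNgt hj.
Qed.

End Growth.

Section Degree.
Variables (L : closedFieldType) (N : nat).
Implicit Types (F G : 'M[L]_N -> L).

(** Genuine multivariate polynomials are used here, because monomials of bounded degree have to be
    counted without the redundancy of words. *)
Definition degf D F := exists2 p : {mpoly L[N * N]}, (msize p <= D.+1)%N &
  forall x, F x = p.@[mxvec x 0].

Lemma degf_ext D F G : F =1 G -> degf D F -> degf D G.
Proof. by move=> e [p sp h]; exists p => // x; rewrite -e. Qed.

Lemma degf_le D E F : (D <= E)%N -> degf D F -> degf E F.
Proof. by move=> DE [p sp h]; exists p => //; apply: leq_trans sp _. Qed.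

Lemma degf_cst D c : degf D (fun=> c).
Proof.
exists c%:MP => [|x]; last by rewrite mevalC.
by rewrite msizeC; case: (_ != _).
Qed.

Lemma degfD D F G : degf D F -> degf D G -> degf D (fun x => F x + G x).
Proof.
move=> [p sp hp] [q sq hq]; exists (p + q) => [|x]; last by rewrite hp hq mevalD.
by rewrite (leq_trans (msizeD_le _ _)) // geq_max sp.
Qed.

Lemma degfM D E F G : degf D F -> degf E G -> degf (D + E) (fun x => F x * G x).
Proof.
move=> [p sp hp] [q sq hq]; exists (p * q) => [|x]; last by rewrite hp hq mevalM.
have [->|p0] := eqVneq p 0; first by rewrite mul0r msize0.
have [->|q0] := eqVneq q 0; first by rewrite mulr0 msize0.
rewrite msizeM //; move: (msize p) (msize q) sp sq => a b; lia.
Qed.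

Lemma degfZ D c F : degf D F -> degf D (fun x => c * F x).
Proof. by move=> h; rewrite -[D]add0n; apply: degfM h; apply: degf_cst. Qed.

Lemma degf_sum (J : Type) (r : seq J) D (F : J -> 'M[L]_N -> L) :
  (forall j, degf D (F j)) -> degf D (fun x => \sum_(j <- r) F j x).
Proof.
move=> h; elim: r => [|j r ih].
  by apply: degf_ext (degf_cst D 0) => x; rewrite big_nil.
by apply: degf_ext (degfD (h j) ih) => x; rewrite big_cons.
Qed.

Lemma degf_prod (J : Type) (r : seq J) (D : J -> nat) (F : J -> 'M[L]_N -> L) :
  (forall j, degf (D j) (F j)) -> degf (\sum_(j <- r) D j) (fun x => \prod_(j <- r) F j x).
Proof.
move=> h; elim: r => [|j r ih].
  by rewrite big_nil; apply: degf_ext (degf_cst 0 1) => x; rewrite big_nil.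
by rewrite big_cons; apply: degf_ext (degfM (h j) ih) => x; rewrite big_cons.
Qed.

Lemma degfX D F n : degf D F -> degf (n * D) (fun x => F x ^+ n).
Proof.
move=> h; elim: n => [|n ih]; first by apply: degf_ext (degf_cst _ 1).
by rewrite mulSn; apply: degf_ext (degfM h ih) => x; rewrite exprS.
Qed.

Lemma degf_mxE i j : degf 1 (fun x => x i j).
Proof.
exists 'X_(mxvec_index i j) => [|x]; first by rewrite msizeX mdeg1.
by rewrite mevalXU mxvecE.
Qed.

Lemma degf_linear (w : 'cV[L]_(N * N)) : degf 1 (fun x => (mxvec x *m w) 0 0).
Proof.
apply: (@degf_ext _ (fun x => \sum_k mxvec x 0 k * w k 0)).
  by move=> x; rewrite mxE.
apply: degf_sum => k; case/mxvec_indexP: k => i j.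
apply: degf_ext (degfZ (w (mxvec_index i j) 0) (degf_mxE i j)) => x.
by rewrite mxvecE mulrC.
Qed.

Lemma degf_relation (J : finType) D (F : J -> 'M[L]_N -> L) : (forall j, degf D (F j)) ->
  (#|{: 'X_{1..(N * N) < D.+1}}| < #|J|)%N ->
  exists c : J -> L, (exists j, c j != 0) /\ forall x, \sum_j c j * F j x = 0.
Proof.
move=> hF hJ; have [p sp hp] := fin_all_exists2 hF.
have [c [cn hc]] := @nontrivial_relation L J _ (fun j i => (p j)@_(val (enum_val i))) hJ.
exists c; split=> // x.
transitivity ((\sum_j c j *: p j).@[mxvec x 0]).
  by rewrite raddf_sum /=; apply: eq_bigr => j _; rewrite mevalZ hp.
suff -> : \sum_j c j *: p j = 0 by rewrite meval0.
apply/mpolyP => m; rewrite mcoeff0 raddf_sum /=.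
have [mD|mD] := ltnP (mdeg m) D.+1; last first.
  rewrite big1 // => j _; rewrite mcoeffZ memN_msupp_eq0 ?mulr0 //.
  by apply: msize_mdeg_ge; apply: leq_trans mD.
rewrite -[RHS](hc (enum_rank (BMultinom mD))); apply: eq_bigr => j _.
by rewrite mcoeffZ enum_rankK.
Qed.

End Degree.

Lemma card_bmultinom_le n D : (#|{: 'X_{1..n < D}}| <= D ^ n)%N.
Proof.
pose f (m : 'X_{1..n < D}) : {ffun 'I_n -> 'I_D} :=
  [ffun i => insubd (Ordinal (leq_ltn_trans (leq0n _) (bmdeg m))) (m i)].
have fE m i : f m i = m i :> nat.
  rewrite ffunE val_insubd ifT //; apply: leq_ltn_trans (bmdeg m).
  by rewrite mdegE (bigD1 i) //= leq_addr.
have inj : injective f.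
  by move=> a b e; apply/val_inj/mnmP => i; rewrite -!fE e.
by have := leq_card f inj; rewrite card_ffun !card_ord.
Qed.

Section Bezout.
Variables (L : closedFieldType) (N d : nat).
Hypothesis NN : (N * N = (N * N - d) + d)%N.
Notation k := (N * N - d)%N.

Lemma sum_low_high (R : nmodType) (h : 'I_(N * N) -> R) :
  \sum_i h i = \sum_i h (lowi NN i) + \sum_i h (highi NN i).
Proof.
rewrite (reindex (cast_ord (esym NN))) /=; last first.
  by exists (cast_ord NN) => i _; rewrite ?cast_ordK ?cast_ordKV.
by rewrite big_split_ord /=; congr (_ + _); apply: eq_bigr => i _; congr h; apply: val_inj.
Qed.

Lemma prod_low_high (h : 'I_(N * N) -> L) :
  \prod_i h i = (\prod_i h (lowi NN i)) * (\prod_i h (highi NN i)).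
Proof.
rewrite (reindex (cast_ord (esym NN))) /=; last first.
  by exists (cast_ord NN) => i _; rewrite ?cast_ordK ?cast_ordKV.
by rewrite big_split_ord /=; congr (_ * _); apply: eq_bigr => i _; congr h; apply: val_inj.
Qed.

Lemma linepoly_degf (V : lmodType L) D (F : 'M[L]_N -> L) (phi : V -> 'M[L]_N) m :
  degf D F -> (forall i j, linepoly m (fun v => phi v i j)) ->
  exists m', linepoly m' (fun v => F (phi v)).
Proof.
move=> [p _ hp] h; have [|m' hm'] := @linepoly_meval L V _ p m (fun v => mxvec (phi v) 0).
  by case/mxvec_indexP => i j; apply: linepoly_ext (h i j) => v; rewrite mxvecE.
by exists m'; apply: linepoly_ext hm' => v.
Qed.

Lemma separating_form (s : seq 'M[L]_N) : exists w : 'cV[L]_(N * N),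
  {in s &, injective (fun x => (mxvec x *m w) 0 0)}.
Proof.
pose g (xy : 'M[L]_N * 'M[L]_N) (w : 'cV[L]_(N * N)) : L :=
  if xy.1 == xy.2 then 1 else ((mxvec xy.1 - mxvec xy.2) *m w) 0 0.
have [xy _|xy _|w hw] := @linepoly_prod_neq0 L _ _ [seq (x, y) | x <- s, y <- s] g.
- exists 1%N; rewrite /g; case: (xy.1 == xy.2); first exact: linepoly_cst.
  by apply: linepoly_lin => t u v; rewrite mulmxDr -scalemxAr; move: (_ *m u) (_ *m v) => a b; rewrite !mxE.
- rewrite /g; case: eqVneq => [_|ne]; first by exists 0; apply: oner_neq0.
  have /rV0Pn[i hi] : mxvec xy.1 - mxvec xy.2 != 0.
    by rewrite subr_eq0 (inj_eq (can_inj mxvecK)).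
  by exists (delta_mx i 0); rewrite -colE mxE.
exists w => x y xs ys e; apply/eqP; apply: contraT => ne.
have : g (x, y) w != 0 by apply: hw; apply/allpairsP; exists (x, y).
rewrite /g /= (negPf ne) mulmxBl; move: e.
move: (mxvec x *m w) (mxvec y *m w) => a b e.
by rewrite !mxE e subrr eqxx.
Qed.

Variables (e : nat) (f : 'I_k -> 'M[L]_N -> L) (V : 'M[L]_N -> Prop).
Hypothesis e0 : (0 < e)%N.
Hypothesis fe : forall i, degf e (f i).
(* The equations [f] are independent to first order along [V]. *)
Hypothesis transversal : forall x0, V x0 -> forall s : 'I_k -> L,
  exists (S : 'M[L]_N) (t : 'I_k -> L), forall (eps : L) i,
    f i (x0 *m (1%:M + eps *: S)) = eps * (s i + eps * t i).

Section Fixed.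
Variable M : nat.

(** The equation [f i] of degree [e] takes the place of the [i]-th low variable, so low exponents
    are divided by [e]; at most [e ^ k] monomials share a quotient. *)
Definition loquo (m : 'X_{1..(N * N)}) : 'X_{1..(N * N)} :=
  [multinom if (i < k)%N then (m i %/ e)%N else m i | i < (N * N)%N].

Lemma loquo_bound (m : 'X_{1..(N * N) < M}) : (mdeg (loquo m) < M)%N.
Proof.
apply: leq_ltn_trans (bmdeg m); rewrite !mdegE; apply: leq_sum => i _.
by rewrite mnmE; case: ifP => _ //; apply: leq_div.
Qed.

Definition bquo (m : 'X_{1..(N * N) < M}) := BMultinom (loquo_bound m).
Definition quos := [set bquo m | m in [set: 'X_{1..(N * N) < M}]].

Lemma low_lt (i : 'I_k) : (lowi NN i < k)%N. Proof. exact: (ltn_ord i). Qed.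
Lemma high_ge (i : 'I_d) : (highi NN i < k)%N = false.
Proof. by apply/negbTE; rewrite -leqNgt /= leq_addr. Qed.

Lemma quos_deg (m : 'X_{1..(N * N) < M}) : m \in quos ->
  (\sum_i m (lowi NN i) * e + \sum_i m (highi NN i) * 1 < M)%N.
Proof.
case/imsetP => m' _ ->; apply: leq_ltn_trans (bmdeg m').
rewrite mdegE (sum_low_high (fun i => m' i)); apply: leq_add; apply: leq_sum => i _.
  by rewrite mnmE low_lt leq_divM.
by rewrite mnmE high_ge muln1.
Qed.

Lemma card_quos : (#|{: 'X_{1..(N * N) < M}}| <= e ^ k * #|quos|)%N.
Proof.
have inq m : bquo m \in quos by apply/imsetP; exists m.
pose g (m : 'X_{1..(N * N) < M}) : {ffun 'I_k -> 'I_e} * {m | m \in quos} :=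
  ([ffun i => Ordinal (ltn_pmod (m (lowi NN i)) e0)], exist _ (bquo m) (inq m)).
have gI : injective g.
  move=> m m' eg; apply/val_inj/mnmP => i.
  have e1 : g m = g m' by []. 
  have /mnmP/(_ i) := congr1 (fun z => bmnm (sval z.2)) eg; rewrite /= !mnmE.
  case: (low_or_high NN i) => -[j ->]; last by rewrite high_ge.
  rewrite low_lt => eq; rewrite [LHS](divn_eq _ e) [RHS](divn_eq _ e) eq; congr (_ + _)%N.
  by have /ffunP/(_ j) := congr1 fst eg; rewrite !ffunE => /(congr1 val).
by have := leq_card g gI; rewrite card_prod card_ffun !card_ord card_sig.
Qed.

(** The products of powers of [f], powers of the high linear forms and powers below [D] of a form
    [w] separating the points of a section are independent of degree below [M + D]. In a relation,
    the part of least order along [V] would vanish in every normal direction, by transversality. *)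
Lemma bezout_count D : (1 < N)%N -> has_degree V d D -> (0 < D)%N ->
  (D * #|quos| <= #|{: 'X_{1..(N * N) < M + D}}|)%N.
Proof.
move=> N1 [p p0 hdeg] D0; rewrite leqNgt; apply/negP => hlt.
have [a0 [[mc1 lc1] [V1 hV1]]] := generic_section NN N1 p0.
have ldet := @linepoly_det_id L (N * N)%N.
have [|V0] := linepoly_mul_neq0 lc1 ldet hV1 (v := 1%:M); first by rewrite det1 oner_neq0.
rewrite mulf_eq0 negb_or => /andP[pa0 dV0]; set Ms := sec_span NN V0 in pa0.
pose T (a : 'rV[L]_(N * N)) := p.@[aff_coords a Ms] != 0.
have hfib (a : 'rV[L]_(N * N)) : exists s : seq 'M[L]_N, T a ->
    [/\ uniq s, size s = D, forall x, x \in s -> V x &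
      forall x i, x \in s -> (mxvec x *m V0) 0 (highi NN i) = (a *m V0) 0 (highi NN i)].
  have [Ta|nT] := boolP (p.@[aff_coords a Ms] != 0); last by exists [::]; rewrite /T (negPf nT).
  have [s [us ss hs]] := hdeg a Ms Ta; exists s => _; split=> //.
    by move=> x /hs[].
  move=> x i /hs[_]; rewrite /aff_sub (sec_spanP NN a (mxvec x) dV0).
  have secE y : (y *m sec_eqs NN V0) 0 i = (y *m V0) 0 (highi NN i).
    by rewrite mxE [RHS]mxE; apply: eq_bigr => l _; rewrite [sec_eqs _ _ _ _]mxE.
  by move/rowP/(_ i); rewrite !secE.
pose K := #|{: 'X_{1..(N * N) < M}}|.
pose FT (l : 'I_K) (a : 'rV[L]_(N * N)) :=
  \prod_i (a *m V0) 0 (highi NN i) ^+ (enum_val l : 'X_{1..(N * N) < M}) (highi NN i).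
(* Finitely many sections already determine the coefficients as functions of [a]; hence a single [w]
   can separate the points of all the sections involved. *)
have [np [pts [_ Tpts sep]]] := separating_points FT T.
have [fib hf] : exists fib : 'I_np -> seq 'M[L]_N, forall i,
    [/\ uniq (fib i), size (fib i) = D, forall x, x \in fib i -> V x &
      forall x j, x \in fib i -> (mxvec x *m V0) 0 (highi NN j) = (pts i *m V0) 0 (highi NN j)].
  have [fib hfib'] := fin_all_exists (fun i => hfib (pts i)).
  by exists fib => i; apply: hfib'; apply: Tpts.
have [w hw] := separating_form (flatten [seq fib i | i <- enum 'I_np]).
have wI i : {in fib i &, injective (fun x => (mxvec x *m w) 0 0)}.
  by move=> x y xi yi; apply: hw; apply/flattenP; exists (fib i) => //;
    apply: map_f; rewrite mem_enum.
pose J := ({m | m \in quos} * 'I_D)%type.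
pose mu (j : J) : 'X_{1..(N * N)} := bmnm (sval j.1).
pose La (j : J) x := (\prod_i (mxvec x *m col (highi NN i) V0) 0 0 ^+ mu j (highi NN i)) *
  (mxvec x *m w) 0 0 ^+ j.2.
pose Fj (j : J) x := (\prod_i f i x ^+ mu j (lowi NN i)) * La j x.
have degLa j : degf (\sum_i mu j (highi NN i) * 1 + j.2 * 1) (La j).
  by apply: degfM; [apply: degf_prod => i|]; apply: degfX; apply: degf_linear.
have degFj j : degf (M + D).-1 (Fj j).
  apply: (@degf_le _ _ (\sum_i mu j (lowi NN i) * e + (\sum_i mu j (highi NN i) * 1 + j.2 * 1))).
    have := quos_deg (svalP j.1); have := ltn_ord j.2; rewrite -/(mu j); lia.
  by apply: degfM => //; apply: degf_prod => i; apply: degfX.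
have [|c [[j1 cj1] hc]] := degf_relation degFj.
  rewrite prednK; last by rewrite addn_gt0 D0 orbT.
  by rewrite card_prod card_sig card_ord mulnC.
pose ld (j : J) := (\sum_i mu j (lowi NN i))%N.
have [K0 [j0 cj0 ldj0] Kmin] :=
  @classical_min (fun q => exists2 j, c j != 0 & ld j = q) _ (ex_intro2 _ _ j1 cj1 erefl).
(* As [0 ^+ 0 = 1], this retains exactly the terms of least order [K0]; terms of smaller order have
   [c j = 0]. *)
pose c' j := c j * 0 ^+ (ld j - K0).
have c'0 : c' j0 != 0 by rewrite /c' ldj0 subnn mulr1.
have Z x0 s : V x0 -> \sum_j c' j * ((\prod_i s i ^+ mu j (lowi NN i)) * La j x0) = 0.
  move=> Vx0; have [S [t hS]] := transversal Vx0 s.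
  pose H j (eps : L^o) : L := 
    c j * ((eps : L) ^+ (ld j - K0) * ((\prod_i (s i + (eps : L) * t i) ^+ mu j (lowi NN i)) *
      La j (x0 *m (1%:M + (eps : L) *: S)))).
  have lid : linepoly 1 (fun eps : L^o => (eps : L)) by apply: linepoly_lin.
  have lH j : exists m, linepoly m (H j).
    have [|m hm] := @linepoly_degf L^o _ _ (fun eps : L^o => x0 *m (1%:M + (eps : L) *: S)) 1 (degLa j).
      move=> a b; rewrite -[1%N]add0n; apply: linepoly_mulmx => {}a {}b; first exact: linepoly_cst.
      apply: linepoly_ext (linepolyD (linepoly_cst 1 ((1%:M : 'M_N) a b)) (linepolyZ (S a b) lid)) => z.
      by rewrite !mxE mulrC.
    have [m2 hm2] : exists m, linepoly m
       (fun eps : L^o => \prod_i (s i + (eps : L) * t i) ^+ mu j (lowi NN i)).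
      apply: linepoly_prod_ex => i _; exists (mu j (lowi NN i) * 1)%N; apply: linepolyX.
      apply: linepoly_ext (linepolyD (linepoly_cst 1 (s i)) (linepolyZ (t i) lid)) => z.
      by rewrite mulrC.
    by exists ((ld j - K0) * 1 + (m2 + m))%N; apply: linepolyZ; apply: linepolyM;
      [apply: linepolyX | apply: linepolyM].
  have [m hm] := fin_all_exists lH.
  have lS : linepoly (\max_j m j) (fun eps => \sum_j H j eps).
    by apply: linepoly_sum => j _; apply: linepoly_le (hm j); apply: leq_bigmax.
  have HZ (eps : L^o) : (eps : L) != 0 -> \sum_j H j eps = 0.
    move=> ez; apply: (mulfI (expf_neq0 K0 ez)); rewrite mulr0.
    rewrite -[RHS](hc (x0 *m (1%:M + (eps : L) *: S))) mulr_sumr; apply: eq_bigr => j _.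
    have [cj|cj] := eqVneq (c j) 0; first by rewrite /H cj !mul0r mulr0.
    have Kj : (K0 <= ld j)%N by apply: Kmin; exists j.
    rewrite /H /Fj mulrCA; congr (_ * _).
    move: (La j _) => la; rewrite !mulrA -exprD subnKC //; congr (_ * _).
    rewrite /ld -prodrXr -big_split /=; apply: eq_bigr => i _.
    by rewrite hS exprMn.
  have H0 : \sum_j H j 0 = 0.
    apply/eqP; apply: contraT => nz0.
    have [|z] := linepoly_mul_neq0 lS lid nz0 (v := 1 : L^o); first exact: oner_neq0.
    by rewrite mulf_eq0 negb_or => /andP[h1 h2]; case/eqP: h1; apply: HZ.
  rewrite -[RHS]H0; apply: eq_bigr => j _; rewrite /c' /H mulrA; congr (_ * (_ * _)).
    by apply: eq_bigr => i _; rewrite mul0r addr0.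
  by rewrite scale0r addr0 mulmx1.
pose r (s : 'I_k -> L) (b : 'I_D) (a : 'rV[L]_(N * N)) := \sum_(q : {m | m \in quos})
  c' (q, b) * ((\prod_i s i ^+ mu (q, b) (lowi NN i)) *
    \prod_i (a *m V0) 0 (highi NN i) ^+ mu (q, b) (highi NN i)).
have rpts s b i : r s b (pts i) = 0.
  have [ui si Vi li] := hf i.
  (* A polynomial of degree below [D] in the value of [w], vanishing at the [D] points of the
     section. *)
  pose P : {poly L} := \poly_(b < D) (if insub b is Some b' then r s b' (pts i) else 0).
  have P0 : P = 0.
    apply: (@roots_geq_poly_eq0 _ _ [seq (mxvec x *m w) 0 0 | x <- fib i]).
    - apply/allP => _ /mapP[x xi ->]; apply/eqP; rewrite horner_poly -[RHS](Z x s (Vi x xi)).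
      rewrite [RHS](eq_bigr (fun j => c' (j.1, j.2) * ((\prod_i s i ^+ mu (j.1, j.2) (lowi NN i)) * La (j.1, j.2) x))) => [|[]//].
      rewrite -(pair_bigA _ (fun q b => c' (q, b) * ((\prod_i s i ^+ mu (q, b) (lowi NN i)) * La (q, b) x))) /=.
      rewrite exchange_big; apply: eq_bigr => b' _; rewrite valK /r mulr_suml.
      apply: eq_bigr => q _; rewrite /La -!mulrA; congr (_ * (_ * (_ * _))).
      congr (_ * _); apply: eq_bigr => l _; congr (_ ^+ _); rewrite -(li x) // [RHS]mxE [LHS]mxE.
      by apply: eq_bigr => z _; rewrite [in RHS]mxE.
    - by rewrite map_inj_in_uniq //; apply: wI.
    - by rewrite size_map si size_poly.
  have : P`_b = 0 by rewrite P0 coef0.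
  by rewrite coef_poly ltn_ord valK.
have rT s b a : T a -> r s b a = 0.
  move=> Ta; have [g gE] : exists g : {m | m \in quos} -> 'I_K, forall q, enum_val (g q) = sval q.
    by exists (fun q => enum_rank (sval q)) => q; rewrite enum_rankK.
  pose X q := c' (q, b) * \prod_i s i ^+ mu (q, b) (lowi NN i).
  pose C (l : 'I_K) : L := \sum_q (g q == l)%:R * X q.
  have rE a' : r s b a' = \sum_l C l * FT l a'.
    under [RHS]eq_bigr => l _ do rewrite mulr_suml.
    rewrite exchange_big; apply: eq_bigr => q _ /=.
    rewrite [RHS](bigD1 (g q)) //= [X in _ = _ + X]big1 => [|l lg]; last by rewrite eq_sym (negPf lg) !mul0r.
    by rewrite eqxx mul1r addr0 /FT gE mulrA.
  by rewrite rE; apply: sep Ta => i; rewrite -rE.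
pose b0 := j0.2.
pose q : {mpoly L[N * N]} := \sum_(q : {m | m \in quos}) c' (q, b0) *: 'X_[mu (q, b0)].
have q0 : q != 0.
  apply: contraNneq c'0 => /(congr1 (mcoeff (mu j0))); rewrite mcoeff0 raddf_sum /=.
  rewrite (bigD1 j0.1) //= big1 ?addr0 => [|q' q'j]; rewrite mcoeffZ mcoeffX.
    by rewrite /b0 -surjective_pairing eqxx mulr1 => ->.
  case: eqP => [h|_]; last by rewrite mulr0.
  by case/eqP: q'j; apply/val_inj/val_inj.
have [v qv] := mpoly_neq0_eval q0.
pose phi (a : 'rV[L]_(N * N)) (i : 'I_(N * N)) := if (i < k)%N then v i else (a *m V0) 0 i.
have rphi a : r (fun i => v (lowi NN i)) b0 a = q.@[phi a].
  rewrite /q raddf_sum /=; apply: eq_bigr => q' _; rewrite mevalZ mevalX; congr (_ * _).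
  rewrite prod_low_high /phi; congr (_ * _); apply: eq_bigr => i _.
    by rewrite low_lt.
  by rewrite high_ge.
have [mr lr] : exists m, linepoly m (fun a => q.@[phi a]).
  apply: (@linepoly_meval _ _ _ q 1 phi) => i; rewrite /phi; case: (i < k)%N.
    exact: linepoly_cst.
  by apply: linepoly_lin => t u u'; rewrite mulmxDl -scalemxAl; move: (u *m _) (u' *m _) => b b'; rewrite !mxE.
have uV : V0 \in unitmx by rewrite unitmxE unitfE.
have ra : q.@[phi ((\row_i v i) *m invmx V0)] != 0.
  apply: contraNneq qv => <-; apply/eqP/meval_eq => i; rewrite /phi mulmxKV //.
  by rewrite mxE; case: ifP.
have [ma la] : exists m, linepoly m (fun a => p.@[aff_coords a Ms]).
  apply: (linepoly_aff_coords _ (m := 1%N) (a := id) (M := fun=> Ms)) => [j|i j].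
    exact: linepoly_mxE.
  exact: linepoly_cst.
have [a] := linepoly_mul_neq0 la lr pa0 ra.
rewrite mulf_eq0 negb_or => /andP[Ta] /eqP; apply.
by rewrite -rphi rT.
Qed.

End Fixed.

(** With [P(M)] the number of monomials of degree below [M], the two counts combine to
    [D P(M) <= e^k P(M + D)]. *)
Lemma bezout_smooth D : (1 < N)%N -> has_degree V d D -> (D <= 2 * e ^ k)%N.
Proof.
move=> N1 hD; have [->//|D0] := posnP D.
apply: (@growth_factor (fun M => #|{: 'X_{1..(N * N) < M}}|) (N * N)%N).
- exact: card_bmultinom_le.
- have h0 : (mdeg (0%MM : 'X_{1..(N * N)}) < 1)%N by rewrite mdeg0.
  by apply/card_gt0P; exists (BMultinom h0).
- move=> M; have h1 := bezout_count M N1 hD D0; have h2 := card_quos M; nia.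
- by rewrite expn_gt0 e0.
Qed.

End Bezout.

(** * Replacing group elements by words, and counting tuples *)

Lemma card_fibres (X Y : finType) (phi : X -> Y) m :
  (forall y, #|[pred x | phi x == y]| <= m)%N -> (#|X| <= #|Y| * m)%N.
Proof.
move=> h; rewrite -sum1_card (partition_big phi predT) //= -sum_nat_const.
by apply: leq_sum => y _; rewrite sum1_card; apply: leq_trans (h y); apply: subset_leq_card;
  apply/subsetP => x; rewrite !inE.
Qed.

Section ReplaceOne.
Variables (L : closedFieldType) (N k d : nat) (X : 'I_d -> 'M[L]_N).

(** Conjugation multiplied by [det h], which makes it polynomial of degree [N] in [h]. *)
Definition adconj (h Z : 'M[L]_N) := h *m Z *m \adj h.

Lemma polyf_adconj Z i j : (0 < N)%N -> polyf (@mxf L N) N (fun x => adconj x Z i j).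
Proof.
move=> N0; suff : polyf (@mxf L N) (1 + 0 + N.-1 * 1) (fun x => adconj x Z i j).
  by have -> : (1 + 0 + N.-1 * 1 = N)%N by lia.
apply: polyf_mulmx => a b.
  apply: polyf_mulmx => {}a {}b; first exact: polyf_mxE.
  exact: polyf_mx_cst.
apply: polyf_ext (polyfZ ((-1) ^+ (b + a)) (@polyf_det _ _ _ _ 1 _
  (fun x : 'M[L]_N => row' b (col' a x)) _)) => [x|c e]; first by rewrite mxE.
have hm : polyf (@mxf L N) 1 (fun x => x (lift b c) (lift a e)) by apply: polyf_mxE.
by apply: polyf_ext hm => x; rewrite !mxE.
Qed.

(** Functionals [phi (j0, i')] dual to the given family annihilate the blocks that stay fixed, so
    only their [d] by [d] determinant on the block of [x] has to be nonzero. *)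
Lemma replace_one (h : 'I_k -> 'M[L]_N) (j0 : 'I_k) : (0 < N)%N ->
  free_mxs (fun p : 'I_k * 'I_d => adconj (h p.1) (X p.2)) ->
  exists f, [/\ polyf (@mxf L N) (d * N) f, f (h j0) != 0 &
    forall x, f x != 0 ->
      free_mxs (fun p : 'I_k * 'I_d => adconj (if p.1 == j0 then x else h p.1) (X p.2))].
Proof.
move=> N0 /free_mxsP/row_freeP[R hR].
pose phi (q : 'I_k * 'I_d) (Z : 'M[L]_N) := (mxvec Z *m R) 0 (enum_rank q).
have key p q : phi q (adconj (h p.1) (X p.2)) = (p == q)%:R.
  move/matrixP/(_ (enum_rank p) (enum_rank q)): hR; rewrite [X in _ = X -> _]mxE.
  rewrite (inj_eq enum_rank_inj) => <-; rewrite /phi mxE [RHS]mxE.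
  by apply: eq_bigr => l _; rewrite [in RHS]mxE enum_rankK.
pose Mx x : 'M[L]_d := \matrix_(i, i') phi (j0, i') (adconj x (X i)).
have phiS (I : finType) (c : I -> L) G q :
    phi q (\sum_i c i *: G i) = \sum_i c i * phi q (G i).
  rewrite /phi linear_sum mulmx_suml summxE; apply: eq_bigr => i _.
  by rewrite linearZ -scalemxAl mxE.
exists (fun x => \det (Mx x)); split.
- apply: polyf_det => i i'; apply: (@polyf_ext _ _ _ _ _
    (fun x => \sum_l R l (enum_rank (j0, i')) * mxvec (adconj x (X i)) 0 l)) => [x|].
    by rewrite [RHS]mxE /phi mxE; apply: eq_bigr => l _; rewrite mulrC.
  apply: polyf_sum => l _; apply: polyfZ; case/mxvec_indexP: l => a b.
  by apply: polyf_ext (polyf_adconj (X i) a b N0) => x; rewrite mxvecE.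
- suff -> : Mx (h j0) = 1%:M by rewrite det1 oner_neq0.
  by apply/matrixP => i i'; rewrite !mxE (key (j0, i)) xpair_eqE eqxx.
move=> x; rewrite -unitfE -unitmxE => uM c hc.
pose G (p : 'I_k * 'I_d) := adconj (if p.1 == j0 then x else h p.1) (X p.2).
have hq q : \sum_p c p * phi q (G p) = 0.
  by rewrite -phiS hc /phi linear0 mul0mx mxE.
have cj0 i : c (j0, i) = 0.
  have : (\row_i c (j0, i)) *m Mx x = 0 *m Mx x.
    apply/rowP => i'; rewrite mul0mx [LHS]mxE [RHS]mxE -[RHS](hq (j0, i')).
    rewrite [RHS](eq_bigr (fun p => c (p.1, p.2) * phi (j0, i') (G (p.1, p.2)))) => [|[]//].
    rewrite -(pair_bigA _ (fun j i => c (j, i) * phi (j0, i') (G (j, i)))) /=.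
    rewrite [RHS](bigD1 j0) //= [X in _ = _ + X]big1 ?addr0 => [|j jj0].
      by apply: eq_bigr => l _; rewrite !mxE /G eqxx.
    apply: big1 => l _; rewrite /G /= (negPf jj0) (key (j, l)) xpair_eqE (negPf jj0).
    by rewrite mulr0.
  by move/(can_inj (mulmxK uM))/rowP/(_ i); rewrite !mxE.
case=> j i; have [->|jj0] := eqVneq j j0; first exact: cj0.
rewrite -[RHS](hq (j, i)) (bigD1 (j, i)) //= {1}/G /= (negPf jj0) (key (j, i)) eqxx mulr1.
rewrite big1 ?addr0 // => -[j' i'] ne; have [->|jj0'] := eqVneq j' j0; first by rewrite cj0 mul0r.
by rewrite /G /= (negPf jj0') (key (j', i')) (negPf ne) mulr0.
Qed.

End ReplaceOne.

Section Counting.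
Variables (L : closedFieldType) (N d s : nat).
Variables (A : 'M[int]_(N, d)) (U : 'M[int]_(d, N)) (P : 'M[L]_N).
Hypothesis UA : U *m A = 1%:M.
Hypothesis uP : P \in unitmx.
Hypothesis N0 : (0 < N)%N.
Hypothesis two : 2%:R != 0 :> L.
Variable y : 'I_s -> 'M[L]_N.
Hypothesis hy : colouring A y.
Variable B : {fset 'M[L]_N}.
Hypothesis B1 : 1%:M \in B.
Hypothesis Bu : forall b, b \in B -> b \in unitmx.
Hypothesis Binv : forall b, b \in B -> invmx b \in B.
Local Notation Xi := (fun i : 'I_d => Xt A P (delta_mx 0 i)).
Local Notation e := (d * N)%N.
Local Notation Q := ((N * N).+1 ^ e)%N.

Hypothesis dense : forall f, polyf (@mxf L N) e f ->
  (forall j x, x \in prodset B j -> f x = 0) ->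
  forall c eps, let Y := eps *: (P *m y c *m invmx P) in
  1%:M + Y \in unitmx -> 1%:M - Y \in unitmx -> f (cay Y) = 0.

Lemma prodset_unit j x : x \in prodset B j -> x \in unitmx.
Proof.
elim: j x => [|j ih] x; first by rewrite prodset0E => /eqP->; apply: unitmx1.
by move=> /prodsetSP[a [b [aB bP ->]]]; rewrite unitmx_mul Bu // ih.
Qed.

Lemma prodset_inv j x : x \in prodset B j -> invmx x \in prodset B j.
Proof.
elim: j x => [|j ih] x; first by rewrite !prodset0E => /eqP->; rewrite invmx1.
move=> /prodsetSP[a [b [aB bP ->]]].
have -> : invmx (a *m b) = invmx b *m invmx a.
  have ua := Bu aB; have ub := prodset_unit bP; have uab : a *m b \in unitmx by rewrite unitmx_mul ua.
  by apply: (can_inj (mulmxK uab)); rewrite mulVmx // mulmxA mulmxKV // mulVmx.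
by rewrite -addn1; apply: prodset_mul (ih _ bP) (prodset1 (Binv aB)).
Qed.

Lemma free_start : exists h : 'I_s.+1 -> 'M[L]_N,
  [/\ h ord0 = 1%:M,
      forall f, polyf (@mxf L N) e f -> (forall j x, x \in prodset B j -> f x = 0) ->
        forall j, j != ord0 -> f (h j) = 0 &
      free_mxs (fun p : 'I_s.+1 * 'I_d => adconj (h p.1) (Xi p.2))].
Proof.
have [eps heps hfree] := near_identity_cayley two (colouring_independent UA uP hy).
pose c (j : 'I_s) := cay (eps *: (P *m y j *m invmx P)).
have uc j : c j \in unitmx.
  by have /andP[u v] := heps j; rewrite unitmx_mul v unitmx_inv.
exists (fun j => if unlift ord0 j is Some i then c i else 1%:M); split.
- by rewrite unlift_none.
- move=> f hf f0 j; case: unliftP => [i _ _|->]; last by rewrite eqxx.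
  by have /andP[u v] := heps i; apply: dense.
move=> b hb.
pose dt j := \det (c j).
have dt0 j : dt j != 0 by rewrite -unitfE -unitmxE.
have cE j Z : adconj (c j) Z = dt j *: (c j *m Z *m invmx (c j)).
  by rewrite /adconj /invmx uc -scalemxAr scalerA mulfV // scale1r.
have [|h0 h1] := hfree (fun i => b (ord0, i)) (fun j i => b (lift ord0 j, i) * dt j).
  rewrite -[RHS]hb.
  rewrite [RHS](eq_bigr (fun p => b (p.1, p.2) *: adconj (if unlift ord0 p.1 is Some i then c i else 1%:M) (Xi p.2))) => [|[]//].
  rewrite -(pair_bigA _ (fun j i => b (j, i) *: adconj (if unlift ord0 j is Some i then c i else 1%:M) (Xi i))) /=.
  rewrite [RHS]big_ord_recl; congr (_ + _).
    by apply: eq_bigr => i _; rewrite unlift_none /adconj adj1 mulmx1 mul1mx.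
  by apply: eq_bigr => j _; apply: eq_bigr => i _; rewrite liftK cE scalerA.
case=> j i; case: (unliftP ord0 j) => [j' ->|->]; last exact: h0.
by have /eqP := h1 j' i; rewrite mulf_eq0 (negPf (dt0 j')) orbF => /eqP.
Qed.

Variables (D1 cst : nat).
Hypothesis hdet : forall m, exists h (q : 'I_h -> 'rV[L]_d),
  [/\ (h <= D1 * (m + cst) ^ d)%N, forall i, nz (q i) &
    forall f, polyf (za A) m f -> (forall i, f (q i) = 0) -> forall tau, nz tau -> f tau = 0].

Lemma choose_escape n (pts : 'I_n -> 'M[L]_N) :
  (forall i, pts i \in prodset B Q) ->
  (forall f, polyf (@mxf L N) e f -> (forall i, f (pts i) = 0) ->
   forall j x, x \in prodset B j -> f x = 0) ->
  forall a : nat -> 'M[L]_N, (forall i, exists j, a i \in prodset B j) ->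
  exists sg : nat -> 'M[L]_N, [/\ forall j, (j < s)%N -> exists i, sg j = pts i,
    forall j, (s <= j)%N -> sg j = 1%:M &
    free_mxs (fun p : 'I_s.+1 * 'I_d => adconj (prefix sg a p.1) (Xi p.2))].
Proof.
move=> hpts sep a ha; have [h [h0 hz hfree]] := free_start.
suff H m : (m <= s)%N -> exists sg : nat -> 'M[L]_N,
    [/\ forall j, (j < m)%N -> exists i, sg j = pts i, forall j, (m <= j)%N -> sg j = 1%:M &
    free_mxs (fun p : 'I_s.+1 * 'I_d => adconj (if (p.1 <= m)%N then prefix sg a p.1 else h p.1) (Xi p.2))].
  have [sg [h1 h2 h3]] := H s (leqnn s); exists sg; split=> // c hc; apply: h3; rewrite -[RHS]hc.
  by apply: eq_bigr => p _; rewrite -ltnS ltn_ord.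
elim: m => [|m ih] ms.
  exists (fun=> 1%:M); split=> // c hc; apply: hfree; rewrite -[RHS]hc; apply: eq_bigr => -[j i] _ /=.
  by case: ifP => // j0; have -> : j = ord0 by [apply: val_inj => /=; lia]; rewrite h0.
have [sg [h1 h2 h3]] := ih (ltnW ms).
have mlt : (m.+1 < s.+1)%N by rewrite ltnS.
pose j0 := Ordinal mlt.
have [f [pf fj0 hf]] := @replace_one L N s.+1 d Xi (fun j : 'I_s.+1 => if (j <= m)%N then prefix sg a j else h j) j0 N0 h3.
have j0m : (j0 <= m)%N = false by rewrite /= ltnn.
rewrite j0m in fj0.
have sgP j : exists l, sg j \in prodset B l.
  have [/h1[i ->]|/h2->] := ltnP j m; first by exists Q.
  by exists 0%N; rewrite prodset0E.
have preP j : exists l, prefix sg a j \in prodset B l.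
  elim: j => [|j [l hl]] /=; first by exists 0%N; rewrite prodset0E.
  have [l1 a1] := ha j; have [l2 s2] := sgP j.
  by exists (l + l1 + l2)%N; apply: prodset_mul s2; apply: prodset_mul.
pose pm := prefix sg a m *m a m.
have [l hl] : exists l, pm \in prodset B l.
  have [l1 p1] := preP m; have [l2 a2] := ha m.
  by exists (l1 + l2)%N; apply: prodset_mul.
(* Otherwise [f] translated by the prefix [pm] would vanish on all words; as [pm] and its inverse
   are words, so would [f], against [f (h j0) != 0]. *)
have [i fi] : exists i, f (pm *m pts i) != 0.
  apply: NNPP => no; case/eqP: fj0; apply: hz => // j x xP.
  have -> : x = pm *m (invmx pm *m x) by rewrite mulKVmx // (prodset_unit hl).
  apply: (sep (fun x => f (pm *m x))) (prodset_mul (prodset_inv hl) xP).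
    by apply: polyf_ext (polyf_mul2 pm 1%:M pf) => z; rewrite mulmx1.
  by move=> i; apply/eqP; apply: contraT => fi; case: no; exists i.
pose sg' j := if j == m then pts i else sg j.
have preE j : (j <= m)%N -> prefix sg' a j = prefix sg a j.
  elim: j => //= j ihj jm; rewrite ihj 1?ltnW // /sg'.
  by rewrite (ltn_eqF jm).
exists sg'; split.
- move=> j; rewrite ltnS leq_eqVlt => /orP[/eqP->|jm]; first by exists i; rewrite /sg' eqxx.
  by rewrite /sg' (ltn_eqF jm); apply: h1.
- by move=> j mj; rewrite /sg' gtn_eqF //; apply: h2; apply: ltnW.
move=> c hc; apply: (hf _ fi); rewrite -[RHS]hc; apply: eq_bigr => -[j l'] _ /=.
congr (_ *: adconj _ _); have [->|jj0] := eqVneq j j0.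
  by rewrite /= leqnn preE // /sg' eqxx.
have jm1 : j != m.+1 :> nat by move: jj0; rewrite -val_eqE.
have -> : (j <= m.+1)%N = (j <= m)%N by lia.
by case: ifP => // jm; rewrite preE.
Qed.

(** A tuple is recorded by the indices of its inserted words and by the value of its product. Tuples
    with the same record use the same words, so they lie in one fibre of one product map. *)
Lemma torus_power_bound t n (tau : 'I_n -> 'rV[L]_d) : (forall i, nz (tau i)) -> injective tau ->
  (forall i, xt A P (tau i) \in prodset B t) ->
  (n ^ s.+1 <= Q ^ s * #|` prodset B (s.+1 * t + s * Q)| *
     (D1 ^ s.+1 * (s.+1 * d) ^ (s.+1 * d)))%N.
Proof.
move=> tnz tI tP; have [nn [pts [nQ hpts sep]]] := escape B1 e.
pose ta (a : {ffun 'I_s.+1 -> 'I_n}) : {ffun 'I_s.+1 -> 'rV[L]_d} := [ffun j => tau (a j)].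
have taP a j : pt A P (ta a) j \in prodset B t.
  rewrite /pt; case: insubP => [l _ _|_]; first by rewrite ffunE.
  by apply: (prodset_le B1 (leq0n t)); rewrite prodset0E.
have hsg a : exists sg : nat -> 'M[L]_N, [/\ forall j, (j < s)%N -> exists i, sg j = pts i,
    forall j, (s <= j)%N -> sg j = 1%:M &
    free_mxs (fun p : 'I_s.+1 * 'I_d => adconj (prefix sg (pt A P (ta a)) p.1) (Xi p.2))].
  by apply: choose_escape => // i; exists t.
have [sg sgE] := fin_all_exists hsg.
have hix a : exists w : {ffun 'I_s -> 'I_nn}, forall j : 'I_s, sg a j = pts (w j).
  have [h1 _ _] := sgE a; have [w hw] := fin_all_exists (fun j : 'I_s => h1 j (ltn_ord j)).
  by exists [ffun j => w j] => j; rewrite ffunE.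
have [w wE] := fin_all_exists hix.
have yP a : prefix (sg a) (pt A P (ta a)) s.+1 \in prodset B (s.+1 * t + s * Q).
  have [h1 h2 _] := sgE a.
  have H m : (m <= s)%N -> prefix (sg a) (pt A P (ta a)) m \in prodset B (m * t + m * Q).
    elim: m => [|m ih] ms; first by rewrite prodset0E.
    have -> : (m.+1 * t + m.+1 * Q = m * t + m * Q + t + Q)%N by rewrite !mulSn; lia.
    have [i si] := h1 m ms.
    by apply: prodset_mul; [apply: prodset_mul; [apply: ih; apply: ltnW | apply: taP] | rewrite si].
  rewrite /= h2 // mulmx1 mulSnr addnAC; apply: prodset_mul (taP _ _); exact: H.
pose phi a : {ffun 'I_s -> 'I_nn} * prodset B (s.+1 * t + s * Q) := (w a, [` yP a]%fset).
have := @card_fibres _ _ phi (D1 ^ s.+1 * (s.+1 * d) ^ (s.+1 * d)).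
rewrite card_ffun !card_ord card_prod card_ffun !card_ord -cardfE => hc.
apply: leq_trans (hc _) _ => [[w0 y0]|]; last first.
  by rewrite leq_mul2r; apply/orP; right; rewrite leq_mul2r leq_expl ?orbT.
set FB := [pred x | _].
pose xs (i : 'I_#|FB|) := ta (enum_val i).
have [->//|FB0] := posnP #|FB|; pose i0 := Ordinal FB0.
have phiE i : phi (enum_val (i : 'I_#|FB|)) = (w0, y0).
  by apply/eqP; have := enum_valP i; rewrite inE.
have sgEq i j : sg (enum_val (i : 'I_#|FB|)) j = sg (enum_val i0) j.
  have [ji|ji] := ltnP j s; last first.
    by have [_ h2 _] := sgE (enum_val i); have [_ h2' _] := sgE (enum_val i0); rewrite h2 // h2'.
  rewrite (wE _ (Ordinal ji)) (wE (enum_val i0) (Ordinal ji)).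
  have := phiE i; have := phiE i0; rewrite /phi => -[-> _] [-> _] //.
have preEq i a m : prefix (sg (enum_val (i : 'I_#|FB|))) a m = prefix (sg (enum_val i0)) a m.
  by elim: m => //= m ->; rewrite sgEq.
have sgu j : sg (enum_val i0) j \in unitmx.
  have [h1 h2 _] := sgE (enum_val i0); have [/h1[i ->]|/h2->] := ltnP j s; last exact: unitmx1.
  exact: prodset_unit (hpts i).
apply: (fibre_bound UA uP sgu (x := xs) (y := fsval y0) hdet).
- move=> i i' /ffunP e; apply: enum_val_inj; apply/ffunP => j; apply: tI.
  by have := e j; rewrite !ffunE.
- by move=> i j; rewrite ffunE.
- by move=> i; rewrite -(preEq i); have /= <- := congr1 (fun z => fsval z.2) (phiE i).
move=> i v; rewrite /tangent => tv.
have [_ _ fr] := sgE (enum_val i).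
pose hh (j : nat) := prefix (sg (enum_val i)) (pt A P (xs i)) j.
have uh j : hh j \in unitmx.
  rewrite /hh preEq; apply: prefix_unit => // l; exact: prodset_unit (taP _ _).
have dh j : \det (hh j) != 0 by rewrite -unitfE -unitmxE.
have XtS (u : 'rV[L]_d) : Xt A P u = \sum_l u 0 l *: Xi l.
  rewrite [RHS](eq_bigr (fun l => P *m (u 0 l *: diag_mx (\row_i wt A (delta_mx 0 l) i)) *m invmx P)).
    rewrite -mulmx_suml -mulmx_sumr; congr (_ *m _ *m _); apply/matrixP => b c.
    have wu : \sum_j (A b j)%:~R * u 0 j = \sum_l u 0 l * wt A (delta_mx 0 l) b.
      by rewrite -(wt_lin A (u 0) (fun l => delta_mx 0 l)) -row_sum_delta.
    rewrite summxE [LHS]mxE [X in X *+ _]mxE wu -sumrMnl; apply: eq_bigr => l _.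
    by rewrite [RHS]mxE [X in _ = _ * X]mxE [X in _ = _ * (X *+ _)]mxE mulrnAr.
  by move=> l _; rewrite -scalemxAr -scalemxAl.
(* The division by [det (hh j)] passes from conjugation to [adconj]. *)
have := fr (fun p => v p.1 p.2 / \det (hh p.1)).
have -> : \sum_p (v p.1 p.2 / \det (hh p.1)) *: adconj (prefix (sg (enum_val i)) (pt A P (ta (enum_val i))) p.1) (Xi p.2) = 0.
  rewrite -(pair_bigA _ (fun (j : 'I_s.+1) l => (v j l / \det (hh j)) *: adconj (hh j) (Xi l))) /=.
  rewrite -[RHS]tv; apply: eq_bigr => j _; rewrite XtS mulmx_sumr mulmx_suml; apply: eq_bigr => l _.
  rewrite -(preEq i) -/(hh j) mxE -scalemxAr -scalemxAl /invmx uh -scalemxAr scalerA.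
  by [].
move=> /(_ erefl) hv; apply/matrixP => j l; have /eqP := hv (j, l).
by rewrite mulf_eq0 invr_eq0 (negPf (dh j)) orbF mxE => /eqP.
Qed.

End Counting.

(** * Transport to the conjugated finite group *)

Section Conjugation.
Variables (L : closedFieldType) (N : nat).
Implicit Types (h Y Q : 'M[L]_N).

Lemma unit_conj h Y : h \in unitmx -> (h *m Y *m invmx h \in unitmx) = (Y \in unitmx).
Proof. by move=> uh; rewrite !unitmx_mul unitmx_inv uh andbT. Qed.

Lemma conj1D h Y : h \in unitmx -> 1%:M + h *m Y *m invmx h = h *m (1%:M + Y) *m invmx h.
Proof. by move=> uh; rewrite mulmxDr mulmxDl mulmx1 mulmxV. Qed.

Lemma conjN h Y : h *m (- Y) *m invmx h = - (h *m Y *m invmx h).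
Proof. by rewrite mulmxN mulNmx. Qed.

Lemma cay_conjugate h Y : h \in unitmx -> 1%:M + Y \in unitmx ->
  cay (h *m Y *m invmx h) = h *m cay Y *m invmx h.
Proof.
move=> uh uY; have u2 : 1%:M + h *m Y *m invmx h \in unitmx by rewrite conj1D // unit_conj.
apply: (can_inj (mulmxK u2)); rewrite /cay mulmxKV // conj1D // -conjN conj1D //.
by rewrite !mulmxA (mulmxKV uh) (mulmxKV uY).
Qed.

Lemma lieform_conj Q h Y : h \in unitmx ->
  lieform (h^T *m Q *m h) Y -> lieform Q (h *m Y *m invmx h).
Proof.
move=> uh; rewrite /lieform => e.
have ut : h^T \in unitmx by rewrite unitmx_tr.
apply: (can_inj (mulKmx ut)); apply: (can_inj (mulmxK uh)).
rewrite mulmx0 mul0mx -[RHS]e mulmxDr mulmxDl; congr (_ + _).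
  by rewrite !trmx_mul trmx_inv !mulmxA mulmxV // mul1mx.
by rewrite !mulmxA mulmxKV.
Qed.

Lemma lieformZ Q a Y : lieform Q Y -> lieform Q (a *: Y).
Proof. by rewrite /lieform => h; rewrite linearZ /= -scalemxAl -scalemxAr -scalerDr h scaler0. Qed.

End Conjugation.

Section ConjugateDensity.
Variables (F : finFieldType) (L : closedFieldType) (iota : {rmorphism F -> L}) (N : nat).
Variable h : 'M[L]_N.

(** Conjugation by the isometry [h] preserves the Lie algebra and commutes with the Cayley
    transform, so the conjugate [f (h x h^-1)] can be used in [form_density]. *)
Lemma form_density_conj (Q : 'M[F]_N) (eta : bool) e (f : 'M[L]_N -> L) :
  2%:R != 0 :> L -> Q \in unitmx -> Q^T = (-1) ^+ eta *: Q ->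
  h \in unitmx -> h^T *m map_mx iota Q *m h = map_mx iota Q ->
  (e * N.+1 + N < #|F|)%N -> polyf (@mxf L N) e f ->
  (forall g : 'M[F]_N, g^T *m Q *m g = Q -> \det g = 1 ->
    f (h *m map_mx iota g *m invmx h) = 0) ->
  forall Y, lieform (map_mx iota Q) Y -> 1%:M + Y \in unitmx -> f (cay Y) = 0.
Proof.
move=> two uQ tQ uh hQ qe pf hG Y lY uY.
have YE : Y = h *m (invmx h *m Y *m h) *m invmx h by rewrite !mulmxA mulmxV // mul1mx mulmxK.
have uh' : invmx h \in unitmx by rewrite unitmx_inv.
have uZ : 1%:M + invmx h *m Y *m h \in unitmx.
  by have := conj1D Y uh'; rewrite invmxK => ->; rewrite !unitmx_mul uh' uh uY.
have lZ : lieform (map_mx iota Q) (invmx h *m Y *m h).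
  have := @lieform_conj L N (map_mx iota Q) (invmx h) Y uh'; rewrite invmxK; apply.
  suff -> : (invmx h)^T *m map_mx iota Q *m invmx h = map_mx iota Q by [].
  by rewrite -{1}hQ trmx_inv !mulmxA mulVmx ?unitmx_tr // mul1mx mulmxK.
rewrite YE cay_conjugate //.
exact: (form_density two uQ tQ qe (polyf_mul2 h (invmx h) pf) hG lZ uZ).
Qed.

(** The Cayley transform of a matrix [Y] of square zero is [1 - 2 Y], a transvection for
    [Y = eps u w], and conjugation by [h] only changes [u] and [w]. *)
Lemma sl_density_conj e (f : 'M[L]_N -> L) :
  h \in unitmx -> (e * 3 < #|F|)%N -> polyf (@mxf L N) e f ->
  (forall g : 'M[F]_N, \det g = 1 -> f (h *m map_mx iota g *m invmx h) = 0) ->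
  forall eps (u : 'cV_N) (w : 'rV_N), w *m u = 0 -> f (cay (eps *: (u *m w))) = 0.
Proof.
move=> uh qe pf hG eps u w wu.
have [_ ->] : 1%:M + eps *: (u *m w) \in unitmx /\
    cay (eps *: (u *m w)) = 1%:M - (eps *: (u *m w)) *+ 2.
  apply: cay_nilp; rewrite -scalemxAl -scalemxAr mulmxA -(mulmxA u) wu mulmx0 mul0mx.
  by rewrite !scaler0.
pose u' := invmx h *m (- ((eps *+ 2) *: u)); pose w' := w *m h.
have wu' : w' *m u' = 0.
  by rewrite /w' /u' mulmxA mulmxK // mulmxN -scalemxAr wu scaler0 oppr0.
have := sl_density qe (polyf_mul2 h (invmx h) pf) hG wu'.
suff -> : h *m (1%:M + u' *m w') *m invmx h = 1%:M - (eps *: (u *m w)) *+ 2 by [].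
rewrite mulmxDr mulmxDl mulmx1 mulmxV // /u' /w' !mulmxA mulmxV // mul1mx mulmxK //.
by rewrite mulNmx -scalemxAl scalerMnl.
Qed.

End ConjugateDensity.

(** * Adapted coordinates for a torus in each type *)

Section Packages.
Variables (L : closedFieldType) (N d : nat) (T : 'M[L]_N -> Prop).
Hypothesis hT : is_torus d T.

Lemma sl_package : (forall x, T x -> \det x = 1) -> (d < N.-1)%N -> N%:R != 0 :> L ->
  exists (A : 'M[int]_(N, d)) (U : 'M[int]_(d, N)) (P : 'M[L]_N) (y : 'I_N.+1 -> 'M[L]_N),
  [/\ U *m A = 1%:M /\ forall j, \sum_i A i j = 0, P \in unitmx,
    forall x, T x <-> exists2 tau, nz tau & x = xt A P tau, colouring A y &
    forall c, exists (u : 'cV_N) (w : 'rV_N), w *m u = 0 /\ P *m y c *m invmx P = u *m w].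
Proof.
move=> hdet dN N0; have [A0 [P uP [rk TE]]] := hT.
have [A [U [UA AE]]] := torus_saturation P rk.
have TX x : T x <-> exists2 tau, nz tau & x = xt A P tau.
  by split=> [/TE/AE[tau h ->]|[tau h ->]]; [exists tau | apply/TE/AE; exists tau].
have Asum j : \sum_i A i j = 0.
  apply: (@trivial_character L d (fun j => \sum_i A i j)) => tau htau.
  have : \det (xt A P tau) = 1 by apply: hdet; apply/TX; exists tau.
  rewrite /xt !det_mulmx det_inv mulrAC mulfV -?unitfE -?unitmxE // mul1r det_diag => h1; rewrite -[RHS]h1.
  rewrite [RHS](eq_bigr (zt A tau)) => [|i _]; last by rewrite mxE.
  rewrite [RHS]exchange_big /=; apply: eq_bigr => l _.
  by rewrite (big_morph (fun n => tau 0 l ^ n) (id1 := 1) (op1 := *%R)) // => a b; rewrite expfzDr.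
have [y [hy hr]] := sl_colouring UA Asum dN N0.
exists A, U, P, y; split=> // c; have [u [w [wu ->]]] := hr c.
exists (P *m u), (w *m invmx P); split; last by rewrite !mulmxA.
by rewrite mulmxA mulmxKV.
Qed.

(** The torus preserves the Gram matrix [g] of [Q] in its weight basis, so [g] pairs only weights
    whose sum is a trivial character, hence zero; [witt_basis] then brings [g] to the shape
    [hypmx]. *)
Lemma form_package (Q : 'M[L]_N) (eta : bool) : 2%:R != 0 :> L -> Q \in unitmx ->
  Q^T = (-1) ^+ eta *: Q -> (forall x, T x -> x^T *m Q *m x = Q) ->
  (d < N./2)%N -> (typeD N eta -> 3 < N./2)%N -> (eta -> ~~ odd N) ->
  exists (A : 'M[int]_(N, d)) (U : 'M[int]_(d, N)) (P : 'M[L]_N) (y : 'I_(ncol N eta) -> 'M[L]_N),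
  [/\ U *m A = 1%:M /\ forall j, \sum_i A i j = 0, P \in unitmx,
    forall x, T x <-> exists2 tau, nz tau & x = xt A P tau, colouring A y &
    forall c, lieform Q (P *m y c *m invmx P)].
Proof.
move=> two uQ tQ TQ dN hD hC; have [A00 [P0 uP0 [rk TE]]] := hT.
have [A0 [U0 [UA0 AE]]] := torus_saturation P0 rk.
have TX x : T x <-> exists2 tau, nz tau & x = xt A0 P0 tau.
  by split=> [/TE/AE[tau h ->]|[tau h ->]]; [exists tau | apply/TE/AE; exists tau].
pose g := P0^T *m Q *m P0.
pose w (i : 'I_N) : 'rV[int]_d := row i A0.
have hw : wform eta w g.
  split; first by rewrite !unitmx_mul unitmx_tr uP0 uQ.
    by rewrite /g !trmx_mul trmxK tQ -scalemxAl -scalemxAr mulmxA.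
  move=> i j gij; apply/rowP => l; rewrite !mxE.
  apply: (@trivial_character L d (fun l => A0 i l + A0 j l)) => tau htau.
  have hx : (xt A0 P0 tau)^T *m Q *m xt A0 P0 tau = Q by apply: TQ; apply/TX; exists tau.
  have E : diag_mx (\row_i zt A0 tau i) *m g *m diag_mx (\row_i zt A0 tau i) = g.
    have -> : diag_mx (\row_i zt A0 tau i) *m g *m diag_mx (\row_i zt A0 tau i) =
      P0^T *m ((xt A0 P0 tau)^T *m Q *m xt A0 P0 tau) *m P0.
      rewrite /xt /g !trmx_mul tr_diag_mx trmx_inv !mulmxA mulmxV ?unitmx_tr // mul1mx.
      by rewrite -!mulmxA mulVmx // mulmx1.
    by rewrite hx.
  have : zt A0 tau i * zt A0 tau j = 1.
    apply: (mulIf gij); rewrite mul1r; move: (g) E => G /matrixP/(_ i j).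
    by rewrite mul_mx_diag mul_diag_mx !mxE => E; rewrite -[RHS]E; ring.
  rewrite /zt -big_split => h1; rewrite -[RHS]h1; apply: eq_bigr => l' _ /=.
  by rewrite expfzDr.
have tfree (x : 'rV[int]_d) : x + x = 0 -> x = 0.
  move=> /rowP h; apply/rowP => l; have := h l; rewrite !mxE -mulr2n => /eqP.
  by rewrite mulrn_eq0 => /eqP.
have [C [w' [hC1 CJ]]] := witt_basis two tfree hw.
have [_ _ anti'] := wform_base hw hC1; rewrite CJ in anti'.
have [uC hCw] := hC1.
pose A := \matrix_(i, j) w' i 0 j.
have rowA i : w' i = row i A by apply/rowP => j; rewrite !mxE.
have anti i j : hypmx L eta N i j != 0 -> forall k, A i k + A j k = 0.
  by move=> /anti'/rowP h k; have := h k; rewrite !mxE.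
(* A nonzero term of [det C] gives a permutation matching old and new weights, so the new weight
   matrix inherits a left inverse. *)
have [s hs] : exists s : {perm 'I_N}, forall i, C i (s i) != 0.
  apply: NNPP => no; have : \det C != 0 by rewrite -unitfE -unitmxE.
  rewrite /determinant big1 ?eqxx // => s _.
  have [i Ci] : exists i, C i (s i) = 0.
    by apply: NNPP => h; apply: no; exists s => i; apply/eqP => Ci; apply: h; exists i.
  by rewrite (bigD1 i) //= Ci mul0r mulr0.
have As i j : A0 i j = A (s i) j by rewrite mxE -(hCw _ _ (hs i)) mxE.
pose U : 'M[int]_(d, N) := \matrix_(a, j) U0 a ((s^-1)%g j).
have UA : U *m A = 1%:M.
  rewrite -UA0; apply/matrixP => a b; rewrite mxE [RHS]mxE (reindex_inj (@perm_inj _ s)).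
  by apply: eq_bigr => i _; rewrite As [U _ _]mxE permK.
pose P := P0 *m C.
have uP : P \in unitmx by rewrite unitmx_mul uP0.
have xtE tau : xt A P tau = xt A0 P0 tau.
  have E : C *m diag_mx (\row_i zt A tau i) = diag_mx (\row_i zt A0 tau i) *m C.
    apply/matrixP => i j; rewrite mul_mx_diag mul_diag_mx !mxE.
    have [->|Cij] := eqVneq (C i j) 0; first by rewrite mul0r mulr0.
    rewrite mulrC; congr (_ * _); apply: eq_bigr => l _; congr (_ ^ _).
    by rewrite mxE -(hCw _ _ Cij) mxE.
  apply: (can_inj (mulmxK uP)); rewrite /xt mulmxKV // /P -[LHS]mulmxA E !mulmxA mulmxKV //.
have [y [hy hl]] := form_colouring UA two anti dN hD hC.
exists A, U, P, y; split=> //; last first.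
- move=> c; apply: lieform_conj => //; rewrite /P trmx_mul.
  suff -> : C^T *m P0^T *m Q *m (P0 *m C) = hypmx L eta N by apply: hl.
  by rewrite -CJ /g !mulmxA.
- by move=> x; rewrite TX; split=> -[tau ht ->]; exists tau; rewrite ?xtE.
split=> // j; have S : \sum_i A i j = - \sum_i A i j.
  rewrite {1}(reindex_inj (inv_inj (@dualoK N))) -sumrN; apply: eq_bigr => i _.
  by apply/eqP; rewrite -addr_eq0 addrC anti // hypmx_neq0.
have : (\sum_i A i j) *+ 2 = 0 by rewrite mulr2n {1}S addNr.
by move/eqP; rewrite mulrn_eq0 => /eqP.
Qed.

End Packages.

(** * Degrees of the classical groups *)

Section GroupDegree.
Variables (L : closedFieldType) (N : nat).

Lemma degf_det : degf N (fun x : 'M[L]_N => \det x).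
Proof.
apply: degf_sum => s; apply: degfZ.
have := @degf_prod L N _ (index_enum 'I_N) (fun=> 1%N) (fun i (x : 'M[L]_N) => x i (s i)).
rewrite sum1_card card_ord; apply=> i; exact: degf_mxE.
Qed.

Lemma sl_degree D : (1 < N)%N -> has_degree (fun x : 'M[L]_N => \det x == 1) (N * N).-1 D ->
  (D <= 2 * N)%N.
Proof.
move=> N1 hD; have N0 : (0 < N)%N by lia.
have NN : (N * N = (N * N - (N * N).-1) + (N * N).-1)%N by rewrite subnK ?leq_pred.
have k1 : (N * N - (N * N).-1 = 1)%N by nia.
have := @bezout_smooth L N (N * N).-1 NN N (fun _ x => \det x + -1) (fun x => \det x == 1) N0 _ _ D N1 hD.
rewrite k1 expn1; apply.
- by move=> i; apply: degfD; [apply: degf_det | apply: degf_cst].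
move=> x0 /eqP dx s; pose z := Ordinal N0.
(* Right multiplication by [1 + eps a E_zz] multiplies the determinant by exactly [1 + eps a], so
   there is no second order term. *)
exists (s ord0 *: delta_mx z z), (fun=> 0) => eps i; rewrite (ord1 i); set a := s ord0.
rewrite det_mulmx dx mul1r.
have -> : 1%:M + eps *: (a *: delta_mx z z) =
    diag_mx (\row_j (1 + (j == z)%:R * (eps * a))) :> 'M[L]_N.
  apply/matrixP => b c; rewrite !mxE; have [->|ab] := eqVneq b c.
    by rewrite !mulr1n andbb; ring.
  have -> : (b == z) && (c == z) = false.
    by apply/negbTE; apply: contra ab => /andP[/eqP-> /eqP->].
  by rewrite /= !mulr0n !mulr0 addr0.
rewrite det_diag (bigD1 z) //= big1 => [|j /negPf jz]; last by rewrite mxE jz mul0r addr0.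
by rewrite mxE eqxx mul1r; ring.
Qed.

(** The equations are quadratic: entries of [x^T Q x - Q] in the upper triangle, strict if [eta]
    holds. Given velocities [s], let [W] have the symmetry of [Q] and the entries [s]; then
    [S = Q^-1 W / 2] satisfies [S^T Q + Q S = W]. *)
Lemma form_degree (Q : 'M[L]_N) (eta : bool) (V : 'M[L]_N -> Prop) g D :
  2%:R != 0 :> L -> Q \in unitmx -> Q^T = (-1) ^+ eta *: Q ->
  (forall x, V x -> x^T *m Q *m x = Q) -> (g <= N * N)%N ->
  (N * N - g <= #|[pred p : 'I_N * 'I_N | if eta then p.1 < p.2 else p.1 <= p.2]|)%N ->
  (1 < N)%N -> has_degree V g D -> (D <= 2 * 2 ^ (N * N - g))%N.
Proof.
move=> two uQ tQ VQ gN kP N1 hD.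
have NN : (N * N = (N * N - g) + g)%N by rewrite subnK.
have [ij ijI ijP] : exists2 ij : 'I_(N * N - g) -> 'I_N * 'I_N, injective ij &
    forall i, (if eta then (ij i).1 < (ij i).2 else (ij i).1 <= (ij i).2)%N.
  exists (fun i => enum_val (widen_ord kP i)).
    by move=> i i' /enum_val_inj/(congr1 val)/= e; apply: val_inj.
  by move=> i; have := enum_valP (widen_ord kP i).
pose f i (x : 'M[L]_N) := (x^T *m Q *m x) (ij i).1 (ij i).2 + - Q (ij i).1 (ij i).2.
apply: (@bezout_smooth L N g NN 2 f V isT _ _ D N1 hD).
  move=> i; apply: degfD; last exact: degf_cst.
  apply: (@degf_ext _ _ _ (fun x => \sum_b (\sum_a Q a b * x a (ij i).1) * x b (ij i).2)).
    move=> x; rewrite mxE; apply: eq_bigr => b _; rewrite mxE; congr (_ * _).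
    by apply: eq_bigr => a _; rewrite mxE mulrC.
  apply: degf_sum => b; apply: (@degfM _ _ 1 1); last exact: degf_mxE.
  by apply: degf_sum => a; apply: degfZ; apply: degf_mxE.
move=> x0 Vx0 s.
(* The half on the diagonal compensates for the doubling by the symmetrisation [W]. *)
pose M : 'M[L]_N := \matrix_(a, b) \sum_i s i * (((a, b) == ij i)%:R * (if a == b then 2%:R^-1 else 1)).
pose W := M + (-1) ^+ eta *: M^T.
have Mij i : M (ij i).1 (ij i).2 = s i * (if (ij i).1 == (ij i).2 then 2%:R^-1 else 1).
  rewrite mxE (bigD1 i) //= -surjective_pairing eqxx mul1r big1 ?addr0 // => j ji.
  by rewrite (inj_eq ijI) eq_sym (negPf ji) mul0r mulr0.
have Mji i : (ij i).1 != (ij i).2 -> M (ij i).2 (ij i).1 = 0.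
  move=> ne; rewrite mxE big1 // => j _; case: eqP => [e|_]; last by rewrite mul0r mulr0.
  have := ijP j; rewrite -e /=; have := ijP i; move: ne; rewrite -val_eqE /=.
  by case: (eta) => /=; lia.
have WE i : W (ij i).1 (ij i).2 = s i.
  rewrite /W [LHS]mxE [X in _ + X]mxE [X in _ * X]mxE.
  have [e|ne] := eqVneq (ij i).1 (ij i).2; last first.
    by rewrite Mij (negPf ne) (Mji _ ne) mulr0 addr0 mulr1.
  have et : eta = false by apply/negbTE/negP => et; have := ijP i; rewrite et e ltnn.
  rewrite et expr0 mul1r -e; have := Mij i; rewrite -e eqxx => ->.
  by rewrite -mulrDr -[RHS]mulr1; congr (_ * _); field.
have tW : W^T = (-1) ^+ eta *: W.
  apply/matrixP => a b; rewrite /W [LHS]mxE; move: (M) => M'; rewrite !mxE mulrDr mulrA -expr2 sqrr_sign mul1r.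
  by rewrite addrC.
pose S := 2%:R^-1 *: (invmx Q *m W).
have QS : Q *m S = 2%:R^-1 *: W by rewrite /S -scalemxAr mulKVmx.
have SQ : S^T *m Q = 2%:R^-1 *: W.
  have -> : S^T *m Q = (Q^T *m S)^T by rewrite trmx_mul trmxK.
  rewrite tQ -scalemxAl QS; apply/matrixP => a b; have := congr1 (fun Z : 'M_N => Z a b) tW.
  move: (W) => W'; rewrite !mxE => ->.
  by rewrite mulrCA [(-1) ^+ eta * (_ * _)]mulrA -expr2 sqrr_sign mul1r.
clearbody S.
exists S, (fun i => (S^T *m Q *m S) (ij i).1 (ij i).2) => eps i; rewrite /f.
have -> : (x0 *m (1%:M + eps *: S))^T *m Q *m (x0 *m (1%:M + eps *: S)) =
    Q + eps *: W + eps ^+ 2 *: (S^T *m Q *m S).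
  rewrite trmx_mul.
  have -> : (1%:M + eps *: S)^T *m x0^T *m Q *m (x0 *m (1%:M + eps *: S)) =
    (1%:M + eps *: S)^T *m (x0^T *m Q *m x0) *m (1%:M + eps *: S) by rewrite !mulmxA.
  have -> : (1%:M + eps *: S)^T = 1%:M + eps *: S^T by rewrite [LHS]linearD /= trmx1 linearZ.
  rewrite (VQ _ Vx0); have -> : (1%:M + eps *: S^T) *m Q = Q + eps *: (S^T *m Q).
    by rewrite mulmxDl mul1mx -scalemxAl.
  have hW : eps *: (2%:R^-1 *: W) + eps *: (2%:R^-1 *: W) = eps *: W.
    by rewrite -scalerDr -scalerDl; congr (_ *: _); rewrite -[RHS]scale1r; congr (_ *: _); field.
  rewrite mulmxDr mulmx1 mulmxDl -!scalemxAr -scalemxAl QS SQ.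
  by rewrite [LHS]addrA -[X in X + _ = _]addrA hW scalerA -expr2.
rewrite -[in RHS](WE i); move: (W) (S^T *m Q *m S) => W' Z; rewrite !mxE; ring.
Qed.

Lemma card_pairs (eta : bool) :
  (#|[pred p : 'I_N * 'I_N | if eta then p.1 < p.2 else p.1 <= p.2]| * 2 =
   if eta then N * N.-1 else N * N.+1)%N.
Proof.
pose S (h : nat -> nat -> bool) := (\sum_(i < N) \sum_(j < N) h i j)%N.
have cE (h : nat -> nat -> bool) : (#|[pred p : 'I_N * 'I_N | h p.1 p.2]| = S h)%N.
  rewrite -sum1_card big_mkcond /S pair_big /=; apply: eq_bigr => p _.
  by rewrite inE; case: (h _ _).
have lg : S (fun i j => i < j)%N = S (fun i j => j < i)%N by rewrite /S exchange_big.
have eN : S (fun i j => i == j)%N = N.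
  rewrite /S -[RHS]card_ord -sum1_card; apply: eq_bigr => i _.
  by rewrite (bigD1 i) //= eqxx big1 // => j; rewrite -val_eqE eq_sym => /negPf->.
have le : S (fun i j => i <= j)%N = (S (fun i j => i < j)%N + N)%N.
  rewrite -[X in (_ + X)%N]eN /S -big_split; apply: eq_bigr => i _ /=.
  by rewrite -big_split; apply: eq_bigr => j _ /=; case: ltngtP.
have tot : (S (fun i j => i < j)%N + N + S (fun i j => j < i)%N = N * N)%N.
  rewrite -le /S -big_split /= -[X in (_ = X * _)%N]card_ord -sum_nat_const; apply: eq_bigr => i _.
  rewrite -big_split /= -[RHS]card_ord -sum1_card; apply: eq_bigr => j _.
  by case: leqP.
case: eta.
  transitivity (S (fun i j => i < j)%N * 2)%N.
    by congr (_ * _)%N; apply: (cE (fun i j => i < j)%N).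
  move: tot; rewrite -lg; move: (S _) => z; clear; case: N => [|n']; rewrite ?mulSn ?mulnS /=; lia.
transitivity (S (fun i j => i <= j)%N * 2)%N.
  by congr (_ * _)%N; apply: (cE (fun i j => i <= j)%N).
by rewrite le; move: tot; rewrite -lg mulnS; move: (S _) => z; clear; lia.
Qed.

End GroupDegree.

(** * Explicit constants *)

Section Numerics.
Local Open Scope nat_scope.

Lemma sq_le_cube r N : 2 <= r -> N <= 2 * r + 1 -> (N * N).+1 <= (2 * r) ^ 3.
Proof.
move=> r2 hN; have h : N * N <= (2 * r + 1) * (2 * r + 1) by apply: leq_mul.
apply: leq_ltn_trans h _; rewrite !expnS expn0; move: r r2 {N hN} => [|[|m]] // _; nia.
Qed.

Lemma dN_le r N d : 2 <= r -> N <= 2 * r + 1 -> d < r -> 3 * (d * N) <= 6 * r ^ 2.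
Proof.
move=> r2 hN hd; have h : d * N <= r.-1 * (2 * r + 1) by apply: leq_mul => //; lia.
move: h; rewrite expnS expn1; move: (d * N) r r2 {hN hd} => z [|[|m]] // _; rewrite /=; nia.
Qed.

Lemma kd_le r s d : s <= 2 * r + 1 -> d < r -> s.+1 * d <= (2 * r) ^ 2.
Proof.
move=> hs hd; have h : s.+1 * d <= (2 * r + 2) * r.-1 by apply: leq_mul => //; lia.
apply: leq_trans h _; rewrite expnS expn1; case: r {hs hd} => [|m] //=; nia.
Qed.

Lemma escape_size_le r N d : 2 <= r -> N <= 2 * r + 1 -> d < r ->
  (N * N).+1 ^ (d * N) <= (2 * r) ^ (6 * r ^ 2).
Proof.
move=> r2 hN hd; apply: leq_trans (leq_expl _ (sq_le_cube r2 hN)) _.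
have R0 : 0 < 2 * r by clear -r2; lia.
by rewrite -expnM leq_pexp2l // dN_le.
Qed.

(** The summands in [hexp] stand for the number of separating points, for the degree of the torus,
    for [((s + 1) d)^d] and for [r (r + 1) <= (2 r)^2]; together they are at most [19 r^2]. *)
Lemma bound_numerics r N s d DT DG X Y : 2 <= r -> N <= 2 * r + 1 -> s <= 2 * r + 1 -> d < r ->
  DG <= (2 * r) ^ (2 * r ^ 2 + 3 * r + 2) -> DT <= 2 * DG ->
  X ^ s.+1 <= ((N * N).+1 ^ (d * N)) ^ s * Y * (maxn DT 1 ^ s.+1 * (s.+1 * d) ^ (s.+1 * d)) ->
  (X * (r * (r + 1))) ^ s.+1 <= ((2 * r) ^ (19 * r ^ 2)) ^ s.+1 * Y.
Proof.
move=> r2 hN hs hd hDG hDT hX; have hQ := escape_size_le r2 hN hd.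
have hkd1 := kd_le hs hd.
have R2 : 2 <= 2 * r by clear -r2; lia.
have hrr : r * (r + 1) <= (2 * r) ^ 2 by rewrite expnS expn1; clear -r2; nia.
have hexp : 6 * r ^ 2 + (2 * r ^ 2 + 3 * r + 3) + 2 * r + 2 <= 19 * r ^ 2.
  by rewrite expnS expn1; clear -r2; nia.
move: (2 * r) R2 hQ hkd1 hrr hDG => R R2 hQ hkd1 hrr hDG.
have R0 : 0 < R by apply: ltnW.
have hD1 : maxn DT 1 <= R ^ (2 * r ^ 2 + 3 * r + 3).
  rewrite geq_max [X in _ && X]expn_gt0 R0 andbT addnS expnS.
  by apply: leq_trans hDT _; apply: leq_mul.
have hkd : (s.+1 * d) ^ d <= R ^ (2 * r).
  apply: leq_trans (leq_expl _ hkd1) _.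
  by rewrite -expnM leq_exp2l // leq_mul2l ltnW.
rewrite expnMn; apply: leq_trans (leq_mul hX (leq_expl s.+1 hrr)) _.
have hQs : ((N * N).+1 ^ (d * N)) ^ s <= (R ^ (6 * r ^ 2)) ^ s.+1.
  apply: leq_trans (leq_expl _ hQ) _; rewrite -!expnM leq_exp2l //.
  by rewrite leq_mul2l leqnSn orbT.
have hkd2 : (s.+1 * d) ^ (s.+1 * d) <= (R ^ (2 * r)) ^ s.+1.
  by rewrite [X in _ ^ X]mulnC expnM; apply: leq_expl.
have hD2 := leq_expl s.+1 hD1.
apply: leq_trans (leq_mul (leq_mul (leq_mul hQs (leqnn Y)) (leq_mul hD2 hkd2)) (leqnn _)) _.
rewrite [_ * Y]mulnC -!mulnA [X in _ <= X]mulnC leq_mul2l; apply/orP; right.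
rewrite !mulnA -!expnMn -!expnD; apply: leq_expl; rewrite leq_exp2l //.
by move: hexp; rewrite !expnS !expn0 !muln1 !mulnA.
Qed.

(** The product of [s + 1] elements of [B^t] and [s] inserted words; the numbers of factors
    contribute exponent 2 and the length of the words exponent [6 r^2]. *)
Lemma exponent_numerics r N s d t : 2 <= r -> N <= 2 * r + 1 -> s <= 2 * r + 1 -> d < r -> 0 < t ->
  s.+1 * t + s * (N * N).+1 ^ (d * N) <= (2 * r) ^ (45 * r ^ 3 - 1) * t.
Proof.
move=> r2 hN hs hd t0; have hQ := escape_size_le r2 hN hd.
have sR : s.+1 + s <= (2 * r) ^ 2.
  apply: (@leq_trans (4 * r + 3)); first by clear -hs; lia.
  by rewrite expnS expn1; clear -r2; nia.
have hexp : 2 + 6 * r ^ 2 <= 45 * r ^ 3 - 1.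
  by rewrite !expnS expn0 !muln1; clear -r2; nia.
have R2 : 1 < 2 * r by clear -r2; lia.
move: (2 * r) R2 hQ sR => R R2 hQ sR.
have Q1 : 0 < R ^ (6 * r ^ 2) by rewrite expn_gt0 ltnW.
apply: (@leq_trans ((s.+1 + s) * R ^ (6 * r ^ 2) * t)).
  rewrite [X in _ <= X * t]mulnDl [X in _ <= X]mulnDl; apply: leq_add.
    by rewrite leq_mul2r leq_pmulr ?orbT.
  by rewrite -mulnA leq_mul2l (leq_trans hQ) ?leq_pmulr ?orbT.
rewrite leq_mul2r; apply/orP; right; apply: leq_trans (leq_mul sR (leqnn _)) _.
by rewrite -expnD leq_exp2l.
Qed.

Lemma density_numerics r N d q : 2 <= r -> N <= 2 * r + 1 -> d < r -> (2 * r) ^ (6 * r) <= q ->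
  (d * N) * N.+1 + N < q /\ (d * N) * 3 < q.
Proof.
move=> r2 hN hd hq; have h4 : (2 * r) ^ 4 <= q.
  have e1 : 4 <= 6 * r by clear -r2; lia.
  have e2 : 1 < 2 * r by clear -r2; lia.
  by apply: leq_trans hq; rewrite leq_exp2l.
have h1 : d * N <= r * (2 * r + 1) by apply: leq_mul (ltnW hd) hN.
have h2 : d * N * N.+1 <= r * (2 * r + 1) * (2 * r + 2).
  by apply: leq_mul h1 _; clear -hN; lia.
have h3 : r * (2 * r + 1) * (2 * r + 2) + (2 * r + 1) < (2 * r) ^ 4.
  by rewrite !expnS expn0 muln1; clear -r2; move: r r2 => [|[|m]] // _; nia.
have h5 : r * (2 * r + 1) * 3 < (2 * r) ^ 4.
  by rewrite !expnS expn0 muln1; clear -r2; move: r r2 => [|[|m]] // _; nia.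
split.
  by apply: leq_trans h4; apply: leq_ltn_trans h3; apply: leq_add.
by apply: leq_trans h4; apply: leq_ltn_trans h5; rewrite leq_mul2r h1.
Qed.

End Numerics.

Section RealNumerics.
Import Rdefinitions Raxioms RIneq Rfunctions Rtrigo_def Rpower Lra.
Import ssrnat.
Local Open Scope nat_scope.

Lemma INR_muln a b : INR (a * b) = Rmult (INR a) (INR b).
Proof. exact: mult_INR. Qed.

Lemma INR_expn a b : INR (a ^ b) = pow (INR a) b.
Proof. by elim: b => [|b ih]; rewrite ?expn0 // expnS INR_muln ih. Qed.

Lemma INR_gt0 a : 0 < a -> Rlt R0 (INR a).
Proof. by move=> a0; apply: lt_0_INR; apply/ltP. Qed.

Lemma INR_leq a b : Rle (INR a) (INR b) -> a <= b.
Proof. by move=> h; apply/leP; apply: INR_le. Qed.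

Lemma q_large_nat q r : 0 < r -> q_large q r -> (2 * r) ^ (6 * r) <= q.
Proof.
move=> r0 h; apply: INR_leq; rewrite INR_expn -Rpower_pow; first exact: h.
by apply: INR_gt0; rewrite muln_gt0.
Qed.

(** Since [dim / r + 1 = s + 1], the real inequality is the root of order [s + 1] of one between
    natural numbers. *)
Lemma main_bound_nat r dim s X Y : 0 < r -> dim = r * s -> 0 < Y ->
  (X * (r * (r + 1))) ^ s.+1 <= ((2 * r) ^ (19 * r ^ 2)) ^ s.+1 * Y -> main_bound r dim X Y.
Proof.
move=> r0 -> Y0 h; rewrite /main_bound.
set C := INR ((2 * r) ^ (19 * r ^ 2)); set y := INR Y; set w := INR (r * (r + 1)).
have w0 : Rlt R0 w by apply: INR_gt0; rewrite muln_gt0 r0 addn1.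
have C0 : Rlt R0 C by apply: INR_gt0; rewrite expn_gt0 muln_gt0 r0.
have y0 : Rlt R0 y by exact: INR_gt0.
have r0' := INR_gt0 r0.
have -> : Rplus (Rdiv (INR (r * s)) (INR r)) R1 = INR s.+1.
  rewrite INR_muln S_INR; congr Rplus; field; lra.
set z := Rpower y _; have z0 : Rlt R0 z by exact: Exp_prop.exp_pos.
have s0 : Rlt R0 (INR s.+1) by exact: INR_gt0.
have zk : pow z s.+1 = y.
  rewrite -Rpower_pow // /z Rpower_mult Rinv_l ?Rpower_1 //; lra.
have hR : Rle (pow (Rmult (INR X) w) s.+1) (pow (Rmult C z) s.+1).
  rewrite [X in Rle _ X]Rpow_mult_distr zk /C /w -INR_muln -!INR_expn -INR_muln.
  by apply: le_INR; apply/leP.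
suff hX : Rle (Rmult (INR X) w) (Rmult C z).
  apply: (Rmult_le_reg_r w) => //.
  have -> : Rmult (Rmult (Rdiv C w) z) w = Rmult C z by field; lra.
  exact: hX.
apply: Rnot_lt_le => hlt; have Cz0 : Rlt R0 (Rmult C z) by apply: Rmult_lt_0_compat.
have := @Rlt_Rpower_l _ _ _ s0 (conj Cz0 hlt).
rewrite !Rpower_pow //; first by lra.
exact: Rlt_trans hlt.
Qed.

End RealNumerics.

(** * Assembly of the bound and the four families of groups *)

Lemma natr_neq0_of_char (F : finFieldType) (L : fieldType) (iota : {rmorphism F -> L}) (N m : nat) :
  (forall p : nat, p \in [pchar F] -> (N < p)%N) -> (0 < m <= N)%N -> m%:R != 0 :> L.
Proof.
move=> hc /andP[m0 mN]; rewrite -(rmorph_nat iota) fmorph_eq0; apply/negP => mz.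
have [p pF] := natf0_pchar m0 mz; move: mz; rewrite -(dvdn_pcharf pF) => /(dvdn_leq m0).
by have := hc p pF; lia.
Qed.

Section Generated.
Variables (L : fieldType) (N : nat) (B : {fset 'M[L]_N}) (H : 'M[L]_N -> Prop).
Hypothesis B1 : 1%:M \in B.
Hypothesis Binv : forall b, b \in B -> invmx b \in B.

Lemma generates_prodset x : generates B H -> H x -> exists j, x \in prodset B j.
Proof.
move=> hg /hg[s [sB ->]]; exists (size s); elim: s sB => [|[b i] s ih] /=.
  by move=> _; rewrite inE.
case/andP=> bB /ih h; apply/prodsetSP.
by exists (if i then invmx b else b), (mxprod [seq if yb.2 then invmx yb.1 else yb.1 | yb <- s]);
  split=> //; case: (i); rewrite ?Binv.
Qed.

End Generated.

Section Core.
Variables (L : closedFieldType) (N r d s : nat).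
Variables (A : 'M[int]_(N, d)) (U : 'M[int]_(d, N)) (P : 'M[L]_N) (y : 'I_s -> 'M[L]_N).
Variables (B : {fset 'M[L]_N}) (T : 'M[L]_N -> Prop) (K : 'M[L]_N -> bool).
Hypothesis UA : U *m A = 1%:M /\ forall j, \sum_i A i j = 0.
Hypothesis uP : P \in unitmx.
Hypothesis TX : forall x, T x <-> exists2 tau, nz tau & x = xt A P tau.
Hypothesis hy : colouring A y.
Hypothesis two : 2%:R != 0 :> L.
Hypothesis B1 : 1%:M \in B.
Hypothesis Bu : forall b, b \in B -> b \in unitmx.
Hypothesis Binv : forall b, b \in B -> invmx b \in B.
Hypothesis dense : forall f, polyf (@mxf L N) (d * N) f ->
  (forall j x, x \in prodset B j -> f x = 0) ->
  forall c eps, let Y := eps *: (P *m y c *m invmx P) in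
  1%:M + Y \in unitmx -> 1%:M - Y \in unitmx -> f (cay Y) = 0.
Hypothesis r2 : (2 <= r)%N.
Hypothesis N0 : (0 < N)%N.
Hypothesis Nr : (N <= 2 * r + 1)%N.
Hypothesis sr : (s <= 2 * r + 1)%N.
Hypothesis dr : (d < r)%N.

Lemma prodset_gt0 m : (0 < #|` prodset B m|)%N.
Proof.
rewrite cardfs_gt0; apply/fset0Pn; exists 1%:M.
by apply: (prodset_le B1 (leq0n m)); rewrite prodset0E.
Qed.

Lemma torus_intersection_bound dim DT DG t X : (0 < t)%N -> dim = (r * s)%N ->
  has_degree T d DT -> (DG <= (2 * r) ^ (2 * r ^ 2 + 3 * r + 2))%N -> (DT <= 2 * DG)%N ->
  card_eq (fun x => [/\ x \in prodset B t, T x & K x]) X ->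
  main_bound r dim X #|` prodset B ((2 * r) ^ (45 * r ^ 3 - 1) * t)|.
Proof.
move=> t0 dimE hT hDG hDT [sX [uX sizeX memX]].
apply: (main_bound_nat _ dimE); [exact: ltnW | exact: prodset_gt0 |].
pose M := (s.+1 * t + s * (N * N).+1 ^ (d * N))%N.
suff hX : (X ^ s.+1 <= ((N * N).+1 ^ (d * N)) ^ s * #|` prodset B M| *
    (maxn DT 1 ^ s.+1 * (s.+1 * d) ^ (s.+1 * d)))%N.
  have hM := exponent_numerics r2 Nr sr dr t0.
  apply: leq_trans (bound_numerics r2 Nr sr dr hDG hDT hX) _.
  rewrite leq_mul2l; apply/orP; right; apply: fsubset_leq_card; apply/fsubsetP => x.
  exact: prodset_le.
have htau (i : 'I_X) : exists tau, nz tau /\ nth 0 sX i = xt A P tau.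
  have : nth 0 sX i \in sX by rewrite mem_nth // sizeX.
  by move=> /memX[_ /TX[tau h1 h2] _]; exists tau.
have [tau tauP] := fin_all_exists htau.
have ltX (i : 'I_X) : (i < size sX)%N by rewrite sizeX.
have tauI : injective tau.
  move=> i j e; apply: val_inj; apply/eqP; rewrite -(nth_uniq 0 (ltX i) (ltX j) uX).
  by rewrite (tauP i).2 (tauP j).2 e.
have tauB i : xt A P (tau i) \in prodset B t.
  rewrite -(tauP i).2; have : nth 0 sX i \in sX by rewrite mem_nth // sizeX.
  by move=> /memX[].
(* A torus of dimension 0 is a single point; the degree estimates need [d > 0]. *)
have [d0|d0] := posnP d.
  have X1 : (X <= 1)%N.
    rewrite leqNgt; apply/negP => X1; have X0 := ltnW X1.
    have := tauI (Ordinal X1) (Ordinal X0); suff -> : tau (Ordinal X1) = tau (Ordinal X0).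
      by move=> /(_ erefl)/(congr1 val).
    by apply/rowP => -[j hj]; exfalso; move: (hj); rewrite d0.
  apply: (@leq_trans 1); first by rewrite -(exp1n s.+1) leq_expl.
  have e0 : ((s.+1 * d) ^ (s.+1 * d) = 1)%N by rewrite d0 muln0.
  by rewrite e0 muln1 !muln_gt0 !expn_gt0 prodset_gt0 leq_max orbT.
have [cst hdet] := torus_degree_bound UA.1 UA.2 uP d0 TX hT.
exact: (torus_power_bound UA.1 uP N0 two hy B1 Bu Binv dense hdet (fun i => (tauP i).1) tauI tauB).
Qed.

End Core.

Section Types.
Variables (F : finFieldType) (L : closedFieldType) (iota : {rmorphism F -> L}).
Variables (N r d t DT DG X : nat) (inG : 'M[L]_N -> bool) (T : 'M[L]_N -> Prop).
Variables (h : 'M[L]_N) (B : {fset 'M[L]_N}).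
Hypothesis Hh : inG h.
Hypothesis HBG : forall x, x \in B -> inG x.
Hypothesis He : 1%:M \in B.
Hypothesis Hsym : [fset invmx x | x in B]%fset = B.
Hypothesis Hgen : generates B
  (fun x => exists2 g, inG g && mx_over iota g & x = h *m g *m invmx h).
Hypothesis HT : is_torus d T.
Hypothesis HTG : forall x, T x -> inG x.
Hypothesis dr : (d < r)%N.
Hypothesis r2 : (2 <= r)%N.
Hypothesis hq : ((2 * r) ^ (6 * r) <= #|F|)%N.
Hypothesis t0 : (0 < t)%N.
Hypothesis hDT : has_degree T d DT.
Hypothesis hDD : (DT <= 2 * DG)%N.
Hypothesis hX : card_eq (fun x => [/\ x \in prodset B t, T x & mx_over iota x]) X.
Hypothesis two : 2%:R != 0 :> L.

Lemma inv_in b : b \in B -> invmx b \in B.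
Proof. by move=> bB; rewrite -Hsym; apply/imfsetP; exists b. Qed.

Lemma vanish_on_conjugates f :
  (forall j x, x \in prodset B j -> f x = 0 :> L) ->
  forall g : 'M[F]_N, inG (map_mx iota g) -> f (h *m map_mx iota g *m invmx h) = 0.
Proof.
move=> f0 g gG; have [|j hj] := @generates_prodset L N B _ inv_in (h *m map_mx iota g *m invmx h) Hgen.
  by exists (map_mx iota g) => //; rewrite gG; apply/mx_overP; exists g.
exact: f0 hj.
Qed.

Lemma form_main (Q0 : 'M[F]_N) (eta : bool) dim (Q := map_mx iota Q0) :
  Q0 \in unitmx -> Q0^T = (-1) ^+ eta *: Q0 ->
  (forall x, inG x -> x^T *m Q *m x = Q) ->
  (forall x, x^T *m Q *m x = Q -> \det x = 1 -> inG x) ->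
  r = N./2 -> (typeD N eta -> 3 < N./2)%N -> (eta -> ~~ odd N) -> dim = (r * ncol N eta)%N ->
  (dim * 2 = if eta then N * N.+1 else N * N.-1)%N ->
  has_degree (fun x : 'M[L]_N => inG x) dim DG ->
  main_bound r dim X #|` prodset B ((2 * r) ^ (45 * r ^ 3 - 1) * t)|.
Proof.
move=> uQ0 tQ0 GQ QG rN hD hC dimE dim2 hDG.
have uQ : Q \in unitmx by rewrite map_unitmx.
have tQ : Q^T = (-1) ^+ eta *: Q by rewrite /Q map_trmx tQ0 map_mxZ rmorphXn rmorphN1.
have Nr : (N <= 2 * r + 1)%N by clear -rN; lia.
have N1 : (1 < N)%N by clear -rN r2; lia.
have Gu x : inG x -> x \in unitmx.
  move=> /GQ e; have : x^T *m Q *m x \in unitmx by rewrite e.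
  by rewrite unitmx_mul => /andP[].
have sr : (ncol N eta <= 2 * r + 1)%N.
  by rewrite /ncol /typeD; case: (eta); clear -rN; case: ifP; lia.
have [qf _] := density_numerics r2 Nr dr hq.
have dN2 : (d < N./2)%N by rewrite -rN.
have [A [U [P [y [UA uP TX hy hl]]]]] := form_package HT two uQ tQ (fun x Tx => GQ x (HTG Tx)) dN2 hD hC.
have dense f : polyf (@mxf L N) (d * N) f -> (forall j x, x \in prodset B j -> f x = 0) ->
    forall c eps, let Y := eps *: (P *m y c *m invmx P) in
    1%:M + Y \in unitmx -> 1%:M - Y \in unitmx -> f (cay Y) = 0.
  move=> pf f0 c eps Y uY _.
  apply: (form_density_conj two uQ0 tQ0 (Gu h Hh) (GQ h Hh) qf pf _ (lieformZ eps (hl c)) uY).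
  move=> g gQ dg; apply: vanish_on_conjugates => //; apply: QG.
    by rewrite map_trmx -!map_mxM gQ.
  by rewrite det_map_mx dg rmorph1.
have gN : (dim <= N * N)%N by move: dim2 N1; clear; case: eta => h N1; nia.
have kP : (N * N - dim <= #|[pred p : 'I_N * 'I_N | if eta then p.1 < p.2 else p.1 <= p.2]|)%N.
  move: (card_pairs N eta) dim2 N1; move: #|_| => z; clear; case: eta => h1 h2 N1; nia.
(* Here [N^2 - dim] is [N (N - 1) / 2] or [N (N + 1) / 2], hence at most [2 r^2 + 3 r + 1]; the
   factor 2 of the Bezout bound adds one more to the exponent. *)
have DGb : (DG <= (2 * r) ^ (2 * r ^ 2 + 3 * r + 2))%N.
  have hb := form_degree two uQ tQ GQ gN kP N1 hDG.
  have m1 : (N * N - dim + 1 <= 2 * r ^ 2 + 3 * r + 2)%N.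
    have : (N * N <= (2 * r + 1) * (2 * r + 1))%N by apply: leq_mul.
    move: dim2 Nr N1; rewrite expnS expn1; clear; case: eta => h Nr N1 h2; nia.
  have R0 : (0 < 2 * r)%N by clear -r2; lia.
  apply: leq_trans hb _; rewrite -expnS.
  apply: leq_trans (leq_expl _ (_ : 2 <= 2 * r)%N) _; first by clear -r2; lia.
  by rewrite leq_pexp2l // -addn1.
exact: (torus_intersection_bound UA uP TX hy two He (fun b bB => Gu b (HBG bB)) inv_in dense
  r2 (ltnW N1) Nr sr dr t0 dimE hDT DGb hDD hX).
Qed.

Lemma sl_main : (forall x, inG x = (\det x == 1)) -> N = r.+1 -> N%:R != 0 :> L ->
  has_degree (fun x : 'M[L]_N => inG x) (N * N).-1 DG ->
  main_bound r (N * N).-1 X #|` prodset B ((2 * r) ^ (45 * r ^ 3 - 1) * t)|.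
Proof.
move=> GE Nr1 NN0 hDG.
have Nr : (N <= 2 * r + 1)%N by clear -Nr1; lia.
have N1 : (1 < N)%N by clear -Nr1 r2; lia.
have Gd x : inG x -> \det x = 1 by rewrite GE => /eqP.
have Gu x : inG x -> x \in unitmx by move=> /Gd e; rewrite unitmxE e unitr1.
have [_ qf] := density_numerics r2 Nr dr hq.
have dN : (d < N.-1)%N by rewrite Nr1.
have [A [U [P [y [UA uP TX hy hl]]]]] := sl_package HT (fun x Tx => Gd x (HTG Tx)) dN NN0.
have dense f : polyf (@mxf L N) (d * N) f -> (forall j x, x \in prodset B j -> f x = 0) ->
    forall c eps, let Y := eps *: (P *m y c *m invmx P) in
    1%:M + Y \in unitmx -> 1%:M - Y \in unitmx -> f (cay Y) = 0.
  move=> pf f0 c eps Y _ _; rewrite /Y; have [u [w [wu ->]]] := hl c.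
  apply: (sl_density_conj (Gu h Hh) qf pf _ eps wu) => g dg.
  by apply: vanish_on_conjugates => //; rewrite GE det_map_mx dg rmorph1.
have DGb : (DG <= (2 * r) ^ (2 * r ^ 2 + 3 * r + 2))%N.
  have [p p0 hp] := hDG; have hDG' : has_degree (fun x : 'M[L]_N => \det x == 1) (N * N).-1 DG.
    exists p => // a M /hp[s [us ss hs]]; exists s; split=> // x; rewrite -hs.
    by rewrite GE.
  apply: leq_trans (sl_degree N1 hDG') _; apply: (@leq_trans ((2 * r) ^ 2)).
    by rewrite Nr1 expnS expn1; clear -r2; nia.
  by rewrite leq_pexp2l //; clear -r2; lia.
(* This identity makes the [N + 1] stars of [sl_colouring] exactly [dim(G) / r] in number. *)
have dimE : ((N * N).-1 = r * N.+1)%N by rewrite Nr1; clear; nia.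
have sr : (N.+1 <= 2 * r + 1)%N by rewrite Nr1; clear -r2; lia.
exact: (torus_intersection_bound UA uP TX hy two He (fun b bB => Gu b (HBG bB)) inv_in dense
  r2 (ltnW N1) Nr sr dr t0 dimE hDT DGb hDD hX).
Qed.

End Types.

Theorem theorem5p5
  (F : finFieldType) (L : closedFieldType) (iota : {rmorphism F -> L})
  (HL : algebraic_over iota)
  (c : chev) (Hc : chev_valid c) (Hr : (2 <= chev_rank c)%N)
  (Hq : q_large #|F| (chev_rank c))
  (Hchar : forall p : nat, p \in [pchar F] -> (chev_N c < p)%N)
  (h : 'M[L]_(chev_N c)) (Hh : in_chev c h)
  (B : {fset 'M[L]_(chev_N c)})
  (HBG : forall x : 'M[L]_(chev_N c), x \in B -> in_chev c x)
  (He : 1%:M \in B)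
  (Hsym : [fset invmx x | x in B]%fset = B)
  (Hgen : generates B
            (fun x => exists2 g, in_chev c g && mx_over iota g
                                 & x = h *m g *m invmx h))
  (T : 'M[L]_(chev_N c) -> Prop) (d : nat)
  (HT : is_torus d T) (HTG : forall x, T x -> in_chev c x)
  (Hd : (d < chev_rank c)%N)
  (Hdeg : exists DT DG : nat,
      [/\ has_degree T d DT,
          has_degree (fun x : 'M[L]_(chev_N c) => in_chev c x) (chev_dim c) DG
        & (DT <= 2 * DG)%N])
  (t : nat) (Ht : (1 <= t)%N) :
  forall X : nat,
    card_eq (fun x => [/\ x \in prodset B t, T x & mx_over iota x]) X ->
    main_bound (chev_rank c) (chev_dim c) X
      #|` prodset B ((2 * chev_rank c) ^ (45 * chev_rank c ^ 3 - 1) * t) |.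
Proof.
move=> X hX; have [DT [DG [hDT hDG hDD]]] := Hdeg.
have hq : ((2 * chev_rank c) ^ (6 * chev_rank c) <= #|F|)%N by apply: q_large_nat Hq; apply: ltnW.
have chN m := @natr_neq0_of_char F L iota (chev_N c) m Hchar.
have two : 2%:R != 0 :> L.
  by apply: chN; move: Hr; case: (c) => n /=; lia.
have so_case n : n = chev_N c -> (1%:M : 'M[F]_n) \in unitmx /\
    (1%:M : 'M[F]_n)^T = (-1) ^+ false *: 1%:M.
  by move=> _; rewrite unitmx1 trmx1 expr0 scale1r.
case: c Hc Hr Hq Hchar h Hh B HBG He Hsym Hgen T HT HTG Hd Hdeg hX hDT hDG hq chN so_case => n Hc Hr Hq Hchar h Hh B HBG He Hsym Hgen T HT HTG Hd Hdeg hX hDT hDG hq chN so_case.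
- have n0 : (n = n.-1.+1)%N by move: Hc; rewrite /=; clear; lia.
  apply: (sl_main Hh HBG He Hsym Hgen HT HTG Hd Hr hq Ht hDT hDD hX two _ n0 _ hDG) => //.
  by apply: chN; move: Hc; rewrite /=; clear; lia.
- have [uQ tQ] := so_case _ (erefl : (n + n)%N = chev_N (SOeven n)).
  apply: (form_main Hh HBG He Hsym Hgen HT HTG Hd Hr hq Ht hDT hDD hX two uQ tQ _ _ _ _ _ _ _ hDG).
  + by move=> x /andP[_ /eqP]; rewrite map_mx1 mulmx1.
  + by move=> x; rewrite map_mx1 mulmx1 => e1 e2; apply/andP; rewrite e1 e2.
  + by rewrite /= addnn doubleK.
  + by move=> _; rewrite /= addnn doubleK.
  + by [].
  + have o : odd (n + n) = false by rewrite addnn odd_double.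
    rewrite /ncol /typeD /chev_dim /chev_N /chev_rank o /=.
    have -> : ((n + n) * (n + n).-1 = (n * (n + n).-1).*2)%N by rewrite -mul2n mulnA mul2n addnn.
    by rewrite doubleK.
  + rewrite /chev_dim /chev_N.
    have -> : ((n + n) * (n + n).-1 = (n * (n + n).-1).*2)%N by rewrite -mul2n mulnA mul2n addnn.
    by rewrite doubleK muln2.
- have [uQ tQ] := so_case _ (erefl : (n + n).+1 = chev_N (SOodd n)).
  apply: (form_main Hh HBG He Hsym Hgen HT HTG Hd Hr hq Ht hDT hDD hX two uQ tQ _ _ _ _ _ _ _ hDG).
  + by move=> x /andP[_ /eqP]; rewrite map_mx1 mulmx1.
  + by move=> x; rewrite map_mx1 mulmx1 => e1 e2; apply/andP; rewrite e1 e2.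
  + by rewrite /= addnn uphalf_double.
  + by rewrite /typeD /= addnn odd_double.
  + by [].
  + have o : odd (n + n) = false by rewrite addnn odd_double.
    rewrite /ncol /typeD /chev_dim /chev_N /chev_rank /= o /= addnn uphalf_double.
    have -> : (n.*2.+1 * n.*2 = (n * n.*2.+1).*2)%N by rewrite mulnC -!mul2n mulnA.
    by rewrite doubleK.
  + rewrite /chev_dim /chev_N addnn.
    have -> : (n.*2.+1 * n.*2 = (n * n.*2.+1).*2)%N by rewrite mulnC -!mul2n mulnA.
    by rewrite doubleK muln2 /= mulnC -!mul2n mulnA.
- have map_om : map_mx iota (omega_mx F n) = omega_mx L n.
    by rewrite /omega_mx map_block_mx map_mxN map_mx1 !map_mx0.
  have om2 : omega_mx F n *m (- omega_mx F n) = 1%:M.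
    rewrite /omega_mx mulmxN mulmx_block !mul0mx !mulmx0 !mul1mx mulNmx mul1mx !addr0 !add0r.
    by rewrite opp_block_mx !oppr0 !opprK -scalar_mx_block.
  have [uQ _] := mulmx1_unit om2.
  have tQ : (omega_mx F n)^T = (-1) ^+ true *: omega_mx F n.
    rewrite /omega_mx tr_block_mx !trmx0 linearN /= trmx1 expr1 scaleN1r opp_block_mx !oppr0 opprK.
    by [].
  apply: (form_main Hh HBG He Hsym Hgen HT HTG Hd Hr hq Ht hDT hDD hX two uQ tQ _ _ _ _ _ _ _ hDG).
  + by move=> x /eqP; rewrite map_om.
  + by move=> x; rewrite map_om => e1 _; apply/eqP.
  + by rewrite /= addnn doubleK.
  + by rewrite /typeD andbF.
  + by move=> _; rewrite /= addnn odd_double.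
  + by rewrite /ncol /typeD andbF /= addnn doubleK.
  + by rewrite /chev_dim /chev_N addnn -!mul2n; clear; lia.
Qed.
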